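(* Let $n\ge 3$ be odd. Let $K$ be an oriented $(n-1)$-dimensional pseudo-manifold, and let $P_t\colon K\to\Lambda^n$, $t\in(a,b)$, be a flexion of a bounded polyhedron of combinatorial type $K$ in the $n$-dimensional Lobachevsky space $\Lambda^n$. Then the generalized oriented volume $\mathcal{V}_K(P_t)$ is constant in $t$.
   Context: $\Lambda^n$ is identified with the standard vector model $\{\mathbf{x}\in\mathbb{R}^{1,n}:\langle\mathbf{x},\mathbf{x}\rangle=1,\ x_0>0\}$, where $\langle\mathbf{x},\mathbf{y}\rangle=x_0y_0-x_1y_1-\cdots-x_ny_n$; curvature is $-1$. A $k$-dimensional pseudo-manifold is a finite simplicial complex $K$ such that every simplex lies in a $k$-simplex, every $(k-1)$-simplex lies in exactly two $k$-simplices, and $K$ minus its $(k-2)$-skeleton is connected. It is oriented if its $k$-simplices are oriented so that for any two $k$-simplices sharing a $(k-1)$-face, the induced orientations of that face are opposite. A map $P\colon\Delta^k\to\Lambda^n$ from an affine simplex with vertices $v_0,\dots,v_k$ is pseudo-linear if $P(\sum\beta_jv_j)=\sum\beta_jP(v_j)/|\sum\beta_jP(v_j)|$ for all $\beta_j\ge0$ with $\sum\beta_j=1$, where $|\mathbf{x}|=\sqrt{\langle\mathbf{x},\mathbf{x}\rangle}$. A bounded (simplicial) polyhedron of combinatorial type $K$ is a map $P\colon K\to\Lambda^n$ whose restriction to every simplex of $K$ is pseudo-linear. A flexion is a continuous family $P_t\colon K\to\Lambda^n$, $t\in(a,b)$, of such polyhedra such that the length of every edge of $P_t$ is independent of $t$.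 If $[v_1^{(s)}\dots v_n^{(s)}]$, $s=1,\dots,q$, are the positively oriented $(n-1)$-simplices of $K$, the generalized oriented volume is $\mathcal{V}_K(P)=\sum_{s=1}^q V_{or}(\mathbf{o},P(v_1^{(s)}),\dots,P(v_n^{(s)}))$, where $\mathbf{o}\in\Lambda^n$ is arbitrary (the sum is independent of it) and $V_{or}(w_0,\dots,w_n)$ is the oriented volume of the simplex with vertices $w_0,\dots,w_n$ with orientation given by this order of vertices. *)

(* Defs.v *)
From HB Require Import structures.
From mathcomp Require Import all_boot all_order all_algebra all_fingroup.
From mathcomp Require Import all_classical all_reals all_analysis.
Set Implicit Arguments. Unset Strict Implicit. Unset Printing Implicit Defensive.
Import Order.TTheory GRing.Theory Num.Theory.
Import numFieldNormedType.Exports.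
Local Open Scope classical_set_scope.
Local Open Scope ring_scope.

Section Hyperbolic.
Variables (R : realType) (n : nat).

(** Points of R^{1,n}: coordinates x_0, x_1, ..., x_n (index 0 is time). *)
Definition pt := 'I_n.+1 -> R.

Definition minkowski (x y : pt) : R :=
  x ord0 * y ord0 - \sum_(i < n) x (lift ord0 i) * y (lift ord0 i).

Definition mnorm (x : pt) : R := Num.sqrt (minkowski x x).

Definition in_Lambda (x : pt) : Prop := minkowski x x = 1 /\ 0 < x ord0.

(** Hyperbolic distance (curvature -1): cosh d(x,y) = <x,y>, i.e.
    d = arcosh <x,y> = ln(<x,y> + sqrt(<x,y>^2 - 1)). *)
Definition hdist (x y : pt) : R :=
  ln (minkowski x y + Num.sqrt (minkowski x y ^+ 2 - 1)).

(** The hyperbolic simplex with vertices w_0..w_n: the image of the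
    pseudo-linear map of the standard simplex. *)
Definition hsimplex (w : 'I_n.+1 -> pt) : set pt :=
  [set x | exists beta : 'I_n.+1 -> R,
     (forall j, 0 <= beta j) /\ \sum_j beta j = 1 /\
     x = (fun k => (\sum_j beta j * w j k) /
                   mnorm (fun k' => \sum_j beta j * w j k'))].

(** Chart Lambda^n -> R^n, x |-> (x_1,...,x_n) (a diffeomorphism). *)
Definition chart (x : pt) : 'I_n -> R := fun i => x (lift ord0 i).

(** Riemannian volume density of Lambda^n in this chart:
    the induced metric g = I - y y^T/(1+|y|^2) has sqrt(det g) = (1+|y|^2)^(-1/2). *)
Definition vol_density (y : 'I_n -> R) : R :=
  (Num.sqrt (1 + \sum_i y i ^+ 2))^-1.

End Hyperbolic.

(** Lebesgue integral of a nonnegative function on R^m, defined as the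
    iterated one-dimensional Lebesgue integral (Tonelli). *)
Definition vcons (R : Type) (m : nat) (x : R) (v : 'I_m -> R) : 'I_m.+1 -> R :=
  fun i => match unlift ord0 i with Some j => v j | None => x end.

Fixpoint iint (R : realType) (m : nat) : (('I_m -> R) -> \bar R) -> \bar R :=
  match m with
  | 0 => fun F => F (fun i => 0)
  | m'.+1 => fun F =>
      (\int[@lebesgue_measure R]_x iint (fun v => F (vcons x v)))%E
  end.

Definition hvol (R : realType) (n : nat) (S : set (pt R n)) : R :=
  fine (iint (fun y : 'I_n -> R =>
    if `[< exists x, S x /\ chart x = y >] then (vol_density y)%:E else 0%E)).

(** Oriented volume V_or(w_0,...,w_n): the volume of the hyperbolic simplex,
    with sign +1/-1 according to whether the ordering w_0,...,w_n agrees with the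
    standard orientation of Lambda^n (sign of det[w_0;...;w_n]); 0 if degenerate. *)
Definition Vor (R : realType) (n : nat) (w : 'I_n.+1 -> pt R n) : R :=
  Num.sg (\det (\matrix_(i, j) w i j)) * hvol (hsimplex w).

(** Combinatorics.  The (n-1)-simplices of K are given by q oriented facets
    f s = [v_1^(s) ... v_n^(s)] (positively oriented orderings) on a finite
    vertex type V; K is the simplicial complex of all faces of these. *)
Section Complex.
Variables (V : finType) (n q : nat) (f : 'I_q -> 'I_n -> V).

Definition facet (s : 'I_q) : {set V} := [set f s i | i : 'I_n].

Definition adjacent (s s' : 'I_q) : bool := (#|facet s :&: facet s'| == n.-1)%N.

Definition is_pseudomanifold : Prop :=
  (forall s, injective (f s)) /\
  (forall s s', facet s = facet s' -> s = s') /\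
  (forall v : V, exists s i, f s i = v) /\
  (forall (s : 'I_q) (i : 'I_n),
     #|[set s' : 'I_q | f s @: (~: [set i]) \subset facet s']| = 2%N) /\
  (* K minus its (n-3)-skeleton is connected (strong connectedness) *)
  (forall s s', connect adjacent s s').

(** Orientation: for adjacent facets s, s' (with a the vertex of s not in s'),
    the ordering of s' with its extra vertex replaced by a is an odd
    permutation of the ordering of s; i.e. the induced orientations of the
    common face are opposite. *)
Definition is_oriented : Prop :=
  forall s s' : 'I_q, s != s' -> adjacent s s' ->
  forall a, a \in facet s -> a \notin facet s' ->
  exists sigma : 'S_n, odd_perm sigma /\
    forall i, (if f s' i \in facet s then f s' i else a) = f s (sigma i).

Definition is_edge (u v : V) : Prop :=
  u != v /\ exists s, u \in facet s /\ v \in facet s.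

End Complex.

(** Generalized oriented volume V_K(P) with auxiliary point o, where the
    polyhedron P (pseudo-linear on every simplex) is determined by its
    vertex map p : V -> Lambda^n. *)
Definition VK (R : realType) (V : finType) (n q : nat) (f : 'I_q -> 'I_n -> V)
  (o : pt R n) (p : V -> pt R n) : R :=
  \sum_(s < q) Vor (fun j : 'I_n.+1 =>
                      match unlift ord0 j with Some i => p (f s i) | None => o end).

Definition is_flexion (R : realType) (V : finType) (n q : nat)
  (f : 'I_q -> 'I_n -> V) (a b : R) (p : R -> V -> pt R n) : Prop :=
  (forall t, a < t < b -> forall v, in_Lambda (p t v)) /\
  (forall v k, {within [set x : R | a < x < b], continuous (fun t => p t v k)}) /\
  (forall u v, is_edge f u v -> forall t t', a < t < b -> a < t' < b ->
     hdist (p t u) (p t v) = hdist (p t' u) (p t' v)).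

(* Main.v *)
(* Up to a constant, the oriented volume is a Gaussian integral over a cone, which extends to complex
   configurations whose facet Gram matrices stay real. When these matrices are fixed, the Schlafli formula
   writes the differential of the extended volume as a sum of c_a d(arg z_a), with constants c_a and with z_a
   algebraic in the coordinates. Expand the c_a in a Q-basis of their span: moving a configuration around a
   large loop in a transcendental parameter gives vanishing integral winding numbers, so the corresponding
   monomials in the z_a cannot depend on the parameter, and the parameter can be specialized without changing
   the volume. Hence all the values of the volume are attained at configurations over a fixed countable field:
   they form a countable set, and a continuous function with countably many values is constant. *)
From Pilot Require Import Defs.
From HB Require Import structures.
From mathcomp Require Import all_boot all_order all_algebra all_fingroup.
From mathcomp Require Import all_classical all_reals all_analysis measurable_realfun.
Set Implicit Arguments. Unset Strict Implicit. Unset Printing Implicit Defensive.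
Import Order.TTheory GRing.Theory Num.Theory.
Import numFieldNormedType.Exports.
Local Open Scope classical_set_scope.
Local Open Scope ring_scope.

(** The extended volume has to be a single-valued function of complex configurations whose facet
    Gram matrices are real; otherwise nothing could be concluded from a loop. Cones over the facets
    with a fixed apex do not serve, since products with the apex may become complex. But in the
    differential of their total volume the walls through the apex cancel between neighbouring
    facets, leaving a 1-form [fluxK] carried by the facets alone, and this form is closed.
    Integrating its imaginary part while the imaginary parts of all vertices grow from 0 defines the
    potential [EK], free of monodromy. The Gaussian turns every coefficient into a moment of a real
    coercive quadratic form. An auxiliary vector [g] splits the rotation of a facet about a ridge
    into logarithmic data of that facet, up to ridge terms that cancel. Oddness of the dimension
    fixes the sign of the ridge Gram determinants: the coefficients of the logarithmic forms are
    then real, so the imaginary part sees arguments only; and i^n has a nonzero imaginary part, so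
    [EK] determines the volume. *)

(** * Derivatives of real functions of one variable *)

Section RealDerivatives.
Context {R : realType}.
Implicit Types (f g : R -> R) (x a b : R).

(** Derivability and value are kept in one relation, so that the rules compose without side
    conditions and [dR_eq] adjusts the computed value at the end. *)
Definition dR f x a := is_derive x (1 : R) f a.

Lemma dR_eq f x a b : dR f x a -> a = b -> dR f x b.
Proof. by move=> h <-. Qed.

Lemma dR_ext f g x a : (forall y, f y = g y) -> dR f x a -> dR g x a.
Proof. by move=> /funext ->. Qed.

Lemma dR_near f g x a : (\forall y \near x, f y = g y) -> dR f x a -> dR g x a.
Proof.
by move=> fg; exact: near_eq_is_derive.
Qed.

Lemma dR_cst c x : dR (fun=> c) x 0.
Proof. exact: is_derive_cst. Qed.

Lemma dR_id x : dR (fun y => y) x 1.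
Proof. exact: is_derive_id. Qed.

Lemma dRD f g x a b : dR f x a -> dR g x b -> dR (fun y => f y + g y) x (a + b).
Proof. by move=> df dg; exact: is_deriveD. Qed.

Lemma dRN f x a : dR f x a -> dR (fun y => - f y) x (- a).
Proof. by move=> df; exact: is_deriveN. Qed.

Lemma dRB f g x a b : dR f x a -> dR g x b -> dR (fun y => f y - g y) x (a - b).
Proof. by move=> df dg; exact: is_deriveB. Qed.

Lemma dRM f g x a b : dR f x a -> dR g x b -> dR (fun y => f y * g y) x (a * g x + f x * b).
Proof.
move=> df dg; have := @is_deriveM _ _ f g x 1 a b df dg.
by rewrite /GRing.scale /= addrC [g x * _]mulrC.
Qed.

Lemma dRZ c f x a : dR f x a -> dR (fun y => c * f y) x (c * a).
Proof. by move=> df; apply: dR_eq (dRM (dR_cst c x) df) _; rewrite mul0r add0r. Qed.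

Lemma dR_comp f g x a b : dR g x a -> dR f (g x) b -> dR (fun y => f (g y)) x (b * a).
Proof. by move=> dg df; exact: is_derive1_comp. Qed.

Lemma dR_exp f x a : dR f x a -> dR (fun y => expR (f y)) x (expR (f x) * a).
Proof. by move=> df; apply: dR_comp df _; exact: is_derive_expR. Qed.

Lemma dR_sum (I : Type) (s : seq I) (f : I -> R -> R) x (a : I -> R) :
  (forall i, dR (f i) x (a i)) -> dR (fun y => \sum_(i <- s) f i y) x (\sum_(i <- s) a i).
Proof.
move=> df; elim: s => [|i s IH].
  rewrite big_nil; apply: dR_ext (dR_cst 0 x) => y; by rewrite big_nil.
rewrite big_cons; apply: dR_ext (dRD (df i) IH) => y; by rewrite big_cons.
Qed.

Lemma dR_continuous f x a : dR f x a -> {for x, continuous f}.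
Proof.
move=> df; apply: differentiable_continuous; apply/derivable1_diffP; by case: df.
Qed.

Lemma dR_unique f x a b : dR f x a -> dR f x b -> a = b.
Proof. by move=> da db; rewrite -(@derive_val _ _ _ _ _ _ _ da) (@derive_val _ _ _ _ _ _ _ db). Qed.

(* A perturbation whose majorant [u] vanishes to second order does not change the derivative. *)
Lemma dR_squeeze f g u x a : dR g x a -> dR u x 0 -> u x = 0 ->
  (\forall y \near x, `|f y - g y| <= u y) -> dR f x a.
Proof.
move=> dg du u0 fg.
have fx : f x = g x.
  have := nbhs_singleton fg; rewrite u0 normr_le0 subr_eq0 => /eqP //.
suff d0 : dR (fun y => f y - g y) x 0.
  apply: dR_ext (dR_eq (dRD d0 dg) (add0r _)) => y; by rewrite subrK.
have E (k : R -> R) : (fun h : R => h^-1 *: (k (h *: (1 : R) + x) - k x)) =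
    (fun h => h^-1 *: (k (h + x) - k x)).
  by apply/funext => h; rewrite [h *: 1]mulr1.
have cu : h^-1 *: (u (h + x) - u x) @[h --> 0^'] --> (0 : R).
  have [/cvg_ex[l /= cl] dl] := du; rewrite E in cl.
  have l0 : l = 0; last by rewrite -[X in _ --> X]l0.
  by rewrite -dl /derive E; exact/esym/cvg_lim.
have c0 : h^-1 *: ((f (h + x) - g (h + x)) - (f x - g x)) @[h --> 0^'] --> (0 : R).
  apply/norm_cvg0P.
  apply: (@squeeze_cvgr _ _ _ _ (cst 0) (fun h => `|h^-1 *: (u (h + x) - u x)|)).
  - have fg' : \forall h \near (0:R), `|f (h + x) - g (h + x)| <= u (h + x).
      have : (h + x) @[h --> (0:R)] --> x.
        by rewrite -[X in _ --> X]add0r; apply: cvgD; [exact: cvg_id|exact: cvg_cst].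
      by move/(_ _ fg).
    near=> h; rewrite normr_ge0 /= fx subrr subr0 u0 subr0 /GRing.scale /= !normrM.
    rewrite ler_wpM2l // (le_trans _ (ler_norm _)) //.
    by near: h; apply: cvg_within.
  - exact: cvg_cst.
  - by apply/norm_cvg0P.
pose k y := f y - g y.
rewrite /dR; apply: DeriveDef; first by apply/cvg_ex; exists 0; rewrite (E k).
by rewrite /derive (E k); exact/cvg_lim.
Unshelve. all: by end_near. Qed.

Lemma dR0_cst f a b : a <= b -> (forall x, a <= x <= b -> dR f x 0) -> f a = f b.
Proof.
rewrite le_eqVlt => /predU1P[-> //|ab] df.
have cf : {within `[a, b], continuous f}.
  apply: continuous_in_subspaceT => x; rewrite inE /= in_itv /= => h.
  exact: dR_continuous (df x h).
have [|c _] := @MVT R f (fun=> 0) a b ab _ cf.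
  by move=> x; rewrite in_itv /= => /andP[h1 h2]; apply: df; rewrite !ltW.
by rewrite mul0r => /eqP; rewrite subr_eq0 => /eqP.
Qed.

End RealDerivatives.

(** * Measurability and Tonelli for the iterated integral *)

Section IteratedIntegral.
Context {R : realType}.
Local Open Scope ereal_scope.
Notation mu := (@lebesgue_measure R).

(** Generalizes [vcons], which is the case [l = ord0]; integration by parts singles out a coordinate
    in any position. The same operation later replaces one vector in a family. *)
Definition vins (T : Type) m (l : 'I_m.+1) (x : T) (v : 'I_m -> T) : 'I_m.+1 -> T :=
  fun i => if unlift l i is Some j then v j else x.

Lemma vins_lift (T : Type) m (l : 'I_m.+1) (x : T) v j : vins l x v (lift l j) = v j.
Proof. by rewrite /vins liftK. Qed.

Lemma vins_id (T : Type) m (l : 'I_m.+1) (x : T) v : vins l x v l = x.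
Proof. by rewrite /vins unlift_none. Qed.

Lemma vconsE (T : Type) m (x : T) (v : 'I_m -> T) : vcons x v = vins ord0 x v.
Proof. by []. Qed.

Lemma vins_vcons (T : Type) m (l : 'I_m.+1) (x y : T) (v : 'I_m -> T) :
  vins (lift ord0 l) x (vcons y v) = vcons y (vins l x v).
Proof.
apply/funext => i; rewrite vconsE.
case: (unliftP ord0 i) => [j ->|->]; rewrite vconsE ?vins_lift ?vins_id.
  case: (unliftP l j) => [k ->|->]; last by rewrite !vins_id.
  rewrite vins_lift.
  have -> : lift ord0 (lift l k) = lift (lift ord0 l) (lift ord0 k).
    by apply: val_inj; rewrite /= /bump /= !add1n ltnS addnS.
  by rewrite !vins_lift.
have -> : ord0 = lift (lift ord0 l) ord0 by apply: val_inj.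
by rewrite vins_lift vins_id.
Qed.

Lemma measurable_vins m (l : 'I_m.+1) d (T : measurableType d) (f : T -> R)
    (g : T -> 'I_m -> R) (i : 'I_m.+1) :
  measurable_fun setT f -> (forall j, measurable_fun setT (fun x => g x j)) ->
  measurable_fun setT (fun x => vins l (f x) (g x) i).
Proof.
move=> mf mg; case: (unliftP l i) => [j ->|->].
  by rewrite [X in measurable_fun _ X](_ : _ = g^~ j) //; apply/funext => x; rewrite vins_lift.
by rewrite [X in measurable_fun _ X](_ : _ = f) //; apply/funext => x; rewrite vins_id.
Qed.

(** Measurability on R^m refers to the product sigma-algebra of [m.-tuple R], transported along
    [tnth]. *)
Definition vmeas m (F : ('I_m -> R) -> \bar R) :=
  measurable_fun setT (fun t : m.-tuple R => F (tnth t)).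

Lemma vmeas_comp m (F : ('I_m -> R) -> \bar R) d (T : measurableType d)
    (phi : T -> 'I_m -> R) :
  vmeas F -> (forall i, measurable_fun setT (fun x => phi x i)) ->
  measurable_fun setT (fun x => F (phi x)).
Proof.
move=> mF mphi.
rewrite (_ : (fun x => F (phi x)) =
  (fun t : m.-tuple R => F (tnth t)) \o (fun x => [tuple phi x i | i < m])).
  apply: measurableT_comp => //; apply/measurable_fun_tnthP => i /=.
  rewrite (_ : _ \o _ = fun x => phi x i) //.
  by apply/funext => x /=; rewrite tnth_mktuple.
apply/funext => x /=; congr F; apply/funext => i.
by rewrite tnth_mktuple.
Qed.

(** A parameter space is carried along because induction on the dimension moves the first coordinate
    into the parameter, replacing [T] by [T * R]. *)
Definition pvmeas d (T : measurableType d) m (F : T -> ('I_m -> R) -> \bar R) :=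
  measurable_fun setT (fun z : T * m.-tuple R => F z.1 (tnth z.2)).

Lemma measurable_tnth2 d (T : measurableType d) m (i : 'I_m) :
  measurable_fun setT (fun z : T * m.-tuple R => tnth z.2 i).
Proof.
apply: (@measurableT_comp _ _ _ _ _ _ (fun t : m.-tuple R => tnth t i)) => //.
exact: measurable_tnth.
Qed.

Lemma pvmeas_comp d (T : measurableType d) m (F : T -> ('I_m -> R) -> \bar R)
    d' (T' : measurableType d') (a : T' -> T) (phi : T' -> 'I_m -> R) :
  pvmeas F -> measurable_fun setT a ->
  (forall i, measurable_fun setT (fun x => phi x i)) ->
  measurable_fun setT (fun x => F (a x) (phi x)).
Proof.
move=> mF ma mphi.
rewrite (_ : (fun x => F (a x) (phi x)) =
  (fun z : T * m.-tuple R => F z.1 (tnth z.2)) \o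
  (fun x => (a x, [tuple phi x i | i < m]))).
  apply: measurableT_comp => //; apply/measurable_fun_pairP; split => //=.
  apply/measurable_fun_tnthP => i /=.
  rewrite (_ : _ \o _ = fun x => phi x i) //.
  by apply/funext => x /=; rewrite tnth_mktuple.
apply/funext => x /=; congr F; apply/funext => i.
by rewrite tnth_mktuple.
Qed.

Lemma iint_ge0 m (F : ('I_m -> R) -> \bar R) : (forall t, 0 <= F t) -> 0 <= iint F.
Proof.
elim: m F => [|m IH] F F0 //=.
by apply: integral_ge0 => x _; apply: IH.
Qed.

Lemma eq_iint m (F G : ('I_m -> R) -> \bar R) : F =1 G -> iint F = iint G.
Proof. by move=> /funext ->. Qed.

Lemma measurable_iint d (T : measurableType d) m (F : T -> ('I_m -> R) -> \bar R) :
  pvmeas F -> (forall x t, 0 <= F x t) -> measurable_fun setT (fun x => iint (F x)).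
Proof.
elim: m d T F => [|m IH] d T F mF F0 /=.
  exact: (@pvmeas_comp _ _ _ _ _ _ id (fun _ _ => 0%R)).
apply: (@measurable_fun_fubini_tonelli_F _ _ _ _ _ mu
   (fun z : T * R => iint (fun v => F z.1 (vcons z.2 v)))).
  apply: (IH _ _ (fun (z : T * R) v => F z.1 (vcons z.2 v))) => //.
  apply: (@pvmeas_comp _ _ _ _ _ _ (fun z : (T * R) * m.-tuple R => z.1.1)
     (fun z => vcons z.1.2 (tnth z.2))) => //.
    exact: measurableT_comp.
  move=> i; apply: (@measurable_vins _ ord0) => [|j]; last exact: measurable_tnth2.
  exact: measurableT_comp.
by move=> z; apply: iint_ge0.
Qed.

Lemma pvmeas_vcons m (F : ('I_m.+1 -> R) -> \bar R) :
  vmeas F -> pvmeas (fun x v => F (vcons x v)).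
Proof.
move=> mF; apply: (@vmeas_comp _ F _ _ (fun z : R * m.-tuple R => vcons z.1 (tnth z.2))) => // i.
apply: (@measurable_vins _ ord0) => [|j]; last exact: measurable_tnth2.
exact: measurable_fst.
Qed.

Lemma pvmeas_vmeas d (T : measurableType d) m (F : T -> ('I_m -> R) -> \bar R) x :
  pvmeas F -> vmeas (F x).
Proof.
move=> mF; apply: (@pvmeas_comp _ _ _ F _ _ (fun=> x) (fun t : m.-tuple R => tnth t)) => //.
by move=> i; exact: measurable_tnth.
Qed.

Lemma pvmeas_flip d (T : measurableType d) m (F : T -> ('I_m -> R) -> \bar R) :
  pvmeas F -> measurable_fun setT (fun z : m.-tuple R * T => F z.2 (tnth z.1)).
Proof.
move=> mF; apply: (@pvmeas_comp _ _ _ F _ _ snd (fun z : m.-tuple R * T => tnth z.1)) => //.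
move=> i.
apply: (@measurableT_comp _ _ _ _ _ _ (fun t : m.-tuple R => tnth t i)) => //.
exact: measurable_tnth.
Qed.

(** The outer variable passes the coordinates one at a time, by the Tonelli theorem in two
    variables. *)
Lemma iint_tonelli m (F : R -> ('I_m -> R) -> \bar R) :
  pvmeas F -> (forall x t, 0 <= F x t) ->
  \int[mu]_x iint (F x) = iint (fun v => \int[mu]_x F x v).
Proof.
elim: m F => [|m IH] F mF F0 //=.
have mG : measurable_fun setT (fun z : R * R => iint (fun v => F z.1 (vcons z.2 v))).
  apply: (@measurable_iint _ _ _ (fun (z : R * R) v => F z.1 (vcons z.2 v))) => //.
  apply: (@pvmeas_comp _ _ _ _ _ _ (fun z : (R * R) * m.-tuple R => z.1.1)
     (fun z => vcons z.1.2 (tnth z.2))) => //; first exact: measurableT_comp.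
  move=> i; apply: (@measurable_vins _ ord0) => [|j]; last exact: measurable_tnth2.
  exact: measurableT_comp.
rewrite (@fubini_tonelli _ _ _ _ _ mu mu
  (fun z : R * R => iint (fun v => F z.1 (vcons z.2 v)))) //=; last first.
  by move=> z; apply: iint_ge0.
apply: eq_integral => y _; rewrite IH //.
apply: (@pvmeas_comp _ _ _ _ _ _ fst
     (fun z : R * m.-tuple R => vcons y (tnth z.2))) => //.
move=> i; apply: (@measurable_vins _ ord0) => // j; exact: measurable_tnth2.
Qed.

Lemma iint_vins m (l : 'I_m.+1) (F : ('I_m.+1 -> R) -> \bar R) :
  vmeas F -> (forall t, 0 <= F t) ->
  iint F = iint (fun v => \int[mu]_x F (vins l x v)).
Proof.
elim: m l F => [|m IH] l F mF F0.
  by rewrite (ord1 l).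
case: (unliftP ord0 l) => [j ->|->]; last first.
  rewrite [LHS]/= (@iint_tonelli _ (fun x v => F (vcons x v))) //.
  exact: pvmeas_vcons.
rewrite [LHS]/= [RHS]/=; apply: eq_integral => y _.
under [in RHS]eq_fun do under eq_integral do rewrite vins_vcons.
rewrite -/(iint (fun v => F (vcons y v))).
apply: (IH j (fun v => F (vcons y v))) => //.
exact: (@pvmeas_vmeas _ _ _ (fun x v => F (vcons x v)) y (pvmeas_vcons mF)).
Qed.

Lemma iintD m (F G : ('I_m -> R) -> \bar R) : vmeas F -> vmeas G ->
  (forall t, 0 <= F t) -> (forall t, 0 <= G t) ->
  iint (fun t => F t + G t) = iint F + iint G.
Proof.
elim: m F G => [|m IH] F G mF mG F0 G0 //=.
rewrite -ge0_integralD //.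
- apply: eq_integral => x _; apply: IH => //.
    exact: (@pvmeas_vmeas _ _ _ (fun x v => F (vcons x v)) x (pvmeas_vcons mF)).
  exact: (@pvmeas_vmeas _ _ _ (fun x v => G (vcons x v)) x (pvmeas_vcons mG)).
- by move=> x _; apply: iint_ge0.
- exact: (measurable_iint (pvmeas_vcons mF)).
- by move=> x _; apply: iint_ge0.
- exact: (measurable_iint (pvmeas_vcons mG)).
Qed.

Lemma iintZl m (k : R) (F : ('I_m -> R) -> \bar R) : vmeas F -> (0 <= k)%R ->
  (forall t, 0 <= F t) -> iint (fun t => k%:E * F t) = k%:E * iint F.
Proof.
elim: m F => [|m IH] F mF k0 F0 //=.
rewrite -ge0_integralZl //.
- apply: eq_integral => x _; apply: IH => //.
  exact: (@pvmeas_vmeas _ _ _ (fun x v => F (vcons x v)) x (pvmeas_vcons mF)).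
- exact: (measurable_iint (pvmeas_vcons mF)).
- by move=> x _; apply: iint_ge0.
Qed.

Lemma le_iint m (F G : ('I_m -> R) -> \bar R) : vmeas F -> vmeas G ->
  (forall t, 0 <= F t) -> (forall t, F t <= G t) -> iint F <= iint G.
Proof.
elim: m F G => [|m IH] F G mF mG F0 FG //=.
have G0 t : 0 <= G t by apply: le_trans (F0 t) (FG t).
apply: ge0_le_integral => //.
- by move=> x _; apply: iint_ge0.
- exact: (measurable_iint (pvmeas_vcons mF)).
- exact: (measurable_iint (pvmeas_vcons mG)).
- move=> x _; apply: IH => //.
    exact: (@pvmeas_vmeas _ _ _ (fun x v => F (vcons x v)) x (pvmeas_vcons mF)).
  exact: (@pvmeas_vmeas _ _ _ (fun x v => G (vcons x v)) x (pvmeas_vcons mG)).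
Qed.

End IteratedIntegral.

(** * One-variable changes of variable from the uniqueness of Lebesgue measure *)

Section ChangeVar1.
Context {R : realType}.
Local Open Scope ereal_scope.
Notation mu := (@lebesgue_measure R).

(** The image under [h] of the measure with density [rho] gives every half-open interval its length,
    hence is Lebesgue measure by uniqueness. The weighted measure is realized as planar Lebesgue
    measure on the region under the graph of [rho]. Stating the condition through integrals admits
    maps defined by cases. *)
Lemma ge0_change_var1 (h rho : R -> R) :
  measurable_fun setT h -> measurable_fun setT rho -> (forall x, (0 <= rho x)%R) ->
  (forall a b, (a < b)%R ->
     \int[mu]_x (if (a < h x <= b)%R then rho x else 0%R)%:E = (b - a)%:E) ->
  forall f : R -> \bar R, measurable_fun setT f -> (forall x, 0 <= f x) ->
  \int[mu]_y f y = \int[mu]_x (f (h x) * (rho x)%:E).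
Proof.
move=> mh mrho rho0 hab f mf f0.
pose u (z : measurableTypeR R * measurableTypeR R) := (0 < z.2 <= rho z.1)%R.
have mu1 : measurable_fun setT u.
  apply: measurable_and.
    by apply: measurable_fun_ltr => //; exact: measurable_snd.
  apply: measurable_fun_ler; first exact: measurable_snd.
  exact: measurableT_comp.
pose U := [set z | u z].
have mU : measurable U.
  by rewrite -[U]setTI; exact: (mu1 measurableT [set true]).
have mh1 : measurable_fun setT (h \o @fst (measurableTypeR R) (measurableTypeR R) : _ -> measurableTypeR R) by exact: measurableT_comp.
have inner (g : R -> \bar R) x : 0 <= g x ->
    \int[mu]_y (g x * (\1_U (x, y))%:E) = g x * (rho x)%:E.
  move=> g0.
  have E y : g x * (\1_U (x, y))%:E = ((fun=> g x) \_ `]0%R, rho x]) y.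
    rewrite patchE indicE /U /u; case: ifPn => [/set_mem/=|] hy.
      by rewrite mem_set //= ?mule1 //; move: hy; rewrite in_itv.
    rewrite memNset ?mule0 //= => hy'; move/negP : hy; apply.
    by apply: mem_set; rewrite /= in_itv.
  under eq_integral do rewrite E.
  rewrite -integral_mkcond integral_cst //= lebesgue_measure_itv /= lte_fin.
  case: ltP => [r0|r0]; first by rewrite -EFinD subr0.
  by have -> : rho x = 0%R by apply/eqP; rewrite eq_le rho0 r0.
pose m2 : {measure set (measurableTypeR R * measurableTypeR R)%type -> \bar R} := mrestr (mu \x mu) mU.
pose nu0 : {measure set (measurableTypeR R) -> \bar R} := pushforward m2 (h \o @fst (measurableTypeR R) (measurableTypeR R) : _ -> measurableTypeR R).
pose nu := nu0 mh1.
have nuE (A : set R) : measurable A -> mu A = nu A.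
  apply: lebesgue_measure_unique => X /ocitvP[->|[[a b] /= ab ->]].
    by rewrite !measure0.
  rewrite lebesgue_measure_itv /= lte_fin ab -EFinD -hab //.
  rewrite /nu /= /pushforward /m2 /= /mrestr.
  have mX : measurable ((h \o @fst (measurableTypeR R) (measurableTypeR R) : _ -> measurableTypeR R) @^-1` `]a, b]%classic).
    by rewrite -[X in measurable X]setTI; exact: (@mh1).
  rewrite -[in RHS](setIT (_ `&` U)) -integral_indic //; last exact: measurableI.
  rewrite fubini_tonelli1 /=; first last.
  - by move=> z; rewrite lee_fin.
  - by apply/measurable_EFinP; exact: measurable_indic (measurableI _ _ mX mU).
  apply: eq_integral => x _; rewrite /fubini_F /=.
  rewrite -[LHS]mul1e (_ : 1 * _ = (if (a < h x <= b)%R then 1 else 0) * (rho x)%:E); last first.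
    by case: ifP; rewrite ?mul1e ?mule0 ?mul0e.
  rewrite -(inner (fun x => if (a < h x <= b)%R then 1 else 0)); last by case: ifP.
  apply: eq_integral => y _; rewrite indicI /= !indicE /=.
  case: ifPn => hx.
    by rewrite [in RHS](@mem_set _ (_ @^-1` _) (x, y)) /= ?in_itv //= mul1r mul1e.
  by rewrite [in RHS](@memNset _ (_ @^-1` _) (x, y)) /= ?in_itv ?mul0r ?mul0e //; exact/negP.
rewrite (eq_measure_integral nu); last by move=> A mA _; exact: nuE.
rewrite ge0_integral_pushforward //= preimage_setT.
rewrite (@ge0_negligible_integral _ _ _ m2 setT (~` U) _ (measurableC mU) measurableT); first last.
- by rewrite /m2 /= /mrestr setICl measure0.
- by move=> x _ /=.
- exact: measurableT_comp.
rewrite setTD setCK (eq_measure_integral (mu \x mu)); last first.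
  by move=> A mA AU; rewrite /m2 /= /mrestr setIidl.
rewrite integral_mkcond fubini_tonelli1 /=; first last.
- by move=> z; rewrite patchE; case: ifP.
- by apply/(measurable_restrictT _ mU); apply: measurable_funTS; exact: measurableT_comp.
apply: eq_integral => x _; rewrite /fubini_F /= -(inner (f \o h)); last exact: f0.
apply: eq_integral => y _; rewrite patchE indicE.
by case: ifP => _; rewrite ?mule1 ?mule0.
Qed.

Lemma ge0_integral_affine (a b : R) (f : R -> \bar R) : a != 0%R ->
  measurable_fun setT f -> (forall x, 0 <= f x) ->
  `|a|%:E * \int[mu]_x f (a * x + b)%R = \int[mu]_x f x.
Proof.
move=> a0 mf f0.
have mh : measurable_fun setT (fun x : R => a * x + b)%R.
  by apply: measurable_funD => //; exact: measurable_funM.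
rewrite [RHS](@ge0_change_var1 (fun x => a * x + b)%R (fun=> `|a|%R)) //.
  rewrite -ge0_integralZl //; last exact: measurableT_comp.
  by apply: eq_integral => x _; rewrite muleC.
move=> c d cd.
(* The preimage of the interval is written through [Num.sg a * x], so that both signs of [a] share
   the bounds [k] and [l]. *)
have [k [l [kl E]]] : exists k l, (k <= l)%R /\ ((forall x, (c < a * x + b <= d)%R =
       (`|a| * k < `|a| * (Num.sg a * x) <= `|a| * l)%R) /\
    (l - k = (d - c) / `|a|)%R).
  exists ((c - b) / `|a|)%R, ((d - b) / `|a|)%R; split.
    by rewrite ler_pM2r ?invr_gt0 ?normr_gt0 // lerD2r ltW.
  split; last by rewrite -mulrBl opprB addrA subrK.
  move=> x; rewrite !mulrA ![(`|a| * _ / _)%R]mulrAC divff ?normr_eq0 // !mul1r.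
  by rewrite [(`|a| * _)%R]mulrC -numEsg ltrBlDr lerBrDr.
case: E => E lk; under eq_integral do rewrite E.
have na0 : (0 < `|a|)%R by rewrite normr_gt0.
have [ap|an] := ltP 0%R a.
  transitivity (\int[mu]_(x in `]k, l]) (`|a|)%:E).
    rewrite [RHS]integral_mkcond; apply: eq_integral => x _.
    rewrite patchE gtr0_sg // mul1r ltr_pM2l // ler_pM2l //.
    case: ifPn => [h|h]; first by rewrite mem_set //= in_itv.
    by rewrite memNset //= in_itv /=; exact/negP.
  rewrite integral_cst //= lebesgue_measure_itv /= lte_fin.
  have kl' : (k < l)%R by rewrite -subr_gt0 lk divr_gt0 // subr_gt0.
  by rewrite kl' -EFinB -EFinM lk mulrCA divff ?mulr1 // normr_eq0.
have {an} an : (a < 0)%R by rewrite lt_neqAle a0.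
transitivity (\int[mu]_(x in `[(- l)%R, (- k)%R[) (`|a|)%:E).
  rewrite [RHS]integral_mkcond; apply: eq_integral => x _.
  rewrite patchE ltr0_sg // mulN1r ltr_pM2l // ler_pM2l //.
  case: ifPn => [/andP[h1 h2]|h].
    by rewrite mem_set //= in_itv /= lerNl ltrNr h1 h2.
  by rewrite memNset //= in_itv /= lerNl ltrNr andbC; exact/negP.
rewrite integral_cst //= lebesgue_measure_itv /= lte_fin.
have kl' : (- l < - k)%R by rewrite ltrN2 -subr_gt0 lk divr_gt0 // subr_gt0.
by rewrite kl' -EFinB -EFinM opprK addrC lk mulrCA divff ?mulr1 // normr_eq0.
Qed.

End ChangeVar1.

(** * Linear change of variables for the iterated integral *)

Section LinearChange.
Context {R : realType}.
Local Open Scope ereal_scope.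
Notation mu := (@lebesgue_measure R).

Lemma iint_shift m (b : 'I_m -> R) (F : ('I_m -> R) -> \bar R) :
  vmeas F -> (forall t, 0 <= F t) ->
  iint (fun t => F (fun i => (t i + b i)%R)) = iint F.
Proof.
elim: m b F => [|m IH] b F mF F0 /=.
  by congr F; apply/funext => -[].
have E x : iint (fun v => F (fun i => (vcons x v i + b i)%R)) =
           iint (fun v => F (vcons (x + b ord0)%R v)).
  rewrite -[RHS](IH (fun i => b (lift ord0 i))) //.
    apply: eq_iint => v; congr F; apply/funext => i; rewrite !vconsE.
    by case: (unliftP ord0 i) => [j ->|->]; rewrite ?vins_lift ?vins_id.
  exact: (@pvmeas_vmeas _ _ _ _ (fun x v => F (vcons x v)) _ (pvmeas_vcons mF)).
under eq_integral do rewrite E.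
have := @ge0_integral_affine R 1 (b ord0) (fun x => iint (fun v => F (vcons x v)))
  (oner_neq0 R) (measurable_iint (pvmeas_vcons mF) (fun _ _ => F0 _)) (fun x => iint_ge0 (fun t => F0 _)).
by rewrite normr1 mul1e => <-; under [RHS]eq_integral do rewrite mul1r.
Qed.

Definition mulv m n (W : 'M[R]_(m, n)) (t : 'I_n -> R) : 'I_m -> R :=
  fun i => (\sum_j (W i j * t j))%R.

Lemma mulvM m n p (A : 'M[R]_(m, n)) (B : 'M[R]_(n, p)) t : mulv A (mulv B t) = mulv (A *m B) t.
Proof.
apply/funext => i; rewrite /mulv.
under [RHS]eq_bigr do rewrite mxE big_distrl.
rewrite exchange_big; apply: eq_bigr => j _; rewrite big_distrr.
by apply: eq_bigr => k _ /=; rewrite mulrA.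
Qed.

Lemma mulv1 m t : mulv (1%:M : 'M[R]_m) t = t.
Proof.
apply/funext => i; rewrite /mulv (bigD1 i) //= big1 ?mxE ?eqxx ?mul1r ?addr0 //.
by move=> j ji; rewrite mxE eq_sym (negbTE ji) mul0r.
Qed.

Lemma measurable_mulv m n (W : 'M[R]_(m, n)) d (T : measurableType d) (phi : T -> 'I_n -> R) i :
  (forall j, measurable_fun setT (fun x => phi x j)) ->
  measurable_fun setT (fun x => mulv W (phi x) i).
Proof.
move=> mphi; apply: measurable_sum => j.
by apply: measurable_funM.
Qed.

Lemma vmeas_mulv m n (W : 'M[R]_(m, n)) (F : ('I_m -> R) -> \bar R) :
  vmeas F -> vmeas (fun t => F (mulv W t)).
Proof.
move=> mF; apply: (@vmeas_comp _ _ F _ _ (fun t : n.-tuple R => mulv W (tnth t))) => // i.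
by apply: measurable_mulv => j; exact: measurable_tnth.
Qed.

(** Induction on the dimension by block elimination. Some cofactor of the first row is nonzero, so
    the coordinate of its column is separated; the other variables are changed by the invertible
    minor [D] and a translation, the separated one by the scalar [al], the Schur complement of
    [D]. *)
Lemma iint_linear m (W : 'M[R]_m) (F : ('I_m -> R) -> \bar R) :
  \det W != 0%R -> vmeas F -> (forall t, 0 <= F t) ->
  `|\det W|%:E * iint (fun t => F (mulv W t)) = iint F.
Proof.
elim: m W F => [|m IH] W F dW mF F0.
  rewrite det_mx00 normr1 mul1e /=; congr F.
  by apply/funext => -[].
have [j cj] : exists j, cofactor W ord0 j != 0%R.
  apply/existsP; apply: contraNT dW; rewrite negb_exists => /forallP h.
  rewrite (expand_det_row _ ord0) big1 // => j _.
  by have := h j; rewrite negbK => /eqP ->; rewrite mulr0.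
pose D := row' ord0 (col' j W).
pose a := W ord0 j.
pose b : 'rV[R]_m := \row_k W ord0 (lift j k).
pose c : 'cV[R]_m := \col_i W (lift ord0 i) j.
have dD : \det D != 0%R.
  by move: cj; rewrite /cofactor mulf_eq0 signr_eq0.
have uD : D \in unitmx by rewrite unitmxE unitfE.
pose al := (a - (b *m (invmx D *m c)) ord0 ord0)%R.
pose be (y : 'I_m -> R) := mulv (b *m invmx D) y ord0.
have mWE x v : mulv W (vins j x v) =
    vcons (a * x + mulv b v ord0)%R (fun i => (mulv D v i + c i ord0 * x)%R).
  apply/funext => i; rewrite /mulv (bigD1_ord j) //= vins_id vconsE.
  case: (unliftP ord0 i) => [k ->|->]; rewrite ?vins_lift ?vins_id.
    rewrite addrC /c mxE; congr (_ + _)%R; apply: eq_bigr => l _.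
    by rewrite vins_lift /D !mxE.
  by congr (_ + _)%R; apply: eq_bigr => l _; rewrite vins_lift !mxE.
have detE : `|\det W|%R = (`|\det D| * `|al|)%R.
  (* A vector with entry 1 at [j] that [W] sends to [al] times the first basis vector; applying the
     adjugate exhibits [\det W] as [al] times a cofactor. *)
  pose u : 'cV[R]_m.+1 := \col_k vins j 1%R (fun k => - (invmx D *m c) k ord0)%R k.
  have Wu : W *m u = al *: delta_mx ord0 ord0.
    apply/matrixP => i o; rewrite (ord1 o) {o}.
    transitivity (mulv W (vins j 1%R (fun k => - (invmx D *m c) k ord0)%R) i).
      by rewrite mxE; apply: eq_bigr => k _; rewrite mxE.
    rewrite mWE vconsE mulr1 !mxE.
    case: (unliftP ord0 i) => [k ->|->]; rewrite ?vins_lift ?vins_id /=; last first.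
      rewrite mulr1 /al /mulv; congr (_ + _)%R; rewrite [in RHS]mxE -sumrN.
      by apply: eq_bigr => l _; rewrite mulrN.
    rewrite mulr0 mulr1.
    transitivity ((c - D *m (invmx D *m c)) k ord0)%R; last by rewrite mulKVmx // subrr mxE.
    rewrite !mxE addrC; congr (_ + _)%R; rewrite -sumrN.
    by apply: eq_bigr => l _; rewrite mulrN.
  have : \adj W *m (W *m u) = \adj W *m (al *: delta_mx ord0 ord0) by rewrite Wu.
  rewrite mulmxA mul_adj_mx mul_scalar_mx -scalemxAr.
  move/matrixP/(_ j ord0); rewrite !mxE vins_id mulr1 => ->.
  rewrite (bigD1 ord0) //= big1 ?addr0; last first.
    by move=> k k0; rewrite [delta_mx _ _ _ _]mxE (negbTE k0) mulr0.
  rewrite [delta_mx _ _ _ _]mxE !eqxx mulr1 mxE /cofactor !normrM normrX normrN1 expr1n mul1r.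
  by rewrite mulrC.
have al0 : al != 0%R.
  apply: contraNneq dW => al0; move: detE; rewrite al0 normr0 mulr0.
  by move/eqP; rewrite normr_eq0.
have mFW : vmeas (fun t => F (mulv W t)) by exact: vmeas_mulv.
rewrite (iint_vins j) //.
under eq_iint do under eq_integral do rewrite mWE.
have pm : pvmeas (fun x v => F (vcons (a * x + mulv b v ord0)%R (fun i => (mulv D v i + c i ord0 * x)%R))).
  apply: (@vmeas_comp _ _ F _ _ (fun z : R * m.-tuple R =>
    vcons (a * z.1 + mulv b (tnth z.2) ord0)%R (fun i => (mulv D (tnth z.2) i + c i ord0 * z.1)%R))) => // i.
  apply: (@measurable_vins _ _ ord0) => [|k]; apply: measurable_funD.
  - by apply: measurable_funM => //; exact: measurable_fst.
  - by apply: measurable_mulv => l; exact: measurable_tnth2.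
  - by apply: measurable_mulv => l; exact: measurable_tnth2.
  - by apply: measurable_funM => //; exact: measurable_fst.
rewrite -(@iint_tonelli _ _ (fun x v => F (vcons (a * x + mulv b v ord0)%R
   (fun i => (mulv D v i + c i ord0 * x)%R)))) //.
have step x : iint (fun v => F (vcons (a * x + mulv b v ord0)%R (fun i => (mulv D v i + c i ord0 * x)%R)))
   = `|\det D|^-1%:E * iint (fun y => F (vcons (al * x + be y)%R y)).
  pose H1 (y : 'I_m -> R) := F (vcons (al * x + be y)%R y).
  have mH1 : vmeas H1.
    apply: (@vmeas_comp _ _ F _ _ (fun t : m.-tuple R => vcons (al * x + be (tnth t))%R (tnth t))) => // i.
    apply: (@measurable_vins _ _ ord0) => [|k]; last exact: measurable_tnth.
    by apply: measurable_funD => //; apply: measurable_mulv => l; exact: measurable_tnth.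
  pose H2 (y : 'I_m -> R) := H1 (fun i => (y i + c i ord0 * x)%R).
  have mH2 : vmeas H2.
    apply: (@vmeas_comp _ _ H1 _ _ (fun t : m.-tuple R => (fun i => (tnth t i + c i ord0 * x)%R))) => // i.
    by apply: measurable_funD => //; exact: measurable_tnth.
  rewrite -/(iint H1) -(iint_shift (fun i => (c i ord0 * x)%R) mH1); last by move=> t; apply: F0.
  rewrite -/H2 -(IH D H2) //; last by move=> t; apply: F0.
  rewrite muleA -EFinM mulVf ?normr_eq0 // mul1e.
  apply: eq_iint => v; rewrite /H2 /H1; congr F; congr vcons.
  rewrite /be; transitivity (al * x + (mulv (b *m invmx D) (mulv D v) ord0 + ((b *m invmx D) *m c) ord0 ord0 * x))%R.
    by rewrite mulvM -mulmxA mulVmx // mulmx1 /al mulrBl -!mulmxA addrA addrAC subrK.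
  congr (_ + _)%R; rewrite [X in (_ + X)%R = _](_ : _ = \sum_k (b *m invmx D) ord0 k * (c k ord0 * x))%R; last first.
    by rewrite mxE big_distrl /=; apply: eq_bigr => k _; rewrite mulrA.
  by rewrite /mulv -big_split /=; apply: eq_bigr => k _; rewrite mulrDr.
under eq_integral do rewrite step.
have pm2 : pvmeas (fun x y => F (vcons (al * x + be y)%R y)).
  apply: (@vmeas_comp _ _ F _ _ (fun z : R * m.-tuple R => vcons (al * z.1 + be (tnth z.2))%R (tnth z.2))) => // i.
  apply: (@measurable_vins _ _ ord0) => [|k]; last exact: measurable_tnth2.
  apply: measurable_funD; first by apply: measurable_funM => //; exact: measurable_fst.
  by apply: measurable_mulv => l; exact: measurable_tnth2.
rewrite ge0_integralZl //; first last.
- by move=> x _; apply: iint_ge0.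
- exact: (measurable_iint pm2).
rewrite muleA -EFinM detE mulrAC divff ?normr_eq0 // mul1r.
rewrite (@iint_tonelli _ _ (fun x y => F (vcons (al * x + be y)%R y))) //.
have mv y : measurable_fun setT (fun x => F (vcons x y)).
  apply: (@vmeas_comp _ _ F _ _ (fun x => vcons x y)) => // i.
  exact: (@measurable_vins _ _ ord0).
rewrite -iintZl //; first last.
- by move=> y; apply: integral_ge0.
- exact: (measurable_fun_fubini_tonelli_F (m2 := mu) _ (pvmeas_flip pm2)).
rewrite [RHS]/= (@iint_tonelli _ _ (fun x y => F (vcons x y))) //; last exact: pvmeas_vcons.
by apply: eq_iint => y; rewrite (@ge0_integral_affine _ al (be y) (fun x => F (vcons x y))).
Qed.

End LinearChange.

(** * Integrals over the nonnegative orthant with exponential domination *)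

Section OrthantIntegral.
Context {R : realType}.
Notation mu := (@lebesgue_measure R).
Implicit Types m : nat.

Definition orth m (t : 'I_m -> R) := [forall i, 0 <= t i].

Lemma orthP m (t : 'I_m -> R) : reflect (forall i, 0 <= t i) (orth t).
Proof. exact: forallP. Qed.

Lemma orth_vins m l (x : R) (v : 'I_m -> R) : orth (vins l x v) = (0 <= x) && orth v.
Proof.
apply/orthP/andP => [h|[x0 /orthP h] i].
  split; first by have := h l; rewrite vins_id.
  by apply/orthP => j; have := h (lift l j); rewrite vins_lift.
by case: (unliftP l i) => [j ->|->]; rewrite ?vins_lift ?vins_id.
Qed.

Definition rmeas m (f : ('I_m -> R) -> R) :=
  measurable_fun setT (fun t : m.-tuple R => f (tnth t)).

Lemma rmeas_orth m : measurable_fun setT (fun t : m.-tuple R => orth (tnth t)).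
Proof.
rewrite (_ : (fun t => _) = (fun t : m.-tuple R => \big[andb/true]_(i < m) (0 <= tnth t i))); last first.
  by apply/funext => t; rewrite big_andE.
have E (s : seq 'I_m) : measurable_fun setT (fun t : m.-tuple R => \big[andb/true]_(i <- s) (0 <= tnth t i)).
  elim: s => [|i s IH].
    by rewrite (_ : (fun t => _) = cst true) //; apply/funext => t; rewrite big_nil.
  under eq_fun do rewrite big_cons.
  apply: measurable_and => //; apply: measurable_fun_ler => //.
  exact: measurable_tnth.
exact: E.
Qed.

Definition ofun m (f : ('I_m -> R) -> R) (t : 'I_m -> R) : \bar R :=
  if orth t then (f t)%:E else 0%E.

Lemma vmeas_ofun m (f : ('I_m -> R) -> R) : rmeas f -> vmeas (ofun f).
Proof.
move=> mf; apply: measurable_fun_ifT => //; first exact: rmeas_orth.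
exact/measurable_EFinP.
Qed.

Definition PI m (f : ('I_m -> R) -> R) : \bar R := iint (ofun f).

Definition opos m (f : ('I_m -> R) -> R) := forall t, orth t -> 0 <= f t.

Lemma ofun_ge0 m (f : ('I_m -> R) -> R) : opos f -> forall t, (0 <= ofun f t)%E.
Proof. by move=> f0 t; rewrite /ofun; case: ifP => // /f0; rewrite lee_fin. Qed.

Lemma eq_PI m (f g : ('I_m -> R) -> R) : (forall t, orth t -> f t = g t) -> PI f = PI g.
Proof.
by move=> fg; apply: eq_iint => t; rewrite /ofun; case: ifP => // /fg ->.
Qed.

Lemma PI_ge0 m (f : ('I_m -> R) -> R) : opos f -> (0 <= PI f)%E.
Proof. by move=> f0; apply: iint_ge0; exact: ofun_ge0. Qed.

Lemma PID m (f g : ('I_m -> R) -> R) : rmeas f -> rmeas g -> opos f -> opos g ->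
  PI (fun t => f t + g t) = (PI f + PI g)%E.
Proof.
move=> mf mg f0 g0; rewrite /PI -iintD; try exact: vmeas_ofun; try exact: ofun_ge0.
by apply: eq_iint => t; rewrite /ofun; case: ifP => _; rewrite ?EFinD ?adde0.
Qed.

Lemma PIZ m k (f : ('I_m -> R) -> R) : rmeas f -> opos f -> 0 <= k ->
  PI (fun t => k * f t) = (k%:E * PI f)%E.
Proof.
move=> mf f0 k0; rewrite /PI -iintZl //; try exact: vmeas_ofun; try exact: ofun_ge0.
by apply: eq_iint => t; rewrite /ofun; case: ifP => _; rewrite ?EFinM ?mule0.
Qed.

Lemma le_PI m (f g : ('I_m -> R) -> R) : rmeas f -> rmeas g -> opos f ->
  (forall t, orth t -> f t <= g t) -> (PI f <= PI g)%E.
Proof.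
move=> mf mg f0 fg; apply: le_iint; try exact: vmeas_ofun; try exact: ofun_ge0.
by move=> t; rewrite /ofun; case: ifP => // /fg; rewrite lee_fin.
Qed.

(** Universal majorant: its integral over the orthant is 1, so a pointwise bound by [C * wexp]
    bounds the integral by [C]. *)
Definition wexp m (t : 'I_m -> R) : R := expR (- \sum_i t i).

Lemma wexp_gt0 m (t : 'I_m -> R) : 0 < wexp t.
Proof. exact: expR_gt0. Qed.

Lemma wexp_vins m l x (v : 'I_m -> R) : wexp (vins l x v) = expR (- x) * wexp v.
Proof.
rewrite /wexp (bigD1_ord l) //= vins_id opprD expRD; congr (_ * expR (- _)).
by apply: eq_bigr => i _; rewrite vins_lift.
Qed.

Lemma rmeas_wexp m : rmeas (@wexp m).
Proof.
apply: measurableT_comp => //; apply: measurableT_comp => //.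
by apply: measurable_sum => i; exact: measurable_tnth.
Qed.

Lemma rmeasD m (f g : ('I_m -> R) -> R) : rmeas f -> rmeas g -> rmeas (fun t => f t + g t).
Proof. by move=> mf mg; apply: measurable_funD. Qed.

Lemma rmeasM m (f g : ('I_m -> R) -> R) : rmeas f -> rmeas g -> rmeas (fun t => f t * g t).
Proof. by move=> mf mg; apply: measurable_funM. Qed.

Lemma rmeasC m (c : R) : rmeas (fun _ : 'I_m -> R => c).
Proof. exact: measurable_cst. Qed.

Lemma rmeasN m (f : ('I_m -> R) -> R) : rmeas f -> rmeas (fun t => - f t).
Proof. by move=> mf; apply: measurableT_comp. Qed.

Lemma rmeasZ m c (f : ('I_m -> R) -> R) : rmeas f -> rmeas (fun t => c * f t).
Proof. by move=> mf; apply: rmeasM => //; exact: rmeasC. Qed.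

Lemma rmeasX m (i : 'I_m) : rmeas (fun t => t i).
Proof. exact: measurable_tnth. Qed.

Lemma rmeas_exp m (f : ('I_m -> R) -> R) : rmeas f -> rmeas (fun t => expR (f t)).
Proof. by move=> mf; apply: measurableT_comp. Qed.

Lemma rmeas_sum m (I : Type) (s : seq I) (f : I -> ('I_m -> R) -> R) :
  (forall i, rmeas (f i)) -> rmeas (fun t => \sum_(i <- s) f i t).
Proof. by move=> mf; apply: measurable_sum => i; exact: mf. Qed.

Lemma rmeas_prod m (I : Type) (s : seq I) (f : I -> ('I_m -> R) -> R) :
  (forall i, rmeas (f i)) -> rmeas (fun t => \prod_(i <- s) f i t).
Proof.
move=> mf; elim: s => [|i s IH]; rewrite /rmeas.
  by rewrite (_ : (fun t => _) = cst 1) //; apply/funext => t; rewrite big_nil.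
by under eq_fun do rewrite big_cons; apply: measurable_funM => //; exact: mf.
Qed.

Lemma rmeas_vins m l x (f : ('I_m.+1 -> R) -> R) : rmeas f -> rmeas (fun v => f (vins l x v)).
Proof.
move=> mf; apply/measurable_EFinP.
apply: (@vmeas_comp _ _ (EFin \o f) _ _ (fun t : m.-tuple R => vins l x (tnth t))).
  exact/measurable_EFinP.
move=> i; apply: measurable_vins => // j; exact: measurable_tnth.
Qed.

Lemma expRN_cvg0 : expR (- x) @[x --> +oo%R] --> (0 : R).
Proof. exact: cvgr_expR. Qed.

Lemma itvcy_int (f : R -> R) : (\int[mu]_x (if (0 <= x)%R then (f x)%:E else 0) =
  \int[mu]_(x in `[0%R, +oo[) (f x)%:E)%E.
Proof.
rewrite [RHS]integral_mkcond; apply: eq_integral => x _.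
rewrite patchE; case: ifPn => h; first by rewrite mem_set //= in_itv /= h.
by rewrite memNset //= in_itv /= andbT; exact/negP.
Qed.

(* Adding the majorant [C * expR (- x)] makes the integrand nonnegative, so that
   the nonnegative form of the fundamental theorem applies. *)
Lemma int_shifted_derivative (h h' : R -> R) (C : R) :
  (forall x, dR h x (h' x)) -> continuous h' ->
  (forall x, 0 <= x -> `|h x| <= C * expR (- x)) ->
  (forall x, 0 <= x -> `|h' x| <= C * expR (- x)) ->
  (\int[mu]_x (if (0 <= x)%R then (h' x + C * expR (- x))%:E else 0) = (C - h 0)%:E)%E.
Proof.
move=> dh ch' hb hb'.
have dE x : dR (fun x => h x - C * expR (- x)) x (h' x + C * expR (- x)).
  apply: dR_eq (dRB (dh x) (dRZ C (dR_exp (dRN (dR_id x))))) _.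
  by rewrite mulrN1 mulrN opprK.
rewrite itvcy_int (@ge0_continuous_FTC2y _ (fun x => h' x + C * expR (- x))
  (fun x => h x - C * expR (- x)) 0 0).
- rewrite oppr0 expR0 mulr1 -EFinB; congr EFin; by rewrite sub0r opprB.
- move=> x x0; have := hb' x x0; rewrite ler_norml => /andP[h1 _].
  by rewrite addrC -lerBlDl sub0r.
- apply: continuous_subspaceT => x; apply: cvgD; first exact: ch'.
  apply: cvgM; first exact: cvg_cst.
  apply: continuous_comp; first exact: opp_continuous.
  exact: continuous_expR.
- rewrite -[X in _ --> X]subr0; apply: cvgB; last first.
    by rewrite -[X in _ --> X](mulr0 C); apply: cvgM; [exact: cvg_cst|exact: expRN_cvg0].
  apply/norm_cvg0P.
  apply: (@squeeze_cvgr _ _ _ _ (cst 0) (fun x => C * expR (- x))).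
  + near=> x; rewrite normr_ge0 /=; apply: hb; near: x; exact: nbhs_pinfty_ge.
  + exact: cvg_cst.
  + by rewrite -[X in _ --> X](mulr0 C); apply: cvgM; [exact: cvg_cst|exact: expRN_cvg0].
- by move=> x _; case: (dE x).
- by apply: cvg_at_right_filter; exact: (dR_continuous (dE 0)).
- by move=> x _; rewrite derive1E; case: (dE x).
Unshelve. all: by end_near. Qed.

Lemma int_expRN : (\int[mu]_x (if (0 <= x)%R then (expR (- x))%:E else 0) = 1)%E.
Proof.
have := @int_shifted_derivative (cst 0) (cst 0) 1.
rewrite subr0 => <-.
- by apply: eq_integral => x _; rewrite add0r mul1r.
- by move=> x; exact: dR_cst.
- exact: cst_continuous.
- by move=> x _; rewrite normr0 mul1r expR_ge0.
- by move=> x _; rewrite normr0 mul1r expR_ge0.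
Qed.

Lemma PI_wexp m : PI (@wexp m) = 1%E.
Proof.
elim: m => [|m IH].
  rewrite /PI /= /ofun /wexp big_ord0 oppr0 expR0.
  by have -> : @orth 0 (fun=> 0) by apply/orthP; case.
rewrite /PI /= -[RHS]int_expRN; apply: eq_integral => x _.
transitivity ((if (0 <= x)%R then (expR (- x)) else 0)%:E * PI (@wexp m))%E; last first.
  by rewrite IH mule1; case: ifP.
rewrite /PI -iintZl; first last.
- by apply: ofun_ge0 => t _; exact/ltW/wexp_gt0.
- by case: ifP => // _; exact: expR_ge0.
- exact: (vmeas_ofun (@rmeas_wexp m)).
apply: eq_iint => v; rewrite /ofun vconsE orth_vins wexp_vins.
by case: (0 <= x); case: (orth v) => /=; rewrite ?mule0 ?mul0e ?EFinM.
Qed.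

Definition gdom m (f : ('I_m -> R) -> R) (C : R) :=
  rmeas f /\ forall t, orth t -> `|f t| <= C * wexp t.

Definition RI m (f : ('I_m -> R) -> R) : R :=
  fine (PI (fun t => Num.max (f t) 0)) - fine (PI (fun t => Num.max (- f t) 0)).

Lemma dom_ge0 m (f : ('I_m -> R) -> R) C : gdom f C -> 0 <= C.
Proof.
move=> [_ h]; have := h (fun=> 0).
have -> : orth (fun _ : 'I_m => 0 : R) by apply/orthP.
move=> /(_ isT)/(le_trans (normr_ge0 _)).
by rewrite pmulr_lge0 // wexp_gt0.
Qed.

Lemma PI_fin m (f : ('I_m -> R) -> R) C : gdom f C -> opos f -> PI f \is a fin_num.
Proof.
move=> df f0; have C0 := dom_ge0 df; case: df => mf fC.
rewrite ge0_fin_numE; last exact: PI_ge0.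
apply: (@le_lt_trans _ _ C%:E); last exact: ltry.
rewrite -[C%:E]mule1 -(PI_wexp m) -PIZ //; first last.
- by move=> t _; exact/ltW/wexp_gt0.
- exact: rmeas_wexp.
apply: le_PI => //; first by apply: rmeasZ; exact: rmeas_wexp.
by move=> t ot; apply: le_trans (fC t ot); exact: ler_norm.
Qed.

Lemma rmeas_max0 m (f : ('I_m -> R) -> R) : rmeas f -> rmeas (fun t => Num.max (f t) 0).
Proof. by move=> mf; apply: measurable_maxr. Qed.

Lemma dom_max0 m (f : ('I_m -> R) -> R) C : gdom f C -> gdom (fun t => Num.max (f t) 0) C.
Proof.
move=> df; have C0 := dom_ge0 df; case: df => mf fC.
split; first exact: rmeas_max0.
move=> t ot; apply: le_trans (fC t ot).
by rewrite ger0_norm ?le_max ?lexx ?orbT // ge_max ler_norm normr_ge0.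
Qed.

Lemma domN m (f : ('I_m -> R) -> R) C : gdom f C -> gdom (fun t => - f t) C.
Proof.
move=> [mf fC]; split; first exact: rmeasN.
by move=> t ot; rewrite normrN; exact: fC.
Qed.

Lemma domD m (f g : ('I_m -> R) -> R) C C' : gdom f C -> gdom g C' ->
  gdom (fun t => f t + g t) (C + C').
Proof.
move=> [mf fC] [mg gC]; split; first exact: rmeasD.
move=> t ot; rewrite mulrDl; apply: le_trans (ler_normD _ _) _.
by apply: lerD; [exact: fC | exact: gC].
Qed.

Lemma domZ m k (f : ('I_m -> R) -> R) C : gdom f C -> gdom (fun t => k * f t) (`|k| * C).
Proof.
move=> [mf fC]; split; first exact: rmeasZ.
by move=> t ot; rewrite normrM -mulrA ler_wpM2l // fC.
Qed.

Lemma dom_wexp m C : 0 <= C -> gdom (fun t => C * @wexp m t) C.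
Proof.
move=> C0; split; first by apply: rmeasZ; exact: rmeas_wexp.
by move=> t _; rewrite ger0_norm // mulr_ge0 // ltW // wexp_gt0.
Qed.

(** Adding [C * wexp] makes the integrand nonnegative on the orthant and raises the integral by
    exactly [C]. Additivity and integration by parts for signed functions are thereby reduced to the
    nonnegative integral [PI]. *)
Lemma RI_shift m (f : ('I_m -> R) -> R) C : gdom f C ->
  (RI f + C)%:E = PI (fun t => f t + C * wexp t).
Proof.
move=> df; have C0 := dom_ge0 df; have [mf fC] := df.
have p1 : opos (fun t => f t + C * wexp t).
  move=> t ot; have := fC t ot; rewrite ler_norml => /andP[h _].
  by rewrite addrC -lerBlDl sub0r.
have mw := @rmeas_wexp m.
have d1 := domD df (@dom_wexp m C C0).
have pm g : @opos m (fun t => Num.max (g t) 0) by move=> t _; rewrite le_max lexx orbT.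
have key : (PI (fun t => f t + C * wexp t)%R + PI (fun t => Num.max (- f t) 0)%R =
   PI (fun t => Num.max (f t) 0)%R + C%:E)%E.
  rewrite -[C%:E]mule1 -(PI_wexp m) -PIZ //; last by move=> t _; exact/ltW/wexp_gt0.
  rewrite -PID //; last 2 first.
  - by apply: rmeasD => //; exact: rmeasZ.
  - by apply: rmeas_max0; apply: rmeasN.
  rewrite -PID //; last 3 first.
  - exact: rmeas_max0.
  - exact: rmeasZ.
  - by move=> t _; rewrite mulr_ge0 // ltW // wexp_gt0.
  apply: eq_PI => t ot; rewrite addrAC; congr (_ + _).
  have [h|/ltW h] := leP 0 (f t).
    have -> : Num.max (- f t) 0 = 0 by apply/max_idPr; rewrite oppr_le0.
    by rewrite addr0.
  have -> : Num.max (- f t) 0 = - f t by apply/max_idPl; rewrite oppr_ge0.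
  by rewrite subrr.
have f1 := PI_fin d1 p1.
have f2 := PI_fin (dom_max0 (domN df)) (pm _).
have f3 := PI_fin (dom_max0 df) (pm _).
move: key; rewrite -(fineK f1) -(fineK f2) -(fineK f3) -!EFinD => -[key].
by congr EFin; rewrite /RI addrAC -key addrK.
Qed.

Lemma PI0 m : PI (fun _ : 'I_m -> R => 0) = 0%E.
Proof.
rewrite (_ : PI _ = PI (fun t => 0 * @wexp m t)); last by apply: eq_PI => t _; rewrite mul0r.
rewrite PIZ ?mul0e //; first exact: rmeas_wexp.
by move=> t _; exact/ltW/wexp_gt0.
Qed.

Lemma eq_RI m (f g : ('I_m -> R) -> R) : (forall t, orth t -> f t = g t) -> RI f = RI g.
Proof.
by move=> fg; rewrite /RI; congr (fine _ - fine _); apply: eq_PI => t ot; rewrite fg.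
Qed.

Lemma RI_ge0E m (f : ('I_m -> R) -> R) : opos f -> RI f = fine (PI f).
Proof.
move=> f0; rewrite /RI [X in _ - fine X](_ : _ = 0%E) ?subr0.
  by congr fine; apply: eq_PI => t ot; rewrite (max_idPl _) // f0.
rewrite -(PI0 m); apply: eq_PI => t ot.
by apply/max_idPr; rewrite oppr_le0 f0.
Qed.

Lemma RID m (f g : ('I_m -> R) -> R) C C' : gdom f C -> gdom g C' ->
  RI (fun t => f t + g t) = RI f + RI g.
Proof.
move=> df dg; have dfg := domD df dg.
have := RI_shift dfg; have := RI_shift df; have := RI_shift dg.
have Cf := dom_ge0 df; have Cg := dom_ge0 dg.
have [mf fC] := df; have [mg gC] := dg; have mw := @rmeas_wexp m.
move=> Eg Ef Efg.
suff : (RI (fun t => f t + g t) + (C + C'))%:E = ((RI f + C)%:E + (RI g + C')%:E)%E.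
  by rewrite -EFinD => -[h]; apply: (addIr (C + C')); rewrite h addrACA.
rewrite Efg Eg Ef -PID //.
- by apply: eq_PI => t ot; rewrite mulrDl addrACA.
- by apply: rmeasD => //; exact: rmeasZ.
- by apply: rmeasD => //; exact: rmeasZ.
- move=> t ot; have := fC t ot; rewrite ler_norml => /andP[h _].
  by rewrite addrC -lerBlDl sub0r.
- move=> t ot; have := gC t ot; rewrite ler_norml => /andP[h _].
  by rewrite addrC -lerBlDl sub0r.
Qed.

Lemma RIN m (f : ('I_m -> R) -> R) : RI (fun t => - f t) = - RI f.
Proof.
rewrite /RI opprB; congr (fine _ - fine _); apply: eq_PI => t _.
by rewrite opprK.
Qed.

Lemma RIZ m k (f : ('I_m -> R) -> R) C : gdom f C -> RI (fun t => k * f t) = k * RI f.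
Proof.
move=> df; have pk l : 0 <= l -> RI (fun t => l * f t) = l * RI f.
  move=> l0; have df' := dom_max0 df; have df'' := dom_max0 (domN df).
  have pm g : @opos m (fun t => Num.max (g t) 0) by move=> t _; rewrite le_max lexx orbT.
  rewrite /RI mulrBr; congr (_ - _).
    transitivity (fine (l%:E * PI (fun t => Num.max (f t) 0)%R)%E); last first.
      by rewrite -(fineK (PI_fin df' (pm _))) -EFinM.
    rewrite -PIZ //; last by case: df'.
    by congr fine; apply: eq_PI => t _; rewrite maxr_pMr // mulr0.
  transitivity (fine (l%:E * PI (fun t => Num.max (- f t) 0)%R)%E); last first.
    by rewrite -(fineK (PI_fin df'' (pm _))) -EFinM.
  rewrite -PIZ //; last by case: df''.
  by congr fine; apply: eq_PI => t _; rewrite maxr_pMr // mulr0 mulrN.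
have [k0|k0] := leP 0 k; first exact: pk.
rewrite -[k]opprK mulNr -(pk (- k)) ?oppr_ge0 ?ltW // -RIN.
by apply: eq_RI => t _; rewrite !mulNr.
Qed.

Lemma RI_bound m (f : ('I_m -> R) -> R) C : gdom f C -> `|RI f| <= C.
Proof.
have up (g : ('I_m -> R) -> R) : gdom g C -> RI g <= C.
  move=> dg; have C0 := dom_ge0 dg.
  have [mg gC] := dg; have mw := @rmeas_wexp m.
  rewrite -(lerD2r C) -lee_fin RI_shift //.
  have pw : opos (@wexp m) by move=> t _; exact/ltW/wexp_gt0.
  have -> : (C + C)%:E = PI (fun t => (C + C) * @wexp m t).
    by rewrite (PIZ mw pw) ?addr_ge0 // PI_wexp mule1.
  apply: (@le_PI m _ _ (rmeasD mg (rmeasZ C mw)) (rmeasZ (C + C) mw)).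
    move=> t ot; have := gC t ot; rewrite ler_norml => /andP[h _].
    by rewrite addrC -lerBlDl sub0r.
  move=> t ot; rewrite mulrDl lerD2r; apply: le_trans (gC t ot); exact: ler_norm.
move=> df; rewrite ler_norml up // andbT lerNl -RIN up //; exact: domN.
Qed.

Lemma dom_sum m (I : Type) (s : seq I) (f : I -> ('I_m -> R) -> R) (C : I -> R) :
  (forall i, gdom (f i) (C i)) -> gdom (fun t => \sum_(i <- s) f i t) (\sum_(i <- s) C i).
Proof.
move=> df; elim: s => [|i s IH].
  split; first by apply: rmeas_sum => i; case: (df i).
  by move=> t _; rewrite !big_nil normr0 mul0r.
rewrite big_cons (_ : (fun t => _) = fun t => f i t + \sum_(j <- s) f j t); last first.
  by apply/funext => t; rewrite big_cons.
exact: domD.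
Qed.

Lemma RI_sum m (I : Type) (s : seq I) (f : I -> ('I_m -> R) -> R) (C : I -> R) :
  (forall i, gdom (f i) (C i)) -> RI (fun t => \sum_(i <- s) f i t) = \sum_(i <- s) RI (f i).
Proof.
move=> df; elim: s => [|i s IH].
  rewrite big_nil (_ : RI _ = RI (fun _ : 'I_m -> R => 0)); last first.
    by apply: eq_RI => t _; rewrite big_nil.
  by rewrite RI_ge0E ?PI0 // => t.
rewrite big_cons -IH -(RID (df i) (dom_sum s df)).
by apply: eq_RI => t _; rewrite big_cons.
Qed.

(** Along coordinate [l] the fundamental theorem leaves minus the value at 0, because domination by
    [wexp] removes the contribution at infinity; the other coordinates are integrated afterwards. *)
Lemma RI_ibp m (l : 'I_m.+1) (f f' : ('I_m.+1 -> R) -> R) (C : R) :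
  gdom f C -> gdom f' C ->
  (forall x v, dR (fun x => f (vins l x v)) x (f' (vins l x v))) ->
  (forall v, continuous (fun x => f' (vins l x v))) ->
  RI f' = - RI (fun v => f (vins l 0 v)).
Proof.
move=> df df' dff' cf'.
have C0 := dom_ge0 df; have [mf fC] := df; have [mf' fC'] := df'; have mw := @rmeas_wexp m.
have d0 : gdom (fun v => f (vins l 0 v)) C.
  split; first exact: rmeas_vins.
  move=> v ov; have := fC (vins l 0 v); rewrite orth_vins lexx => /(_ ov).
  by rewrite wexp_vins oppr0 expR0 mul1r.
suff : (RI f' + C)%:E = (RI (fun v => - f (vins l 0 v)) + C)%:E.
  by case => /addIr ->; rewrite RIN.
rewrite (RI_shift df') (RI_shift (domN d0)) /PI (iint_vins l); first last.
- apply: ofun_ge0 => t ot; have := fC' t ot; rewrite ler_norml => /andP[h _].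
  by rewrite addrC -lerBlDl sub0r.
- by apply: vmeas_ofun; apply: rmeasD => //; apply: rmeasZ; exact: rmeas_wexp.
apply: eq_iint => v; rewrite /ofun.
under eq_integral do rewrite orth_vins.
case: ifPn => ov; last first.
  by under eq_integral do rewrite andbF; rewrite integral0.
under eq_integral do rewrite andbT wexp_vins.
rewrite [X in _ = X%:E]addrC -(@int_shifted_derivative (fun x => f (vins l x v))
   (fun x => f' (vins l x v)) (C * wexp v)) //; first last.
- move=> x x0; have := fC' (vins l x v); rewrite orth_vins x0 ov => /(_ isT).
  by rewrite wexp_vins mulrCA [in X in _ -> X]mulrC.
- move=> x x0; have := fC (vins l x v); rewrite orth_vins x0 ov => /(_ isT).
  by rewrite wexp_vins mulrCA [in X in _ -> X]mulrC.
by apply: eq_integral => x _; rewrite -mulrA [wexp v * _]mulrC.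
Qed.

End OrthantIntegral.

From mathcomp Require Import ring lra.

(** * Gaussian moments on the orthant as functions of the quadratic form *)

Section Moments.
Context {R : realType}.
Implicit Types m : nat.

Definition qf m (G : 'M[R]_m) (t : 'I_m -> R) : R := \sum_i \sum_j G i j * (t i * t j).

(** Coercivity is asked on the orthant only, where Gram matrices of points of Lambda have it because
    their entries are at least 1. The normalized constant makes all bounds uniform in the matrix. *)
Definition coer m (G : 'M[R]_m) := forall t : 'I_m -> R, orth t -> \sum_i t i ^+ 2 <= qf G t.

Definition mono m (s : seq 'I_m) (t : 'I_m -> R) : R := \prod_(i <- s) t i.

Definition gau m (s : seq 'I_m) (G : 'M[R]_m) (t : 'I_m -> R) : R := mono s t * expR (- qf G t).

(** Monomials are sequences of indices, so that differentiating in [G i j] simply prepends [i] and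
    [j]. *)
Definition mom m (s : seq 'I_m) (G : 'M[R]_m) : R := RI (gau s G).

Lemma mono_cons m i (s : seq 'I_m) t : mono (i :: s) t = t i * mono s t.
Proof. by rewrite /mono big_cons. Qed.

Lemma mono_ge0 m (s : seq 'I_m) (t : 'I_m -> R) : orth t -> 0 <= mono s t.
Proof. by move=> /orthP ot; apply: prodr_ge0 => i _; exact: ot. Qed.

Lemma rmeas_mono m (s : seq 'I_m) : rmeas (mono s).
Proof. by apply: rmeas_prod => i; exact: rmeasX. Qed.

Lemma rmeas_qf m (G : 'M[R]_m) : rmeas (qf G).
Proof.
apply: rmeas_sum => i; apply: rmeas_sum => j; apply: rmeasZ; apply: rmeasM; exact: rmeasX.
Qed.

Lemma rmeas_gau m (s : seq 'I_m) (G : 'M[R]_m) : rmeas (gau s G).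
Proof.
apply: rmeasM; first exact: rmeas_mono.
by apply: rmeas_exp; apply: rmeasN; exact: rmeas_qf.
Qed.

(** Comes from c t - t^2 <= c^2 with c = k + 1, summed over [m] coordinates: k is the total degree
    to be absorbed and the additional 1 pays for [wexp]. *)
Definition Cst m k : R := expR (m%:R * k.+1%:R ^+ 2).

Lemma gauss_bound m (s : seq 'I_m) k (t : 'I_m -> R) : orth t ->
  mono s t * (\sum_i t i) ^+ k * expR (- \sum_i t i ^+ 2) <= Cst m (size s + k) * wexp t.
Proof.
move=> ot; have /orthP h := ot; set T := \sum_i t i.
have T0 : 0 <= T by apply: sumr_ge0.
have leT x : 0 <= x -> x <= T -> x <= expR T.
  by move=> x0 xT; apply: le_trans xT _; apply: le_trans (expR_ge1Dx T); rewrite lerDr.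
have le1 i : t i <= expR T.
  by apply: leT => //; rewrite /T (bigD1 i) //= lerDl sumr_ge0.
have b1 : mono s t <= expR T ^+ size s.
  elim: s => [|i s IH]; first by rewrite /mono big_nil expr0.
  by rewrite mono_cons exprS; apply: ler_pM => //; exact: mono_ge0.
have b2 : T ^+ k <= expR T ^+ k by apply: lerXn2r; rewrite ?nnegrE ?expR_ge0 //; exact: leT.
have b3 : mono s t * T ^+ k <= expR (T * (size s + k)%:R).
  rewrite expRM_natr exprD; apply: ler_pM => //; [exact: mono_ge0|exact: exprn_ge0].
apply: (@le_trans _ _ (expR (T * (size s + k)%:R) * expR (- \sum_i t i ^+ 2))).
  by rewrite ler_wpM2r // expR_ge0.
rewrite -expRD /Cst /wexp -expRD ler_expR -/T.
set M := (size s + k)%N.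
suff : \sum_i (M.+1%:R * t i - t i ^+ 2) <= m%:R * M.+1%:R ^+ 2.
  rewrite big_split /= -mulr_sumr sumrN -/T -natr1; lra.
have -> : m%:R = \sum_(i < m) (1 : R) by rewrite sumr_const card_ord.
rewrite mulr_suml; apply: ler_sum => i _; rewrite mul1r.
set c := M.+1%:R; have : 0 <= (c - t i) ^+ 2 by exact: sqr_ge0.
have := h i; have c0 : 0 <= c by exact: ler0n.
have := mulr_ge0 c0 (h i); nra.
Qed.

Lemma dom_gau m (s : seq 'I_m) (G : 'M[R]_m) : coer G -> gdom (gau s G) (Cst m (size s)).
Proof.
move=> cG; split; first exact: rmeas_gau.
move=> t ot; rewrite ger0_norm ?mulr_ge0 ?expR_ge0 ?mono_ge0 //.
have := gauss_bound s 0 ot; rewrite addn0 expr0 mulr1; apply: le_trans.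
by rewrite ler_wpM2l ?mono_ge0 // ler_expR lerN2; exact: cG.
Qed.

(** Second-order remainder of the exponential. The common lower bound [r] of both exponents
    preserves Gaussian decay in the estimate. *)
Lemma exp_taylor (r a b : R) : r <= a -> r <= b ->
  `|expR (- b) - expR (- a) + (b - a) * expR (- a)| <= (b - a) ^+ 2 * expR (- r).
Proof.
move=> ra rb; have [ab|ba] := leP a b.
  have -> : expR (- b) = expR (- a) * expR (- (b - a)) by rewrite -expRD; congr expR; ring.
  set d := b - a; have d0 : 0 <= d by rewrite subr_ge0.
  have -> : expR (- a) * expR (- d) - expR (- a) + d * expR (- a) =
            expR (- a) * (expR (- d) - 1 + d) by ring.
  have e1 := expR_ge1Dx (- d).
  have e2 : expR (- d) <= 1 - d + d ^+ 2.
    rewrite expRN; apply: (@le_trans _ _ (1 + d)^-1).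
      by rewrite lef_pV2 ?posrE ?expR_gt0 ?expR_ge1Dx //; lra.
    by rewrite -div1r ler_pdivrMr; [nra|lra].
  rewrite normrM ger0_norm ?expR_ge0 // mulrC; apply: ler_pM => //; rewrite ?ler_expR; try lra.
  by rewrite ger0_norm; lra.
have -> : expR (- a) = expR (- b) * expR (- (a - b)) by rewrite -expRD; congr expR; ring.
set d := a - b; have d0 : 0 <= d by rewrite subr_ge0 ltW.
have -> : b - a = - d by rewrite /d opprB.
have -> : expR (- b) - expR (- b) * expR (- d) + - d * (expR (- b) * expR (- d)) =
          expR (- b) * (1 - (1 + d) * expR (- d)) by ring.
have e1 := expR_ge1Dx (- d).
have e2 : (1 + d) * expR (- d) <= 1.
  rewrite expRN ler_pdivrMr ?expR_gt0 // mul1r; exact: expR_ge1Dx.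
rewrite normrM ger0_norm ?expR_ge0 // mulrC; apply: ler_pM => //; rewrite ?ler_expR; try lra.
by rewrite ger0_norm; nra.
Qed.

Lemma qf_diff m (G G' : 'M[R]_m) t : qf G' t - qf G t = qf (G' - G) t.
Proof.
rewrite /qf -sumrB; apply: eq_bigr => i _; rewrite -sumrB; apply: eq_bigr => j _.
by rewrite !mxE mulrBl.
Qed.

Definition mxabs m (D : 'M[R]_m) : R := \sum_i \sum_j `|D i j|.

Lemma qf_bound m (D : 'M[R]_m) t : orth t -> `|qf D t| <= mxabs D * (\sum_i t i) ^+ 2.
Proof.
move=> /orthP h; have T0 : 0 <= \sum_i t i by apply: sumr_ge0.
have le1 i : t i <= \sum_i t i by rewrite (bigD1 i) //= lerDl sumr_ge0.
rewrite /qf /mxabs mulr_suml; apply: le_trans (ler_norm_sum _ _ _) _; apply: ler_sum => i _.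
rewrite mulr_suml; apply: le_trans (ler_norm_sum _ _ _) _; apply: ler_sum => j _.
rewrite normrM ler_wpM2l // ger0_norm ?mulr_ge0 // expr2; exact: ler_pM.
Qed.

(** The first variation of the Gaussian in the entry (i, j) brings down - t_i t_j. The remainder is
    quadratic in the perturbation and costs the fourth power of the sum of the coordinates, whence
    the 4 in the constant. *)
Lemma mom_taylor m (s : seq 'I_m) (G G' : 'M[R]_m) : coer G -> coer G' ->
  `|mom s G' - (mom s G - \sum_i \sum_j (G' - G) i j * mom [:: i, j & s] G)|
   <= Cst m (size s + 4) * mxabs (G' - G) ^+ 2.
Proof.
move=> cG cG'; set D := G' - G; set K := Cst m (size s + 4).
pose h t := gau s G' t + (- 1 * gau s G t + \sum_i \sum_j D i j * gau [:: i, j & s] G t).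
have dS : gdom (fun t => \sum_i \sum_j D i j * gau [:: i, j & s] G t)
  (\sum_i \sum_j `|D i j| * Cst m (size s).+2).
  apply: dom_sum => i; apply: dom_sum => j.
  by apply: domZ; exact: dom_gau.
have dG := dom_gau s cG; have dG' := dom_gau s cG'.
have -> : mom s G' - (mom s G - \sum_i \sum_j D i j * mom [:: i, j & s] G) = RI h.
  rewrite (RID dG' (domD (domZ (-1) dG) dS)) (RID (domZ (-1) dG) dS) (RIZ _ dG).
  rewrite (@RI_sum _ _ _ _ _ (fun i => \sum_j `|D i j| * Cst m (size s).+2)); last first.
    by move=> i; apply: dom_sum => j; apply: domZ; exact: dom_gau.
  rewrite mulN1r opprB [_ - mom s G]addrC; congr (_ + (_ + _)); apply: eq_bigr => i _.
  rewrite (@RI_sum _ _ _ _ _ (fun j => `|D i j| * Cst m (size s).+2)); last first.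
    by move=> j; apply: domZ; exact: dom_gau.
  by apply: eq_bigr => j _; rewrite (RIZ _ (dom_gau _ cG)).
apply: RI_bound; split; first by case: (domD dG' (domD (domZ (-1) dG) dS)).
move=> t ot.
have -> : h t = mono s t * (expR (- qf G' t) - expR (- qf G t) + (qf G' t - qf G t) * expR (- qf G t)).
  rewrite /h /gau qf_diff -/D mulN1r -addrA !mulrDr mulrN; congr (_ + (_ + _)).
  rewrite /qf !mulr_suml mulr_sumr; apply: eq_bigr => i _.
  rewrite mulr_suml mulr_sumr; apply: eq_bigr => j _.
  by rewrite !mono_cons; ring.
rewrite normrM ger0_norm ?mono_ge0 //.
apply: (@le_trans _ _ (mono s t * ((mxabs D * (\sum_i t i) ^+ 2) ^+ 2 * expR (- \sum_i t i ^+ 2)))).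
  rewrite ler_wpM2l ?mono_ge0 //; apply: le_trans (exp_taylor (cG t ot) (cG' t ot)) _.
  rewrite ler_wpM2r ?expR_ge0 // qf_diff -[X in X <= _]ger0_norm ?sqr_ge0 // normrX.
  by apply: lerXn2r; rewrite ?nnegrE ?normr_ge0 //; [apply: le_trans (qf_bound D ot)|exact: qf_bound].
have := gauss_bound s 4 ot; rewrite -/K => gb.
have D0 : 0 <= mxabs D ^+ 2 by exact: sqr_ge0.
have := ler_wpM2r D0 gb; rewrite (_ : _ * wexp t * _ = K * mxabs D ^+ 2 * wexp t); last by ring.
by apply: le_trans; rewrite le_eqVlt; apply/orP; left; apply/eqP; ring.
Qed.

Lemma mom_dR m (s : seq 'I_m) (G : R -> 'M[R]_m) (G' : 'M[R]_m) (x : R) :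
  (\forall y \near x, coer (G y)) -> (forall i j, dR (fun y => G y i j) x (G' i j)) ->
  dR (fun y => mom s (G y)) x (- \sum_i \sum_j G' i j * mom [:: i, j & s] (G x)).
Proof.
move=> cG dG; have cx := nbhs_singleton cG.
pose d y i j := G y i j - G x i j.
have dd i j : dR (fun y => d y i j) x (G' i j).
  by apply: dR_eq (dRB (dG i j) (dR_cst _ _)) _; rewrite subr0.
have dx i j : d x i j = 0 by rewrite /d subrr.
have dsq i j : dR (fun y => d y i j ^+ 2) x 0.
  apply: dR_ext (dR_eq (dRM (dd i j) (dd i j)) _) => [y|]; first by rewrite expr2.
  by rewrite dx mulr0 mul0r addr0.
(* Products of absolute values are dominated by sums of squares, which are differentiable with zero
   derivative at [x], as [dR_squeeze] requires. *)
pose u y := Cst m (size s + 4) *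
  \sum_i \sum_j \sum_k \sum_l (d y i j ^+ 2 + d y k l ^+ 2).
apply: (@dR_squeeze _ _ (fun y => mom s (G x) - \sum_i \sum_j d y i j * mom [:: i, j & s] (G x)) u).
- apply: dR_eq; first apply: (dRB (dR_cst (mom s (G x)) x)).
    apply: dR_sum => i; apply: dR_sum => j; apply: dRM (dd i j) (dR_cst _ _).
  rewrite sub0r; congr (- _); apply: eq_bigr => i _; apply: eq_bigr => j _.
  by rewrite mulr0 addr0.
- apply: dR_eq; first apply: dRZ.
    apply: dR_sum => i; apply: dR_sum => j; apply: dR_sum => k; apply: dR_sum => l.
    exact: dRD (dsq i j) (dsq k l).
  by rewrite big1 ?mulr0 // => i _; rewrite big1 // => j _; rewrite big1 // => k _;
     rewrite big1 // => l _; rewrite addr0.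
- rewrite /u big1 ?mulr0 // => i _; rewrite big1 // => j _; rewrite big1 // => k _;
     rewrite big1 // => l _; by rewrite !dx expr0n addr0.
apply: filterS cG => y cy.
have := mom_taylor s cx cy.
rewrite (_ : \sum_i \sum_j (G y - G x) i j * _ = \sum_i \sum_j d y i j * mom [:: i, j & s] (G x)); last first.
  by apply: eq_bigr => i _; apply: eq_bigr => j _; rewrite !mxE.
move=> /le_trans; apply; rewrite /u ler_wpM2l ?expR_ge0 // expr2 /mxabs mulr_suml.
apply: ler_sum => i _; rewrite mulr_suml; apply: ler_sum => j _.
rewrite mulr_sumr; apply: ler_sum => k _; rewrite mulr_sumr; apply: ler_sum => l _.
rewrite !mxE -/(d y i j) -/(d y k l) -(real_normK (num_real (d y i j))) -(real_normK (num_real (d y k l))).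
have := normr_ge0 (d y i j); have := normr_ge0 (d y k l).
have := sqr_ge0 (`|d y i j| - `|d y k l|); nra.
Qed.

(** Formal derivative of a monomial in t_l: all sequences with one occurrence of [l] deleted,
    counted with multiplicity. *)
Fixpoint dl m (l : 'I_m) (s : seq 'I_m) : seq (seq 'I_m) :=
  if s is i :: s' then (if i == l then [:: s'] else [::]) ++ map (cons i) (dl l s') else [::].

Lemma dR_mono m (l : 'I_m.+1) s (v : 'I_m -> R) x :
  dR (fun x => mono s (vins l x v)) x (\sum_(s' <- dl l s) mono s' (vins l x v)).
Proof.
elim: s => [|i s IH] /=.
  by rewrite big_nil; apply: dR_ext (dR_cst 1 x) => y; rewrite /mono big_nil.
have di : dR (fun x => vins l x v i) x (i == l)%:R.
  case: (unliftP l i) => [j ->|->].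
    rewrite eq_sym (negbTE (neq_lift _ _)).
    by apply: dR_ext (dR_cst (v j) x) => y; rewrite vins_lift.
  by rewrite eqxx; apply: dR_ext (dR_id x) => y; rewrite vins_id.
apply: dR_ext (dR_eq (dRM di IH) _) => [y|]; first by rewrite mono_cons.
rewrite big_cat big_map /=; congr (_ + _).
  by case: eqP => _; rewrite ?big_nil ?mul0r // big_seq1 mul1r.
by rewrite mulr_sumr; apply: eq_bigr => s' _; rewrite mono_cons.
Qed.

Lemma dR_qf m (l : 'I_m.+1) (G : 'M[R]_m.+1) (v : 'I_m -> R) x : G^T = G ->
  dR (fun x => qf G (vins l x v)) x (2 * \sum_k G l k * vins l x v k).
Proof.
move=> sG.
have di i : dR (fun x => vins l x v i) x (i == l)%:R.
  have := dR_mono l [:: i] v x; rewrite /= cats0 => h.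
  apply: dR_ext (dR_eq h _) => [y|]; first by rewrite /mono big_seq1.
  by case: eqP => _; rewrite ?big_nil // big_seq1 /mono big_nil.
apply: dR_eq.
  apply: dR_sum => i; apply: dR_sum => j; apply: dRZ; exact: dRM (di i) (di j).
rewrite mulr_natl mulr2n.
transitivity (\sum_i \sum_j (G i j * ((i == l)%:R * vins l x v j)) +
              \sum_i \sum_j (G i j * (vins l x v i * (j == l)%:R))).
  rewrite -big_split; apply: eq_bigr => i _; rewrite -big_split.
  by apply: eq_bigr => j _ /=; rewrite mulrDr.
congr (_ + _).
  rewrite (bigD1 l) //= [X in _ + X]big1 ?addr0.
    by apply: eq_bigr => j _; rewrite eqxx mul1r.
  by move=> i il; rewrite big1 // => j _; rewrite (negbTE il) mul0r mulr0.
apply: eq_bigr => i _; rewrite (bigD1 l) //= big1 ?addr0.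
  by rewrite eqxx mulr1 -[in LHS]sG mxE.
by move=> j jl; rewrite (negbTE jl) !mulr0.
Qed.

Lemma mono_vins0 m (l : 'I_m.+1) s (v : 'I_m -> R) :
  mono s (vins l 0 v) = if l \in s then 0 else mono (pmap (unlift l) s) v.
Proof.
elim: s => [|i s IH] /=; first by rewrite /mono !big_nil.
rewrite mono_cons IH in_cons; case: (unliftP l i) => [j ->|->].
  by rewrite vins_lift (negbTE (neq_lift _ _)) /=; case: ifP => _; rewrite ?mulr0 // mono_cons.
by rewrite eqxx vins_id mul0r.
Qed.

Lemma qf_vins0 m (l : 'I_m.+1) (G : 'M[R]_m.+1) (v : 'I_m -> R) :
  qf G (vins l 0 v) = qf (row' l (col' l G)) v.
Proof.
rewrite /qf (bigD1_ord l) //= big1 ?add0r; last first.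
  by move=> j _; rewrite vins_id mul0r mulr0.
apply: eq_bigr => i _; rewrite (bigD1_ord l) //= vins_id !mulr0 add0r.
by apply: eq_bigr => j _; rewrite !vins_lift !mxE.
Qed.

(** Integrate the l-th partial derivative of t^s exp(-q) over the orthant. The face t_l = 0
    contributes the moment of the form with row and column [l] removed, or nothing when [l] occurs
    in [s]. Every passage from a simplex to its faces below rests on this recurrence. *)
Lemma mom_ibp m (l : 'I_m.+1) (s : seq 'I_m.+1) (G : 'M[R]_m.+1) : coer G -> G^T = G ->
  2 * \sum_k G l k * mom (k :: s) G =
  \sum_(s' <- dl l s) mom s' G +
  (if l \in s then 0 else mom (pmap (unlift l) s) (row' l (col' l G))).
Proof.
move=> cG sG.
have dE s0 (v : 'I_m -> R) x : dR (fun x => gau s0 G (vins l x v)) x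
   (\sum_(s' <- dl l s0) gau s' G (vins l x v) -
    \sum_k (2 * G l k) * gau (k :: s0) G (vins l x v)).
  apply: dR_eq; first exact: dRM (dR_mono l s0 v x) (dR_exp (dRN (dR_qf l v x sG))).
  rewrite mulr_suml mulrN mulrN; congr (_ - _).
  rewrite mulrA mulr_sumr mulr_sumr; apply: eq_bigr => k _.
  by rewrite /gau mono_cons; ring.
pose f' (t : 'I_m.+1 -> R) := \sum_(s' <- dl l s) gau s' G t - \sum_k (2 * G l k) * gau (k :: s) G t.
have size_dl s0 s' : s' \in dl l s0 -> (size s' <= size s0)%N.
  elim: s0 s' => [|i s0 IH] s' //=; rewrite mem_cat => /orP[|/mapP[s1 /IH h ->]] //=.
  by case: ifP => // _; rewrite inE => /eqP ->.
have d1 : gdom (fun t => \sum_(s' <- dl l s) gau s' G t) (\sum_(s' <- dl l s) Cst m.+1 (size s')).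
  by apply: dom_sum => s'; exact: dom_gau.
have d2 : gdom (fun t => \sum_k (2 * G l k) * gau (k :: s) G t)
   (\sum_k `|2 * G l k| * Cst m.+1 (size s).+1).
  by apply: dom_sum => k; apply: domZ; exact: dom_gau.
have df' := domD d1 (domN d2).
have df := dom_gau s cG.
have widen h (C C' : R) : C <= C' -> @gdom R m.+1 h C -> gdom h C'.
  move=> CC' [mh hC]; split => // t ot; apply: le_trans (hC t ot) _.
  by rewrite ler_wpM2r // ltW // wexp_gt0.
have C1 := dom_ge0 df; have C2 := dom_ge0 df'.
have cf' v : continuous (fun x => f' (vins l x v)).
  move=> x; apply: dR_continuous; apply: dRB.
    by apply: dR_sum => s'; exact: dE.
  by apply: dR_sum => k; apply: dRZ; exact: dE.
have w1 := widen _ _ _ (ler_wpDr C2 (lexx _)) df.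
have w2 := widen _ _ _ (ler_wpDl C1 (lexx _)) df'.
have := RI_ibp w1 w2 (fun x v => dE s v x) cf'.
rewrite (RID d1 (domN d2)) RIN (RI_sum _ (fun s' => dom_gau s' cG)).
rewrite (RI_sum _ (fun k => domZ (2 * G l k) (dom_gau (k :: s) cG))).
rewrite (eq_bigr (fun k => 2 * (G l k * mom (k :: s) G))); last first.
  by move=> k _; rewrite (RIZ _ (dom_gau _ cG)) mulrA.
rewrite -mulr_sumr => /eqP; rewrite subr_eq addrC eq_sym subr_eq => /eqP ->; congr (_ + _).
case: ifPn => ls.
  rewrite (@eq_RI _ _ _ (fun=> 0)); first by rewrite RI_ge0E ?PI0.
  by move=> v _; rewrite /gau mono_vins0 ls mul0r.
by apply: eq_RI => v _; rewrite /gau mono_vins0 (negbTE ls) qf_vins0.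
Qed.

Lemma PI_perm m (f : ('I_m -> R) -> R) (sg : 'S_m) : rmeas f -> opos f ->
  PI (fun t => f (fun i => t (sg i))) = PI f.
Proof.
move=> mf f0.
have dp : \det (perm_mx sg : 'M[R]_m) = (-1) ^+ sg by exact: det_perm.
rewrite /PI -(@iint_linear R m (perm_mx sg) (ofun f)); first last.
- exact: ofun_ge0.
- exact: vmeas_ofun.
- by rewrite dp signr_eq0.
rewrite dp normrX normrN1 expr1n mul1e; apply: eq_iint => t.
have E : mulv (perm_mx sg) t = fun i => t (sg i).
  apply/funext => i; rewrite /mulv (bigD1 (sg i)) //= !mxE eqxx mul1r big1 ?addr0 //.
  by move=> j ji; rewrite !mxE eq_sym (negbTE ji) mul0r.
rewrite E /ofun; congr (if _ then _ else _); apply/orthP/orthP => h i; first exact: h.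
by have := h ((sg^-1)%g i); rewrite permKV.
Qed.

Lemma mom_perm m (s : seq 'I_m) (G : 'M[R]_m) (sg : 'S_m) :
  mom s (\matrix_(i, j) G (sg i) (sg j)) = mom (map sg s) G.
Proof.
have pos s0 G0 : @opos R m (gau s0 G0).
  by move=> t ot; rewrite mulr_ge0 ?expR_ge0 ?mono_ge0.
rewrite /mom !RI_ge0E //; congr fine.
rewrite -[in RHS](@PI_perm _ _ (sg^-1)%g) //; last exact: rmeas_gau.
apply: eq_PI => t _; rewrite /gau; congr (_ * expR (- _)).
  by rewrite /mono big_map; apply: eq_bigr => i _; rewrite permK.
rewrite /qf (reindex_inj (@perm_inj _ (sg^-1)%g)) /=; apply: eq_bigr => i _.
rewrite (reindex_inj (@perm_inj _ (sg^-1)%g)) /=; apply: eq_bigr => j _.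
by rewrite mxE !permKV.
Qed.

Lemma mom_perm_eq m (s s' : seq 'I_m) (G : 'M[R]_m) : perm_eq s s' -> mom s G = mom s' G.
Proof. by move=> e; apply: eq_RI => t _; rewrite /gau /mono (perm_big _ e). Qed.

Lemma mom_ge0 m (s : seq 'I_m) (G : 'M[R]_m) : 0 <= mom s G.
Proof.
rewrite /mom RI_ge0E; first by rewrite fine_ge0 // PI_ge0 // => t ot; rewrite mulr_ge0 ?expR_ge0 ?mono_ge0.
by move=> t ot; rewrite mulr_ge0 ?expR_ge0 ?mono_ge0.
Qed.

End Moments.

(** * The substitution x = sqrt(r^2 + s^2) *)

Section HyperbolicSubstitution.
Context {R : realType}.
Notation mu := (@lebesgue_measure R).
Variable s : R.
Hypothesis s0 : 0 < s.

Let H (r : R) : R := Num.sqrt (r ^+ 2 + s ^+ 2).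

Let pos (r : R) : 0 < r ^+ 2 + s ^+ 2.
Proof. by rewrite ltr_wpDl ?sqr_ge0 // exprn_gt0. Qed.

Let H0 r : 0 < H r. Proof. by rewrite sqrtr_gt0. Qed.

Let H2 r : H r ^+ 2 = r ^+ 2 + s ^+ 2. Proof. by rewrite sqr_sqrtr // ltW. Qed.

Let dH r : dR H r (r / H r).
Proof.
have d1 : dR (fun y : R => y ^+ 2 + s ^+ 2) r (r + r).
  apply: dR_ext (dR_eq (dRD (dRM (dR_id r) (dR_id r)) (dR_cst (s ^+ 2) r)) _) => [y|].
    by rewrite expr2.
  by rewrite mul1r mulr1 addr0.
apply: dR_eq; first exact: dR_comp d1 (is_derive1_sqrt (pos r)).
rewrite -/(H r) -mulr2n -mulr_natl; have := H0 r; set k := H r => k0.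
by field; rewrite gt_eqF.
Qed.

Let cf : continuous (fun r : R => r / H r).
Proof.
move=> r; apply: cvgM; first exact: cvg_id.
apply: cvgV; first by rewrite gt_eqF.
exact: (dR_continuous (dH r)).
Qed.

Let sqr_lt (a b : R) : 0 <= a -> 0 <= b -> (a < b) = (a ^+ 2 < b ^+ 2).
Proof. by move=> a0 b0; rewrite ltr_pXn2r ?nnegrE. Qed.

Let sqr_le (a b : R) : 0 <= a -> 0 <= b -> (a <= b) = (a ^+ 2 <= b ^+ 2).
Proof. by move=> a0 b0; rewrite ler_pXn2r ?nnegrE. Qed.

Let ltH a r : 0 < a -> (a < H r) = (a ^+ 2 - s ^+ 2 < r ^+ 2).
Proof. by move=> a0; rewrite sqr_lt ?ltW // H2 ltrBlDr. Qed.

Let leH a r : 0 < a -> (H r <= a) = (r ^+ 2 <= a ^+ 2 - s ^+ 2).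
Proof. by move=> a0; rewrite (sqr_le (ltW (H0 r)) (ltW a0)) H2 lerBrDr. Qed.

Let int_H a b : s <= a -> a < b ->
  (\int[mu]_x (if (0 < x) && (a < H x <= b) then x / H x else 0)%:E = (b - a)%:E)%E.
Proof.
move=> sa ab; have a0 : 0 < a by apply: lt_le_trans sa.
have b0 := lt_trans a0 ab.
pose u := Num.sqrt (a ^+ 2 - s ^+ 2); pose v := Num.sqrt (b ^+ 2 - s ^+ 2).
have as2 : 0 <= a ^+ 2 - s ^+ 2 by rewrite subr_ge0 -(sqr_le (ltW s0) (ltW a0)).
have bs2 : 0 < b ^+ 2 - s ^+ 2.
  by apply: le_lt_trans as2 _; rewrite ltrD2r -sqr_lt // ltW.
have u0 : 0 <= u by exact: sqrtr_ge0.
have uv : u < v by rewrite ltr_sqrt // ltrD2r -sqr_lt // ltW.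
have v0 := le_lt_trans u0 uv.
have u2 : u ^+ 2 = a ^+ 2 - s ^+ 2 by rewrite sqr_sqrtr.
have v2 : v ^+ 2 = b ^+ 2 - s ^+ 2 by rewrite sqr_sqrtr // ltW.
have Hu : H u = a by rewrite /H u2 subrK sqrtr_sqr ger0_norm // ltW.
have Hv : H v = b by rewrite /H v2 subrK sqrtr_sqr ger0_norm // ltW.
transitivity (\int[mu]_(x in `]u, v]) (x / H x)%:E)%E.
  rewrite [RHS]integral_mkcond; apply: eq_integral => x _; rewrite patchE.
  have -> : (x \in `]u, v]%classic) = (0 < x) && (a < H x <= b).
    rewrite mem_setE in_itv /= ltH // leH // -u2 -v2.
    have [x0|x0] /= := ltP 0 x; last by rewrite ltNge (le_trans x0 u0).
    by rewrite -(sqr_lt u0 (ltW x0)) -(sqr_le (ltW x0) (ltW v0)).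
  by case: ifP.
rewrite integral_itv_obnd_cbnd; last first.
  by apply: measurable_funTS; apply/measurable_EFinP; exact: continuous_measurable_fun.
rewrite (@continuous_FTC2 _ _ H) ?Hu ?Hv //.
- by apply: continuous_subspaceT.
- split.
  + by move=> x _; case: (dH x).
  + by apply: cvg_at_right_filter; exact: (dR_continuous (dH u)).
  + by apply: cvg_at_left_filter; exact: (dR_continuous (dH v)).
- by move=> x _; rewrite derive1E; case: (dH x).
Qed.

Lemma ge0_hyperbolic_substitution (f : R -> \bar R) :
  measurable_fun setT f -> (forall x, (0 <= f x)%E) -> (forall x, x <= s -> f x = 0%E) ->
  (\int[mu]_x f x =
   \int[mu]_r (if (0 < r)%R then f (Num.sqrt (r ^+ 2 + s ^+ 2))%R *
                 (r / Num.sqrt (r ^+ 2 + s ^+ 2))%:E else 0))%E.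
Proof.
move=> mf f0 fs.
(* The branch [r + s] for r <= 0 completes the map to the whole line, so that intervals below [s]
   also receive their length; [f] vanishes there. *)
pose h r := if 0 < r then H r else r + s.
pose rho r := if 0 < r then r / H r else 1.
have mp : measurable_fun setT (fun r : R => 0 < r) by exact: measurable_fun_ltr.
have mH : measurable_fun setT H.
  by apply: continuous_measurable_fun => r; exact: (dR_continuous (dH r)).
have mrH : measurable_fun setT (fun r : R => r / H r) by exact: continuous_measurable_fun.
rewrite (@ge0_change_var1 R h rho) //; first last.
- move=> a b ab.
  have sH x : 0 < x -> s < H x.
    by move=> x0; rewrite sqr_lt ?ltW // H2 ltrDr exprn_gt0.
  have intI c d : c <= d -> (\int[mu]_x (if (c < x <= d)%R then 1 else 0)%R%:E = (d - c)%:E)%E.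
    move=> cd; transitivity (\int[mu]_(x in `]c, d]) (1%R)%:E)%E.
      rewrite [RHS]integral_mkcond; apply: eq_integral => x _; rewrite patchE mem_setE in_itv /=.
      by case: ifP.
    rewrite integral_cst //= lebesgue_measure_itv /= lte_fin mul1e.
    by move: cd; rewrite le_eqVlt => /predU1P[->|->]; rewrite ?ltxx ?subrr.
  have m1 c d : measurable_fun setT (fun x : R => (if (c < x <= d)%R then 1 else 0 : R)%:E).
    apply/measurable_EFinP; apply: measurable_fun_ifT => //; apply: measurable_and.
      exact: measurable_fun_ltr.
    exact: measurable_fun_ler.
  have [bs|sb] := leP b s.
    rewrite (_ : (b - a)%:E = ((b - s) - (a - s))%:E); last by congr EFin; ring.
    rewrite -intI; last by rewrite lerD2r ltW.
    apply: eq_integral => x _; rewrite /h /rho; case: (ltP 0 x) => x0 /=.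
      have := sH x x0 => sHx.
      rewrite (@leNgt _ _ (H x)) (le_lt_trans bs sHx) andbF.
      have -> : (x <= b - s) = false by apply/negbTE; rewrite -ltNge; lra.
      by rewrite andbF.
    by rewrite ltrBlDr lerBrDr.
  have [sa|as_] := leP s a.
    rewrite -int_H //; apply: eq_integral => x _; rewrite /h /rho; case: (ltP 0 x) => x0 //=.
    have -> : (a < x + s) = false by apply/negbTE; rewrite -leNgt; lra.
    by [].
  rewrite (_ : (b - a)%:E = ((b - s)%:E + (0 - (a - s))%:E)%E); last first.
    by rewrite -EFinD; congr EFin; ring.
  rewrite -int_H // -intI; last by lra.
  rewrite -ge0_integralD //; first last.
  - exact: m1.
  - by move=> x _; case: ifP.
  - apply/measurable_EFinP; apply: measurable_fun_ifT => //; apply: measurable_and => //.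
    apply: measurable_and; [exact: measurable_fun_ltr|exact: measurable_fun_ler].
  - move=> x _; rewrite lee_fin; case: ifP => // /andP[x0 _].
    by rewrite divr_ge0 // ltW.
  apply: eq_integral => x _; rewrite /h /rho; case: (ltP 0 x) => x0 /=.
    rewrite andbF adde0 sH //= (lt_trans as_ (sH _ _)) //.
  rewrite add0e ltrBlDr andbT; have -> : x + s <= b by lra.
  by rewrite andbT.
- by move=> r; rewrite /rho; case: ifP => // r0; rewrite divr_ge0 // ltW.
- by apply: measurable_fun_ifT.
- by apply: measurable_fun_ifT => //; apply: measurable_funD.
apply: eq_integral => x _; rewrite /h /rho; case: ltP => x0 //.
by rewrite fs ?mul0e // gerDr.
Qed.

End HyperbolicSubstitution.

Import Pilot.Defs.

(** * Hyperbolic volume of a simplex as a Gaussian integral over its cone *)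

Section HyperbolicVolume.
Context {R : realType}.
Notation mu := (@lebesgue_measure R).

Lemma ler_sqrE (a b : R) : 0 <= a -> 0 <= b -> (a <= b) = (a ^+ 2 <= b ^+ 2).
Proof. by move=> a0 b0; rewrite ler_pXn2r ?nnegrE. Qed.

Lemma measurable_inv_ge0 d (T : measurableType d) (f : T -> R) :
  measurable_fun setT f -> (forall x, 0 <= f x) -> measurable_fun setT (fun x => (f x)^-1).
Proof.
move=> mf f0.
pose g (x : R) := if 0 < x then x^-1 else 0.
rewrite (_ : (fun x => _) = g \o f).
  apply: measurableT_comp => //; apply: measurable_fun_if => //=.
    exact: measurable_fun_ltr.
  rewrite setTI (_ : _ @^-1` _ = `]0, +oo[%classic); last first.
    by apply/seteqP; split => x /=; rewrite in_itv /= andbT => ->.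
  apply: open_continuous_measurable_fun => //= x; rewrite inE /= in_itv /= andbT => x0.
  by apply: inv_continuous; rewrite gt_eqF.
apply/funext => x /=; rewrite /g; case: ltP => // h.
by have -> : f x = 0 by [apply/eqP; rewrite eq_le h f0]; rewrite invr0.
Qed.

Lemma measurable_sqrt_comp d (T : measurableType d) (f : T -> R) :
  measurable_fun setT f -> measurable_fun setT (fun x => Num.sqrt (f x)).
Proof.
move=> mf; apply: (measurableT_comp (f := @Num.sqrt R)) => //.
by apply: continuous_measurable_fun; exact: sqrt_continuous.
Qed.

(** Extends the substitution to [s = 0] and to functions that may be nonzero at the single point
    [s], a null set. *)
Lemma ge0_hyperbolic_substitutionW (s : R) (f : R -> \bar R) : 0 <= s ->
  measurable_fun setT f -> (forall x, (0 <= f x)%E) -> (forall x, x < s -> f x = 0%E) ->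
  (\int[mu]_x f x =
   \int[mu]_r (if (0 < r)%R then f (Num.sqrt (r ^+ 2 + s ^+ 2))%R *
                 (r / Num.sqrt (r ^+ 2 + s ^+ 2))%:E else 0))%E.
Proof.
move=> s0 mf f0 fs.
have -> : (\int[mu]_x f x = \int[mu]_(x in `]s, +oo[) f x)%E.
  rewrite integral_itv_obnd_cbnd; last exact: measurable_funTS.
  rewrite [RHS]integral_mkcond; apply: eq_integral => x _; rewrite patchE mem_setE in_itv /= andbT.
  by case: leP => // /fs.
rewrite integral_mkcond.
set f1 := f \_ _.
have mf1 : measurable_fun setT f1 by apply/(measurable_restrictT f (measurable_itv _)); exact: measurable_funTS.
have f10 x : (0 <= f1 x)%E by rewrite /f1 patchE; case: ifP.
have f1s x : x <= s -> f1 x = 0%E.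
  by move=> xs; rewrite /f1 patchE mem_setE in_itv /= andbT ltNge xs.
have f1E x : s < x -> f1 x = f x.
  by move=> sx; rewrite /f1 patchE mem_setE in_itv /= andbT sx.
move: s0; rewrite le_eqVlt => /predU1P[s0|s0].
  apply: eq_integral => x _; case: ltP => x0.
    rewrite -s0 expr0n addr0 sqrtr_sqr gtr0_norm // divff ?gt_eqF // mule1 f1E //.
    by rewrite -s0.
  by rewrite f1s // -s0.
rewrite (ge0_hyperbolic_substitution s0 mf1 f10 f1s); apply: eq_integral => x _.
case: ltP => // x0; rewrite f1E //.
rewrite -[X in X < _]ger0_norm ?ltW // -sqrtr_sqr ltr_sqrt ?ltrDr ?exprn_gt0 //.
by rewrite ltr_wpDl ?sqr_ge0 // exprn_gt0.
Qed.

Section Vol.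
Variable n : nat.

Definition gram m (w : 'I_m -> pt R n) : 'M[R]_m :=
  \matrix_(i, j) minkowski (w i) (w j).

Definition wmx m (w : 'I_m -> pt R n) : 'M[R]_(m, n.+1) := \matrix_(i < m, j < n.+1) (w i : 'I_n.+1 -> R) j.

Lemma minkowskiC (x y : pt R n) : minkowski x y = minkowski y x.
Proof.
rewrite /minkowski mulrC; congr (_ - _); apply: eq_bigr => i _; exact: mulrC.
Qed.

Lemma minkowski_suml m (t : 'I_m -> R) (w : 'I_m -> pt R n) (y : pt R n) :
  minkowski (fun k => \sum_j t j * w j k) y = \sum_j t j * minkowski (w j) y.
Proof.
rewrite /minkowski mulr_suml.
under [in RHS]eq_bigr do rewrite mulrBr.
rewrite [in RHS]sumrB; congr (_ - _).
  by apply: eq_bigr => j _; rewrite mulrA.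
under eq_bigr do rewrite mulr_suml.
rewrite exchange_big; apply: eq_bigr => j _; rewrite mulr_sumr.
by apply: eq_bigr => i _; rewrite mulrA.
Qed.

Lemma minkowski_mulv m (w : 'I_m -> pt R n) (t : 'I_m -> R) :
  minkowski (mulv (wmx w)^T t) (mulv (wmx w)^T t) = qf (gram w) t.
Proof.
have E : mulv (wmx w)^T t = fun k => \sum_j t j * w j k.
  by apply/funext => k; apply: eq_bigr => j _; rewrite !mxE mulrC.
rewrite E minkowski_suml /qf; apply: eq_bigr => i _.
rewrite minkowskiC minkowski_suml mulr_sumr; apply: eq_bigr => j _.
by rewrite mxE [minkowski (w j) _]minkowskiC; ring.
Qed.

Lemma CauchySchwarz_sum m (a b : 'I_m -> R) :
  (\sum_i a i * b i) ^+ 2 <= (\sum_i a i ^+ 2) * \sum_i b i ^+ 2.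
Proof.
set S := \sum_i _ * _; set A := \sum_i a i ^+ 2; set B := \sum_i b i ^+ 2.
have B0 : 0 <= B by apply: sumr_ge0 => i _; exact: sqr_ge0.
have h : 0 <= \sum_i (B * a i - S * b i) ^+ 2 by apply: sumr_ge0 => i _; exact: sqr_ge0.
have : \sum_i (B * a i - S * b i) ^+ 2 = B * (A * B - S ^+ 2).
  rewrite (eq_bigr (fun i => B ^+ 2 * a i ^+ 2 + (- (2 * B * S)) * (a i * b i) + S ^+ 2 * b i ^+ 2)).
    by rewrite !big_split /= -!mulr_sumr -/A -/B -/S; ring.
  by move=> i _; ring.
move: B0; rewrite le_eqVlt => /predU1P[B0 _|B0 E].
  have bi i : b i = 0.
    apply/eqP; rewrite -sqrf_eq0; apply/eqP/(psumr_eq0P _ (esym B0)) => // j _; exact: sqr_ge0.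
  by rewrite /S big1 ?expr0n -?B0 ?mulr0 // => i _; rewrite bi mulr0.
by move: h; rewrite E pmulr_rge0 // subr_ge0.
Qed.

Lemma Lambda_ge1 (x : pt R n) : in_Lambda x -> 1 <= x ord0.
Proof.
case; rewrite /minkowski => h x0.
rewrite (ler_sqrE ler01 (ltW x0)) expr1n expr2 -[X in X <= _]h gerDl oppr_le0.
by apply: sumr_ge0 => i _; rewrite -expr2 sqr_ge0.
Qed.

(** Reversed Cauchy-Schwarz inequality on the upper sheet of the hyperboloid. *)
Lemma minkowski_ge1 (x y : pt R n) : in_Lambda x -> in_Lambda y -> 1 <= minkowski x y.
Proof.
move=> [hx x0] [hy y0]; rewrite /minkowski.
set S := \sum_(i < n) _.
set X := \sum_(i < n) x (lift ord0 i) ^+ 2; set Y := \sum_(i < n) y (lift ord0 i) ^+ 2.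
have CS : S ^+ 2 <= X * Y by exact: CauchySchwarz_sum.
have X0 : 0 <= X by apply: sumr_ge0 => i _; exact: sqr_ge0.
have Y0 : 0 <= Y by apply: sumr_ge0 => i _; exact: sqr_ge0.
have EX : x ord0 ^+ 2 = 1 + X.
  by move: hx; rewrite /minkowski -expr2 => /eqP; rewrite subr_eq => /eqP ->.
have EY : y ord0 ^+ 2 = 1 + Y.
  by move: hy; rewrite /minkowski -expr2 => /eqP; rewrite subr_eq => /eqP ->.
have XY : 2 * S <= X + Y.
  have [S0|S0] := leP S 0; first by nra.
  rewrite ler_sqrE; [|by nra|by nra].
  have := sqr_ge0 (X - Y); nra.
rewrite lerBrDr.
have [S1|S1] := leP (1 + S) 0; first by apply: le_trans S1 _; rewrite mulr_ge0 // ltW.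
rewrite (ler_sqrE (ltW S1) (ltW (mulr_gt0 x0 y0))) exprMn EX EY; nra.
Qed.

Lemma coer_ge1 m (G : 'M[R]_m) : (forall i, 1 <= G i i) -> (forall i j, 0 <= G i j) -> coer G.
Proof.
move=> G1 G0 t /orthP t0; rewrite /qf; apply: ler_sum => i _.
rewrite (bigD1 i) //= -[X in X <= _]addr0; apply: lerD.
  by rewrite expr2 ler_peMl // mulr_ge0.
by apply: sumr_ge0 => j _; rewrite !mulr_ge0.
Qed.

Lemma coer_gram m (w : 'I_m -> pt R n) : (forall i, in_Lambda (w i)) -> coer (gram w).
Proof.
by move=> wL; apply: coer_ge1 => i *; rewrite mxE ?(le_trans ler01) // minkowski_ge1.
Qed.

(** Inverse of [chart] on Lambda. *)
Definition hyp (y : 'I_n -> R) : pt R n := vcons (Num.sqrt (1 + \sum_i y i ^+ 2)) y.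

Lemma minkowski_vcons (x0 : R) (y : 'I_n -> R) :
  minkowski (vcons x0 y) (vcons x0 y) = x0 ^+ 2 - \sum_i y i ^+ 2.
Proof.
rewrite /minkowski vconsE vins_id expr2; congr (_ - _).
by apply: eq_bigr => i _; rewrite vins_lift expr2.
Qed.

Lemma vcons_eta (x : pt R n) : x = vcons (x ord0) (chart x).
Proof.
apply/funext => i; rewrite vconsE.
by case: (unliftP ord0 i) => [j ->|->]; rewrite ?vins_lift ?vins_id.
Qed.

Let sumsq0 (y : 'I_n -> R) : 0 <= \sum_i y i ^+ 2.
Proof. by apply: sumr_ge0 => i _; exact: sqr_ge0. Qed.

Lemma minkowski_hyp (y : 'I_n -> R) : minkowski (hyp y) (hyp y) = 1.
Proof.
rewrite minkowski_vcons sqr_sqrtr ?addrK //.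
by rewrite addr_ge0.
Qed.

(** Radial factor of a Gaussian integral over a cone in R^{1,n}, equal to half of Gamma((n+1)/2);
    only its positivity and finiteness are used. *)
Definition gam : \bar R :=
  (\int[mu]_r (if (0 < r)%R then (r ^+ n * expR (- r ^+ 2))%:E else 0))%E.

Variable w : 'I_n.+1 -> pt R n.
Hypothesis wL : forall i, in_Lambda (w i).
Hypothesis dW : \det (wmx w) != 0.

Let W := (wmx w)^T.
Let Wi := invmx W.
Let uW : W \in unitmx. Proof. by rewrite unitmxE det_tr unitfE. Qed.

Let WiK t : mulv Wi (mulv W t) = t.
Proof. by rewrite mulvM mulVmx // mulv1. Qed.
Let WKi x : mulv W (mulv Wi x) = x.
Proof. by rewrite mulvM mulmxV // mulv1. Qed.

Let cone (x : pt R n) := orth (mulv Wi x).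

Let Fg (x : pt R n) : \bar R := if cone x then (expR (- minkowski x x))%:E else 0%E.

Let Fg0 x : (0 <= Fg x)%E.
Proof. by rewrite /Fg; case: ifP => // _; rewrite lee_fin expR_ge0. Qed.

Let mcone d (T : measurableType d) (phi : T -> 'I_n.+1 -> R) :
  (forall i, measurable_fun setT (fun z : T => phi z i)) -> measurable_fun setT (fun z : T => cone (phi z)).
Proof.
move=> mphi.
have : vmeas (fun t : 'I_n.+1 -> R => if orth t then 1%:E else 0%:E : \bar R).
  by apply: measurable_fun_ifT => //; exact: rmeas_orth.
move=> /(vmeas_comp (phi := fun z : T => mulv Wi (phi z))) h.
have {}h : measurable_fun setT (fun z : T => if cone (phi z) then 1%:E else 0%:E : \bar R).
  by apply: h => i; exact: measurable_mulv.
rewrite (_ : (fun z : T => cone (phi z)) = (fun z : T => ((1/2)%:E < (if cone (phi z) then 1%:E else 0%:E : \bar R))%E)); last first.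
  by apply/funext => z; case: ifP => _; rewrite lte_fin; apply/esym; [|apply/negbTE]; lra.
by apply: measurable_fun_lte.
Qed.

Let mFg : vmeas Fg.
Proof.
apply: measurable_fun_ifT => //; first by apply: mcone => i; exact: measurable_tnth.
apply/measurable_EFinP; apply: measurableT_comp => //; apply: measurableT_comp => //.
apply: measurable_funB; first by apply: measurable_funM; exact: measurable_tnth.
by apply: measurable_sum => i; apply: measurable_funM; exact: measurable_tnth.
Qed.

Let cone_ge0 x : cone x -> 0 <= x ord0 /\ 0 <= minkowski x x.
Proof.
move=> cx; rewrite -(WKi x); set t := mulv Wi x; have /orthP t0 : orth t by exact: cx.
split.
  by apply: sumr_ge0 => j _; rewrite !mxE mulr_ge0 // ltW //; case: (wL j).
rewrite minkowski_mulv; apply: le_trans (coer_gram wL cx).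
by apply: sumr_ge0 => i _; exact: sqr_ge0.
Qed.

(** In the coordinates of the cone the Minkowski form becomes [qf (gram w)], and the Jacobian is the
    determinant of the vertices. *)
Let iint_Fg_orthant : iint Fg = (`|\det (wmx w)|%:E * (mom [::] (gram w))%:E)%E.
Proof.
rewrite -(@iint_linear _ _ W) ?det_tr //; congr (_ * _)%E.
rewrite /mom RI_ge0E; last by move=> t _; rewrite mulr_ge0 ?expR_ge0 // /mono big_nil.
rewrite fineK; last first.
  apply: (PI_fin (dom_gau [::] (coer_gram wL))).
  by move=> t _; rewrite mulr_ge0 ?expR_ge0 // /mono big_nil.
apply: eq_iint => t; rewrite /Fg /cone WiK /ofun; case: ifP => // _.
by rewrite minkowski_mulv /gau /mono big_nil mul1r.
Qed.

Let coneZ r x : 0 < r -> cone (fun i => r * x i) = cone x.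
Proof.
move=> r0; rewrite /cone.
have -> : mulv Wi (fun i => r * x i) = fun i => r * mulv Wi x i.
  by apply/funext => i; rewrite /mulv mulr_sumr; apply: eq_bigr => j _; rewrite mulrCA.
by apply/orthP/orthP => h i; have := h i; rewrite pmulr_rge0.
Qed.

Let hA : \bar R := iint (fun y : 'I_n -> R => if cone (hyp y) then (vol_density y)%:E else 0%E).

Let mhyp d (T : measurableType d) (phi : T -> 'I_n -> R) i :
  (forall i, measurable_fun setT (fun z : T => phi z i)) -> measurable_fun setT (fun z : T => hyp (phi z) i).
Proof.
move=> mphi; apply: (@measurable_vins _ _ ord0) => //.
apply: measurable_sqrt_comp; apply: measurable_funD => //.
by apply: measurable_sum => j; exact: measurable_funX.
Qed.

Let vden0 (y : 'I_n -> R) : 0 <= vol_density y.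
Proof. by rewrite /vol_density invr_ge0 sqrtr_ge0. Qed.

(** Polar coordinates on the cone. For a fixed space part y the time coordinate is sqrt(r^2 +
    |y|^2); rescaling y by r then turns the point into r times a point of the hyperboloid, the
    exponent into -r^2, and the Jacobian into r^n times [vol_density]. *)
Let iint_Fg_radial : iint Fg = (gam * hA)%E.
Proof.
pose s (y : 'I_n -> R) := Num.sqrt (\sum_i y i ^+ 2).
have s0 y : 0 <= s y by exact: sqrtr_ge0.
have s2 y : s y ^+ 2 = \sum_i y i ^+ 2 by rewrite sqr_sqrtr.
pose H r (y : 'I_n -> R) := Num.sqrt (r ^+ 2 + s y ^+ 2).
pose K r (y : 'I_n -> R) : \bar R :=
  if 0 < r then (Fg (vcons (H r y) y) * (r / H r y)%:E)%E else 0%E.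
have K0 r y : (0 <= K r y)%E.
  by rewrite /K; case: ifP => // r0; rewrite mule_ge0 // lee_fin divr_ge0 ?sqrtr_ge0 // ltW.
have mH : measurable_fun setT (fun z : R * n.-tuple R => H z.1 (tnth z.2)).
  apply: measurable_sqrt_comp; apply: measurable_funD.
    by apply: measurable_funX; exact: measurable_fst.
  apply: measurable_funX; apply: measurable_sqrt_comp.
  by apply: measurable_sum => i; apply: measurable_funX; exact: measurable_tnth2.
have mK : pvmeas K.
  apply: measurable_fun_ifT => //.
    by apply: measurable_fun_ltr => //; exact: measurable_fst.
  apply: emeasurable_funM.
    apply: (@vmeas_comp _ _ Fg _ _ (fun z : R * n.-tuple R => vcons (H z.1 (tnth z.2)) (tnth z.2))) => // i.
    by apply: (@measurable_vins _ _ ord0) => // j; exact: measurable_tnth2.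
  apply/measurable_EFinP; apply: measurable_funM; first exact: measurable_fst.
  by apply: measurable_inv_ge0 => // z; exact: sqrtr_ge0.
rewrite [LHS]/= (@iint_tonelli _ _ (fun x v => Fg (vcons x v))) //; last exact: pvmeas_vcons.
have step y : (\int[mu]_x Fg (vcons x y) = \int[mu]_r K r y)%E.
  rewrite (@ge0_hyperbolic_substitutionW (s y)) //.
    apply: (@vmeas_comp _ _ Fg _ _ (fun x => vcons x y)) => // i.
    exact: (@measurable_vins _ _ ord0).
  move=> x xs; rewrite /Fg; case: ifP => // /cone_ge0[].
  rewrite minkowski_vcons vconsE vins_id -s2 subr_ge0 => x0.
  by rewrite ler_pXn2r ?nnegrE // leNgt xs.
under eq_iint do rewrite step.
rewrite -iint_tonelli //.
have mA : vmeas (fun y : 'I_n -> R => if cone (hyp y) then (vol_density y)%:E else 0%E).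
  apply: measurable_fun_ifT => //.
    by apply: mcone => i; apply: mhyp => j; exact: measurable_tnth.
  apply/measurable_EFinP; apply: measurable_inv_ge0; last by move=> z; exact: sqrtr_ge0.
  apply: measurable_sqrt_comp; apply: measurable_funD => //.
  by apply: measurable_sum => i; apply: measurable_funX; exact: measurable_tnth.
have A0 (y : 'I_n -> R) : (0 <= (if cone (hyp y) then (vol_density y)%:E else 0%E))%E.
  by case: ifP => // _; rewrite lee_fin.
rewrite muleC /gam -ge0_integralZl //; first last.
- exact: iint_ge0.
- by move=> r _; case: ifP => // r0; rewrite lee_fin mulr_ge0 ?expR_ge0 // exprn_ge0 // ltW.
- apply: measurable_fun_ifT => //; first exact: measurable_fun_ltr.
  apply/measurable_EFinP; apply: measurable_funM; first exact: measurable_funX.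
  by apply: measurableT_comp => //; apply: measurableT_comp => //; exact: measurable_funX.
apply: eq_integral => r _; rewrite /K; case: ltP => r0; last first.
  rewrite mule0; transitivity (PI (fun _ : 'I_n -> R => 0)); last exact: PI0.
  by apply: eq_iint => t; rewrite /ofun; case: ifP.
have mKr : vmeas (fun y => (Fg (vcons (H r y) y) * (r / H r y)%:E)%E).
  by have := pvmeas_vmeas r mK; rewrite /K r0.
rewrite -(@iint_linear _ _ (r%:M)) //; first last.
- by move=> y; have := K0 r y; rewrite /K r0.
- by rewrite det_scalar expf_neq0 // gt_eqF.
rewrite det_scalar normrX gtr0_norm // [RHS]muleC EFinM -muleA; congr (_ * _)%E.
rewrite -iintZl ?expR_ge0 //; apply: eq_iint => y.
have -> : mulv r%:M y = fun i => r * y i.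
  apply/funext => i; rewrite /mulv (bigD1 i) //= big1 ?mxE ?eqxx ?addr0 //.
  by move=> j ji; rewrite mxE eq_sym (negbTE ji) mul0r.
have Hr : H r (fun i => r * y i) = r * Num.sqrt (1 + \sum_i y i ^+ 2).
  rewrite /H s2; have -> : r ^+ 2 + \sum_i (r * y i) ^+ 2 = r ^+ 2 * (1 + \sum_i y i ^+ 2).
    rewrite mulrDr mulr1 mulr_sumr; congr (_ + _).
    by apply: eq_bigr => i _; rewrite exprMn.
  by rewrite sqrtrM ?sqr_ge0 // sqrtr_sqr gtr0_norm.
rewrite Hr (_ : vcons _ _ = fun i => r * hyp y i); last first.
  apply/funext => i; rewrite /hyp !vconsE.
  by case: (unliftP ord0 i) => [j ->|->]; rewrite ?vins_lift ?vins_id.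
rewrite /Fg coneZ //; case: ifP => _; last by rewrite mul0e mule0.
rewrite -EFinM; congr EFin.
have -> : minkowski (fun i => r * hyp y i) (fun i => r * hyp y i) = r ^+ 2.
  rewrite -[RHS]mulr1 -(minkowski_hyp y) /minkowski mulrBr mulr_sumr; congr (_ - _); first by ring.
  by apply: eq_bigr => i _; ring.
by congr (_ * _); rewrite invfM mulrA divff ?mul1r // gt_eqF.
Qed.

(** Pseudo-linear normalization is radial projection, so the simplex is the intersection of the cone
    over its vertices with the hyperboloid. *)
Let hsimplexE (y : 'I_n -> R) : (exists x, hsimplex w x /\ chart x = y) <-> cone (hyp y).
Proof.
have WE t : mulv W t = fun k => \sum_j t j * w j k.
  by apply/funext => k; apply: eq_bigr => j _; rewrite !mxE mulrC.
split.
  move=> [x [[be [be0 [be1 xE]]] <-]].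
  pose nb := mnorm (fun k' => \sum_j be j * w j k').
  have qb : 0 < qf (gram w) be.
    have : orth be by apply/orthP.
    move=> /(coer_gram wL); apply: lt_le_trans.
    have [j bj] : exists j, be j != 0.
      apply/existsP; apply: contraT; rewrite negb_exists => /forallP h.
      move: be1; rewrite big1 => [/eqP|j _]; first by rewrite eq_sym oner_eq0.
      by have := h j; rewrite negbK => /eqP.
    rewrite (bigD1 j) //= ltr_pwDl ?exprn_even_gt0 // sumr_ge0 // => i _; exact: sqr_ge0.
  have nbE : nb ^+ 2 = qf (gram w) be.
    by rewrite /nb /mnorm -WE minkowski_mulv sqr_sqrtr // ltW.
  have nb0 : 0 < nb by rewrite /nb /mnorm sqrtr_gt0 -WE minkowski_mulv.
  have xW : x = mulv W (fun j => be j / nb).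
    by rewrite xE WE; apply/funext => k; rewrite mulr_suml; apply: eq_bigr => j _; rewrite mulrAC.
  have xx : minkowski x x = 1.
    rewrite xW minkowski_mulv; transitivity (qf (gram w) be / nb ^+ 2); last first.
      by rewrite -nbE divff // expf_neq0 // gt_eqF.
    rewrite /qf mulr_suml; apply: eq_bigr => i _; rewrite mulr_suml; apply: eq_bigr => j _.
    by field; rewrite gt_eqF.
  have x0 : 0 <= x ord0.
    rewrite xW; apply: sumr_ge0 => j _; rewrite !mxE mulr_ge0 // ?divr_ge0 // ltW //.
    by case: (wL j).
  have -> : hyp (chart x) = x.
    rewrite [RHS]vcons_eta /hyp; congr vcons.
    have := xx; rewrite {1 2}(vcons_eta x) minkowski_vcons => /eqP.
    by rewrite subr_eq => /eqP <-; rewrite sqrtr_sqr ger0_norm.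
  rewrite /cone xW WiK; apply/orthP => j; exact: divr_ge0 (be0 j) (ltW nb0).
move=> cy; set t := mulv Wi (hyp y); have /orthP t0 : orth t by exact: cy.
have tW : mulv W t = hyp y by rewrite /t WKi.
pose T := \sum_j t j.
have T0 : 0 < T.
  rewrite lt_neqAle sumr_ge0 // andbT eq_sym; apply/eqP => T0.
  have tj j : t j = 0 by exact: (psumr_eq0P _ T0).
  have := minkowski_hyp y; rewrite -tW minkowski_mulv /qf big1 => [/eqP|i _].
    by rewrite eq_sym oner_eq0.
  by rewrite big1 // => j _; rewrite !tj mul0r mulr0.
exists (hyp y); split; last by apply/funext => i; rewrite /chart /hyp vconsE vins_lift.
have E1 : (fun k' => \sum_j t j / T * w j k') = fun k => hyp y k / T.
  apply/funext => k; rewrite -tW WE mulr_suml; apply: eq_bigr => j _; by rewrite mulrAC.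
exists (fun j => t j / T); split; first by move=> j; rewrite divr_ge0 // ltW.
split; first by rewrite -mulr_suml divff // gt_eqF.
rewrite E1.
have -> : mnorm (fun k => hyp y k / T) = T^-1.
  rewrite /mnorm (_ : minkowski _ _ = T^-1 ^+ 2); first by rewrite sqrtr_sqr ger0_norm // invr_ge0 ltW.
  rewrite -[RHS]mul1r -(minkowski_hyp y) /minkowski mulrBl mulr_suml; congr (_ - _); first by ring.
  by apply: eq_bigr => i _; ring.
apply/funext => k; rewrite -[RHS]/((\sum_j t j / T * w j k) / T^-1).
by have /(congr1 (fun f => f k)) /= -> := E1; rewrite invrK divfK // gt_eqF.
Qed.

(** Comparison of the linear and the radial evaluation of one Gaussian integral. *)
Lemma iint_gram_hvol : (gam * iint (fun y : 'I_n -> R =>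
    if `[< exists x, hsimplex w x /\ chart x = y >] then (vol_density y)%:E else 0%E)
  = (`|\det (wmx w)| * mom [::] (gram w))%:E)%E.
Proof.
rewrite EFinM -iint_Fg_orthant iint_Fg_radial; congr (_ * _)%E; apply: eq_iint => y.
by have -> : `[< exists x, hsimplex w x /\ chart x = y >] = cone (hyp y) by apply/asboolP/idP => /hsimplexE.
Qed.

End Vol.
End HyperbolicVolume.

From mathcomp Require Import ring lra complex.

(** * Oriented volume as a determinant times a Gaussian moment *)

Section VorFormula.
Context {R : realType}.
Notation mu := (@lebesgue_measure R).
Variable n : nat.

Lemma gam_fin : (0 < @gam R n)%E /\ @gam R n \is a fin_num.
Proof.
have g0 (r : R) : (0 <= (if (0 < r)%R then (r ^+ n * expR (- r ^+ 2))%:E else 0%E : \bar R))%E.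
  by case: ifP => // r0; rewrite lee_fin mulr_ge0 ?expR_ge0 // exprn_ge0 // ltW.
have mg : measurable_fun setT (fun r : R => (if 0 < r then (r ^+ n * expR (- r ^+ 2))%:E else 0%E : \bar R)).
  apply: measurable_fun_ifT => //; first exact: measurable_fun_ltr.
  apply/measurable_EFinP; apply: measurable_funM; first exact: measurable_funX.
  by apply: measurableT_comp => //; apply: measurableT_comp => //; exact: measurable_funX.
have pos : (0 < @gam R n)%E.
  apply: (@lt_le_trans _ _ (\int[mu]_(x in `[1%R, 2%R]) (expR (- 4))%:E)%E).
    rewrite integral_cst //= lebesgue_measure_itv /= lte_fin ltr1n -EFinB.
    by rewrite (_ : 2 - 1 = 1) ?mule1 ?lte_fin ?expR_gt0 //; lra.
  rewrite integral_mkcond; apply: ge0_le_integral => //.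
  - by move=> x _; rewrite patchE; case: ifP => // _; rewrite lee_fin expR_ge0.
  - by apply/(measurable_restrictT _ (measurable_itv _)).
  - move=> x _; rewrite patchE mem_setE in_itv /=; case: ifP => [/andP[x1 x2]|_]; last exact: g0.
    have x0 : 0 < x by lra.
    rewrite x0 lee_fin -[X in X <= _]mul1r; apply: ler_pM; rewrite ?expR_ge0 //.
      by rewrite exprn_ege1.
    by rewrite ler_expR; nra.
split => //; rewrite ge0_fin_numE; last exact: ltW.
have c1 : coer (1%:M : 'M[R]_1).
  move=> t _; rewrite /qf !big_ord1 mxE eqxx mul1r expr2; exact: lexx.
have gp s : opos (gau s (1%:M : 'M[R]_1)).
  by move=> t ot; rewrite mulr_ge0 ?expR_ge0 ?mono_ge0.
(* Finiteness: up to extension by zero the integrand is the one-dimensional Gaussian with monomial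
   t^n. *)
have := PI_fin (dom_gau (nseq n ord0) c1) (gp _).
rewrite ge0_fin_numE; last exact: PI_ge0.
apply: le_lt_trans; apply: ge0_le_integral => //.
- have mf := vmeas_ofun (rmeas_gau (nseq n ord0) (1%:M : 'M[R]_1)).
  exact: (measurable_iint (pvmeas_vcons mf) (fun x t => ofun_ge0 (gp _) _)).
- move=> x _; rewrite /= /ofun vconsE orth_vins.
  have -> : orth (fun _ : 'I_0 => 0 : R) by apply/orthP; case.
  rewrite andbT; case: ltP => [x0|x0]; last by case: ifP => // h; rewrite lee_fin gp // orth_vins h; apply/orthP; case.
  rewrite (ltW x0) lee_fin /gau /mono big_nseq /qf !big_ord1 mxE eqxx mul1r vins_id iter_mulr_1.
  by rewrite -expr2.
Qed.

(** The sign in [Vor] turns the absolute value of the determinant into the determinant itself. The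
    formula therefore holds for degenerate simplices too, where both sides vanish, and its right
    side varies continuously through them. *)
Lemma Vor_formula (w : 'I_n.+1 -> pt R n) : (forall i, in_Lambda (w i)) ->
  Vor w = (fine (@gam R n))^-1 * (\det (wmx w) * mom [::] (gram w)).
Proof.
move=> wL; rewrite /Vor -/(wmx w).
have [d0|d0] := eqVneq (\det (wmx w)) 0.
  by rewrite d0 sgr0 !mul0r mulr0.
have [gpos gfin] := gam_fin.
have := iint_gram_hvol wL d0.
rewrite /hvol; set A := iint _; move=> E.
have Afin : A \is a fin_num.
  have A0 : (0 <= A)%E.
    by apply: iint_ge0 => y; case: ifP => // _; rewrite lee_fin invr_ge0 sqrtr_ge0.
  case: A A0 E => // _; rewrite muleC gt0_mulye //.
have f0 : fine (@gam R n) != 0 by rewrite gt_eqF // fine_gt0 // gpos -ge0_fin_numE // ltW.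
have {}E : fine (@gam R n) * fine A = `|\det (wmx w)| * mom [::] (gram w).
  by rewrite -fineM // E.
rewrite [X in _ = _ * (X * _)]numEsg -(mulrA (Num.sg _)) -E mulrCA; congr (_ * _).
by rewrite mulrA mulVf // mul1r.
Qed.

End VorFormula.

(** * Derivatives of complex-valued functions of a real variable *)

Section ComplexDerivative.
Context {R : realType}.
Local Open Scope complex_scope.
Local Open Scope ring_scope.
Local Notation C := R[i].
Implicit Types (f g : R -> C) (a b : C).

Definition dC f (x : R) a :=
  dR (fun t => complex.Re (f t)) x (complex.Re a) /\ dR (fun t => complex.Im (f t)) x (complex.Im a).

Lemma ReMul a b : complex.Re (a * b) = complex.Re a * complex.Re b - complex.Im a * complex.Im b.
Proof. by case: a b => [? ?] [? ?]. Qed.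

Lemma ImMul a b : complex.Im (a * b) = complex.Re a * complex.Im b + complex.Im a * complex.Re b.
Proof. by case: a b => [? ?] [? ?]. Qed.

Lemma ReAdd a b : complex.Re (a + b) = complex.Re a + complex.Re b.
Proof. by case: a b => [? ?] [? ?]. Qed.

Lemma ImAdd a b : complex.Im (a + b) = complex.Im a + complex.Im b.
Proof. by case: a b => [? ?] [? ?]. Qed.

Lemma complex_eq a b : complex.Re a = complex.Re b -> complex.Im a = complex.Im b -> a = b.
Proof. by case: a b => [? ?] [? ?] /= -> ->. Qed.

Lemma dC_eq f x a b : dC f x a -> a = b -> dC f x b.
Proof. by move=> h <-. Qed.

Lemma dC_ext f g x a : (forall y, f y = g y) -> dC f x a -> dC g x a.
Proof. by move=> /funext ->. Qed.

Lemma dC_near f g x a : (\forall y \near x, f y = g y) -> dC f x a -> dC g x a.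
Proof.
move=> fg [d1 d2]; split.
  by apply: dR_near d1; apply: filterS fg => y ->.
by apply: dR_near d2; apply: filterS fg => y ->.
Qed.

Lemma dC_cst a x : dC (fun=> a) x 0.
Proof. by split; exact: dR_cst. Qed.

Lemma dC_real (f : R -> R) x (a : R) : dR f x a -> dC (fun t => (f t)%:C) x a%:C.
Proof. by move=> df; split => //=; exact: dR_cst. Qed.

Lemma dCD f g x a b : dC f x a -> dC g x b -> dC (fun y => f y + g y) x (a + b).
Proof.
move=> [f1 f2] [g1 g2]; split.
  by apply: dR_ext (dR_eq (dRD f1 g1) _) => [y|]; rewrite raddfD.
by apply: dR_ext (dR_eq (dRD f2 g2) _) => [y|]; rewrite raddfD.
Qed.

Lemma dCN f x a : dC f x a -> dC (fun y => - f y) x (- a).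
Proof.
move=> [f1 f2]; split.
  by apply: dR_ext (dR_eq (dRN f1) _) => [y|]; rewrite raddfN.
by apply: dR_ext (dR_eq (dRN f2) _) => [y|]; rewrite raddfN.
Qed.

Lemma dCB f g x a b : dC f x a -> dC g x b -> dC (fun y => f y - g y) x (a - b).
Proof. by move=> df dg; exact: dCD df (dCN dg). Qed.

Lemma dCM f g x a b : dC f x a -> dC g x b -> dC (fun y => f y * g y) x (a * g x + f x * b).
Proof.
move=> [f1 f2] [g1 g2]; split.
  apply: dR_ext (dR_eq (dRB (dRM f1 g1) (dRM f2 g2)) _) => [y|]; first by rewrite ReMul.
  by rewrite ReAdd !ReMul; ring.
apply: dR_ext (dR_eq (dRD (dRM f1 g2) (dRM f2 g1)) _) => [y|]; first by rewrite ImMul.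
by rewrite ImAdd !ImMul; ring.
Qed.

Lemma dCZ c f x a : dC f x a -> dC (fun y => c * f y) x (c * a).
Proof. by move=> df; apply: dC_eq (dCM (dC_cst c x) df) _; rewrite mul0r add0r. Qed.

Lemma dC_sum (I : Type) (s : seq I) (f : I -> R -> C) x (a : I -> C) :
  (forall i, dC (f i) x (a i)) -> dC (fun y => \sum_(i <- s) f i y) x (\sum_(i <- s) a i).
Proof.
move=> df; elim: s => [|i s IH].
  by rewrite big_nil; apply: dC_ext (dC_cst 0 x) => y; rewrite big_nil.
by rewrite big_cons; apply: dC_ext (dCD (df i) IH) => y; rewrite big_cons.
Qed.

Lemma dC_prod (I : finType) (f : I -> R -> C) x (a : I -> C) :
  (forall i, dC (f i) x (a i)) ->
  dC (fun y => \prod_i f i y) x (\sum_i a i * \prod_(j | j != i) f j x).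
Proof.
move=> df.
have H (s : seq I) : uniq s -> dC (fun y => \prod_(i <- s) f i y) x
    (\sum_(i <- s) a i * \prod_(j <- s | j != i) f j x).
  elim: s => [|i s IH] /=.
    by move=> _; rewrite big_nil; apply: dC_ext (dC_cst 1 x) => y; rewrite big_nil.
  move=> /andP[is_ us]; apply: dC_ext (dC_eq (dCM (df i) (IH us)) _) => [y|].
    by rewrite big_cons.
  rewrite big_cons big_cons eqxx /=; congr (_ + _).
    congr (_ * _); rewrite [RHS]big_mkcond [LHS]big_seq [RHS]big_seq.
    apply: eq_bigr => j js; case: eqP => // ji; by move: is_; rewrite -ji js.
  rewrite mulr_sumr big_seq [RHS]big_seq; apply: eq_bigr => j js.
  rewrite big_cons; case: eqP => [ij|_]; first by move: is_; rewrite ij js.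
  by rewrite mulrCA.
exact: H (index_enum_uniq I).
Qed.

(** Jacobi's formula, taken row by row from the Leibniz expansion so that singular matrices are
    covered. *)
Lemma dC_det m (Y : R -> 'M[C]_m) (Y' : 'M[C]_m) x :
  (forall i j, dC (fun t => Y t i j) x (Y' i j)) ->
  dC (fun t => \det (Y t)) x (\sum_i \sum_k Y' i k * cofactor (Y x) i k).
Proof.
move=> dY.
have E i : \sum_k Y' i k * cofactor (Y x) i k =
  \sum_(s : 'S_m) (-1) ^+ s * (Y' i (s i) * \prod_(j | j != i) Y x j (s j)).
  pose Z := \matrix_(a, b) if a == i then Y' i b else Y x a b.
  transitivity (\det Z).
    rewrite (expand_det_row _ i); apply: eq_bigr => k _; rewrite mxE eqxx; congr (_ * _).
    rewrite /cofactor; congr (_ * \det _); apply/matrixP => a b; rewrite !mxE.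
    by rewrite eq_sym (negbTE (neq_lift _ _)).
  apply: eq_bigr => s _; congr (_ * _); rewrite (bigD1 i) //= mxE eqxx; congr (_ * _).
  by apply: eq_bigr => j ji; rewrite mxE (negbTE ji).
under eq_bigr do rewrite E.
rewrite exchange_big /=; apply: dC_sum => s.
apply: dC_eq; first exact: (dCZ ((-1) ^+ s) (dC_prod (fun i => dY i (s i)))).
by rewrite mulr_sumr.
Qed.

Lemma dC_unique f x a b : dC f x a -> dC f x b -> a = b.
Proof.
move=> [a1 a2] [b1 b2]; apply: complex_eq; [exact: dR_unique a1 b1|exact: dR_unique a2 b2].
Qed.

End ComplexDerivative.

(** * Bilinear product, generalized cross product and Cramer's rule *)

Section Rows.
Variable K : comNzRingType.

Definition dot k (u v : 'rV[K]_k) : K := \sum_j u 0 j * v 0 j.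

Lemma dotC k (u v : 'rV[K]_k) : dot u v = dot v u.
Proof. by apply: eq_bigr => j _; exact: mulrC. Qed.

Lemma dotDl k (u v w : 'rV[K]_k) : dot (u + v) w = dot u w + dot v w.
Proof. by rewrite -big_split; apply: eq_bigr => j _; rewrite mxE mulrDl. Qed.

Lemma dotZl k c (u w : 'rV[K]_k) : dot (c *: u) w = c * dot u w.
Proof. by rewrite /dot mulr_sumr; apply: eq_bigr => j _; rewrite mxE mulrA. Qed.

Lemma dot0l k (w : 'rV[K]_k) : dot 0 w = 0.
Proof. by rewrite /dot big1 // => j _; rewrite mxE mul0r. Qed.

Lemma dotNl k (u w : 'rV[K]_k) : dot (- u) w = - dot u w.
Proof. by rewrite -scaleN1r dotZl mulN1r. Qed.

Lemma dotDr k (u v w : 'rV[K]_k) : dot w (u + v) = dot w u + dot w v.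
Proof. by rewrite dotC dotDl !(dotC w). Qed.

Lemma dotZr k c (u w : 'rV[K]_k) : dot w (c *: u) = c * dot w u.
Proof. by rewrite dotC dotZl dotC. Qed.

Lemma dotNr k (u w : 'rV[K]_k) : dot w (- u) = - dot w u.
Proof. by rewrite dotC dotNl dotC. Qed.

Lemma dot_suml k (I : Type) (r : seq I) (F : I -> 'rV[K]_k) w :
  dot (\sum_(i <- r) F i) w = \sum_(i <- r) dot (F i) w.
Proof.
by elim/big_rec2: _ => [|i a u _ <-]; [exact: dot0l|rewrite dotDl].
Qed.

Definition rowsmx m k (r : 'I_m -> 'rV[K]_k) : 'M[K]_(m, k) := \matrix_(i, j) r i 0 j.

Lemma rowsmxT m k (r r' : 'I_m -> 'rV[K]_k) i j :
  (rowsmx r *m (rowsmx r')^T) i j = dot (r i) (r' j).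
Proof. by rewrite mxE; apply: eq_bigr => l _; rewrite !mxE. Qed.

(** The vector of signed maximal minors: pairing it with v gives the determinant of the family
    preceded by v. It is the normal vector of a facet. *)
Definition cross n (p : 'I_n -> 'rV[K]_n.+1) : 'rV[K]_n.+1 :=
  \row_j ((-1) ^+ j * \det (col' j (rowsmx p))).

Lemma cofactor_rowsmx n (y : 'I_n.+1 -> 'rV[K]_n.+1) l j :
  cofactor (rowsmx y) l j = (-1) ^+ l * cross (fun k => y (lift l k)) 0 j.
Proof.
rewrite /cofactor mxE exprD -mulrA; congr (_ * (_ * \det _)).
by apply/matrixP => a b; rewrite !mxE.
Qed.

Lemma det_vins n l (v : 'rV[K]_n.+1) (p : 'I_n -> 'rV[K]_n.+1) :
  \det (rowsmx (vins l v p)) = (-1) ^+ l * dot v (cross p).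
Proof.
rewrite (expand_det_row _ l) mulr_sumr; apply: eq_bigr => j _.
rewrite cofactor_rowsmx mxE vins_id mulrCA; congr (_ * (_ * cross _ _ _)).
by apply/funext => k; rewrite vins_lift.
Qed.

Lemma det_vins0 n (v : 'rV[K]_n.+1) (p : 'I_n -> 'rV[K]_n.+1) :
  \det (rowsmx (vins ord0 v p)) = dot v (cross p).
Proof. by rewrite det_vins expr0 mul1r. Qed.

Lemma dot_cross_vins n l (xi eta : 'rV[K]_n.+2) (r : 'I_n -> 'rV[K]_n.+2) :
  dot xi (cross (vins l eta r)) = (-1) ^+ l.+1 * dot eta (cross (vins ord0 xi r)).
Proof.
have E : vins ord0 xi (vins l eta r) = vins (lift ord0 l) eta (vins ord0 xi r).
  exact: (esym (vins_vcons l eta xi r)).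
by rewrite -det_vins0 E det_vins lift0.
Qed.

Lemma dot_cross_swap n (xi eta : 'rV[K]_n.+2) (r : 'I_n -> 'rV[K]_n.+2) :
  dot xi (cross (vins ord0 eta r)) = - dot eta (cross (vins ord0 xi r)).
Proof. by rewrite dot_cross_vins expr1 mulN1r. Qed.

Lemma dot_cross_vinsE n l (xi eta : 'rV[K]_n.+2) (r : 'I_n -> 'rV[K]_n.+2) :
  dot xi (cross (vins l eta r)) = (-1) ^+ l * dot xi (cross (vins ord0 eta r)).
Proof. by rewrite dot_cross_vins (dot_cross_swap xi) exprS mulN1r mulNr mulrN. Qed.

Lemma vins_eta (T : Type) n (l : 'I_n.+1) (p : 'I_n.+1 -> T) :
  vins l (p l) (fun k => p (lift l k)) = p.
Proof.
by apply/funext => i; case: (unliftP l i) => [j ->|->]; rewrite ?vins_lift ?vins_id.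
Qed.

Lemma cramer n (xi eta u : 'rV[K]_n.+2) (p : 'I_n.+1 -> 'rV[K]_n.+2) :
  dot xi (cross p) * dot eta u - dot eta (cross p) * dot xi u =
  \sum_l dot xi (cross (vins l eta (fun k => p (lift l k)))) * dot (p l) u.
Proof.
pose y := vins ord0 xi p.
have E : (eta *m \adj (rowsmx y)) *m (rowsmx y *m u^T) = \det (rowsmx y) *: (eta *m u^T).
  by rewrite mulmxA -(mulmxA eta) mul_adj_mx scalar_mxC -mulmxA mul_scalar_mx.
move/matrixP/(_ 0 0): E; rewrite !mxE det_vins0.
have d1 (v : 'rV[K]_n.+2) : (v *m u^T) 0 0 = dot v u.
  by rewrite mxE; apply: eq_bigr => j _; rewrite mxE.
have -> : \sum_j eta 0 j * u^T j 0 = dot eta u by apply: eq_bigr => j _; rewrite mxE.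
move=> <-.
have adjE l : (eta *m \adj (rowsmx y)) 0 l = (-1) ^+ l * dot eta (cross (fun k => y (lift l k))).
  rewrite mxE /dot mulr_sumr; apply: eq_bigr => j _; rewrite mxE cofactor_rowsmx.
  by rewrite mulrCA.
have yu l : (rowsmx y *m u^T) l 0 = dot (y l) u.
  by rewrite mxE; apply: eq_bigr => j _; rewrite !mxE.
rewrite big_ord_recl adjE yu expr0 mul1r {2}/y vins_id.
rewrite (_ : (fun k => y (lift ord0 k)) = p); last by apply/funext => k; rewrite /y vins_lift.
rewrite addrAC subrr add0r; apply: eq_bigr => l _; rewrite adjE yu /y vins_lift; congr (_ * _).
rewrite lift0 dot_cross_vins; congr (_ * dot _ (cross _)).
apply/funext => k; case: (unliftP ord0 k) => [j ->|->].
  have -> : lift (lift ord0 l) (lift ord0 j) = lift ord0 (lift l j).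
    by apply: val_inj; rewrite /= /bump /= !add1n ltnS addnS.
  by rewrite !vins_lift.
have -> : lift (lift ord0 l) ord0 = ord0 by apply: val_inj.
by rewrite !vins_id.
Qed.

Lemma cross_perm n (p : 'I_n -> 'rV[K]_n.+1) (s : 'S_n) :
  cross (fun i => p (s i)) = (-1) ^+ s *: cross p.
Proof.
apply/rowP => j; rewrite !mxE mulrCA; congr (_ * _).
have -> : col' j (rowsmx (fun i => p (s i))) = row_perm s (col' j (rowsmx p)).
  by apply/matrixP => a b; rewrite !mxE.
by rewrite row_permE det_mulmx det_perm.
Qed.

End Rows.

(** * Cancellation over the ridges of an oriented pseudo-manifold *)

Section Ridges.
Variables (V : finType) (n q : nat) (f : 'I_q -> 'I_n.+1 -> V).
Hypothesis pm : is_pseudomanifold f.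
Hypothesis oriented : is_oriented f.
Variable K : numFieldType.
Variable r : ('I_n -> V) -> K.
Hypothesis alt : forall (rho : 'I_n -> V) (s : 'S_n), r (fun i => rho (s i)) = (-1) ^+ s * r rho.

Let inj_f s : injective (f s). Proof. by case: pm. Qed.

Let ridge s l : {set V} := f s @: (~: [set l]).

Let memf s i : f s i \in facet f s.
Proof. by apply: imset_f. Qed.

Let card_facet s : #|facet f s| = n.+1.
Proof. by rewrite /facet card_imset // card_ord. Qed.

Let card_ridge s l : #|ridge s l| = n.
Proof. by rewrite /ridge card_imset // cardsC1 card_ord. Qed.

Let partnerP s l : exists x : 'I_q * 'I_n.+1,
  [/\ x.1 != s, ridge x.1 x.2 = ridge s l & forall x', x'.1 != s -> ridge x'.1 x'.2 = ridge s l -> x' = x].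
Proof.
have [_ [inj_facet [_ [two _]]]] := pm.
pose A := [set s' : 'I_q | ridge s l \subset facet f s']%SET.
have cA : #|A| == 2%N.
  rewrite -(two s l); apply/eqP/eq_card => x; rewrite inE -/(ridge s l).
  by apply/idP/idP => h; [exact: mem_set|exact: (set_mem h)].
have [a [b [ab E]]] := cards2P _ cA.
have ins : s \in A.
  by rewrite inE; apply/fintype.subsetP => v /imsetP[i _ ->].
have [s' [s's E']] : exists s', s' != s /\ A = [set s; s']%SET.
  move: ins; rewrite E !inE => /orP[/eqP->|/eqP->]; first by exists b; rewrite eq_sym.
  by exists a; rewrite finset.setUC.
have sub' : ridge s l \subset facet f s'.
  have : s' \in [set s; s']%SET by rewrite !inE eqxx orbT.
  by rewrite -E' inE.
have [v vs' vr] : exists2 v, v \in facet f s' & v \notin ridge s l.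
  apply/fintype.subsetPn; apply/negP => /subset_leq_card.
  by rewrite card_facet card_ridge ltnn.
have /imsetP[i _ vi] := vs'.
have ri : ridge s' i = ridge s l.
  apply/esym/eqP; rewrite eqEcard !card_ridge leqnn andbT; apply/fintype.subsetP => u ur.
  have /imsetP[j _ uj] := fintype.subsetP sub' u ur.
  rewrite uj; apply: imset_f; rewrite !inE; apply: contraNneq vr => ji.
  by rewrite vi -ji -uj.
exists (s', i); split => //= -[t j] /= ts rj.
have : t \in A.
  by rewrite inE -rj; apply/fintype.subsetP => u /imsetP[k _ ->].
rewrite E' !inE (negbTE ts) /= => /eqP tE; subst t; congr pair.
apply/eqP; rewrite eq_sym; apply: contraT => ij.
have : f s' i \in ridge s' j by apply: imset_f; rewrite !inE.
rewrite rj -ri => /imsetP[k]; rewrite !inE => ki /inj_f ik.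
by rewrite ik eqxx in ki.
Qed.

Let partner (x : 'I_q * 'I_n.+1) := sval (cid (partnerP x.1 x.2)).

Let partnerE x : [/\ (partner x).1 != x.1, ridge (partner x).1 (partner x).2 = ridge x.1 x.2
  & forall x', x'.1 != x.1 -> ridge x'.1 x'.2 = ridge x.1 x.2 -> x' = partner x].
Proof. exact: (svalP (cid (partnerP x.1 x.2))). Qed.

Let partnerK : involutive partner.
Proof.
move=> x; have [h1 h2 _] := partnerE x; have [_ _ h3] := partnerE (partner x).
by apply/esym/h3; [rewrite eq_sym|rewrite h2].
Qed.

Let term (x : 'I_q * 'I_n.+1) := (-1) ^+ x.2 * r (fun k => f x.1 (lift x.2 k)).

(** The odd permutation provided by the orientation sends the omitted position [l'] to [l]. Its
    parity is that of [l + l'] plus the parity of the permutation induced on the ridge, which is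
    exactly the comparison of the two signs. *)
Let term_partner x : term (partner x) = - term x.
Proof.
case: x => s l; have [] := partnerE (s, l); case: (partner (s, l)) => s' l' /= ns rE _.
rewrite /term /=.
have notin t k : f t k \notin ridge t k.
  by apply/negP => /imsetP[j]; rewrite !inE => jk /inj_f kj; rewrite kj eqxx in jk.
have an : f s l \notin facet f s'.
  apply/negP => /imsetP[j _ e].
  have [jl|jl] := eqVneq j l'.
    suff : facet f s = facet f s'.
      by have [_ [inj_facet _]] := pm => /inj_facet E; rewrite E eqxx in ns.
    have U t k : facet f t = f t k |: ridge t k.
      apply/finset.setP => v; rewrite !inE; apply/imsetP/orP => [[i _ ->]|[/eqP->|/imsetP[i _ ->]]].
      - have [->|ik] := eqVneq i k; first by left.
        by right; apply: imset_f; rewrite !inE.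
      - by exists k.
      - by exists i.
    by rewrite (U s l) (U s' l') rE e jl.
  have : f s' j \in ridge s' l' by apply: imset_f; rewrite !inE.
  by rewrite rE -e (negbTE (notin _ _)).
have al' : f s' l' \notin facet f s.
  apply/negP => /imsetP[j _ e].
  have [jl|jl] := eqVneq j l; first by move: an; rewrite -jl -e memf.
  have : f s j \in ridge s l by apply: imset_f; rewrite !inE.
  by rewrite -rE -e (negbTE (notin _ _)).
have I : facet f s :&: facet f s' = ridge s l.
  apply/finset.setP => v; rewrite inE; apply/andP/idP => [[/imsetP[i _ ->] h]|h].
    by apply: imset_f; rewrite !inE; apply: contraNneq an => <-.
  split; first by move: h => /imsetP[i _ ->].
  by move: h; rewrite -rE => /imsetP[i _ ->].
have adj : adjacent f s s' by rewrite /adjacent I card_ridge.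
have ns' : s != s' by rewrite eq_sym.
have [sg [osg sgE]] := oriented ns' adj (memf s l) an.
have sl : sg l' = l.
  by have := sgE l'; rewrite (negbTE al') => /inj_f ->.
pose tau := lift_perm l' l (1%g : 'S_n).
have [sg' sgL] : exists sg' : 'S_n, sg = lift_perm l' l sg'.
  have nl k : sg (lift l' k) != l.
    by apply/eqP => e; have /eqP := neq_lift l' k; apply; apply: (@perm_inj _ sg); rewrite sl e.
  have ex k : exists j, sg (lift l' k) = lift l j.
    by case: (unliftP l (sg (lift l' k))) => [j ->|e]; [exists j|have := nl k; rewrite e eqxx].
  pose g k := sval (cid (ex k)).
  have gE k : sg (lift l' k) = lift l (g k) by exact: (svalP (cid (ex k))).
  have ig : injective g.
    move=> a b e; have := gE a; rewrite e -gE => /perm_inj; exact: lift_inj.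
  exists (perm ig); apply/permP => k; case: (unliftP l' k) => [j ->|->].
    by rewrite lift_perm_lift permE gE.
  by rewrite lift_perm_id sl.
have fE : (fun k => f s' (lift l' k)) = (fun k => f s (lift l (sg' k))).
  apply/funext => k; have := sgE (lift l' k); rewrite sgL lift_perm_lift => <-.
  rewrite ifT //.
  have : f s' (lift l' k) \in ridge s' l'.
    by apply: imset_f; rewrite !inE eq_sym neq_lift.
  by rewrite rE => /imsetP[i _ ->].
rewrite fE (alt (fun k => f s (lift l k)) sg') mulrA -mulNr; congr (_ * _).
move: osg; rewrite sgL odd_lift_perm -[(-1) ^+ l']signr_odd -[(-1) ^+ l]signr_odd.
by case: (odd l'); case: (odd l); case: (odd_perm sg') => //= _; rewrite ?expr1 ?expr0; ring.
Qed.

(** Every ridge lies in exactly two facets, so the pairs of a facet and an omitted vertex are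
    matched, and an alternating function takes opposite signed values on matched pairs. The
    orientation enters the proof only through this cancellation. *)
Lemma ridge_cancel : \sum_s \sum_(l < n.+1) (-1) ^+ l * r (fun k => f s (lift l k)) = 0.
Proof.
rewrite pair_big /=; set S := \sum_p _.
have : S = - S.
  rewrite {1}/S (reindex_inj (can_inj partnerK)) /= -sumrN; apply: eq_bigr => x _.
  exact: term_partner.
by move/eqP; rewrite -addr_eq0 -mulr2n mulrn_eq0 /= => /eqP.
Qed.

End Ridges.

Local Open Scope complex_scope.

(** * The flux form of one facet and its exterior derivative *)

Section Flux.
Context {R : realType}.
Local Notation C := R[i].

Definition rc (x : R) : C := x%:C.

Lemma rcE x : rc x = x%:C. Proof. by []. Qed.
Lemma rcD (x y : R) : (x + y)%:C = x%:C + y%:C :> C. Proof. exact: rmorphD. Qed.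
Lemma rcM (x y : R) : (x * y)%:C = x%:C * y%:C :> C. Proof. exact: rmorphM. Qed.
Lemma rcN (x : R) : (- x)%:C = - x%:C :> C. Proof. exact: rmorphN. Qed.

Lemma rc_sum (I : Type) (r : seq I) (F : I -> R) :
  (\sum_(i <- r) F i)%:C = \sum_(i <- r) (F i)%:C :> C.
Proof. exact: rmorph_sum. Qed.

(** The vectors are complex but their Gram matrix is real, which keeps all moments real
    integrals. *)
Definition rgram k n (y : 'I_k -> 'rV[C]_n) (G : 'M[R]_k) :=
  forall i j, dot (y i) (y j) = (G i j)%:C.

Lemma rgram_sym k n (y : 'I_k -> 'rV[C]_n) G : rgram y G -> G^T = G.
Proof.
by move=> h; apply/matrixP => i j; rewrite mxE; have := h i j; rewrite dotC h => -[].
Qed.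

Lemma dC_dot k (u v : R -> 'rV[C]_k) (u' v' : 'rV[C]_k) x :
  (forall j, dC (fun t => u t 0 j) x (u' 0 j)) -> (forall j, dC (fun t => v t 0 j) x (v' 0 j)) ->
  dC (fun t => dot (u t) (v t)) x (dot u' (v x) + dot (u x) v').
Proof.
move=> du dv; rewrite -big_split; apply: dC_sum => j; exact: dCM.
Qed.

Lemma rgram_dR k n (y : R -> 'I_k -> 'rV[C]_n) (y' : 'I_k -> 'rV[C]_n) (G : R -> 'M[R]_k) x :
  (forall i j, dC (fun t => y t i 0 j) x (y' i 0 j)) ->
  (\forall t \near x, rgram (y t) (G t)) ->
  exists G' : 'M[R]_k, (forall i j, dR (fun t => G t i j) x (G' i j)) /\
    (forall i j, (G' i j)%:C = dot (y' i) (y x j) + dot (y x i) (y' j)).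
Proof.
move=> dy gr.
exists (\matrix_(i, j) complex.Re (dot (y' i) (y x j) + dot (y x i) (y' j))).
have d i j : dC (fun t => (G t i j)%:C) x (dot (y' i) (y x j) + dot (y x i) (y' j)).
  apply: dC_near (dC_dot (dy i) (dy j)); by apply: filterS gr => t h; rewrite h.
split=> i j; first by rewrite mxE; case: (d i j).
rewrite mxE; apply: complex_eq => //=.
have [_ d2] := d i j; exact: dR_unique (dR_cst 0 x) d2.
Qed.

Lemma dl1 m (l i : 'I_m) : dl l [:: i] = if i == l then [:: [::]] else [::].
Proof. by rewrite /= cats0. Qed.

(* Derivative of the complex volume integral of a simplicial cone: only its facets contribute. *)
Lemma dC_cone_volume n (y : R -> 'I_n.+1 -> 'rV[C]_n.+1) (y' : 'I_n.+1 -> 'rV[C]_n.+1)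
    (G : R -> 'M[R]_n.+1) x :
  (forall i j, dC (fun t => y t i 0 j) x (y' i 0 j)) ->
  (\forall t \near x, rgram (y t) (G t)) -> (\forall t \near x, coer (G t)) ->
  dC (fun t => \det (rowsmx (y t)) * (mom [::] (G t))%:C) x
    (- \sum_(l < n.+1) \sum_(k < n) (-1) ^+ l * dot (y' (lift l k)) (cross (fun j => y x (lift l j))) *
         (mom [:: k] (row' l (col' l (G x))))%:C).
Proof.
move=> dy gr cG.
have [G' [dG G'E]] := rgram_dR dy gr.
have gx := nbhs_singleton gr; have cx := nbhs_singleton cG.
have sG := rgram_sym gx.
pose Y := rowsmx (y x); pose Y' := rowsmx y'; pose A := Y' *m \adj Y.
have dY i j : dC (fun t => rowsmx (y t) i j) x (Y' i j).
  by apply: dC_ext (dC_eq (dy i j) _) => [t|]; rewrite mxE.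
apply: dC_eq; first exact: dCM (dC_det dY) (dC_real (mom_dR [::] cG dG)).
rewrite -/Y.
have AE i l : A i l = \sum_k Y' i k * cofactor Y l k.
  by rewrite mxE; apply: eq_bigr => k _; rewrite [\adj _ _ _]mxE.
have AG i j : \sum_l A i l * (G x l j)%:C = \det Y * dot (y' i) (y x j).
  transitivity ((A *m (Y *m Y^T)) i j).
    by rewrite [RHS]mxE; apply: eq_bigr => l _; rewrite rowsmxT gx.
  by rewrite /A -mulmxA (mulmxA _ Y) mul_adj_mx mul_scalar_mx -scalemxAr mxE rowsmxT.
pose bnd l i := if l \in [:: i] then 0 else mom (pmap (unlift l) [:: i]) (row' l (col' l (G x))).
have ibp l i : 2 * \sum_j G x l j * mom [:: j; i] (G x) = (i == l)%:R * mom [::] (G x) + bnd l i.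
  rewrite mom_ibp // dl1; congr (_ + _).
  by case: eqP => _; rewrite ?big_nil ?mul0r // big_seq1 mul1r.
have key : \det Y * (\sum_i \sum_j G' i j * mom [:: i; j] (G x))%:C =
    (\sum_i A i i) * (mom [::] (G x))%:C + \sum_i \sum_l A i l * (bnd l i)%:C.
  transitivity (\sum_i \sum_l A i l * (2 * \sum_j G x l j * mom [:: j; i] (G x))%:C); last first.
    rewrite mulr_suml -big_split; apply: eq_bigr => i _ /=.
    transitivity (\sum_l (A i l * (i == l)%:R * (mom [::] (G x))%:C + A i l * (bnd l i)%:C)).
      apply: eq_bigr => l _; rewrite ibp rcD rcM mulrDr mulrA; congr (_ * _ * _ + _).
      by case: (i == l).
    rewrite big_split /=; congr (_ + _); rewrite -mulr_suml; congr (_ * _).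
    rewrite (bigD1 i) //= eqxx mulr1 big1 ?addr0 // => l li.
    by rewrite eq_sym (negbTE li) mulr0.
  transitivity (\sum_i \sum_j 2 * (\det Y * dot (y' i) (y x j) * (mom [:: i; j] (G x))%:C)).
    transitivity (\sum_i \sum_j (\det Y * dot (y' i) (y x j) * (mom [:: i; j] (G x))%:C) +
                  \sum_i \sum_j (\det Y * dot (y x i) (y' j) * (mom [:: i; j] (G x))%:C)).
      rewrite rc_sum mulr_sumr -big_split; apply: eq_bigr => i _ /=.
      rewrite rc_sum mulr_sumr -big_split; apply: eq_bigr => j _ /=.
      by rewrite rcM G'E; ring.
    rewrite [X in _ + X]exchange_big -big_split; apply: eq_bigr => i _ /=.
    rewrite -big_split; apply: eq_bigr => j _ /=.
    rewrite [dot (y x j) _]dotC (@mom_perm_eq _ _ [:: j; i] [:: i; j]); first by ring.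
    by rewrite (perm_catC [:: j] [:: i]).
  apply: eq_bigr => i _.
  transitivity (\sum_l \sum_j 2 * (A i l * (G x l j)%:C * (mom [:: j; i] (G x))%:C)).
    rewrite exchange_big; apply: eq_bigr => j _ /=; rewrite -AG mulr_suml mulr_sumr.
    apply: eq_bigr => l _; rewrite (@mom_perm_eq _ _ [:: i; j] [:: j; i]) //.
    by rewrite (perm_catC [:: i] [:: j]).
  apply: eq_bigr => l _; rewrite rcM rc_sum mulrCA mulr_sumr mulr_sumr; apply: eq_bigr => j _.
  rewrite rcM (_ : 2%:C = 2) ?mulrA //; by rewrite rmorph_nat.
rewrite rcN mulrN key.
have -> : \sum_i \sum_k Y' i k * cofactor Y i k = \sum_i A i i.
  by apply: eq_bigr => i _; rewrite AE.
rewrite opprD addrA subrr add0r; congr (- _); rewrite exchange_big; apply: eq_bigr => l _ /=.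
rewrite (bigD1_ord l) //= {1}/bnd inE eqxx mulr0 add0r; apply: eq_bigr => k _.
rewrite /bnd inE (negbTE (neq_lift _ _)) /= liftK /=; congr (_ * _).
rewrite AE /dot mulr_sumr; apply: eq_bigr => j _.
by rewrite cofactor_rowsmx mxE mulrCA.
Qed.

Section OneFacet.
Variable n : nat.
Implicit Types (p xi eta zeta : 'I_n.+1 -> 'rV[C]_n.+2) (G : 'M[R]_n.+1).

(** A 1-form evaluated at the configuration [p] on the tangent vector [xi]: each vertex velocity is
    paired with the normal of the facet and weighted by a first moment of the Gaussian of the
    facet. *)
Definition flux p xi G : C := \sum_k dot (xi k) (cross p) * (mom [:: k] G)%:C.

(** Derivative of [flux p xi G] when [p], [xi], [G] move with velocities [eta], [zeta], [G']. Its
    antisymmetrization in [xi] and [eta] is the exterior derivative. *)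
Definition dflux p xi eta zeta G (G' : 'M[R]_n.+1) : C :=
  \sum_k ((dot (zeta k) (cross p) +
            \sum_l dot (xi k) (cross (vins l (eta l) (fun j => p (lift l j))))) * (mom [:: k] G)%:C
          - dot (xi k) (cross p) * (\sum_i \sum_j G' i j * mom [:: i; j; k] G)%:C).

Lemma dC_dot_cross (p : R -> 'I_n.+1 -> 'rV[C]_n.+2) (v : R -> 'rV[C]_n.+2) p' (v' : 'rV[C]_n.+2) x :
  (forall i j, dC (fun t => p t i 0 j) x (p' i 0 j)) -> (forall j, dC (fun t => v t 0 j) x (v' 0 j)) ->
  dC (fun t => dot (v t) (cross (p t))) x
    (dot v' (cross (p x)) + \sum_l dot (v x) (cross (vins l (p' l) (fun j => p x (lift l j))))).
Proof.
move=> dp dv.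
pose y t := vins ord0 (v t) (p t); pose y' := vins ord0 v' p'.
have dy i j : dC (fun t => rowsmx (y t) i j) x (rowsmx y' i j).
  rewrite mxE /y'; case: (unliftP ord0 i) => [k ->|->].
    by rewrite vins_lift; apply: dC_ext (dp k j) => t; rewrite mxE /y vins_lift.
  by rewrite vins_id; apply: dC_ext (dv j) => t; rewrite mxE /y vins_id.
apply: dC_ext (dC_eq (dC_det dy) _) => [t|]; first by rewrite det_vins0.
have E i : \sum_k rowsmx y' i k * cofactor (rowsmx (y x)) i k =
    (-1) ^+ i * dot (y' i) (cross (fun k => y x (lift i k))).
  rewrite /dot mulr_sumr; apply: eq_bigr => k _; by rewrite cofactor_rowsmx mxE mulrCA.
rewrite big_ord_recl E expr0 mul1r /y' vins_id; congr (dot _ (cross _) + _).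
  by apply/funext => k; rewrite /y vins_lift.
apply: eq_bigr => l _; rewrite E /y' vins_lift lift0 dot_cross_vins; congr (_ * dot _ (cross _)).
apply/funext => k; rewrite /y; case: (unliftP ord0 k) => [j ->|->].
  have -> : lift (lift ord0 l) (lift ord0 j) = lift ord0 (lift l j).
    by apply: val_inj; rewrite /= /bump /= !add1n ltnS addnS.
  by rewrite !vins_lift.
have -> : lift (lift ord0 l) ord0 = ord0 by apply: val_inj.
by rewrite !vins_id.
Qed.

Lemma dC_flux (p xi : R -> 'I_n.+1 -> 'rV[C]_n.+2) p' xi' (G : R -> 'M[R]_n.+1) G' x :
  (forall i j, dC (fun t => p t i 0 j) x (p' i 0 j)) ->
  (forall i j, dC (fun t => xi t i 0 j) x (xi' i 0 j)) ->
  (\forall t \near x, coer (G t)) -> (forall i j, dR (fun t => G t i j) x (G' i j)) ->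
  dC (fun t => flux (p t) (xi t) (G t)) x (dflux (p x) (xi x) p' xi' (G x) G').
Proof.
move=> dp dxi cG dG; apply: dC_sum => k.
apply: dC_eq; first exact: dCM (dC_dot_cross dp (dxi k)) (dC_real (mom_dR [:: k] cG dG)).
by rewrite rcN mulrN.
Qed.

Lemma dl2 m (l i j : 'I_m) (F : seq 'I_m -> R) :
  \sum_(s <- dl l [:: i; j]) F s = (i == l)%:R * F [:: j] + (j == l)%:R * F [:: i].
Proof.
rewrite /= cats0 big_cat /=; congr (_ + _).
  by case: eqP => _; rewrite ?big_nil ?mul0r // big_seq1 mul1r.
by case: eqP => _; rewrite ?big_nil ?mul0r //= big_seq1 mul1r.
Qed.

(* The flux form is closed up to terms carried by the codimension-one faces. *)
Lemma flux_closed p xi eta zeta G (Gx Ge : 'M[R]_n.+1) : rgram p G -> coer G ->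
  (forall i j, (Gx i j)%:C = dot (xi i) (p j) + dot (p i) (xi j)) ->
  (forall i j, (Ge i j)%:C = dot (eta i) (p j) + dot (p i) (eta j)) ->
  dflux p xi eta zeta G Ge - dflux p eta xi zeta G Gx =
  - \sum_(l < n.+1) \sum_(k < n) \sum_(i < n) (-1) ^+ l *
      dot (xi (lift l k)) (cross (vins ord0 (eta (lift l i)) (fun j => p (lift l j)))) *
      (mom [:: i; k] (row' l (col' l G)))%:C.
Proof.
move=> gr cG GxE GeE; have sG := rgram_sym gr.
pose DD u l v := dot u (cross (vins l v (fun j => p (lift l j)))).
pose M3 i j k := (mom [:: i; j; k] G)%:C : C.
pose M1 k := (mom [:: k] G)%:C : C.
have M3C i j k : M3 i j k = M3 j i k.
  by rewrite /M3 (@mom_perm_eq _ _ [:: i; j; k] [:: j; i; k]) // (perm_cat2r [:: k] [:: i; j] [:: j; i]) (perm_catC [:: i] [:: j]).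
have M3R i j k : M3 i j k = M3 i k j.
  by rewrite /M3 (@mom_perm_eq _ _ [:: i; j; k] [:: i; k; j]) // perm_cons (perm_catC [:: j] [:: k]).
pose bnd l i k := if l \in [:: i; k] then 0 else mom (pmap (unlift l) [:: i; k]) (row' l (col' l G)).
have ibp l i k : 2 * \sum_j (G l j)%:C * M3 j i k =
   (i == l)%:R * M1 k + (k == l)%:R * M1 i + (bnd l i k)%:C.
  have := mom_ibp l [:: i; k] cG sG; rewrite dl2 -/(bnd l i k) => /(congr1 (fun z => z%:C : C)).
  rewrite rcM rc_sum !rcD !rcM => E.
  have b2 (b : bool) : (b%:R)%:C = b%:R :> C by case: b.
  move: E; rewrite !b2 rmorph1 => <-; congr (_ * _).
  by apply: eq_bigr => j _; rewrite rcM.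
have mE (H : 'M[R]_n.+1) (u : 'I_n.+1 -> 'rV[C]_n.+2) k :
    (forall i j, (H i j)%:C = dot (u i) (p j) + dot (p i) (u j)) ->
    (\sum_i \sum_j H i j * mom [:: i; j; k] G)%:C = 2 * \sum_i \sum_j dot (u i) (p j) * M3 i j k.
  move=> HE; rewrite rc_sum mulr_sumr.
  transitivity (\sum_i \sum_j dot (u i) (p j) * M3 i j k + \sum_i \sum_j dot (p i) (u j) * M3 i j k).
    rewrite -big_split; apply: eq_bigr => i _ /=; rewrite rc_sum -big_split.
    by apply: eq_bigr => j _ /=; rewrite rcM HE mulrDl.
  rewrite [X in _ + X]exchange_big -big_split; apply: eq_bigr => i _ /=.
  rewrite mulr_sumr -big_split; apply: eq_bigr => j _ /=.
  by rewrite [dot (p j) _]dotC (M3C j); ring.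
have E1 : dflux p xi eta zeta G Ge - dflux p eta xi zeta G Gx =
  \sum_k (\sum_l DD (xi k) l (eta l) * M1 k - \sum_l DD (eta k) l (xi l) * M1 k)
  - 2 * \sum_k \sum_i \sum_j (dot (xi k) (cross p) * dot (eta i) (p j)
        - dot (eta i) (cross p) * dot (xi k) (p j)) * M3 i j k.
  transitivity (\sum_k (\sum_l DD (xi k) l (eta l) * M1 k - \sum_l DD (eta k) l (xi l) * M1 k)
   - (\sum_k \sum_i \sum_j 2 * (dot (xi k) (cross p) * dot (eta i) (p j) * M3 i j k)
      - \sum_k \sum_i \sum_j 2 * (dot (eta k) (cross p) * dot (xi i) (p j) * M3 i j k))).
    rewrite -sumrB -sumrB -sumrB; apply: eq_bigr => k _.
    rewrite (mE _ _ _ GeE) (mE _ _ _ GxE) -/(M1 k) !mulrDl -!mulr_suml.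
    rewrite (_ : \sum_i \sum_j 2 * _ = dot (xi k) (cross p) * (2 * \sum_i \sum_j dot (eta i) (p j) * M3 i j k)); last first.
      rewrite mulrCA !mulr_sumr; apply: eq_bigr => i _; rewrite !mulr_sumr; apply: eq_bigr => j _; ring.
    rewrite (_ : \sum_i \sum_j 2 * _ = dot (eta k) (cross p) * (2 * \sum_i \sum_j dot (xi i) (p j) * M3 i j k)); last first.
      rewrite mulrCA !mulr_sumr; apply: eq_bigr => i _; rewrite !mulr_sumr; apply: eq_bigr => j _; ring.
    by rewrite -/(DD _ _ _); ring.
  congr (_ - _); rewrite [X in _ - X]exchange_big -sumrB mulr_sumr; apply: eq_bigr => k _.
  rewrite -sumrB mulr_sumr; apply: eq_bigr => i _.
  rewrite -sumrB mulr_sumr; apply: eq_bigr => j _.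
  by rewrite (_ : M3 k j i = M3 i j k); [ring|rewrite M3R M3C M3R].
(* [cramer] rewrites the two-by-two minor of normal and tangential products through entries of the
   Gram matrix, ready for [mom_ibp]. *)
have E2 : 2 * \sum_k \sum_i \sum_j (dot (xi k) (cross p) * dot (eta i) (p j)
        - dot (eta i) (cross p) * dot (xi k) (p j)) * M3 i j k =
   \sum_k \sum_i \sum_l DD (xi k) l (eta i) * ((i == l)%:R * M1 k + (k == l)%:R * M1 i + (bnd l i k)%:C).
  rewrite mulr_sumr; apply: eq_bigr => k _; rewrite mulr_sumr; apply: eq_bigr => i _.
  rewrite mulr_sumr.
  transitivity (\sum_j \sum_l 2 * (DD (xi k) l (eta i) * (G l j)%:C * M3 j i k)).
    apply: eq_bigr => j _; rewrite cramer mulr_suml mulr_sumr; apply: eq_bigr => l _.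
    by rewrite gr M3C.
  rewrite exchange_big; apply: eq_bigr => l _; rewrite -ibp mulrCA !mulr_sumr.
  by apply: eq_bigr => j _; ring.
have E3 : \sum_k \sum_i \sum_l DD (xi k) l (eta i) * ((i == l)%:R * M1 k + (k == l)%:R * M1 i + (bnd l i k)%:C)
  = \sum_k \sum_l DD (xi k) l (eta l) * M1 k - \sum_k \sum_l DD (eta k) l (xi l) * M1 k
    + \sum_k \sum_i \sum_l DD (xi k) l (eta i) * (bnd l i k)%:C.
  have S1 : \sum_k \sum_i \sum_l DD (xi k) l (eta i) * ((i == l)%:R * M1 k) =
     \sum_k \sum_l DD (xi k) l (eta l) * M1 k.
    apply: eq_bigr => k _; rewrite exchange_big; apply: eq_bigr => l _ /=.
    rewrite (bigD1 l) //= eqxx mul1r big1 ?addr0 // => i il.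
    by rewrite (negbTE il) mul0r mulr0.
  have S2 : \sum_k \sum_i \sum_l DD (xi k) l (eta i) * ((k == l)%:R * M1 i) =
     - \sum_k \sum_l DD (eta k) l (xi l) * M1 k.
    rewrite exchange_big -sumrN; apply: eq_bigr => i _; rewrite exchange_big -sumrN.
    apply: eq_bigr => l _ /=; rewrite (bigD1 l) //= eqxx mul1r big1 ?addr0; last first.
      by move=> k kl; rewrite (negbTE kl) mul0r mulr0.
    by rewrite /DD !(dot_cross_vinsE l) dot_cross_swap mulrN mulNr.
  rewrite -S1 -S2 -!big_split; apply: eq_bigr => k _ /=; rewrite -!big_split; apply: eq_bigr => i _ /=.
  by rewrite -!big_split; apply: eq_bigr => l _ /=; rewrite !mulrDr.
rewrite E1 E2 E3 -sumrB opprD addrA subrr add0r; congr (- _).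
transitivity (\sum_l \sum_k \sum_i DD (xi k) l (eta i) * (bnd l i k)%:C).
  under eq_bigr do rewrite exchange_big.
  by rewrite exchange_big.
apply: eq_bigr => l _.
rewrite (bigD1_ord l) //= [X in X + _]big1 ?add0r; last first.
  by move=> i _; rewrite /bnd !inE eqxx orbT mulr0.
apply: eq_bigr => k _; rewrite (bigD1_ord l) //= {1}/bnd inE eqxx /= mulr0 add0r.
apply: eq_bigr => i _; rewrite /bnd !inE !(negbTE (neq_lift _ _)) /= !liftK /= .
by rewrite /DD dot_cross_vinsE.
Qed.

End OneFacet.
End Flux.

(** * The flux form of the whole complex *)

Section GlobalFlux.
Context {R : realType}.
Local Notation C := R[i].
Variables (V : finType) (n q : nat) (f : 'I_q -> 'I_n.+1 -> V).
Hypothesis pm : is_pseudomanifold f.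
Hypothesis oriented : is_oriented f.
Implicit Types (P : V -> 'rV[C]_n.+2).

Definition fluxK P (xi : V -> 'rV[C]_n.+2) (G : 'I_q -> 'M[R]_n.+1) : C :=
  \sum_s flux (fun i => P (f s i)) (fun i => xi (f s i)) (G s).

Definition dfluxK P (xi eta zeta : V -> 'rV[C]_n.+2) (G G' : 'I_q -> 'M[R]_n.+1) : C :=
  \sum_s dflux (fun i => P (f s i)) (fun i => xi (f s i)) (fun i => eta (f s i))
     (fun i => zeta (f s i)) (G s) (G' s).

(** Recovers the Gram matrix from the vectors, so that a ridge term depends on the ridge and not on
    the facet in which it was computed, as [ridge_cancel] demands. *)
Definition regram m k (y : 'I_m -> 'rV[C]_k) : 'M[R]_m :=
  \matrix_(i, j) complex.Re (dot (y i) (y j)).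

Lemma rgram_regram m k (y : 'I_m -> 'rV[C]_k) G : rgram y G -> regram y = G.
Proof. by move=> h; apply/matrixP => i j; rewrite mxE h. Qed.

Lemma rgram_sub m m' k (y : 'I_m -> 'rV[C]_k) G (g : 'I_m' -> 'I_m) : rgram y G ->
  rgram (fun i => y (g i)) (\matrix_(i, j) G (g i) (g j)).
Proof. by move=> h i j; rewrite mxE h. Qed.

Lemma vins_perm (T : Type) m (u : T) (y : 'I_m -> T) (s : 'S_m) :
  vins ord0 u (fun i => y (s i)) = fun i => vins ord0 u y (lift_perm ord0 ord0 s i).
Proof.
apply/funext => i; case: (unliftP ord0 i) => [j ->|->].
  by rewrite lift_perm_lift !vins_lift.
by rewrite lift_perm_id !vins_id.
Qed.

Lemma cross_vins_perm m (u : 'rV[C]_m.+2) (y : 'I_m -> 'rV[C]_m.+2) (s : 'S_m) :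
  cross (vins ord0 u (fun i => y (s i))) = (-1) ^+ s *: cross (vins ord0 u y).
Proof. by rewrite vins_perm cross_perm odd_lift_perm. Qed.

Lemma regram_perm m k (y : 'I_m -> 'rV[C]_k) (s : 'S_m) :
  regram (fun i => y (s i)) = \matrix_(i, j) regram y (s i) (s j).
Proof. by apply/matrixP => i j; rewrite !mxE. Qed.

Lemma regram_minor m k (y : 'I_m.+1 -> 'rV[C]_k) G (l : 'I_m.+1) : rgram y G ->
  row' l (col' l G) = regram (fun j => y (lift l j)).
Proof. by move=> h; apply/matrixP => i j; rewrite !mxE h. Qed.

(** The terms left over by [flux_closed] are alternating functions of the ridges, hence cancel in
    the sum over all facets. *)
Lemma fluxK_closed P xi eta zeta (G Gx Ge : 'I_q -> 'M[R]_n.+1) :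
  (forall s, rgram (fun i => P (f s i)) (G s)) -> (forall s, coer (G s)) ->
  (forall s i j, (Gx s i j)%:C = dot (xi (f s i)) (P (f s j)) + dot (P (f s i)) (xi (f s j))) ->
  (forall s i j, (Ge s i j)%:C = dot (eta (f s i)) (P (f s j)) + dot (P (f s i)) (eta (f s j))) ->
  dfluxK P xi eta zeta G Ge = dfluxK P eta xi zeta G Gx.
Proof.
move=> gr cG hx he; apply/eqP; rewrite -subr_eq0 -sumrB; apply/eqP.
under eq_bigr => s _ do rewrite (flux_closed _ (gr s) (cG s) (hx s) (he s)).
rewrite sumrN; apply/eqP; rewrite oppr_eq0; apply/eqP.
pose r (rho : 'I_n -> V) : C := \sum_(k < n) \sum_(i < n)
  dot (xi (rho k)) (cross (vins ord0 (eta (rho i)) (fun j => P (rho j)))) *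
  (mom [:: i; k] (regram (fun j => P (rho j))))%:C.
have alt (rho : 'I_n -> V) (s : 'S_n) : r (fun i => rho (s i)) = (-1) ^+ s * r rho.
  pose T k i : C := dot (xi (rho k)) (cross (vins ord0 (eta (rho i)) (fun j => P (rho j)))) *
    (mom [:: i; k] (regram (fun j => P (rho j))))%:C.
  have RE : r rho = \sum_k \sum_i T (s k) (s i).
    rewrite /r (reindex_inj (@perm_inj _ s)); apply: eq_bigr => k _.
    by rewrite (reindex_inj (@perm_inj _ s)).
  rewrite RE mulr_sumr; apply: eq_bigr => k _; rewrite mulr_sumr; apply: eq_bigr => i _.
  rewrite (cross_vins_perm (eta (rho (s i))) (fun j => P (rho j))) dotZr.
  by rewrite (regram_perm (fun j => P (rho j)) s) mom_perm /= /T !mulrA.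
apply: etrans (ridge_cancel pm oriented alt); apply: eq_bigr => s _; apply: eq_bigr => l _.
rewrite mulr_sumr; apply: eq_bigr => k _; rewrite mulr_sumr; apply: eq_bigr => i _.
by rewrite (regram_minor l (gr s)) mulrA.
Qed.

(** In the derivative of the total cone volume the walls through the apex are alternating functions
    of the ridges and cancel. Only the faces opposite to the apex remain, and the velocity of the
    apex drops out. *)
Lemma dC_volK (o : R -> 'rV[C]_n.+2) (P : R -> V -> 'rV[C]_n.+2) (o' : 'rV[C]_n.+2) (P' : V -> 'rV[C]_n.+2)
    (H : R -> 'I_q -> 'M[R]_n.+2) x :
  (forall j, dC (fun t => o t 0 j) x (o' 0 j)) ->
  (forall v j, dC (fun t => P t v 0 j) x (P' v 0 j)) ->
  (\forall t \near x, forall s, rgram (vins ord0 (o t) (fun i => P t (f s i))) (H t s)) ->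
  (\forall t \near x, forall s, coer (H t s)) ->
  dC (fun t => \sum_s \det (rowsmx (vins ord0 (o t) (fun i => P t (f s i)))) * (mom [::] (H t s))%:C) x
    (- fluxK (P x) P' (fun s => row' ord0 (col' ord0 (H x s)))).
Proof.
move=> d_o dP gr cH.
pose y s t := vins ord0 (o t) (fun i => P t (f s i)).
pose y' s := vins ord0 o' (fun i => P' (f s i)).
have dy s i j : dC (fun t => y s t i 0 j) x (y' s i 0 j).
  rewrite /y /y'; case: (unliftP ord0 i) => [k ->|->].
    by rewrite vins_lift; apply: dC_ext (dP (f s k) j) => t; rewrite vins_lift.
  by rewrite vins_id; apply: dC_ext (d_o j) => t; rewrite vins_id.
apply: dC_eq; first apply: dC_sum => s.
  by apply: (dC_cone_volume (G := fun t => H t s) (dy s)); [apply: filterS gr => t; exact|apply: filterS cH => t; exact].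
rewrite sumrN; congr (- _).
have gx := nbhs_singleton gr.
pose r (rho : 'I_n -> V) : C := - \sum_(k < n.+1)
  dot (vins ord0 o' (fun i => P' (rho i)) k) (cross (vins ord0 (o x) (fun j => P x (rho j)))) *
  (mom [:: k] (regram (vins ord0 (o x) (fun j => P x (rho j)))))%:C.
have alt (rho : 'I_n -> V) (s : 'S_n) : r (fun i => rho (s i)) = (-1) ^+ s * r rho.
  rewrite /r mulrN; congr (- _); set sg := lift_perm ord0 ord0 s.
  rewrite [X in _ = _ * X](reindex_inj (@perm_inj _ sg)) /= mulr_sumr; apply: eq_bigr => k _.
  rewrite (vins_perm o' (fun i => P' (rho i))) (cross_vins_perm (o x) (fun j => P x (rho j))) dotZr.
  by rewrite (vins_perm (o x) (fun j => P x (rho j))) regram_perm mom_perm /= !mulrA.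
have E s : \sum_(l < n.+2) \sum_(k < n.+1) (-1) ^+ l * dot (y' s (lift l k)) (cross (fun j => y s x (lift l j))) *
         (mom [:: k] (row' l (col' l (H x s))))%:C =
   flux (fun i => P x (f s i)) (fun i => P' (f s i)) (row' ord0 (col' ord0 (H x s))) +
   \sum_(l < n.+1) (-1) ^+ l * r (fun k => f s (lift l k)).
  rewrite big_ord_recl; congr (_ + _).
    apply: eq_bigr => k _; rewrite expr0 mul1r /y' vins_lift; congr (dot _ (cross _) * _).
    by apply/funext => j; rewrite /y vins_lift.
  apply: eq_bigr => l _; rewrite /r mulrN -mulNr (_ : - (-1) ^+ l = (-1) ^+ lift ord0 l :> C); last by rewrite lift0 exprS mulN1r.
  rewrite mulr_sumr; apply: eq_bigr => k _.
  have L j : lift (lift ord0 l) j = vins ord0 ord0 (fun j => lift ord0 (lift l j)) j.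
    case: (unliftP ord0 j) => [i ->|->]; rewrite ?vins_lift ?vins_id; apply: val_inj => //=.
    by rewrite /bump /= !add1n ltnS addnS.
  have zE (T : Type) (a : T) (b : 'I_n.+1 -> T) :
      (fun j => vins ord0 a b (lift (lift ord0 l) j)) = vins ord0 a (fun j => b (lift l j)).
    apply/funext => j; rewrite L; case: (unliftP ord0 j) => [i ->|->]; by rewrite ?vins_lift ?vins_id ?vins_lift.
  rewrite (regram_minor _ (gx s)) (zE _ (o x) (fun i => P x (f s i))) -mulrA; congr (_ * (_ * _)).
  congr (dot _ _).
  exact: (congr1 (fun g => g k) (zE _ o' (fun i => P' (f s i)))).
by rewrite (eq_bigr _ (fun s _ => E s)) big_split /= (ridge_cancel pm oriented alt) addr0.
Qed.

End GlobalFlux.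

(** * Differentiation under the integral sign on [0, 1] *)

Section ParametricIntegral.
Context {R : realType}.
Local Notation mu := (@lebesgue_measure R).

Definition int01 (f : R -> R) : R := (\int[mu]_(x in `[0, 1]) f x)%R.

Lemma within01 (f : R -> R) : (forall x, 0 <= x <= 1 -> {for x, continuous f}) ->
  {within `[0, 1], continuous f}.
Proof.
move=> h; apply: continuous_in_subspaceT => x; rewrite inE /= in_itv /=; exact: h.
Qed.

Lemma integrable01 (f : R -> R) : (forall x, 0 <= x <= 1 -> {for x, continuous f}) ->
  mu.-integrable `[0, 1] (EFin \o f).
Proof.
by move=> h; apply: continuous_compact_integrable; [exact: segment_compact|exact: within01].
Qed.

Lemma int01_FTC (f F : R -> R) : (forall x, 0 <= x <= 1 -> {for x, continuous f}) ->
  (forall x, 0 <= x <= 1 -> dR F x (f x)) -> int01 f = F 1 - F 0.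
Proof.
move=> cf dF; rewrite /int01 /Rintegral (continuous_FTC2 (F := F)) //.
- exact: within01.
- split.
  + move=> x; rewrite in_itv /= => /andP[h1 h2].
    by have [] : dR F x (f x) by apply: dF; rewrite !ltW.
  + apply: cvg_at_right_filter; apply: (dR_continuous (dF 0 _)); by rewrite lexx ler01.
  + apply: cvg_at_left_filter; apply: (dR_continuous (dF 1 _)); by rewrite lexx ler01.
- move=> x; rewrite in_itv /= => /andP[h1 h2]; rewrite derive1E.
  have d : dR F x (f x) by apply: dF; rewrite !ltW.
  exact: (@derive_val _ _ _ _ _ _ _ d).
Qed.

(** Shaped for a closed 1-form: the t-derivative [c] of the integrand is also the x-derivative of
    [b], so the derivative of the integral is a difference of boundary values. The constant [B]
    provides the domination. *)
Lemma dR_int01 (a c : R -> R -> R) (b : R -> R) (t0 B : R) :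
  (\forall t \near t0, forall x, 0 <= x <= 1 -> dR (a ^~ x) t (c t x) /\ `|c t x| <= B) ->
  (\forall t \near t0, forall x, 0 <= x <= 1 -> {for x, continuous (a t)}) ->
  (forall x, 0 <= x <= 1 -> {for x, continuous (c t0)}) ->
  (forall x, 0 <= x <= 1 -> dR b x (c t0 x)) ->
  dR (fun t => int01 (a t)) t0 (b 1 - b 0).
Proof.
move=> da ca cc db.
have /nbhs_ballP[e /= e0 he] : \forall t \near t0,
   (forall x, 0 <= x <= 1 -> dR (a ^~ x) t (c t x) /\ `|c t x| <= B) /\
   (forall x, 0 <= x <= 1 -> {for x, continuous (a t)}).
  by near=> t; split; near: t.
have inI t : `]t0 - e, t0 + e[%classic t -> ball t0 e t.
  by rewrite /= in_itv /= /ball /= => /andP[h1 h2]; rewrite ltr_distlC h1 h2.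
have It : `]t0 - e, t0 + e[%classic t0.
  by rewrite /= in_itv /= ltrBlDr !ltrDl e0.
have in01 (x : R) : `[0, 1]%classic x -> 0 <= x <= 1 by rewrite /= in_itv.
have dE t x : `]t0 - e, t0 + e[%classic t -> `[0, 1]%classic x ->
    partial1of2 a t x = c t x.
  move=> /inI/he[h _] /in01 /h[d _]; rewrite partial1of2E; exact: (@derive_val _ _ _ _ _ _ _ d).
have intf x : `]t0 - e, t0 + e[%classic x -> mu.-integrable `[0, 1] (EFin \o a x).
  by move=> /inI/he[_ h]; exact: integrable01.
have derf x y : `]t0 - e, t0 + e[%classic x -> `[0, 1]%classic y -> derivable (a ^~ y) x 1.
  by move=> /inI/he[h _] /in01/h[[]].
have B0 : 0 <= B.
  have /he[h _] := inI _ It; have [|_] := h 0; first by rewrite lexx ler01.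
  exact: le_trans.
have intG : mu.-integrable `[0, 1] (EFin \o (fun=> B)).
  by apply: integrable01 => x _; exact: cst_continuous.
have ub x y : `]t0 - e, t0 + e[%classic x -> `[0, 1]%classic y -> `|partial1of2 a x y| <= B.
  by move=> hx hy; rewrite dE //; have /he[h _] := inI _ hx; case: (h y (in01 _ hy)).
have m01 : measurable (`[0%R, 1%R] : set (measurableTypeR R)) by exact: measurable_itv.
have D := @derivable_under_integral R _ _ mu a _ m01 t0 _ _ It intf derf _ (fun=> B0) intG ub.
have V := @differentiation_under_integral R _ _ mu a _ m01 t0 _ _ It intf derf _ (fun=> B0) intG ub.
apply: DeriveDef; first exact: D.
rewrite -derive1E V -(int01_FTC cc db); apply: eq_Rintegral => x; rewrite inE => hx; exact: dE.
Unshelve. all: by end_near. Qed.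

Lemma exists_primitive (g : R -> R) (l : R) : 0 < l -> continuous g ->
  exists F, forall x, 0 <= x <= l -> dR F x (g x).
Proof.
move=> l0 cg; exists (fun x => (\int[mu]_(t in `[-1, x]) g t)%R) => x /andP[x0 xl].
have ig : mu.-integrable `[-1, (l + 1)] (EFin \o g).
  apply: continuous_compact_integrable; first exact: segment_compact.
  exact: continuous_subspaceT.
have [||] := @continuous_FTC1_closed R g (-1) x (l + 1) _ ig _ (cg x).
- by rewrite (le_lt_trans xl) // ltrDl.
- by rewrite (lt_le_trans _ x0) // ltrN10.
by move=> D V; apply: DeriveDef => //; rewrite -derive1E V.
Qed.

End ParametricIntegral.

(** * Continuity and C^1 regularity of complex-valued functions *)

Section ComplexContinuity.
Context {R : realType}.
Local Notation C := R[i].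
Implicit Types (f g : R -> C) (t : R).

Lemma dR_inv (f : R -> R) x a : dR f x a -> f x != 0 -> dR (fun y => (f y)^-1) x (- (f x ^- 2) * a).
Proof. by move=> df f0; exact: (is_deriveV f0 df). Qed.

Definition nsq (z : C) : R := complex.Re z ^+ 2 + complex.Im z ^+ 2.

Lemma nsq_gt0 z : z != 0 -> 0 < nsq z.
Proof.
move=> z0; rewrite lt_neqAle addr_ge0 ?sqr_ge0 // andbT eq_sym paddr_eq0 ?sqr_ge0 //.
apply: contra z0; rewrite !sqrf_eq0 => /andP[/eqP a /eqP b]; apply/eqP; exact: complex_eq.
Qed.

Lemma invcE z : z^-1 = (complex.Re z / nsq z) +i* (- complex.Im z / nsq z).
Proof. by case: z => a b; rewrite mulNr. Qed.

Definition cC f t :=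
  {for t, continuous (fun t => complex.Re (f t))} /\ {for t, continuous (fun t => complex.Im (f t))}.

Lemma dC_cC f t a : dC f t a -> cC f t.
Proof. by move=> [h1 h2]; split; [exact: dR_continuous h1|exact: dR_continuous h2]. Qed.

Lemma cC_ext f g t : (forall y, f y = g y) -> cC f t -> cC g t.
Proof. by move=> /funext ->. Qed.

Lemma cC_cst a t : cC (fun=> a) t.
Proof. by split; exact: cst_continuous. Qed.

Lemma cCD f g t : cC f t -> cC g t -> cC (fun y => f y + g y) t.
Proof.
move=> [f1 f2] [g1 g2]; split.
  rewrite (_ : (fun _ => _) = (fun t => complex.Re (f t) + complex.Re (g t))); last by apply/funext => y; rewrite ReAdd.
  exact: continuousD.
rewrite (_ : (fun _ => _) = (fun t => complex.Im (f t) + complex.Im (g t))); last by apply/funext => y; rewrite ImAdd.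
exact: continuousD.
Qed.

Lemma cCM f g t : cC f t -> cC g t -> cC (fun y => f y * g y) t.
Proof.
move=> [f1 f2] [g1 g2]; split.
  rewrite (_ : (fun _ => _) = (fun t => complex.Re (f t) * complex.Re (g t) - complex.Im (f t) * complex.Im (g t))); last by apply/funext => y; rewrite ReMul.
  by apply: continuousB; exact: continuousM.
rewrite (_ : (fun _ => _) = (fun t => complex.Re (f t) * complex.Im (g t) + complex.Im (f t) * complex.Re (g t))); last by apply/funext => y; rewrite ImMul.
by apply: continuousD; exact: continuousM.
Qed.

Lemma cC_re f t : cC f t -> cC (fun y => (complex.Re (f y))%:C) t.
Proof. by move=> [f1 f2]; split => //; exact: cst_continuous. Qed.

Lemma cC_inv f t : f t != 0 -> cC f t -> cC (fun y => (f y)^-1) t.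
Proof.
move=> f0 [f1 f2].
have n0 : nsq (f t) != 0 by rewrite gt_eqF // nsq_gt0.
have cn : {for t, continuous (fun y => (nsq (f y))^-1)}.
  apply: continuousV => //; rewrite /nsq.
  by apply: continuousD; rewrite /=; apply: continuousM.
split.
  rewrite (_ : (fun _ => _) = (fun t => complex.Re (f t) / nsq (f t))); last by apply/funext => y; rewrite invcE.
  exact: continuousM.
rewrite (_ : (fun _ => _) = (fun t => - complex.Im (f t) / nsq (f t))); last by apply/funext => y; rewrite invcE.
by apply: continuousM => //; exact: continuousN.
Qed.

Lemma cC_near f g t : (\forall y \near t, f y = g y) -> cC f t -> cC g t.
Proof.
move=> fg [f1 f2]; have fgt := nbhs_singleton fg; split.
  move: f1; rewrite /prop_for /continuous_at fgt => f1.
  by apply: cvg_trans f1; apply: near_eq_cvg; apply: filterS fg => y ->.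
move: f2; rewrite /prop_for /continuous_at fgt => f2.
by apply: cvg_trans f2; apply: near_eq_cvg; apply: filterS fg => y ->.
Qed.

Lemma dC_inv f x a : dC f x a -> f x != 0 -> dC (fun y => (f y)^-1) x (- a / f x ^+ 2).
Proof.
move=> [f1 f2] f0.
have n0 : nsq (f x) != 0 by rewrite gt_eqF // nsq_gt0.
have dn : dR (fun y => nsq (f y)) x (2 * (complex.Re a * complex.Re (f x) + complex.Im a * complex.Im (f x))).
  apply: dR_ext (dR_eq (dRD (dRM f1 f1) (dRM f2 f2)) _) => [y|]; first by rewrite /nsq !expr2.
  by ring.
have di := dR_inv dn n0.
set N' := (X in - _ * X) in di.
have D : dC (fun y => (f y)^-1) x
    ((complex.Re a * (nsq (f x))^-1 + complex.Re (f x) * (- (nsq (f x) ^- 2) * N')) +i*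
     (- complex.Im a * (nsq (f x))^-1 + - complex.Im (f x) * (- (nsq (f x) ^- 2) * N'))).
  split; first by apply: dR_ext (dRM f1 di) => y; rewrite invcE.
  by apply: dR_ext (dRM (dRN f2) di) => y; rewrite invcE.
apply: dC_eq D _; rewrite /N'.
rewrite expr2 invfM !invcE; move: n0; rewrite /nsq.
case: (f x) => p q /=; case: (a) => b c /= n0.
apply: complex_eq; rewrite !(ReMul, ImMul) /=; field.
all: rewrite n0 andbT (_ : _ + _ = (p ^+ 2 + q ^+ 2) ^+ 2) ?expf_neq0 //; ring.
Qed.

(** Regularity on a neighbourhood of [t], with an existential derivative so that closure properties
    need no formulas. *)
Definition C1 f (t : R) := exists f', \forall y \near t, dC f y (f' y) /\ cC f' y.

Lemma C1_near f g t : (\forall y \near t, f y = g y) -> C1 f t -> C1 g t.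
Proof.
move=> fg [f' h]; exists f'.
have fg2 := near_join fg.
near=> y; have [|d c] := near h y => //; split => //; apply: dC_near d.
by near: y; exact: fg2.
Unshelve. all: by end_near. Qed.

Lemma C1_cst (a : C) t : C1 (fun=> a) t.
Proof. by exists (fun=> 0); near=> y; split; [exact: dC_cst|exact: cC_cst]. Unshelve. all: by end_near. Qed.

Lemma C1D f g t : C1 f t -> C1 g t -> C1 (fun y => f y + g y) t.
Proof.
move=> [f' hf] [g' hg]; exists (fun y => f' y + g' y); near=> y.
have [|df cf] := near hf y => //; have [|dg cg] := near hg y => //.
by split; [exact: dCD|exact: cCD].
Unshelve. all: by end_near. Qed.

Lemma C1M f g t : C1 f t -> C1 g t -> C1 (fun y => f y * g y) t.
Proof.
move=> [f' hf] [g' hg]; exists (fun y => f' y * g y + f y * g' y); near=> y.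
have [|df cf] := near hf y => //; have [|dg cg] := near hg y => //.
split; first exact: dCM.
by apply: cCD; apply: cCM => //; [exact: dC_cC dg|exact: dC_cC df].
Unshelve. all: by end_near. Qed.

Lemma cC_near_neq0 f t : cC f t -> f t != 0 -> \forall y \near t, f y != 0.
Proof.
move=> [f1 f2] f0.
have : {for t, continuous (fun y => nsq (f y))}.
  by rewrite /nsq; apply: continuousD; rewrite /=; apply: continuousM.
move/cvgr_gt/(_ _ (nsq_gt0 f0)); apply: filterS => y; apply: contraTneq => ->.
by rewrite /nsq /= expr0n addr0 ltxx.
Qed.

Lemma C1_cC f t : C1 f t -> cC f t.
Proof. by move=> [f' /nbhs_singleton[d _]]; exact: dC_cC d. Qed.

Lemma C1_inv f t : f t != 0 -> C1 f t -> C1 (fun y => (f y)^-1) t.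
Proof.
move=> f0 C1f; have n0 := cC_near_neq0 (C1_cC C1f) f0.
case: C1f => f' hf; exists (fun y => - f' y / f y ^+ 2); near=> y.
have [|df cf] := near hf y => //; have fy : f y != 0 by near: y.
split; first exact: dC_inv.
apply: cCM.
  by apply: cC_ext (cCM (cC_cst (-1) y) cf) => z; rewrite mulN1r.
apply: cC_inv; first by rewrite expf_neq0.
by apply: cC_ext (cCM (dC_cC df) (dC_cC df)) => z; rewrite expr2.
Unshelve. all: by end_near. Qed.

Lemma C1_near2 f t : C1 f t -> \forall y \near t, C1 f y.
Proof.
move=> [f' hf]; have hf2 := near_join hf; near=> y; exists f'; by near: y; exact: hf2.
Unshelve. all: by end_near.
Qed.

End ComplexContinuity.

(** * Closure of function algebras under determinants, cross products and flux derivatives *)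

Section Subalgebra.
Context {R : realType}.
Local Notation C := R[i].
Variables (X : Type) (Q : (X -> C) -> Prop).
Hypothesis Q_cst : forall a, Q (fun=> a).
Hypothesis QD : forall f g, Q f -> Q g -> Q (fun x => f x + g x).
Hypothesis QM : forall f g, Q f -> Q g -> Q (fun x => f x * g x).

Lemma Q_sum (I : Type) (r : seq I) (f : I -> X -> C) : (forall i, Q (f i)) ->
  Q (fun x => \sum_(i <- r) f i x).
Proof.
move=> h; elim: r => [|i r IH].
  by rewrite (_ : (fun _ => _) = fun=> 0) //; apply/funext => x; rewrite big_nil.
rewrite (_ : (fun _ => _) = fun x => f i x + \sum_(j <- r) f j x); first exact: QD.
by apply/funext => x; rewrite big_cons.
Qed.

Lemma Q_prod (I : Type) (r : seq I) (f : I -> X -> C) : (forall i, Q (f i)) ->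
  Q (fun x => \prod_(i <- r) f i x).
Proof.
move=> h; elim: r => [|i r IH].
  by rewrite (_ : (fun _ => _) = fun=> 1) //; apply/funext => x; rewrite big_nil.
rewrite (_ : (fun _ => _) = fun x => f i x * \prod_(j <- r) f j x); first exact: QM.
by apply/funext => x; rewrite big_cons.
Qed.

Lemma Q_det m (Y : X -> 'M[C]_m) : (forall i j, Q (fun x => Y x i j)) -> Q (fun x => \det (Y x)).
Proof. by move=> h; apply: Q_sum => s; apply: QM => //; exact: Q_prod. Qed.

Lemma Q_dot k (u v : X -> 'rV[C]_k) : (forall j, Q (fun x => u x 0 j)) -> (forall j, Q (fun x => v x 0 j)) ->
  Q (fun x => dot (u x) (v x)).
Proof. by move=> hu hv; apply: Q_sum => j; exact: QM. Qed.

Lemma Q_cross k (p : X -> 'I_k -> 'rV[C]_k.+1) j : (forall i j, Q (fun x => p x i 0 j)) ->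
  Q (fun x => cross (p x) 0 j).
Proof.
move=> h; rewrite (_ : (fun _ => _) = fun x => (-1) ^+ j * \det (col' j (rowsmx (p x)))); last first.
  by apply/funext => x; rewrite mxE.
apply: QM => //; apply: Q_det => a b.
by rewrite (_ : (fun _ => _) = fun x => p x a 0 (lift j b)) //; apply/funext => x; rewrite !mxE.
Qed.

Hypothesis Q_re : forall f, Q f -> Q (fun x => (complex.Re (f x))%:C).

(** One argument for two uses in differentiating the potential: continuity of the derivative of the
    integrand in the homotopy parameter, and its bound uniform in that parameter. *)
Lemma Q_dflux n (p xi eta zeta : X -> 'I_n.+1 -> 'rV[C]_n.+2) (G G' : X -> 'M[R]_n.+1) :
  (forall i j, Q (fun x => p x i 0 j)) -> (forall i j, Q (fun x => xi x i 0 j)) ->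
  (forall i j, Q (fun x => eta x i 0 j)) -> (forall i j, Q (fun x => zeta x i 0 j)) ->
  (forall s, Q (fun x => (mom s (G x))%:C)) -> (forall i j, Q (fun x => (G' x i j)%:C)) ->
  Q (fun x => dflux (p x) (xi x) (eta x) (zeta x) (G x) (G' x)).
Proof.
move=> hp hxi he hz hm hG; apply: Q_sum => k.
have QN f : Q f -> Q (fun x => - f x).
  by move=> hf; rewrite (_ : (fun _ => _) = fun x => -1 * f x); [exact: QM|apply/funext => x; rewrite mulN1r].
apply: QD; last apply: QN.
  apply: QM => //; apply: QD; first by apply: Q_dot => // j; exact: Q_cross.
  apply: Q_sum => l; apply: Q_dot => // j; apply: Q_cross => i j'.
  case: (unliftP l i) => [i' ->|->].
    by rewrite (_ : (fun _ => _) = fun x => p x (lift l i') 0 j') //; apply/funext => x; rewrite vins_lift.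
  by rewrite (_ : (fun _ => _) = fun x => eta x l 0 j') //; apply/funext => x; rewrite vins_id.
apply: QM; first by apply: Q_dot => // j; exact: Q_cross.
rewrite (_ : (fun _ => _) = fun x => \sum_i \sum_j (G' x i j)%:C * (mom [:: i; j; k] (G x))%:C); last first.
  apply/funext => x; rewrite rc_sum; apply: eq_bigr => i _; rewrite rc_sum; apply: eq_bigr => j _.
  exact: rcM.
by apply: Q_sum => i; apply: Q_sum => j; exact: QM.
Qed.

End Subalgebra.

(** * Scaling the imaginary parts of a configuration *)

Section Homotopy.
Context {R : realType}.
Local Notation C := R[i].

Definition cz (c : R) (z : C) : C := complex.Re z +i* (c * complex.Im z).
(** Profile of the scaling, from 0 at x = 0 to 1 at x = 1. Since 1 - x(2 - x) = (1 - x)^2, it never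
    exceeds 1, so [1 - cf x ^+ 2] stays nonnegative on both sides of x = 1; a linear profile would
    fail there, and two-sided derivatives are needed at the endpoint. *)
Definition cf (x : R) : R := x * (2 - x).
Definition imdot k (u v : 'rV[C]_k) : R := \sum_j complex.Im (u 0 j) * complex.Im (v 0 j).

Lemma Re_sum (I : Type) (r : seq I) (F : I -> C) :
  complex.Re (\sum_(i <- r) F i) = \sum_(i <- r) complex.Re (F i).
Proof. exact: raddf_sum. Qed.

Lemma Im_sum (I : Type) (r : seq I) (F : I -> C) :
  complex.Im (\sum_(i <- r) F i) = \sum_(i <- r) complex.Im (F i).
Proof. exact: raddf_sum. Qed.

(** A real product forces the mixed sum of real and imaginary parts to vanish; that sum is all that
    scaling could contribute to the imaginary part. *)
Lemma dot_cz k c (u v : 'rV[C]_k) (g : R) : dot u v = g%:C ->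
  dot (\row_j cz c (u 0 j)) (\row_j cz c (v 0 j)) = (g + (1 - c ^+ 2) * imdot u v)%:C.
Proof.
move=> h; have := congr1 (@complex.Re R) h; have := congr1 (@complex.Im R) h.
rewrite /dot Re_sum Im_sum /= => hI hR; apply: complex_eq; rewrite ?Re_sum ?Im_sum /=.
  rewrite -hR /imdot mulr_sumr -big_split; apply: eq_bigr => j _ /=.
  by rewrite !mxE !ReMul /=; ring.
transitivity (c * \sum_j complex.Im (u 0 j * v 0 j)); last by rewrite hI mulr0.
rewrite mulr_sumr; apply: eq_bigr => j _.
by rewrite !mxE !ImMul /=; ring.
Qed.

(** The added matrix is a nonnegative multiple of a Gram matrix of real vectors, hence positive
    semidefinite. *)
Lemma coerD_imdot m k (y : 'I_m -> 'rV[C]_k) (G : 'M[R]_m) (d : R) : 0 <= d -> coer G ->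
  coer (\matrix_(i, j) (G i j + d * imdot (y i) (y j))).
Proof.
move=> d0 cG t ot; apply: le_trans (cG t ot) _.
have -> : qf (\matrix_(i, j) (G i j + d * imdot (y i) (y j))) t =
    qf G t + d * \sum_l (\sum_i t i * complex.Im (y i 0 l)) ^+ 2.
  have -> : \sum_l (\sum_i t i * complex.Im (y i 0 l)) ^+ 2 =
     \sum_i \sum_j imdot (y i) (y j) * (t i * t j).
    transitivity (\sum_l \sum_i \sum_j (complex.Im (y i 0 l) * complex.Im (y j 0 l)) * (t i * t j)).
      apply: eq_bigr => l _; rewrite expr2 mulr_suml; apply: eq_bigr => i _; rewrite mulr_sumr.
      by apply: eq_bigr => j _; ring.
    rewrite exchange_big; apply: eq_bigr => i _; rewrite exchange_big; apply: eq_bigr => j _.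
    by rewrite -mulr_suml.
  rewrite /qf mulr_sumr -big_split; apply: eq_bigr => i _ /=.
  by rewrite mulr_sumr -big_split; apply: eq_bigr => j _ /=; rewrite mxE; ring.
by rewrite lerDl mulr_ge0 // sumr_ge0 // => l _; exact: sqr_ge0.
Qed.

Lemma cf01 (x : R) : 0 <= x <= 1 -> 0 <= cf x <= 1.
Proof. by rewrite /cf => /andP[h1 h2]; apply/andP; split; nra. Qed.

Lemma dR_cf x : dR cf x (2 - 2 * x).
Proof.
apply: dR_eq (dRM (dR_id x) (dRB (dR_cst 2 x) (dR_id x))) _; ring.
Qed.

Lemma cf_near (x : R) : 0 <= x <= 1 -> \forall y \near x, 0 <= 1 - cf y ^+ 2.
Proof.
move=> x01; have /andP[c0 _] := cf01 x01.
have : \forall y \near x, -1 < cf y.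
  by apply: cvgr_gt (dR_continuous (dR_cf x)) _ _; rewrite (lt_le_trans _ c0) // ltrN10.
apply: filterS => y h.
have le1 : cf y <= 1 by rewrite -subr_ge0 (_ : 1 - cf y = (1 - y) ^+ 2) ?sqr_ge0 // /cf; ring.
by rewrite (_ : 1 - cf y ^+ 2 = (1 - cf y) * (1 + cf y)); [apply: mulr_ge0; lra|ring].
Qed.

Section Family.
Variables (V : Type) (k : nat).
Implicit Types (P : V -> 'rV[C]_k).

Definition homot P x v : 'rV[C]_k := \row_j cz (cf x) (P v 0 j).
Definition dhom P x v : 'rV[C]_k := \row_j (0 +i* ((2 - 2 * x) * complex.Im (P v 0 j))).
Definition ddhom P v : 'rV[C]_k := \row_j (0 +i* (- 2 * complex.Im (P v 0 j))).

Lemma hom1 P v : homot P 1 v = P v.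
Proof.
apply/rowP => j; rewrite mxE /cz /cf (_ : 1 * (2 - 1) = 1); last by ring.
by rewrite mul1r; case: (P v 0 j).
Qed.

Lemma dC_hom P x v j : dC (fun x => homot P x v 0 j) x (dhom P x v 0 j).
Proof.
rewrite mxE; split => /=.
  by apply: dR_ext (dR_cst (complex.Re (P v 0 j)) x) => y; rewrite mxE.
apply: dR_ext (dR_eq (dRM (dR_cf x) (dR_cst (complex.Im (P v 0 j)) x)) _) => [y|]; first by rewrite mxE.
by rewrite mulr0 addr0.
Qed.

Lemma dC_dhom P x v j : dC (fun x => dhom P x v 0 j) x (ddhom P v 0 j).
Proof.
rewrite mxE; split => /=.
  by apply: dR_ext (dR_cst 0 x) => y; rewrite mxE.
apply: dR_ext (dR_eq (dRM (dRB (dR_cst 2 x) (dRZ 2 (dR_id x))) (dR_cst (complex.Im (P v 0 j)) x)) _) => [y|].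
  by rewrite mxE.
by rewrite mulr0 addr0 sub0r mulr1.
Qed.

Lemma dC_homt (P : R -> V -> 'rV[C]_k) P' t x v j : dC (fun t => P t v 0 j) t (P' v 0 j) ->
  dC (fun t => homot (P t) x v 0 j) t (homot P' x v 0 j).
Proof.
move=> [d1 d2]; rewrite mxE; split => /=; first by apply: dR_ext d1 => y; rewrite mxE.
by apply: dR_ext (dRZ (cf x) d2) => y; rewrite mxE.
Qed.

Lemma dC_dhomt (P : R -> V -> 'rV[C]_k) P' t x v j : dC (fun t => P t v 0 j) t (P' v 0 j) ->
  dC (fun t => dhom (P t) x v 0 j) t (dhom P' x v 0 j).
Proof.
move=> [d1 d2]; rewrite mxE; split => /=; first by apply: dR_ext (dR_cst 0 t) => y; rewrite mxE.
by apply: dR_ext (dRZ (2 - 2 * x) d2) => y; rewrite mxE.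
Qed.

Lemma rgram_hom P x m (h : 'I_m -> V) G : rgram (fun i => P (h i)) G ->
  rgram (fun i => homot P x (h i)) (\matrix_(i, j) (G i j + (1 - cf x ^+ 2) * imdot (P (h i)) (P (h j)))).
Proof. by move=> gr i j; rewrite (dot_cz _ (gr i j)) mxE. Qed.

End Family.

Lemma bound_mom m (s : seq 'I_m) (G : 'M[R]_m) : coer G -> `|mom s G| <= Cst m (size s).
Proof. by move=> cG; apply: RI_bound; exact: dom_gau. Qed.

(** Bounds uniform in x over [0, 1] for t near [t0]: the domination needed to differentiate an
    integral over x with respect to t. *)
Definition bdd (t0 : R) (F : R * R -> C) := exists B : R, \forall t \near t0, forall x, 0 <= x <= 1 ->
  `|complex.Re (F (t, x))| <= B /\ `|complex.Im (F (t, x))| <= B.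

Lemma bdd_cst t0 a : bdd t0 (fun=> a).
Proof.
exists (`|complex.Re a| + `|complex.Im a|); near=> t => x _.
by rewrite lerDl lerDr !normr_ge0.
Unshelve. all: by end_near. Qed.

Lemma bddD t0 F F' : bdd t0 F -> bdd t0 F' -> bdd t0 (fun z => F z + F' z).
Proof.
move=> [B h] [B' h']; exists (B + B'); near=> t => x x01.
have [|a b] := near h t _ x x01 => //; have [|a' b'] := near h' t _ x x01 => //.
rewrite ReAdd ImAdd; split; apply: le_trans (ler_normD _ _) _; exact: lerD.
Unshelve. all: by end_near. Qed.

Lemma bddM t0 F F' : bdd t0 F -> bdd t0 F' -> bdd t0 (fun z => F z * F' z).
Proof.
move=> [B h] [B' h']; exists (B * B' + B * B'); near=> t => x x01.
have [|a b] := near h t _ x x01 => //; have [|a' b'] := near h' t _ x x01 => //.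
rewrite ReMul ImMul; split; [apply: le_trans (ler_normB _ _) _|apply: le_trans (ler_normD _ _) _].
  by apply: lerD; rewrite normrM ler_pM.
by apply: lerD; rewrite normrM ler_pM.
Unshelve. all: by end_near. Qed.

Lemma bdd_re t0 F : bdd t0 F -> bdd t0 (fun z => (complex.Re (F z))%:C).
Proof.
move=> [B h]; exists B; apply: filterS h => t h x x01; have [h1 _] := h x x01; split => //=.
by rewrite normr0 (le_trans _ h1).
Qed.

Lemma bdd_comp t0 (a b : R -> R) (f : R -> C) : cC f t0 ->
  (forall x, 0 <= x <= 1 -> `|a x| <= 2 /\ `|b x| <= 2) ->
  bdd t0 (fun z => (a z.2 * complex.Re (f z.1)) +i* (b z.2 * complex.Im (f z.1))).
Proof.
move=> [f1 f2] h.
exists (2 * (`|complex.Re (f t0)| + `|complex.Im (f t0)| + 1)); near=> t => x x01 /=.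
have [ha hb] := h x x01; rewrite !normrM; split; apply: ler_pM => //; apply: ltW.
  near: t; apply: cvgr_norm_lt f1 _ _; by rewrite -addrA ltrDl ltr_wpDl.
near: t; apply: cvgr_norm_lt f2 _ _; by rewrite addrAC ltrDr ltr_wpDl.
Unshelve. all: by end_near. Qed.

End Homotopy.

(** * The single-valued potential of the imaginary flux *)

Section Potential.
Context {R : realType}.
Local Notation C := R[i].
Variables (V : finType) (n q : nat) (f : 'I_q -> 'I_n.+1 -> V).
Hypothesis pm : is_pseudomanifold f.
Hypothesis oriented : is_oriented f.
Implicit Types (P : V -> 'rV[C]_n.+2).

Definition homG P x s : 'M[R]_n.+1 := regram (fun i => homot P x (f s i)).

(* The imaginary part of the complex volume swept while the imaginary parts of the vertices grow from 0 to their actual values; the Gram matrices stay real on the way. *)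
Definition EK P : R :=
  int01 (fun x => complex.Im (fluxK f (homot P x) (dhom P x) (homG P x))).

Lemma homG_spec P (G : 'I_q -> 'M[R]_n.+1) x s : (forall s, rgram (fun i => P (f s i)) (G s)) ->
  rgram (fun i => homot P x (f s i)) (homG P x s).
Proof. by move=> gr; have h := rgram_hom x (gr s); rewrite /homG (rgram_regram h). Qed.

Lemma coer_homG P (G : 'I_q -> 'M[R]_n.+1) x s : (forall s, rgram (fun i => P (f s i)) (G s)) ->
  (forall s, coer (G s)) -> 0 <= 1 - cf x ^+ 2 -> coer (homG P x s).
Proof.
move=> gr cG h; rewrite /homG (rgram_regram (rgram_hom x (gr s))).
exact: coerD_imdot.
Qed.

(** Determinants and moments of real data are real. This makes the boundary term at the start of the
    homotopy vanish. *)
Lemma flux_real P (xi : V -> 'rV[C]_n.+2) (G : 'I_q -> 'M[R]_n.+1) : (forall v j, complex.Im (P v 0 j) = 0) ->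
  (forall v j, complex.Im (xi v 0 j) = 0) -> complex.Im (fluxK f P xi G) = 0.
Proof.
move=> hP hxi.
rewrite /fluxK Im_sum big1 // => s _; rewrite Im_sum big1 // => k _.
rewrite ImMul /= mulr0 add0r (_ : complex.Im _ = 0) ?mul0r // /dot Im_sum big1 // => j _.
rewrite ImMul hxi mul0r addr0 (_ : complex.Im _ = 0) ?mulr0 //.
rewrite mxE.
have sgn m : complex.Im ((-1) ^+ m : C) = 0.
  by elim: m => [|m IH] //; rewrite exprS ImMul IH mulr0 /= oppr0 mul0r addr0.
rewrite ImMul sgn mul0r addr0 /determinant Im_sum big1 ?mulr0 // => sg _.
rewrite ImMul sgn mul0r addr0 (_ : complex.Im _ = 0) ?mulr0 //.
have : forall i, complex.Im (col' j (rowsmx (fun i => P (f s i))) i (sg i)) = 0.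
  by move=> i; rewrite !mxE hP.
move=> h; elim/big_rec: _ => // i z _ IH; by rewrite ImMul IH h mulr0 mul0r addr0.
Qed.

Definition varG P (xi : V -> 'rV[C]_n.+2) s : 'M[R]_n.+1 := \matrix_(i, j)
  complex.Re (dot (xi (f s i)) (P (f s j)) + dot (P (f s i)) (xi (f s j))).

Lemma dC_fluxK (P xi : R -> V -> 'rV[C]_n.+2) (P' xi' : V -> 'rV[C]_n.+2) (H : R -> 'I_q -> 'M[R]_n.+1) x :
  (forall v j, dC (fun t => P t v 0 j) x (P' v 0 j)) ->
  (forall v j, dC (fun t => xi t v 0 j) x (xi' v 0 j)) ->
  (\forall t \near x, forall s, rgram (fun i => P t (f s i)) (H t s)) ->
  (\forall t \near x, forall s, coer (H t s)) ->
  dC (fun t => fluxK f (P t) (xi t) (H t)) x (dfluxK f (P x) (xi x) P' xi' (H x) (varG (P x) P')) /\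
  (forall s i j, (varG (P x) P' s i j)%:C = dot (P' (f s i)) (P x (f s j)) + dot (P x (f s i)) (P' (f s j))).
Proof.
move=> dP dxi gr cH.
have K s : exists G' : 'M[R]_n.+1, (forall i j, dR (fun t => H t s i j) x (G' i j)) /\
    (forall i j, (G' i j)%:C = dot (P' (f s i)) (P x (f s j)) + dot (P x (f s i)) (P' (f s j))).
  apply: (@rgram_dR _ _ _ (fun t i => P t (f s i)) (fun i => P' (f s i)) (fun t => H t s)).
    by move=> i j; exact: dP.
  by apply: filterS gr.
have KE s (G' : 'M[R]_n.+1) : (forall i j, (G' i j)%:C = dot (P' (f s i)) (P x (f s j)) + dot (P x (f s i)) (P' (f s j))) ->
    G' = varG (P x) P' s.
  by move=> h; apply/matrixP => i j; rewrite mxE -h.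
split=> [|s i j]; last by have [G' [_ h]] := K s; rewrite -(KE _ _ h).
apply: dC_sum => s; have [G' [h1 h2]] := K s; rewrite -(KE _ _ h2).
apply: (dC_flux (p := fun t i => P t (f s i)) (xi := fun t i => xi t (f s i)) (G := fun t => H t s)) => //.
by apply: filterS cH.
Qed.

(** Argument of the Poincare lemma: closedness exchanges the derivative in t with the derivative in
    the homotopy parameter, the integral becomes exact, and only the end x = 1, the configuration
    itself, contributes, because at x = 0 everything is real. *)
Lemma dR_EK (P P' : R -> V -> 'rV[C]_n.+2) (G : 'I_q -> 'M[R]_n.+1) t0 :
  (\forall t \near t0, forall v j, dC (fun t => P t v 0 j) t (P' t v 0 j)) ->
  (forall v j, cC (fun t => P' t v 0 j) t0) ->
  (\forall t \near t0, forall s, rgram (fun i => P t (f s i)) (G s)) ->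
  (forall s, coer (G s)) ->
  dR (fun t => EK (P t)) t0 (complex.Im (fluxK f (P t0) (P' t0) G)).
Proof.
move=> dP cP' gr cG.
have cP v j : cC (fun t => P t v 0 j) t0 by exact: dC_cC (nbhs_singleton dP v j).
have gr0 := nbhs_singleton gr; have dP0 := nbhs_singleton dP.
(* [a] is the integrand, the imaginary part of [c] is its t-derivative, and [b] is the flux in the
   direction of the t-motion. Closedness will make [c] also the source of the x-derivative of
   [b]. *)
pose a t x := complex.Im (fluxK f (homot (P t) x) (dhom (P t) x) (homG (P t) x)).
pose c t x := dfluxK f (homot (P t) x) (dhom (P t) x) (homot (P' t) x) (dhom (P' t) x)
   (homG (P t) x) (varG (homot (P t) x) (homot (P' t) x)).
pose b x := complex.Im (fluxK f (homot (P t0) x) (homot (P' t0) x) (homG (P t0) x)).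
have dx t (xi xi' : R -> V -> 'rV[C]_n.+2) x : (forall s, rgram (fun i => P t (f s i)) (G s)) -> 0 <= x <= 1 ->
   (forall v j, dC (fun x => xi x v 0 j) x (xi' x v 0 j)) ->
   dC (fun x => fluxK f (homot (P t) x) (xi x) (homG (P t) x)) x
     (dfluxK f (homot (P t) x) (xi x) (dhom (P t) x) (xi' x) (homG (P t) x) (varG (homot (P t) x) (dhom (P t) x)))
   /\ (forall s i j, (varG (homot (P t) x) (dhom (P t) x) s i j)%:C =
        dot (dhom (P t) x (f s i)) (homot (P t) x (f s j)) + dot (homot (P t) x (f s i)) (dhom (P t) x (f s j))).
  move=> grt x01 dxi.
  apply: (@dC_fluxK (fun x => homot (P t) x) xi (dhom (P t) x) (xi' x) (fun x => homG (P t) x)) => //.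
  - by move=> v j; exact: dC_hom.
  - by near=> y => s; exact: homG_spec grt.
  - by apply: filterS (cf_near x01) => y h s; apply: coer_homG grt cG h.
have dt : \forall t \near t0, forall x, 0 <= x <= 1 ->
   dC (fun t => fluxK f (homot (P t) x) (dhom (P t) x) (homG (P t) x)) t (c t x) /\
   (forall s i j, (varG (homot (P t) x) (homot (P' t) x) s i j)%:C =
        dot (homot (P' t) x (f s i)) (homot (P t) x (f s j)) + dot (homot (P t) x (f s i)) (homot (P' t) x (f s j))).
  have gr2 := near_join gr; near=> t => x x01.
  have h : 0 <= 1 - cf x ^+ 2 by exact: nbhs_singleton (cf_near x01).
  have dPt : forall v j, dC (fun t => P t v 0 j) t (P' t v 0 j) by near: t.
  have grt : \forall t' \near t, forall s, rgram (fun i => P t' (f s i)) (G s) by near: t; exact: gr2.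
  apply: (@dC_fluxK (fun t => homot (P t) x) (fun t => dhom (P t) x) (homot (P' t) x) (dhom (P' t) x) (fun t => homG (P t) x)).
  - by move=> v j; exact: dC_homt.
  - by move=> v j; exact: dC_dhomt.
  - by apply: filterS grt => t' g s; exact: homG_spec g.
  - by apply: filterS grt => t' g s; exact: coer_homG g cG h.
have ca : \forall t \near t0, forall x, 0 <= x <= 1 -> {for x, continuous (a t)}.
  apply: filterS gr => t grt x x01.
  have [d _] := dx t (dhom (P t)) (fun=> ddhom (P t)) x grt x01 (fun v j => dC_dhom (P t) x v j).
  by have [] := dC_cC d.
have cc x : 0 <= x <= 1 -> {for x, continuous (fun x => complex.Im (c t0 x))}.
  move=> x01; have cch P1 v j : cC (fun x : R => homot P1 x v 0 j) x by exact: dC_cC (dC_hom P1 x v j).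
  have ccd P1 v j : cC (fun x : R => dhom P1 x v 0 j) x by exact: dC_cC (dC_dhom P1 x v j).
  have Qdot := Q_dot (@cC_cst _ ^~ x) (fun f g => @cCD _ f g x) (fun f g => @cCM _ f g x).
  suff [] : cC (c t0) x by [].
  apply: (Q_sum (@cC_cst _ ^~ x) (fun f g => @cCD _ f g x)) => s.
  apply: (Q_dflux (@cC_cst _ ^~ x) (fun f g => @cCD _ f g x) (fun f g => @cCM _ f g x)) => //.
    move=> ss; have [G' [dG _]] : exists G' : 'M[R]_n.+1, (forall i j, dR (fun x => homG (P t0) x s i j) x (G' i j)) /\
        (forall i j, (G' i j)%:C = dot (dhom (P t0) x (f s i)) (homot (P t0) x (f s j)) + dot (homot (P t0) x (f s i)) (dhom (P t0) x (f s j))).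
      apply: (@rgram_dR _ _ _ (fun x i => homot (P t0) x (f s i)) (fun i => dhom (P t0) x (f s i))).
        by move=> i j; exact: dC_hom.
      by near=> y; exact: homG_spec gr0.
    have cH : \forall y \near x, coer (homG (P t0) y s).
      by apply: filterS (cf_near x01) => y h; apply: coer_homG gr0 cG h.
    exact: dC_cC (dC_real (mom_dR ss cH dG)).
  move=> i j; rewrite (_ : (fun _ => _) = fun x => (complex.Re (dot (homot (P' t0) x (f s i)) (homot (P t0) x (f s j)) +
      dot (homot (P t0) x (f s i)) (homot (P' t0) x (f s j))))%:C); last by apply/funext => y; rewrite mxE.
  by apply: cC_re; apply: cCD; exact: Qdot.
have [B hB] : bdd t0 (fun z => c z.1 z.2).
  have h2 x : 0 <= x <= 1 -> `|cf x| <= 2.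
    by move=> /cf01/andP[h1 h2]; rewrite ger0_norm // (le_trans h2) // ler1n.
  have h3 (x : R) : 0 <= x <= 1 -> `|2 - 2 * x| <= 2.
    by move=> /andP[h1 h3]; rewrite ler_norml; apply/andP; split; lra.
  have bh (P1 : R -> V -> 'rV[C]_n.+2) v j : cC (fun t => P1 t v 0 j) t0 -> bdd t0 (fun z => homot (P1 z.1) z.2 v 0 j).
    move=> h; rewrite (_ : (fun _ => _) = fun z => (1 * complex.Re (P1 z.1 v 0 j)) +i* (cf z.2 * complex.Im (P1 z.1 v 0 j))).
      by apply: (bdd_comp (a := fun=> 1) h) => x x01; rewrite normr1 ler1n; split; last exact: h2.
    by apply/funext => z; rewrite mxE mul1r.
  have bd (P1 : R -> V -> 'rV[C]_n.+2) v j : cC (fun t => P1 t v 0 j) t0 -> bdd t0 (fun z => dhom (P1 z.1) z.2 v 0 j).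
    move=> h; rewrite (_ : (fun _ => _) = fun z => (0 * complex.Re (P1 z.1 v 0 j)) +i* ((2 - 2 * z.2) * complex.Im (P1 z.1 v 0 j))).
      by apply: (bdd_comp (a := fun=> 0) (b := fun x => 2 - 2 * x) h) => x x01; rewrite normr0 ler0n; split; last exact: h3.
    by apply/funext => z; rewrite mxE mul0r.
  have Qdot := Q_dot (@bdd_cst _ t0) (@bddD _ t0) (@bddM _ t0).
  apply: (Q_sum (@bdd_cst _ t0) (@bddD _ t0)) => s.
  apply: (Q_dflux (@bdd_cst _ t0) (@bddD _ t0) (@bddM _ t0)) => //; try by move=> i j; (exact: bh || exact: bd).
    move=> ss; exists (Cst n.+1 (size ss)); apply: filterS gr => t grt x x01 /=; rewrite normr0; split.
      apply: bound_mom; apply: coer_homG grt cG _; exact: nbhs_singleton (cf_near x01).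
    by rewrite /Cst expR_ge0.
  move=> i j; rewrite (_ : (fun _ => _) = fun z => (complex.Re (dot (homot (P' z.1) z.2 (f s i)) (homot (P z.1) z.2 (f s j)) +
      dot (homot (P z.1) z.2 (f s i)) (homot (P' z.1) z.2 (f s j))))%:C); last by apply/funext => y; rewrite mxE.
  by apply: bdd_re; apply: bddD; apply: Qdot => k; exact: bh.
have -> : complex.Im (fluxK f (P t0) (P' t0) G) = b 1 - b 0.
  rewrite /b [X in _ = _ - X]flux_real ?subr0; last 2 first.
  - by move=> v j; rewrite mxE /= /cf mul0r mul0r.
  - by move=> v j; rewrite mxE /= /cf mul0r mul0r.
  have E1 P1 : homot P1 1 = P1 by apply/funext => v; exact: hom1.
  rewrite !E1; congr (complex.Im (fluxK _ _ _ _)); apply/funext => s.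
  by rewrite /homG E1 (rgram_regram (gr0 s)).
apply: (dR_int01 (c := fun t x => complex.Im (c t x)) (B := B)) => //.
  near=> t => x x01; split.
    have [|d _] := near dt t _ x x01 => //; by case: d.
  by have [|_ ?] := near hB t _ x x01.
move=> x x01.
have [d hx] := dx t0 (homot (P' t0)) (dhom (P' t0)) x gr0 x01 (fun v j => dC_hom (P' t0) x v j).
have [_ ht] := nbhs_singleton dt x x01.
have -> : c t0 x = dfluxK f (homot (P t0) x) (homot (P' t0) x) (dhom (P t0) x) (dhom (P' t0) x)
    (homG (P t0) x) (varG (homot (P t0) x) (dhom (P t0) x)).
  apply: (fluxK_closed pm oriented) => //; first by move=> s; exact: homG_spec gr0.
  by move=> s; apply: coer_homG gr0 cG _; exact: nbhs_singleton (cf_near x01).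
by case: d.
Unshelve. all: by end_near. Qed.

End Potential.

(** * Hyperbolic polyhedra as complex configurations *)

Section HyperbolicConfigurations.
Context {R : realType}.
Local Notation C := R[i].

(* R^{1,n} inside C^{n+1} with its complex bilinear dot product. *)
Definition cpx n (x : pt R n) : 'rV[C]_n.+1 :=
  \row_j (if j == ord0 then (x j)%:C else 0 +i* x j).

Lemma dot_cpx n (x y : pt R n) : dot (cpx x) (cpx y) = (minkowski x y)%:C.
Proof.
rewrite /dot big_ord_recl !mxE eqxx /minkowski rcD rcM rcN rc_sum -sumrN; congr (_ + _).
apply: eq_bigr => i _; rewrite !mxE (_ : (lift ord0 i == ord0) = false); last by rewrite eq_sym (negbTE (neq_lift _ _)).
by apply: complex_eq; rewrite /= ?ReMul ?ImMul /=; ring.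
Qed.

Lemma rgram_cpx n m (w : 'I_m -> pt R n) : rgram (fun i => cpx (w i)) (gram w).
Proof. by move=> i j; rewrite dot_cpx mxE. Qed.

Lemma det_cpx n (w : 'I_n.+1 -> pt R n) :
  \det (rowsmx (fun i => cpx (w i))) = (0 +i* 1) ^+ n * (\det (wmx w))%:C.
Proof.
pose d : 'rV[C]_n.+1 := \row_j (if j == ord0 then 1 else 0 +i* 1).
have -> : rowsmx (fun i => cpx (w i)) = map_mx (real_complex R) (wmx w) *m diag_mx d.
  apply/matrixP => i j; rewrite mul_mx_diag !mxE; case: eqP => _; first by rewrite mulr1.
  by apply: complex_eq; rewrite /= ?ReMul ?ImMul /=; ring.
rewrite det_mulmx det_map_mx det_diag mulrC big_ord_recl mxE eqxx mul1r.
rewrite (eq_bigr (fun=> 0 +i* 1)) ?prodr_const ?card_ord // => i _.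
by rewrite mxE eq_sym (negbTE (neq_lift _ _)).
Qed.

Variables (V : finType) (n q : nat) (f : 'I_q -> 'I_n.+1 -> V).
Hypothesis pm : is_pseudomanifold f.
Hypothesis oriented : is_oriented f.

Let simp (o : pt R n.+1) (p : V -> pt R n.+1) s : 'I_n.+2 -> pt R n.+1 :=
  vins ord0 o (fun i => p (f s i)).

Let VK_volume o p : in_Lambda o -> (forall v, in_Lambda (p v)) ->
  \sum_s \det (rowsmx (fun i => cpx (simp o p s i))) * (mom [::] (gram (simp o p s)))%:C =
  (0 +i* 1) ^+ n.+1 * (fine (@gam R n.+1) * VK f o p)%:C.
Proof.
move=> oL pL; have [gpos gfin] := @gam_fin R n.+1.
have f0 : fine (@gam R n.+1) != 0 by rewrite gt_eqF // fine_gt0 // gpos -ge0_fin_numE // ltW.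
rewrite /VK mulr_sumr rc_sum mulr_sumr; apply: eq_bigr => s _.
have wL i : in_Lambda (simp o p s i).
  by rewrite /simp; case: (unliftP ord0 i) => [j ->|->]; rewrite ?vins_lift ?vins_id.
have -> : (fun j => match unlift ord0 j with Some i => p (f s i) | None => o end) = simp o p s.
  apply/funext => j; rewrite /simp; case: (unliftP ord0 j) => [i ->|->].
    by rewrite vins_lift.
  by rewrite vins_id.
by rewrite (Vor_formula wL) mulrA divff // mul1r det_cpx -mulrA rcM.
Qed.

(** Shrinking the imaginary parts to 0 leaves only the time coordinate, so all vertices lie on one
    line and every cone volume starts at 0. The flux swept by the homotopy is thus the whole volume,
    up to the power of i that the embedding [cpx] puts into determinants. *)
Lemma VK_EK o p : in_Lambda o -> (forall v, in_Lambda (p v)) ->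
  EK f (fun v => cpx (p v)) = - complex.Im ((0 +i* 1) ^+ n.+1 : C) * (fine (@gam R n.+1) * VK f o p).
Proof.
move=> oL pL; pose P v := cpx (p v).
have wL s i : in_Lambda (simp o p s i).
  by rewrite /simp; case: (unliftP ord0 i) => [j ->|->]; rewrite ?vins_lift ?vins_id.
have gr s : rgram (fun i => P (f s i)) (gram (fun i => p (f s i))) by exact: rgram_cpx.
have cG s : coer (gram (fun i => p (f s i))) by apply: coer_gram => i.
pose Y s := homot (fun i => cpx (simp o p s i)).
have YE s x : vins ord0 (homot (fun=> cpx o) x tt) (fun i => homot P x (f s i)) = Y s x.
  apply/funext => i; case: (unliftP ord0 i) => [j ->|->].
    by rewrite vins_lift /Y /homot /simp vins_lift.
  by rewrite vins_id /Y /homot /simp vins_id.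
pose H x s := \matrix_(i, j) (gram (simp o p s) i j + (1 - cf x ^+ 2) * imdot (cpx (simp o p s i)) (cpx (simp o p s j))).
have grY s x : rgram (Y s x) (H x s).
  exact: (@rgram_hom _ _ _ (fun i => cpx (simp o p s i)) x _ id _ (rgram_cpx _)).
pose vol x : C := \sum_s \det (rowsmx (vins ord0 (homot (fun=> cpx o) x tt) (fun i => homot P x (f s i)))) * (mom [::] (H x s))%:C.
have HE x : (fun s => row' ord0 (col' ord0 (H x s))) = homG f P x.
  apply/funext => s; rewrite (regram_minor _ (grY s x)) /homG; congr regram; apply/funext => i.
  by rewrite -YE vins_lift.
have dvol x : 0 <= x <= 1 -> dC vol x (- fluxK f (homot P x) (dhom P x) (homG f P x)).
  move=> x01; rewrite -HE.
  apply: (dC_volK pm oriented (o := fun x => homot (fun=> cpx o) x tt) (P := fun x => homot P x)).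
  - move=> j; exact: (dC_hom (fun=> cpx o) x tt j).
  - move=> v j; exact: (dC_hom P x v j).
  - by near=> y => s; rewrite YE.
  - apply: filterS (cf_near x01) => y h s; apply: coerD_imdot => //; exact: coer_gram.
rewrite /EK (int01_FTC (F := fun x => - complex.Im (vol x))).
- have -> : vol 0 = 0.
    rewrite /vol big1 // => s _; rewrite (expand_det_col _ (lift ord0 ord0)) big1 ?mul0r // => i _.
    rewrite mxE YE mxE /cz /cf mul0r mul0r mxE /=.
    by rewrite (_ : _ +i* _ = 0) ?mul0r //.
  rewrite oppr0 subr0 (_ : vol 1 = (0 +i* 1) ^+ n.+1 * (fine (@gam R n.+1) * VK f o p)%:C).
    by rewrite ImMul /= mulr0 add0r mulNr.
  rewrite -(VK_volume oL pL); apply: eq_bigr => s _; rewrite YE.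
  have -> : Y s 1 = (fun i => cpx (simp o p s i)) by apply/funext => i; rewrite /Y hom1.
  have -> : H 1 s = gram (simp o p s); last by [].
  apply/matrixP => i j; rewrite mxE (_ : cf 1 = 1); last by rewrite /cf; ring.
  by rewrite expr1n subrr mul0r addr0.
- move=> x x01.
  have g1 : \forall y \near x, forall s, rgram (fun i => homot P y (f s i)) (homG f P y s).
    by near=> y => s; exact: homG_spec gr.
  have g2 : \forall y \near x, forall s, coer (homG f P y s).
    by apply: filterS (cf_near x01) => y h s; exact: coer_homG gr cG h.
  have [d _] := @dC_fluxK R V n q f (homot P) (dhom P) (dhom P x) (ddhom P) (homG f P) x
    (fun v j => dC_hom P x v j) (fun v j => dC_dhom P x v j) g1 g2.
  by have [] := dC_cC d.
- move=> x x01; have [_ d] := dvol x x01.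
  apply: dR_eq (dRN d) _; by rewrite raddfN opprK.
Unshelve. all: by end_near. Qed.

End HyperbolicConfigurations.

From mathcomp Require polyrcf.

(** * Signs and kernels of Gram matrices in Lorentzian signature *)

Section LorentzGram.
Context {R : realType}.

(** With a negative determinant the characteristic polynomial of -B would be negative at 0 and
    positive far to the right; a positive eigenvalue of -B contradicts semidefiniteness. *)
Lemma psd_det_ge0 m (B : 'M[R]_m) : (forall v : 'rV[R]_m, 0 <= (v *m B *m v^T) 0 0) -> 0 <= \det B.
Proof.
move=> pB; rewrite leNgt; apply/negP => dB.
pose p := char_poly (- B).
have p0 : p.[0] = \det B.
  rewrite horner_coef0 char_poly_det (_ : \det (- B) = (-1) ^+ m * \det B); last by rewrite -detZ scaleN1r.
  by rewrite mulrA -expr2 sqrr_sign mul1r.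
have lp : lead_coef p = 1 by exact/monicP/char_poly_monic.
have [M hM] : exists M, forall x, x >= M -> p.[x] >= lead_coef p.
  by apply: polyrcf.poly_pinfty_gt_lc; rewrite lp.
have [||r /andP[r0 _] rr] := @poly_ivt R p 0 (Num.max 0 M).
- by rewrite le_max lexx.
- rewrite p0 (ltW dB) /= (le_trans _ (hM _ _)) ?lp ?ler01 //; by rewrite le_max lexx orbT.
have : eigenvalue (- B) r by rewrite eigenvalue_root_char.
move=> /eigenvalueP[v vB v0].
have rn0 : r != 0.
  by apply: contraTneq rr => ->; rewrite /root p0 lt_eqF.
have r1 : 0 < r by rewrite lt_neqAle eq_sym rn0.
have v1 : 0 < (v *m v^T) 0 0.
  have sq i : 0 <= v 0 i * v^T i 0 by rewrite mxE -expr2 sqr_ge0.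
  rewrite mxE lt_neqAle sumr_ge0 // andbT eq_sym psumr_neq0 //.
  have /existsP[i vi] : [exists i, v 0 i != 0].
    apply: contraNT v0; rewrite negb_exists => /forallP h; apply/eqP/rowP => i; rewrite mxE; apply/eqP.
    by have := h i; rewrite negbK.
  apply/hasP; exists i; first exact: mem_index_enum.
  by rewrite mxE -expr2 exprn_even_gt0.
have := pB v; have -> : v *m B = - r *: v by rewrite scaleNr -vB mulmxN opprK.
rewrite -scalemxAl mxE mulNr oppr_ge0 leNgt => /negP; apply; exact: mulr_gt0.
Qed.

Variable n : nat.
Implicit Types (x y : pt R n).

(** The form is negative definite on the orthogonal complement of a timelike vector, by
    Cauchy-Schwarz for the space parts. *)
Lemma orth_timelike x y : in_Lambda y -> minkowski x y = 0 ->
  minkowski x x <= 0 /\ (minkowski x x = 0 -> forall k, x k = 0).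
Proof.
move=> [hy y0] xy.
set X := \sum_(i < n) x (lift ord0 i) ^+ 2; set Y := \sum_(i < n) y (lift ord0 i) ^+ 2.
have XE : minkowski x x = x ord0 ^+ 2 - X by rewrite /minkowski expr2.
have YE : y ord0 ^+ 2 = 1 + Y by rewrite -hy /minkowski expr2 /Y; under [X in _ + X]eq_bigr do rewrite expr2; rewrite subrK.
have CS : (x ord0 * y ord0) ^+ 2 <= X * Y.
  have -> : x ord0 * y ord0 = \sum_(i < n) x (lift ord0 i) * y (lift ord0 i).
    by apply/eqP; rewrite -subr_eq0 -/(minkowski x y) xy.
  exact: CauchySchwarz_sum.
have X0 : 0 <= X by apply: sumr_ge0 => i _; exact: sqr_ge0.
have Y0 : 0 <= Y by apply: sumr_ge0 => i _; exact: sqr_ge0.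
rewrite exprMn YE in CS.
have s0 := sqr_ge0 (x ord0).
split; first by rewrite XE; nra.
rewrite XE => e; have {}e : x ord0 ^+ 2 = X by apply/eqP; rewrite -subr_eq0 e.
have x0 : x ord0 ^+ 2 = 0 by nra.
have Xz : X = 0 by rewrite -e.
move=> k; case: (unliftP ord0 k) => [j ->|->]; apply/eqP; rewrite -sqrf_eq0; last by rewrite x0.
have := Xz; rewrite /X => /eqP; rewrite psumr_eq0 => [/allP/(_ j)|i _]; last exact: sqr_ge0.
by rewrite mem_index_enum => /(_ isT).
Qed.

(** Eliminating the first vector leaves the Gram matrix of [m] vectors projected to its orthogonal
    complement, where the form is negative semidefinite; each of them contributes one sign. *)
Lemma gram_sign m (w : 'I_m.+1 -> pt R n) : (forall i, in_Lambda (w i)) ->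
  0 <= (-1) ^+ m * \det (gram w).
Proof.
move=> wL.
pose r : 'rV[R]_m := \row_j minkowski (w ord0) (w (lift ord0 j)).
pose G2 : 'M[R]_m := \matrix_(i, j) minkowski (w (lift ord0 i)) (w (lift ord0 j)).
have GE : (gram w : 'M[R]_(1 + m, 1 + m)) = block_mx 1%:M r r^T G2.
  apply/matrixP => i j; case: (split_ordP i) => i' ->; case: (split_ordP j) => j' ->.
  - rewrite block_mxEul !ord1 !mxE eqxx mulr1n; have [<- _] := wL ord0.
    by congr (minkowski (w _) (w _)); apply: val_inj.
  - rewrite block_mxEur !ord1 !mxE; congr (minkowski (w _) (w _)); apply: val_inj => //=.
  - rewrite block_mxEdl !ord1 !mxE minkowskiC; congr (minkowski (w _) (w _)); apply: val_inj => //=.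
  - rewrite block_mxEdr !mxE; congr (minkowski (w _) (w _)); exact: val_inj.
have dE : \det (gram w) = \det (G2 - r^T *m r).
  have := congr1 determinant (mulmx_block (1%:M : 'M[R]_1) 0 (- r^T) 1%:M 1%:M r r^T G2).
  rewrite det_mulmx det_lblock !det1 !mul1r -GE => ->.
  rewrite !mul0mx !addr0 !mul1mx mulmx1 addNr det_ublock det1 mul1r mulNmx addrC.
  by [].
pose B := r^T *m r - G2.
have -> : (-1) ^+ m * \det (gram w) = \det B.
  by rewrite dE -detZ scaleN1r opprB.
apply: psd_det_ge0 => v.
pose c := vcons (- \sum_j v 0 j * minkowski (w (lift ord0 j)) (w ord0)) (fun j => v 0 j).
pose x : pt R n := fun k => \sum_i c i * w i k.
have c0 : c ord0 = - \sum_j v 0 j * minkowski (w (lift ord0 j)) (w ord0).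
  by rewrite /c /vcons unlift_none.
have cl j : c (lift ord0 j) = v 0 j by rewrite /c /vcons liftK.
have x0 : minkowski x (w ord0) = 0.
  rewrite minkowski_suml big_ord_recl c0; have [-> _] := wL ord0; rewrite mulr1.
  by under [X in _ + X]eq_bigr do rewrite cl; rewrite addNr.
have [h _] := orth_timelike (wL ord0) x0.
suff -> : (v *m B *m v^T) 0 0 = - minkowski x x by rewrite oppr_ge0.
rewrite {1}/x minkowski_suml big_ord_recl [minkowski (w ord0) x]minkowskiC x0 mulr0 add0r mxE -sumrN.
apply: eq_bigr => i _; rewrite cl !mxE [minkowski _ x]minkowskiC minkowski_suml big_ord_recl c0 mulrC -mulrN; congr (_ * _).
rewrite opprD mulNr opprK mulr_suml -sumrN -big_split; apply: eq_bigr => j _ /=.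
rewrite cl !mxE big_ord1 !mxE ![minkowski (w ord0) _]minkowskiC; ring.
Qed.

(** The combination of the remaining vectors with coefficients [c] is orthogonal to each of them,
    hence isotropic and orthogonal to a timelike vector, hence zero. *)
Lemma gram_kernel_minor m (w : 'I_m.+2 -> pt R n) (l : 'I_m.+2) (c : 'I_m.+1 -> R) : (forall i, in_Lambda (w i)) ->
  (forall k, \sum_j c j * gram w (lift l j) (lift l k) = 0) ->
  forall k, \sum_j c j * gram w (lift l j) k = 0.
Proof.
move=> wL h.
pose x : pt R n := fun k => \sum_i c i * w (lift l i) k.
have xE k : minkowski x (w k) = \sum_j c j * gram w (lift l j) k.
  by rewrite minkowski_suml; apply: eq_bigr => j _; rewrite mxE.
have xx : minkowski x x = 0.
  rewrite {1}/x minkowski_suml big1 // => i _.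
  by rewrite minkowskiC xE h mulr0.
have [|_ /(_ xx) xz] := orth_timelike (wL (lift l ord0)) (x := x); first by rewrite xE h.
by move=> k; rewrite -xE /minkowski xz mul0r big1 ?subrr // => i _; rewrite xz mul0r.
Qed.

End LorentzGram.

(** * The flux of one facet through logarithmic derivatives *)

(** With l = k / dG the factors a + l D and a - l D multiply to gi ga, and the difference of their
    logarithmic derivatives is 2 l (a D' - a' D) / (gi ga). *)
Lemma dlog_alg (K : fieldType) (a a' D D' k gi dG X S ga : K) : 2%:R != 0 :> K -> gi != 0 -> dG != 0 ->
  k ^+ 2 = - (gi * dG) -> a * D' - a' * D = - S - X * ga -> ga = a ^+ 2 / gi + D ^+ 2 / dG ->
  a + k / dG * D != 0 -> a - k / dG * D != 0 ->
  X = k / 2%:R * ((a' + k / dG * D') / (a + k / dG * D) - (a' - k / dG * D') / (a - k / dG * D)) - S / ga.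
Proof.
move=> two gi0 dG0 k2 E gaE zp zm.
have zz : (a + k / dG * D) * (a - k / dG * D) = gi * ga.
  transitivity (a ^+ 2 - k ^+ 2 * D ^+ 2 / dG ^+ 2); first by field.
  by rewrite k2 gaE; field; rewrite gi0 dG0.
have ga0 : ga != 0.
  have : gi * ga != 0 by rewrite -zz mulf_neq0.
  by rewrite mulf_eq0 negb_or => /andP[].
have -> : (a' + k / dG * D') / (a + k / dG * D) - (a' - k / dG * D') / (a - k / dG * D) =
   2%:R * (k / dG) * (a * D' - a' * D) / (gi * ga).
  rewrite -zz; set l := k / dG; rewrite -/l in zp zm.
  by field; rewrite zp zm.
rewrite E.
have -> : k / 2%:R * (2%:R * (k / dG) * (- S - X * ga) / (gi * ga)) = k ^+ 2 / dG * (- S - X * ga) / (gi * ga).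
  by field; rewrite gi0 ga0 two dG0.
by rewrite k2; field; rewrite gi0 ga0.
Qed.

Section Facet.
Context {R : realType}.
Local Notation C := R[i].
Variable n : nat.
Implicit Types (p : 'I_n.+1 -> 'rV[C]_n.+2) (G : 'M[R]_n.+1) (g v : 'rV[C]_n.+2).

Lemma dot_cross0 p j : dot (p j) (cross p) = 0.
Proof.
rewrite -det_vins0; apply: (determinant_alternate (i1 := ord0) (i2 := lift ord0 j)) => // k.
by rewrite !mxE vins_id vins_lift.
Qed.

(** For invertible [G], the basis dual to the facet vectors inside their span. *)
Definition qv p G i : 'rV[C]_n.+2 := \sum_k (invmx G i k)%:C *: p k.

Lemma dot_qv p G i v : dot (qv p G i) v = \sum_k (invmx G i k)%:C * dot (p k) v.
Proof. by rewrite dot_suml; apply: eq_bigr => k _; rewrite dotZl. Qed.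

Variables (p p' : 'I_n.+1 -> 'rV[C]_n.+2) (G : 'M[R]_n.+1).
Hypothesis gr : rgram p G.
Hypothesis cG : coer G.

Let sG : G^T = G. Proof. exact: rgram_sym gr. Qed.

Lemma mom1_ibp l : 2 * \sum_k G l k * mom [:: k] G = mom [::] (row' l (col' l G)).
Proof. by rewrite mom_ibp //= big_nil add0r. Qed.

Section Nondegenerate.
Hypothesis dG : \det G != 0.

Let uG : G \in unitmx. Proof. by rewrite unitmxE unitfE. Qed.

Lemma dot_qv_p i j : dot (qv p G i) (p j) = (i == j)%:R.
Proof.
rewrite dot_qv; transitivity (((invmx G *m G) i j)%:C : C).
  by rewrite mxE rc_sum; apply: eq_bigr => k _; rewrite gr rcM.
by rewrite mulVmx // mxE; case: (i == j).
Qed.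

Lemma sum_qv i : \sum_k (G i k)%:C *: qv p G k = p i.
Proof.
transitivity (\sum_k ((1%:M : 'M[R]_n.+1) i k)%:C *: p k); last first.
  rewrite (bigD1 i) //= mxE eqxx scale1r big1 ?addr0 // => k ki.
  by rewrite mxE eq_sym (negbTE ki) scale0r.
rewrite -(mulmxV uG) /qv; under eq_bigr do rewrite scaler_sumr.
rewrite exchange_big; apply: eq_bigr => l _ /=; rewrite mxE rc_sum scaler_suml.
by apply: eq_bigr => k _; rewrite rcM scalerA.
Qed.

Lemma cross_nonzero : exists v, dot v (cross p) != 0.
Proof.
pose A := rowsmx p; pose GC := map_mx (real_complex R) G.
have AA : A *m A^T = GC by apply/matrixP => i j; rewrite rowsmxT gr mxE.
have GCu : GC \in unitmx by rewrite unitmxE det_map_mx unitfE fmorph_eq0.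
have frA : row_free A.
  by apply/row_freeP; exists (A^T *m invmx GC); rewrite mulmxA AA mulmxV.
have nfull : ~~ (1%:M <= A)%MS.
  rewrite sub1mx /row_full; move: frA; rewrite /row_free => /eqP ->; by rewrite neq_ltn ltnSn.
have /row_subPn[i vi] := nfull; exists (row i 1%:M).
rewrite -det_vins0; apply/det0P => -[c c0 cE].
have E : c 0 ord0 *: row i 1%:M + (\row_k c 0 (lift ord0 k)) *m A = 0.
  apply/rowP => j; have := congr1 (fun M : 'rV__ => M 0 j) cE; rewrite [RHS]mxE => h.
  rewrite [RHS]mxE; apply: etrans h; rewrite !mxE [in RHS]big_ord_recl !mxE vins_id !mxE.
  by congr (_ + _); apply: eq_bigr => k _; rewrite !mxE vins_lift.
have [c00|c00] := eqVneq (c 0 ord0) 0.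
  move: E; rewrite c00 scale0r add0r => E.
  have rz : \row_k c 0 (lift ord0 k) = 0 by apply: (row_free_inj frA); rewrite E mul0mx.
  move/eqP: c0; apply; apply/rowP => j; rewrite mxE; case: (unliftP ord0 j) => [k ->|->] //.
  by have := congr1 (fun M : 'rV__ => M 0 k) rz; rewrite !mxE.
move/negP: vi; apply.
have -> : row i 1%:M = (- (c 0 ord0)^-1 *: \row_k c 0 (lift ord0 k)) *m A.
  rewrite -scalemxAl; have /eqP := E; rewrite addr_eq0 => /eqP/(congr1 (fun x => (c 0 ord0)^-1 *: x)).
  by rewrite scalerA mulVf // scale1r => ->; rewrite scalerN scaleNr.
exact: submxMl.
Qed.

(** Multiply the determinants whose first rows are v and the normal: the first column of the product
    matrix vanishes below its top entry, and the remaining block is [G]. *)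
Lemma dot_cross_cross : dot (cross p) (cross p) = (\det G)%:C.
Proof.
have [v v0] := cross_nonzero; apply: (mulfI v0).
rewrite -{1}det_vins0 -{1}det_vins0 -[X in _ * X]det_tr -det_mulmx.
set M := _ *m _; have ME i j : M i j = dot (vins ord0 v p i) (vins ord0 (cross p) p j) by exact: rowsmxT.
rewrite (expand_det_col _ ord0) big_ord_recl big1 ?addr0 => [|i _]; last first.
  by rewrite ME vins_id vins_lift dot_cross0 mul0r.
rewrite ME !vins_id /cofactor expr0 mul1r -(det_map_mx (real_complex R)); congr (_ * \det _).
apply/matrixP => i j; transitivity (dot (p i) (p j)); last by rewrite gr [RHS]mxE.
by rewrite 2![LHS]mxE ME !vins_lift.
Qed.

(** The facet vectors and their normal form a basis, since the normal has nonzero square [\det G];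
    [v] is expanded in this basis. *)
Lemma dot_expand u v : dot u v = \sum_k dot v (qv p G k) * dot u (p k) +
  dot v (cross p) / (\det G)%:C * dot u (cross p).
Proof.
have dGC : (\det G)%:C != 0 :> C by rewrite fmorph_eq0.
pose w := v - \sum_k dot v (qv p G k) *: p k - (dot v (cross p) / (\det G)%:C) *: cross p.
have wp j : dot (p j) w = 0.
  rewrite /w dotDr dotNr dotZr dot_cross0 mulr0 oppr0 addr0 dotDr dotNr [dot (p j) (\sum_k _)]dotC dot_suml.
  transitivity (dot (p j) v - \sum_k dot v (qv p G k) * (G k j)%:C).
    by congr (_ - _); apply: eq_bigr => k _; rewrite dotZl gr.
  apply/eqP; rewrite subr_eq0 dotC -[in X in X == _](sum_qv j) dotC dot_suml; apply/eqP.
  by apply: eq_bigr => k _; rewrite dotZl mulrC dotC; congr (_ * (_ )%:C); rewrite -{1}sG mxE.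
have wN : dot (cross p) w = 0.
  rewrite /w dotDr dotNr dotZr dot_cross_cross mulfVK // dotDr dotNr [dot (cross p) (\sum_k _)]dotC dot_suml big1.
    by rewrite subr0 dotC subrr.
  by move=> k _; rewrite dotZl dot_cross0 mulr0.
have w0 : w = 0.
  pose M := rowsmx (vins ord0 (cross p) p).
  have uM : M \in unitmx by rewrite unitmxE det_vins0 dot_cross_cross unitfE.
  apply: trmx_inj; apply: (can_inj (mulKmx uM)); rewrite trmx0 mulmx0; apply/matrixP => i j.
  rewrite [j]ord1 !mxE (_ : \sum__ _ = dot (vins ord0 (cross p) p i) w); last first.
    by apply: eq_bigr => l _; rewrite !mxE.
  by case: (unliftP ord0 i) => [l ->|->]; rewrite ?vins_lift ?vins_id.
have -> : v = \sum_k dot v (qv p G k) *: p k + (dot v (cross p) / (\det G)%:C) *: cross p.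
  by apply/eqP; rewrite -subr_eq0 opprD addrA -/w w0.
rewrite {1}dotDr dotZr [dot u (\sum_k _)]dotC dot_suml; congr (_ + _).
  apply: eq_bigr => k _; rewrite dotZl [dot (p k) u]dotC; congr (dot _ _ * _).
  by apply/eqP; rewrite -subr_eq0 opprD addrA -/w w0.
congr (dot _ _ / _ * _); by apply/eqP; rewrite -subr_eq0 opprD addrA -/w w0.
Qed.

End Nondegenerate.
End Facet.

Section FacetForms.
Context {R : realType}.
Local Notation C := R[i].
Variable n : nat.
Implicit Types (p : 'I_n.+1 -> 'rV[C]_n.+2) (G : 'M[R]_n.+1) (g v : 'rV[C]_n.+2).

Lemma minor_sol_unique G (i : 'I_n.+1) (d : 'I_n -> C) : \det (row' i (col' i G)) != 0 ->
  (forall k, \sum_j d j * (G (lift i j) (lift i k))%:C = 0) -> forall j, d j = 0.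
Proof.
move=> d0 h; pose A := map_mx (real_complex R) (row' i (col' i G)).
have uA : A \in unitmx by rewrite unitmxE det_map_mx unitfE fmorph_eq0.
have E : (\row_j d j) *m A = 0 *m A.
  apply/rowP => k; rewrite mul0mx [RHS]mxE -[RHS](h k) mxE; apply: eq_bigr => j _; by rewrite !mxE.
by move=> j; have := congr1 (fun M : 'rV__ => M 0 j) (can_inj (mulmxK uA) E); rewrite !mxE.
Qed.

(** The two denominators pair [g] with the vectors [qv p G i] plus or minus [kap / \det G] times the
    normal. By the choice of [kap] these are isotropic, and they span the plane orthogonal to the
    ridge opposite to vertex [i]. The difference of logarithmic derivatives is the rotation about
    this ridge, up to a last term that involves only [g], the ridge and its velocity and therefore
    cancels against the neighbouring facet. *)
Lemma facet_dlog (p p' : 'I_n.+1 -> 'rV[C]_n.+2) G g (N' : 'rV[C]_n.+2) (i : 'I_n.+1) (kap : R) (h : 'I_n -> C) :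
  rgram p G -> \det G != 0 -> (forall i j, dot (p' i) (p j) + dot (p i) (p' j) = 0) ->
  (forall j, dot N' (p j) = - dot (cross p) (p' j)) -> dot N' (cross p) = 0 ->
  invmx G i i != 0 -> kap ^+ 2 = - (invmx G i i * \det G) -> \det (row' i (col' i G)) != 0 ->
  (forall k, \sum_j h j * (G (lift i j) (lift i k))%:C = dot g (p (lift i k))) ->
  dot g (qv p G i) + kap%:C / (\det G)%:C * dot (cross p) g != 0 ->
  dot g (qv p G i) - kap%:C / (\det G)%:C * dot (cross p) g != 0 ->
  dot (qv p' G i) (cross p) = kap%:C / 2%:R *
    ((dot g (qv p' G i) + kap%:C / (\det G)%:C * dot N' g) / (dot g (qv p G i) + kap%:C / (\det G)%:C * dot (cross p) g) -
     (dot g (qv p' G i) - kap%:C / (\det G)%:C * dot N' g) / (dot g (qv p G i) - kap%:C / (\det G)%:C * dot (cross p) g)) -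
   ((-1) ^+ i * \sum_j h j * dot (p' (lift i j)) (cross (vins ord0 g (fun k => p (lift i k))))) /
     (dot g g - \sum_j h j * dot g (p (lift i j))).
Proof.
move=> gr dG tan NP NN gi0 kk dm hs zp zm.
set a := dot g (qv p G i); set D := dot (cross p) g; set X := dot _ (cross p).
pose gi := (invmx G i i)%:C : C; pose dd := (\det G)%:C : C; pose b k := dot g (qv p G k).
have gi0C : gi != 0 by rewrite fmorph_eq0.
have ddC : dd != 0 by rewrite fmorph_eq0.
have uG : G \in unitmx by rewrite unitmxE unitfE.
have bG l : \sum_k b k * (G k l)%:C = dot g (p l).
  rewrite -(sum_qv p dG l) dotC dot_suml; apply: eq_bigr => k _; rewrite dotZl mulrC dotC.
  by rewrite -{1}(rgram_sym gr) mxE.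
have GiG l : \sum_k (invmx G i k)%:C * (G k l)%:C = (i == l)%:R :> C.
  rewrite -(dot_qv_p gr dG) dot_qv; by apply: eq_bigr => k _; rewrite gr.
(* The projection of [g] to the facet has coordinates [b]; removing its component along [qv p G i]
   leaves the projection to the ridge, whose i-th coordinate is zero. *)
pose H k := b k - a * (invmx G i k)%:C / gi.
have Hi : H i = 0 by rewrite /H -/gi mulfK // subrr.
have HG l : \sum_k H k * (G k l)%:C = dot g (p l) - a / gi * (i == l)%:R.
  rewrite -bG -GiG mulr_sumr -sumrB; apply: eq_bigr => k _; rewrite /H; field; exact: gi0C.
have hH j : h j = H (lift i j).
  apply/eqP; rewrite -subr_eq0; apply/eqP; move: j; apply: (minor_sol_unique dm) => k.
  under eq_bigr do rewrite mulrBl; rewrite sumrB hs.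
  have := HG (lift i k); rewrite (bigD1_ord i) //= Hi mul0r add0r (negbTE (neq_lift _ _)) mulr0 subr0 => ->.
  by rewrite subrr.
have qp k : dot (qv p' G i) (p k) = - dot (qv p G i) (p' k).
  rewrite !dot_qv -sumrN; apply: eq_bigr => l _; rewrite -mulrN; congr (_ * _).
  by apply/eqP; rewrite -addr_eq0 tan.
have qq : dot (qv p G i) (qv p' G i) = 0.
  have : dot (qv p' G i) (qv p G i) = - dot (qv p G i) (qv p' G i).
    rewrite [LHS]dotC [dot (qv p G i) (qv p' G i) in RHS]dotC !dot_qv -sumrN; apply: eq_bigr => k _.
    by rewrite [dot (p k) _]dotC qp [dot (qv p G i) _]dotC mulrN.
  rewrite dotC => /eqP; rewrite -addr_eq0 -mulr2n mulrn_eq0 /= => /eqP //.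
pose T k := dot (p' k) (cross p) * a - dot g (cross p) * dot (p' k) (qv p G i).
have TE k : T k = (-1) ^+ i * dot (p' k) (cross (vins ord0 g (fun k => p (lift i k)))).
  rewrite /T cramer (bigD1 i) //= big1 => [|l li]; last by rewrite [dot (p l) _]dotC (dot_qv_p gr dG) eq_sym (negbTE li) mulr0.
  by rewrite [dot (p i) _]dotC (dot_qv_p gr dG) eqxx mulr1 addr0 dot_cross_vinsE.
have sumT : \sum_k (invmx G i k)%:C * T k = a * X.
  transitivity ((\sum_k (invmx G i k)%:C * dot (p' k) (cross p)) * a -
     dot g (cross p) * \sum_k (invmx G i k)%:C * dot (p' k) (qv p G i)).
    rewrite mulr_suml mulr_sumr -sumrB; apply: eq_bigr => k _; rewrite /T; ring.
  by rewrite -!dot_qv [dot (qv p' G i) (qv p G i)]dotC qq mulr0 subr0 mulrC.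
have SE : (-1) ^+ i * \sum_j h j * dot (p' (lift i j)) (cross (vins ord0 g (fun k => p (lift i k)))) = \sum_k H k * T k.
  rewrite [RHS](bigD1_ord i) //= Hi mul0r add0r mulr_sumr; apply: eq_bigr => j _.
  by rewrite hH TE mulrCA.
have gaE : dot g g - \sum_j h j * dot g (p (lift i j)) = a ^+ 2 / gi + D ^+ 2 / dd.
  have -> : \sum_j h j * dot g (p (lift i j)) = \sum_k H k * dot g (p k).
    rewrite [RHS](bigD1_ord i) //= Hi mul0r add0r; by apply: eq_bigr => j _; rewrite hH.
  rewrite (dot_expand gr dG g g) -/D [dot g (cross p)]dotC -/D.
  have -> : \sum_k H k * dot g (p k) = \sum_k b k * dot g (p k) - a / gi * a.
    have -> : \sum_k b k * dot g (p k) - a / gi * a =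
       \sum_k b k * dot g (p k) - a / gi * \sum_k (invmx G i k)%:C * dot (p k) g.
      by rewrite -dot_qv [dot (qv p G i) g]dotC.
    rewrite mulr_sumr -sumrB; apply: eq_bigr => k _; rewrite /H [dot (p k) g]dotC; field; exact: gi0C.
  rewrite /dd /gi; ring.
have two : 2%:R != 0 :> C by rewrite pnatr_eq0.
have k2 : kap%:C ^+ 2 = - (gi * dd) by rewrite -[LHS]rmorphXn kk rmorphN rmorphM.
apply: (dlog_alg two gi0C ddC k2 _ gaE zp zm).
rewrite SE gaE.
have D'E : dot N' g = - \sum_k b k * dot (p' k) (cross p).
  rewrite (dot_expand gr dG N' g) NN mulr0 addr0 -sumrN; apply: eq_bigr => k _.
  by rewrite NP mulrN [dot (cross p) _]dotC.
have a'E : dot g (qv p' G i) = - (\sum_k b k * dot (p' k) (qv p G i)) + D / dd * X.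
  rewrite dotC (dot_expand gr dG (qv p' G i) g) [dot g (cross p)]dotC -sumrN; congr (_ + _).
  by apply: eq_bigr => k _; rewrite qp mulrN [dot (qv p G i) _]dotC.
have bT : \sum_k b k * T k = \sum_k H k * T k + a / gi * (a * X).
  rewrite -sumT mulr_sumr -big_split; apply: eq_bigr => k _; rewrite /H /=; field; exact: gi0C.
have bT2 : \sum_k b k * T k = (\sum_k b k * dot (p' k) (cross p)) * a - D * \sum_k b k * dot (p' k) (qv p G i).
  rewrite mulr_suml mulr_sumr -sumrB; apply: eq_bigr => k _; rewrite /T [dot g (cross p)]dotC -/D; ring.
rewrite D'E a'E.
have -> : \sum_k H k * T k = (\sum_k b k * dot (p' k) (cross p)) * a - D * (\sum_k b k * dot (p' k) (qv p G i)) - a / gi * (a * X).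
  by rewrite -bT2 bT addrK.
by field; rewrite gi0C ddC.
Qed.

(** Kernel vectors of a principal minor, extended by zero, are kernel vectors of [G]; for points of
    Lambda this is [gram_kernel_minor]. *)
Definition lor G := forall (l : 'I_n.+1) (c : 'I_n -> R), (forall k, \sum_j c j * G (lift l j) (lift l k) = 0) ->
  forall k, \sum_j c j * G (lift l j) k = 0.

(** For complex vectors a kernel vector of the Gram matrix need not be a linear relation between
    them; the condition makes degenerate facets linearly degenerate. *)
Definition kerrel p G := forall c : 'I_n.+1 -> R, (forall k, \sum_j c j * G j k = 0) -> \sum_j (c j)%:C *: p j = 0.

Lemma kerrelC p G (d : 'I_n.+1 -> C) : kerrel p G -> (forall k, \sum_j d j * (G j k)%:C = 0) -> \sum_j d j *: p j = 0.
Proof.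
move=> kp h.
have r k : \sum_j complex.Re (d j) * G j k = 0.
  have e := congr1 (@complex.Re R) (h k); rewrite Re_sum in e; apply: etrans e; apply: eq_bigr => j _.
  by rewrite ReMul /= mulr0 subr0.
have m k : \sum_j complex.Im (d j) * G j k = 0.
  have e := congr1 (@complex.Im R) (h k); rewrite Im_sum in e; apply: etrans e; apply: eq_bigr => j _.
  by rewrite ImMul /= mulr0 add0r.
have := kp _ r; have := kp _ m => E1 E2.
transitivity (\sum_j (complex.Re (d j))%:C *: p j + (0 +i* 1) *: \sum_j (complex.Im (d j))%:C *: p j).
  rewrite scaler_sumr -big_split; apply: eq_bigr => j _ /=; rewrite scalerA -scalerDl; congr (_ *: _).
  by apply: complex_eq; rewrite ?ReAdd ?ImAdd ?ReMul ?ImMul /=; ring.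
by rewrite E1 E2 scaler0 addr0.
Qed.

Lemma row_neq0 (K : nzRingType) m (v : 'rV[K]_m) : v != 0 -> exists j, v 0 j != 0.
Proof.
move=> v0; apply/existsP; apply: contraNT v0; rewrite negb_exists => /forallP h.
by apply/eqP/rowP => j; rewrite mxE; apply/eqP; have := h j; rewrite negbK.
Qed.

Lemma det_dep m (y : 'I_m -> 'rV[C]_m) (c : 'I_m -> C) j : \sum_i c i *: y i = 0 -> c j != 0 ->
  \det (rowsmx y) = 0.
Proof.
move=> h cj; apply/eqP/det0P; exists (\row_i c i).
  by apply: contraNneq cj => /(congr1 (fun M : 'rV__ => M 0 j)); rewrite !mxE => ->.
apply/rowP => k; have := congr1 (fun M : 'rV__ => M 0 k) h; rewrite summxE [RHS]mxE => e.
rewrite [RHS]mxE; apply: etrans e; rewrite mxE; apply: eq_bigr => i _; by rewrite !mxE.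
Qed.

(** A kernel vector of [G] is a relation between the vertices, so the normal vanishes and the flux
    with it. The ridge terms of the facet must then cancel among themselves: after a common factor
    their coefficients form a kernel vector of [G], while [mom1_ibp] expresses the ridge moments
    through [G]. *)
Lemma facet_deg (p p' : 'I_n.+1 -> 'rV[C]_n.+2) G g (h : 'I_n.+1 -> 'I_n -> C) :
  rgram p G -> coer G -> lor G -> kerrel p G -> kerrel p' G -> \det G = 0 ->
  (forall i, \det (row' i (col' i G)) != 0 -> forall k, \sum_j h i j * (G (lift i j) (lift i k))%:C = dot g (p (lift i k))) ->
  (forall v, dot v (cross p) = 0) /\
  \sum_i (if \det (row' i (col' i G)) == 0 then 0 else (mom [::] (row' i (col' i G)))%:C *
   (((-1) ^+ i * \sum_j h i j * dot (p' (lift i j)) (cross (vins ord0 g (fun k => p (lift i k))))) /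
     (dot g g - \sum_j h i j * dot g (p (lift i j))))) = 0.
Proof.
move=> gr cG lG kp kp' dG hs.
have /eqP/det0P[cv cv0 cvG] := dG.
pose c j := cv 0 j.
have cG0 k : \sum_j c j * G j k = 0.
  by have := congr1 (fun M : 'rV__ => M 0 k) cvG; rewrite !mxE.
have [j0 cj0] := row_neq0 cv0.
have cp := kp _ cG0.
have N0 v : dot v (cross p) = 0.
  rewrite -det_vins0; apply: (@det_dep _ _ (vins ord0 0 (fun j => (c j)%:C)) (lift ord0 j0)); last by rewrite vins_lift fmorph_eq0.
  rewrite big_ord_recl !vins_id scale0r add0r -[RHS]cp; by apply: eq_bigr => j _; rewrite !vins_lift.
split=> //.
have [i0 di0|all0] := pickP (fun i => \det (row' i (col' i G)) != 0); last first.
  by apply: big1 => i _; have := all0 i; rewrite /= => /negbFE ->.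
pose hh i := vins i 0 (h i).
have hhs i : \det (row' i (col' i G)) != 0 -> forall l, \sum_k hh i k * (G k l)%:C = dot g (p l).
  move=> di; have A k : \sum_l hh i l * (G l (lift i k))%:C = dot g (p (lift i k)).
    rewrite (bigD1_ord i) //= /hh vins_id mul0r add0r -hs //; apply: eq_bigr => j _.
    by rewrite vins_lift.
  have ci : c i != 0.
    apply: contra di => /eqP ci; apply/det0P; exists (\row_j c (lift i j)).
      apply: contraNneq cj0 => e; rewrite -/(c j0); case: (unliftP i j0) => [j ->|-> ]; last by rewrite ci.
      by have := congr1 (fun M : 'rV__ => M 0 j) e; rewrite !mxE => ->.
    apply/rowP => k; rewrite [RHS]mxE -[RHS](cG0 (lift i k)) (bigD1_ord i) //= ci mul0r add0r mxE.
    by apply: eq_bigr => j _; rewrite !mxE.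
  move=> l; case: (unliftP i l) => [k ->|->] //.
  pose e l := \sum_k hh i k * (G k l)%:C - dot g (p l).
  suff : (c i)%:C * e i = 0 by move/eqP; rewrite mulf_eq0 fmorph_eq0 (negbTE ci) subr_eq0 => /eqP.
  have <- : \sum_l (c l)%:C * e l = (c i)%:C * e i.
    rewrite (bigD1_ord i) //= big1 ?addr0 // => k _; by rewrite /e A subrr mulr0.
  have -> : \sum_l (c l)%:C * e l = \sum_k hh i k * (\sum_l c l * G l k)%:C - dot (\sum_l (c l)%:C *: p l) g.
    rewrite dot_suml; under eq_bigr do rewrite /e mulrBr mulr_sumr.
    rewrite sumrB exchange_big; congr (_ - _); apply: eq_bigr => k _; last by rewrite dotZl dotC.
    rewrite rc_sum mulr_sumr; apply: eq_bigr => l' _.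
    by rewrite rcM -{1}(rgram_sym gr) mxE mulrCA.
  by rewrite cp dot0l subr0 big1 // => k _; rewrite cG0 mulr0.
(* Solutions belonging to different ridges differ by kernel vectors, which [kerrel] annihilates on
   positions and velocities; [u] and [ga] are thus common to all ridges. *)
pose u := \sum_k hh i0 k *: p' k; pose ga := dot g g - \sum_k hh i0 k * dot g (p k).
have lin i (di : \det (row' i (col' i G)) != 0) (y : 'I_n.+1 -> 'rV[C]_n.+2) : kerrel y G ->
    \sum_k hh i k *: y k = \sum_k hh i0 k *: y k.
  move=> ky; apply/eqP; rewrite -subr_eq0 -sumrB; apply/eqP.
  under eq_bigr do rewrite -scalerBl; apply: (kerrelC ky) => k.
  by under eq_bigr do rewrite mulrBl; rewrite sumrB !hhs // subrr.
have uE i : \det (row' i (col' i G)) != 0 -> forall v, \sum_j h i j * dot (p' (lift i j)) v = dot u v.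
  move=> di v; rewrite /u -(lin i di p' kp') dot_suml (bigD1_ord i) //= dotZl /hh vins_id mul0r add0r.
  by apply: eq_bigr => j _; rewrite dotZl vins_lift.
have gaE i : \det (row' i (col' i G)) != 0 -> dot g g - \sum_j h i j * dot g (p (lift i j)) = ga.
  move=> di; rewrite /ga; congr (_ - _).
  have -> : \sum_k hh i0 k * dot g (p k) = dot (\sum_k hh i0 k *: p k) g.
    by rewrite dot_suml; apply: eq_bigr => k _; rewrite dotZl dotC.
  rewrite -(lin i di p kp) dot_suml (bigD1_ord i) //= dotZl /hh vins_id mul0r add0r.
  by apply: eq_bigr => j _; rewrite dotZl vins_lift dotC.
pose d l := dot u (cross (vins l g (fun k => p (lift l k)))).
have dG0 k : \sum_l d l * (G l k)%:C = 0.
  have := cramer u g (p k) p; rewrite !N0 !mul0r subrr => e; rewrite [RHS]e.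
  by apply: eq_bigr => l _; rewrite gr.
transitivity (ga^-1 * \sum_l d l * (mom [::] (row' l (col' l G)))%:C); last first.
  under eq_bigr => l _ do rewrite -(mom1_ibp gr cG) rcM rc_sum mulrCA mulr_sumr mulr_sumr.
  rewrite exchange_big big1 ?mulr0 // => k _ /=.
  transitivity (2%:C * (mom [:: k] G)%:C * \sum_l d l * (G l k)%:C : C); last by rewrite dG0 mulr0.
  by rewrite mulr_sumr; apply: eq_bigr => l _; rewrite rcM; ring.
rewrite mulr_sumr; apply: eq_bigr => i _; case: eqP => [di|/eqP di].
  suff -> : d i = 0 by rewrite mul0r mulr0.
  have /eqP/det0P[c' c'0 c'G] := di; have [j1 cj1] := row_neq0 c'0.
  have ck : \sum_j (c' 0 j)%:C *: p (lift i j) = 0.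
    have := kp (vins i 0 (fun j => c' 0 j)); rewrite (bigD1_ord i) //= vins_id scale0r add0r => E.
    rewrite -[RHS]E; first by apply: eq_bigr => j _; rewrite vins_lift.
    move=> k; rewrite (bigD1_ord i) //= vins_id mul0r add0r.
    have := lG i (fun j => c' 0 j); under eq_bigr do rewrite -?(vins_lift i 0 (fun j => c' 0 j)).
    move=> L; under eq_bigr do rewrite vins_lift; apply: L => k'.
    have e := congr1 (fun M : 'rV__ => M 0 k') c'G; rewrite mxE [RHS]mxE in e; apply: etrans e.
    by apply: eq_bigr => j _; rewrite !mxE.
  rewrite /d -det_vins0; apply: (@det_dep _ _ (vins ord0 0 (vins i 0 (fun j => (c' 0 j)%:C))) (lift ord0 (lift i j1))); last by rewrite !vins_lift fmorph_eq0.
  rewrite big_ord_recl !vins_id scale0r add0r (bigD1_ord i) //= !vins_lift !vins_id scale0r add0r -[RHS]ck.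
  by apply: eq_bigr => j _; rewrite !vins_lift.
by rewrite uE // gaE // /d (dot_cross_vinsE i) [RHS]mulrC mulrA; congr (_ / _); exact: mulrC.
Qed.

End FacetForms.

(** * The flux as a combination of logarithmic differentials *)

Section LogarithmicForm.
Context {R : realType}.
Local Notation C := R[i].

Lemma dC_cross k (p : R -> 'I_k -> 'rV[C]_k.+1) (p' : 'I_k -> 'rV[C]_k.+1) x :
  (forall i j, dC (fun t => p t i 0 j) x (p' i 0 j)) ->
  exists N' : 'rV[C]_k.+1, forall j, dC (fun t => cross (p t) 0 j) x (N' 0 j).
Proof.
move=> dp.
pose d j := \sum_i \sum_l (col' j (rowsmx p')) i l * cofactor (col' j (rowsmx (p x))) i l.
exists (\row_j ((-1) ^+ j * d j)) => j; rewrite mxE.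
apply: dC_ext (dCZ ((-1) ^+ j) (dC_det (Y := fun t => col' j (rowsmx (p t))) (Y' := col' j (rowsmx p')) _)) => [t|a b].
  by rewrite mxE.
by rewrite !mxE; apply: dC_ext (dp a (lift j b)) => t; rewrite !mxE.
Qed.

Lemma invmx_minor m (G : 'M[R]_m.+1) i : \det G != 0 -> \det (row' i (col' i G)) = invmx G i i * \det G.
Proof.
move=> dG; rewrite /invmx unitmxE unitfE dG !mxE mulrAC mulVf // mul1r /cofactor.
by rewrite addnn -signr_odd odd_double expr0 mul1r.
Qed.

(** If the entry were zero, the rest of row [i] of the inverse would be a kernel vector of the i-th
    minor, and [lor] would make it annihilate column [i] of [G], where the product has to be 1. *)
Lemma invmx_diag_neq0 m (G : 'M[R]_m.+1) i : \det G != 0 -> lor G -> invmx G i i != 0.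
Proof.
move=> dG lG; apply/eqP => gi.
have uG : G \in unitmx by rewrite unitmxE unitfE.
have E l : \sum_j invmx G i (lift i j) * G (lift i j) l = (i == l)%:R.
  have := congr1 (fun M : 'M[R]_m.+1 => M i l) (mulVmx uG); rewrite !mxE (bigD1_ord i) //= gi mul0r add0r.
  by move=> ->; case: (i == l).
have := lG i (fun j => invmx G i (lift i j)) _ i; rewrite E eqxx => F.
have := F _; suff h : forall k, \sum_j invmx G i (lift i j) * G (lift i j) (lift i k) = 0.
  by move=> /(_ h)/eqP; rewrite oner_eq0.
by move=> k; rewrite E (negbTE (neq_lift _ _)).
Qed.

Variables (V : finType) (n q : nat) (f : 'I_q -> 'I_n.+1 -> V).
Hypothesis pm : is_pseudomanifold f.
Hypothesis oriented : is_oriented f.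
Variable G : 'I_q -> 'M[R]_n.+1.
Hypothesis cG : forall s, coer (G s).
Hypothesis lG : forall s, lor (G s).
Hypothesis sgnG : forall s i, 0 <= - \det (row' i (col' i (G s))).
Implicit Types (P : V -> 'rV[C]_n.+2) (g : 'rV[C]_n.+2).

Definition conf P := forall s, rgram (fun i => P (f s i)) (G s) /\ kerrel (fun i => P (f s i)) (G s).

(** The radicand is nonnegative by [sgnG], which for points of Lambda expresses that the dimension
    is odd; this is what makes the coefficients [coef] real. *)
Definition kap s i : R := Num.sqrt (- \det (row' i (col' i (G s)))).

(** Pairing of [g] with one of the two isotropic directions orthogonal to the i-th ridge of facet
    [s], the sign being chosen by [b]. Degenerate facets get the neutral value 1. *)
Definition zeta g (b : bool) s i P : C := if \det (G s) == 0 then 1 else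
  let e := (kap s i)%:C / (\det (G s))%:C * dot (cross (fun i => P (f s i))) g in
  dot g (qv (fun i => P (f s i)) (G s) i) + (if b then - e else e).

(** The 4 is a factor 2 from solving [mom1_ibp] for the first moments and a factor 2 from
    [facet_dlog]. *)
Definition coef s i : R := if \det (G s) == 0 then 0 else mom [::] (row' i (col' i (G s))) * kap s i / 4.

Section Ridge.
Variables (P P' : V -> 'rV[C]_n.+2) (g : 'rV[C]_n.+2).

(** [hr] gives the coordinates of the projection of [g] to the span of a ridge, and [ups] the
    weighted correction term of [facet_dlog]. Both are computed from the ridge alone, so that
    [ridge_cancel] applies. *)
Let hr (rho : 'I_n -> V) (j : 'I_n) : C :=
  ((\row_k dot g (P (rho k))) *m invmx (map_mx (real_complex R) (regram (fun k => P (rho k))))) 0 j.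

Let ups (rho : 'I_n -> V) : C :=
  if \det (regram (fun k => P (rho k)) : 'M[R]_n) == 0 then 0 else
  (mom [::] (regram (fun k => P (rho k)) : 'M[R]_n))%:C *
  ((\sum_j hr rho j * dot (P' (rho j)) (cross (vins ord0 g (fun k => P (rho k))))) /
     (dot g g - \sum_j hr rho j * dot g (P (rho j)))).

Let hr_sol rho : \det (regram (fun k => P (rho k)) : 'M[R]_n) != 0 ->
  forall k, \sum_j hr rho j * ((regram (fun k => P (rho k)) : 'M[R]_n) j k)%:C = dot g (P (rho k)).
Proof.
move=> d0 k; pose A := map_mx (real_complex R) (regram (fun k => P (rho k)) : 'M[R]_n).
have uA : A \in unitmx by rewrite unitmxE det_map_mx unitfE fmorph_eq0.
have := congr1 (fun M : 'rV__ => M 0 k) (mulmxKV uA (\row_k dot g (P (rho k)))).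
by rewrite mxE [RHS]mxE => <-; apply: eq_bigr => j _; rewrite [A j k]mxE.
Qed.

Let ups_alt (rho : 'I_n -> V) (s : 'S_n) : ups (fun i => rho (s i)) = (-1) ^+ s * ups rho.
Proof.
pose A := regram (fun k => P (rho k)) : 'M[R]_n.
have AE : regram (fun k => P (rho (s k))) = row_perm s (col_perm s A).
  by rewrite (regram_perm (fun k => P (rho k)) s); apply/matrixP => i j; rewrite !mxE.
have dE : \det (regram (fun k => P (rho (s k))) : 'M[R]_n) = \det A.
  rewrite AE row_permE col_permE !det_mulmx !det_perm odd_permV mulrCA -expr2 sqrr_sign; exact: mulr1.
rewrite /ups dE -/A; case: eqP => [_|/eqP d0]; first by rewrite mulr0.
have hE j : hr (fun i => rho (s i)) j = hr rho (s j).
  have d1 : \det (regram (fun k => P (rho (s k))) : 'M[R]_n) != 0 by rewrite dE.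
  pose B := map_mx (real_complex R) (regram (fun k => P (rho (s k))) : 'M[R]_n).
  have uB : B \in unitmx by rewrite unitmxE det_map_mx unitfE fmorph_eq0.
  suff E : (\row_j hr rho (s j)) *m B = \row_k dot g (P (rho (s k))).
    by rewrite /hr -/B -E mulmxK // mxE.
  apply/rowP => k; rewrite mxE [RHS]mxE -(hr_sol d0) [RHS](reindex_inj (@perm_inj _ s)).
  by apply: eq_bigr => l _; rewrite mxE [B l k]mxE !mxE.
rewrite (_ : mom [::] _ = mom [::] A); last by rewrite (regram_perm (fun k => P (rho k)) s) mom_perm.
rewrite [RHS]mulrCA; congr (_ * _); rewrite mulrA; congr (_ / (_ - _)).
  rewrite [in RHS](reindex_inj (@perm_inj _ s)) mulr_sumr; apply: eq_bigr => j _.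
  by rewrite hE (cross_vins_perm g (fun k => P (rho k))) dotZr mulrCA.
by rewrite [RHS](reindex_inj (@perm_inj _ s)); apply: eq_bigr => j _; rewrite hE.
Qed.

(** Flux minus logarithmic sum is a multiple of the sum of [ups] over all ridges. The vectors [P']
    and [N'] stand for the velocities of vertices and normals; the product identities they must
    satisfy are taken as hypotheses. *)
Lemma fluxK_dlog (N' : 'I_q -> 'rV[C]_n.+2) : conf P ->
  (forall s, kerrel (fun i => P' (f s i)) (G s)) ->
  (forall s i j, dot (P' (f s i)) (P (f s j)) + dot (P (f s i)) (P' (f s j)) = 0) ->
  (forall s j, dot (N' s) (P (f s j)) = - dot (cross (fun i => P (f s i))) (P' (f s j))) ->
  (forall s, \det (G s) != 0 -> dot (N' s) (cross (fun i => P (f s i))) = 0) ->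
  (forall b s i, zeta g b s i P != 0) ->
  fluxK f P P' G = \sum_s \sum_i (coef s i)%:C *
    (if \det (G s) == 0 then 0 else
    (dot g (qv (fun i => P' (f s i)) (G s) i) + (kap s i)%:C / (\det (G s))%:C * dot (N' s) g) / zeta g false s i P -
    (dot g (qv (fun i => P' (f s i)) (G s) i) - (kap s i)%:C / (\det (G s))%:C * dot (N' s) g) / zeta g true s i P).
Proof.
move=> cP kP' tan NP NN z0.
apply/eqP; rewrite -subr_eq0 -sumrB; apply/eqP.
transitivity (- 2^-1 * \sum_s \sum_(l < n.+1) (-1) ^+ l * ups (fun k => f s (lift l k))); last first.
  by rewrite (ridge_cancel pm oriented ups_alt) mulr0.
rewrite mulr_sumr; apply: eq_bigr => s _; have [gr kr] := cP s.
have mE (i : 'I_n.+1) : regram (fun k => P (f s (lift i k))) = row' i (col' i (G s)).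
  by rewrite (regram_minor i gr).
have hs (i : 'I_n.+1) : \det (row' i (col' i (G s))) != 0 -> forall k,
    \sum_j hr (fun k => f s (lift i k)) j * (G s (lift i j) (lift i k))%:C = dot g (P (f s (lift i k))).
  rewrite -mE => d k; have := hr_sol d k => <-; apply: eq_bigr => j _.
  by rewrite mE !mxE.
have [d0|d0] := eqVneq (\det (G s)) 0.
  have [N0 S0] := facet_deg gr (cG s) (@lG s) kr (kP' s) d0 hs.
  rewrite /flux big1 ?sub0r; last by move=> k _; rewrite N0 mul0r.
  rewrite big1 ?oppr0 => [|i _]; last by rewrite mulr0.
  rewrite (_ : \sum_(l < n.+1) _ = 0) ?mulr0 //.
  apply: etrans S0; apply: eq_bigr => i _; rewrite /ups mE; case: ifP => _; first by rewrite mulr0.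
  by rewrite mulrCA; congr (_ * _); rewrite mulrA.
have uG : G s \in unitmx by rewrite unitmxE unitfE.
have sI : (invmx (G s))^T = invmx (G s) by rewrite trmx_inv (rgram_sym gr).
pose J i := mom [::] (row' i (col' i (G s))).
have momE k : (mom [:: k] (G s))%:C = 2^-1 * \sum_i (invmx (G s) i k)%:C * (J i)%:C :> C.
  have -> : \sum_i (invmx (G s) i k)%:C * (J i)%:C = (2 * mom [:: k] (G s))%:C :> C.
    under eq_bigr => i _ do rewrite -rcM; rewrite -rc_sum; congr (_%:C).
    under eq_bigr => i _ do rewrite /J -(mom1_ibp gr (cG s)) mulrCA mulr_sumr.
    rewrite -mulr_sumr; congr (_ * _); rewrite exchange_big /=.
    transitivity (\sum_l ((1%:M : 'M[R]_n.+1) k l) * mom [:: l] (G s)).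
      apply: eq_bigr => l _; rewrite -(mulVmx uG) mxE mulr_suml; apply: eq_bigr => i _.
      by rewrite -{1}sI mxE mulrA.
    rewrite (bigD1 k) //= mxE eqxx mul1r big1 ?addr0 // => l lk.
    by rewrite mxE eq_sym (negbTE lk) mul0r.
  rewrite rcM (_ : 2%:C = 2); last by rewrite rmorph_nat.
  by rewrite mulKf // pnatr_eq0.
have -> : flux (fun i => P (f s i)) (fun i => P' (f s i)) (G s) =
   \sum_i 2^-1 * (J i)%:C * dot (qv (fun i => P' (f s i)) (G s) i) (cross (fun i => P (f s i))).
  rewrite /flux; under eq_bigr => k _ do rewrite momE mulrCA mulr_sumr mulr_sumr.
  rewrite exchange_big; apply: eq_bigr => i _ /=; rewrite dot_qv mulr_sumr; apply: eq_bigr => k _.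
  by ring.
rewrite -sumrB mulr_sumr; apply: eq_bigr => i _.
have gi0 := invmx_diag_neq0 i d0 (@lG s).
have dm : \det (row' i (col' i (G s))) != 0 by rewrite invmx_minor // mulf_neq0.
have kk : kap s i ^+ 2 = - (invmx (G s) i i * \det (G s)).
  by rewrite -invmx_minor // sqr_sqrtr.
have zE b : zeta g b s i P = dot g (qv (fun i => P (f s i)) (G s) i) +
    (if b then - ((kap s i)%:C / (\det (G s))%:C * dot (cross (fun i => P (f s i))) g)
     else (kap s i)%:C / (\det (G s))%:C * dot (cross (fun i => P (f s i))) g) by rewrite /zeta (negbTE d0).
have zp := z0 false s i; have zm := z0 true s i; rewrite !zE in zp zm.
rewrite !zE (facet_dlog gr d0 (tan s) (NP s) (NN s d0) gi0 kk dm (hs i dm) zp zm).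
rewrite /coef (negbTE d0) /ups mE (negbTE dm) -/(J i) !rcM.
have -> : (4^-1 : R)%:C = 2^-1 * 2^-1 :> C by rewrite fmorphV -invfM -natrM rmorph_nat.
set A := (X in _ / 2%:R * X); set S := \sum_j _; set Ga := dot g g - _.
set A2 := (X in _ * (2^-1 / 2) * X); have -> : A2 = A by [].
by ring.
Qed.

End Ridge.

(** Along a path the hypotheses of [fluxK_dlog] come from differentiating what is constant: Gram
    products, kernel relations, orthogonality of the normal and its square. *)
Lemma dlog_flux (P : R -> V -> 'rV[C]_n.+2) (P' : V -> 'rV[C]_n.+2) (z' : bool -> 'I_q -> 'I_n.+1 -> C) t g :
  (forall v j, dC (fun t => P t v 0 j) t (P' v 0 j)) ->
  (\forall t \near t, conf (P t)) -> (forall b s i, zeta g b s i (P t) != 0) ->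
  (forall b s i, dC (fun t => zeta g b s i (P t)) t (z' b s i)) ->
  fluxK f (P t) P' G = \sum_s \sum_i (coef s i)%:C *
    (z' false s i / zeta g false s i (P t) - z' true s i / zeta g true s i (P t)).
Proof.
move=> dP cP z0 dz; have cPt := nbhs_singleton cP.
have exN s : exists N' : 'rV[C]_n.+2, forall j, dC (fun t => cross (fun i => P t (f s i)) 0 j) t (N' 0 j).
  by apply: (dC_cross (p := fun t i => P t (f s i)) (p' := fun i => P' (f s i))) => i j; exact: dP.
pose N' s := sval (cid (exN s)).
have dN s : forall j, dC (fun t => cross (fun i => P t (f s i)) 0 j) t (N' s 0 j) by exact: (svalP (cid (exN s))).
rewrite (@fluxK_dlog (P t) P' g N') //.
- apply: eq_bigr => s _; apply: eq_bigr => i _; have [d0|d0] := eqVneq (\det (G s)) 0.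
    by rewrite /coef d0 eqxx !mul0r.
  have zE b : z' b s i = dot g (qv (fun i => P' (f s i)) (G s) i) +
      (if b then - ((kap s i)%:C / (\det (G s))%:C * dot (N' s) g) else (kap s i)%:C / (\det (G s))%:C * dot (N' s) g).
    apply: dC_unique (dz b s i) _; rewrite /zeta (negbTE d0); apply: dCD.
      have := @dC_dot _ _ (fun=> g) (fun t => qv (fun i => P t (f s i)) (G s) i) 0 (qv (fun i => P' (f s i)) (G s) i) t.
      rewrite dot0l add0r; apply=> j; first by rewrite mxE; exact: dC_cst.
      rewrite /qv summxE; under eq_bigr do rewrite mxE.
      apply: dC_ext (dC_sum _ (fun k => dCZ (invmx (G s) i k)%:C (dP (f s k) j))) => y.
      by rewrite summxE; apply: eq_bigr => k _; rewrite mxE.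
    have dNg := @dC_dot _ _ (fun t => cross (fun i => P t (f s i))) (fun=> g) (N' s) 0 t (dN s) (fun j => dC_eq (dC_cst (g 0 j) t) (esym (mxE _ _ _ _))).
    have {}dNg := dC_eq dNg (etrans (congr1 _ (etrans (dotC _ _) (dot0l _))) (addr0 _)).
    by case: b; [apply: dCN|]; exact: dCZ.
  by rewrite !zE.
- move=> s c h; have [_ k0] := cPt s.
  apply/rowP => j; rewrite summxE [RHS]mxE.
  apply: (@dC_unique _ (fun t => \sum_k (c k)%:C * P t (f s k) 0 j) t); last first.
    apply: dC_near (dC_cst 0 t); apply: filterS cP => y cy; have [_ ky] := cy s.
    have e := congr1 (fun M : 'rV__ => M 0 j) (ky c h); rewrite summxE [RHS]mxE in e.
    apply: etrans (esym e) _; by apply: eq_bigr => k _; rewrite mxE.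
  apply: dC_eq (dC_sum _ (fun k => dCZ (c k)%:C (dP (f s k) j))) _.
  by apply: eq_bigr => k _; rewrite mxE.
- move=> s i j; apply: dC_unique (dC_dot (dP (f s i)) (dP (f s j))) _.
  apply: dC_near (dC_cst (G s i j)%:C t); apply: filterS cP => y cy; have [gy _] := cy s.
  by rewrite gy.
- move=> s j; apply/eqP; rewrite -addr_eq0; apply/eqP.
  apply: dC_unique (dC_dot (dN s) (dP (f s j))) _.
  apply: dC_ext (dC_cst 0 t) => y.
  by rewrite dotC (dot_cross0 (fun i => P y (f s i))).
- move=> s d0; have : dot (N' s) (cross (fun i => P t (f s i))) + dot (cross (fun i => P t (f s i))) (N' s) = 0.
    apply: dC_unique (dC_dot (dN s) (dN s)) _.
    apply: dC_near (dC_cst (\det (G s))%:C t); apply: filterS cP => y cy; have [gy _] := cy s.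
    by rewrite (dot_cross_cross gy).
  by rewrite [X in _ + X]dotC -mulr2n => /eqP; rewrite mulrn_eq0 /= => /eqP.
Qed.

Lemma dR_EK_dlog (P P' : R -> V -> 'rV[C]_n.+2) (z' : bool -> 'I_q -> 'I_n.+1 -> C) t0 g :
  (\forall t \near t0, forall v j, dC (fun t => P t v 0 j) t (P' t v 0 j)) ->
  (forall v j, cC (fun t => P' t v 0 j) t0) ->
  (\forall t \near t0, conf (P t)) -> (forall b s i, zeta g b s i (P t0) != 0) ->
  (forall b s i, dC (fun t => zeta g b s i (P t)) t0 (z' b s i)) ->
  dR (fun t => EK f (P t)) t0 (\sum_s \sum_i coef s i *
    complex.Im (z' false s i / zeta g false s i (P t0) - z' true s i / zeta g true s i (P t0))).
Proof.
move=> dP cP' cP z0 dz.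
apply: dR_eq (dR_EK pm oriented dP cP' _ cG) _.
  by apply: filterS cP => t c s; case: (c s).
rewrite (dlog_flux (nbhs_singleton dP) cP z0 dz) Im_sum; apply: eq_bigr => s _.
rewrite Im_sum; apply: eq_bigr => i _; by rewrite ImMul /= mul0r addr0.
Qed.

End LogarithmicForm.

(** * Continuity and differentiability of simple roots *)

Section RootBranches.
Context {R : realType}.
Local Notation C := R[i].
Implicit Types (t : R) (z : C).

(** At a zero of [f] the product rule asks only continuity of [g]; it will be applied to the
    reciprocal of a divided difference. *)
Lemma dR_mul0 (f g : R -> R) x a : dR f x a -> f x = 0 -> {for x, continuous g} ->
  dR (fun y => f y * g y) x (a * g x).
Proof.
move=> df f0 cg.
have E (k : R -> R) : (fun h : R => h^-1 *: (k (h *: (1 : R) + x) - k x)) =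
    (fun h => h^-1 *: (k (h + x) - k x)).
  by apply/funext => h; rewrite [h *: 1]mulr1.
have cf : h^-1 *: (f (h + x) - f x) @[h --> 0^'] --> (a : R).
  have [/cvg_ex[l /= cl] dl] := df; rewrite E in cl.
  have l0 : l = a; last by rewrite -[X in _ --> X]l0.
  by rewrite -dl /derive E; exact/esym/cvg_lim.
have cg' : g (h + x) @[h --> 0^'] --> g x.
  have s : (h + x) @[h --> (0 : R)] --> x.
    by rewrite -[X in _ --> X]add0r; apply: cvgD; [exact: cvg_id|exact: cvg_cst].
  have c1 : g (h + x) @[h --> (0 : R)] --> g x by apply: (@cvg_comp _ _ _ (fun h => h + x) g _ _ _ s); exact: cg.
  exact: cvg_within_filter c1.
have c0 : h^-1 *: (f (h + x) * g (h + x) - f x * g x) @[h --> 0^'] --> (a * g x : R).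
  rewrite (_ : (fun h => _) = (fun h => (h^-1 *: (f (h + x) - f x)) * g (h + x))); first exact: cvgM.
  by apply/funext => h; rewrite f0 mul0r !subr0 /GRing.scale /= mulrA.
rewrite /dR; apply: DeriveDef; first by apply/cvg_ex; exists (a * g x); rewrite (E (fun y => f y * g y)).
by rewrite /derive (E (fun y => f y * g y)); exact/cvg_lim.
Qed.

Lemma dC_mul0 (f g : R -> C) x a : dC f x a -> f x = 0 -> cC g x -> dC (fun y => f y * g y) x (a * g x).
Proof.
move=> [f1 f2] f0 [g1 g2]; have fr : complex.Re (f x) = 0 by rewrite f0.
have fi : complex.Im (f x) = 0 by rewrite f0.
split.
  rewrite ReMul; apply: dR_ext (dRB (dR_mul0 f1 fr g1) (dR_mul0 f2 fi g2)) => y; by rewrite ReMul.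
rewrite ImMul; apply: dR_ext (dRD (dR_mul0 f1 fr g2) (dR_mul0 f2 fi g1)) => y; by rewrite ImMul.
Qed.

Lemma nsqM (a b : C) : nsq (a * b) = nsq a * nsq b.
Proof. by rewrite /nsq ReMul ImMul; ring. Qed.

Lemma nsq_ge0 (a : C) : 0 <= nsq a. Proof. by rewrite addr_ge0 ?sqr_ge0. Qed.

Lemma nsqD (a b : C) : nsq (a + b) <= 2 * nsq a + 2 * nsq b.
Proof. by rewrite /nsq ReAdd ImAdd; have := sqr_ge0 (complex.Re a - complex.Re b); have := sqr_ge0 (complex.Im a - complex.Im b); nra. Qed.

Lemma nsqN (a : C) : nsq (- a) = nsq a.
Proof. by rewrite /nsq !raddfN /= !sqrrN. Qed.

Lemma nsq_prod (I : Type) (r : seq I) (F : I -> C) : nsq (\prod_(i <- r) F i) = \prod_(i <- r) nsq (F i).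
Proof.
elim: r => [|i r IH]; first by rewrite !big_nil /nsq /= expr1n expr0n addr0.
by rewrite !big_cons nsqM IH.
Qed.

Lemma cC_nsq (f : R -> C) t : cC f t -> {for t, continuous (fun y => nsq (f y))}.
Proof. by move=> [f1 f2]; rewrite /nsq; apply: continuousD; rewrite /=; apply: continuousM. Qed.

Definition rts (p : {poly C}) : seq C := sval (closed_field_poly_normal p).

Lemma rtsE (p : {poly C}) : p = lead_coef p *: \prod_(z <- rts p) ('X - z%:P).
Proof. exact: (svalP (closed_field_poly_normal p)). Qed.

Lemma size_rts (p : {poly C}) d : size p = d.+1 -> size (rts p) = d.
Proof.
move=> sp; have p0 : lead_coef p != 0 by rewrite lead_coef_eq0 -size_poly_eq0 sp.
by have := congr1 (fun q : {poly C} => size q) (rtsE p); rewrite size_scale // size_prod_XsubC sp => -[].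
Qed.

Lemma mem_rts (p : {poly C}) z : p != 0 -> (z \in rts p) = root p z.
Proof.
move=> p0; rewrite [in RHS](rtsE p) rootZ ?lead_coef_eq0 //; by rewrite root_prod_XsubC.
Qed.

Lemma horner_rts (p : {poly C}) y : p.[y] = lead_coef p * \prod_(z <- rts p) (y - z).
Proof.
by rewrite {1}(rtsE p) hornerZ horner_prod; congr (_ * _); apply: eq_bigr => z _; rewrite hornerXsubC.
Qed.

Definition sep (p : {poly C}) := forall z, root p z -> p^`().[z] != 0.

Lemma uniq_rts (p : {poly C}) : p != 0 -> sep p -> uniq (rts p).
Proof.
move=> p0 sp; apply: contraT => nu.
have [z [s1 [s2 E]]] : exists z s1 s2, perm_eq (rts p) [:: z, z & s1] /\ s2 = s1.
  elim: (rts p) nu => //= z s IH; rewrite negb_and negbK => /orP[zs|/IH[y [s1 [_ [h _]]]]].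
    exists z, (rem z s), (rem z s); split => //; by rewrite perm_cons perm_to_rem.
  exists y, (z :: s1), (z :: s1); split => //.
  rewrite (@perm_trans _ (z :: [:: y, y & s1])) ?perm_cons //.
  by rewrite (perm_catCA [:: z] [:: y; y] s1).
case: E => pe _.
have rz : root p z by rewrite -mem_rts // (perm_mem pe) inE eqxx.
have := sp z rz; rewrite (rtsE p) (perm_big _ pe) /= !big_cons derivZ hornerZ.
rewrite (_ : (_^`()).[z] = 0) ?mulr0 ?eqxx //.
rewrite !derivM !derivXsubC !(hornerXsubC, hornerM, hornerC, hornerD) subrr; ring.
Qed.

Variables (p : R -> {poly C}) (d : nat).

Definition good t := (forall k, C1 (fun t => (p t)`_k) t) /\ (\forall y \near t, size (p y) = d.+1).

Lemma good_neq0 t : good t -> p t != 0.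
Proof. by move=> [_ /nbhs_singleton s]; rewrite -size_poly_eq0 s. Qed.

Lemma horner_size y z : size (p y) = d.+1 -> (p y).[z] = \sum_(k < d.+1) (p y)`_k * z ^+ k.
Proof. by move=> s; rewrite horner_coef s. Qed.

Lemma cC_horner t (z : R -> C) : good t -> cC z t -> cC (fun y => (p y).[z y]) t.
Proof.
move=> [hc hs] cz; apply: (@cC_near _ (fun y => \sum_(k < d.+1) (p y)`_k * z y ^+ k)).
  by apply: filterS hs => y s; rewrite horner_size.
apply: (Q_sum (@cC_cst _ ^~ t) (fun f g => @cCD _ f g t)) => k.
apply: cCM; first exact: C1_cC.
elim: (k : nat) => [|m IH]; first by apply: cC_ext (cC_cst 1 t).
by apply: cC_ext (cCM cz IH) => y; rewrite exprS.
Qed.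

(** The value at z is the leading coefficient times the product of the differences with the roots.
    It tends to 0 while the leading coefficient stays away from 0, so some root comes close to z. *)
Lemma near_root t z e : good t -> root (p t) z -> 0 < e ->
  \forall y \near t, exists2 x, root (p y) x & nsq (x - z) < e.
Proof.
move=> gt rz e0; have [hc hs] := gt.
have st := nbhs_singleton hs.
pose L := nsq ((p t)`_d).
have L0 : 0 < L.
  apply: nsq_gt0; have := good_neq0 gt; rewrite -lead_coef_eq0 lead_coefE st //.
have c1 : \forall y \near t, L / 2 < nsq ((p y)`_d).
  by apply: cvgr_gt (cC_nsq (C1_cC (hc d))) _ _; rewrite -/L; lra.
have c2 : \forall y \near t, nsq ((p y).[z]) < L / 2 * e ^+ d.
  have cz := cC_nsq (cC_horner gt (cC_cst z t)).
  apply: cvgr_lt cz _ _; move/rootP: rz => ->; rewrite /nsq /= expr0n addr0 mulr_gt0 ?exprn_gt0 //; lra.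
near=> y.
have sy : size (p y) = d.+1 by near: y.
have [/hasP[x xr xe]|/hasPn h] := boolP (has (fun x => nsq (x - z) < e) (rts (p y))).
  by exists x => //; rewrite -mem_rts // -size_poly_eq0 sy.
have : nsq ((p y).[z]) < L / 2 * e ^+ d by near: y.
rewrite horner_rts nsqM nsq_prod ltNge => /negP[].
apply: ler_pM; [lra|by rewrite exprn_ge0 // ltW| |].
  rewrite lead_coefE sy; apply: ltW; near: y; exact: c1.
rewrite -(size_rts sy); elim: (rts (p y)) h => [|x s IH] h; first by rewrite big_nil expr0.
rewrite big_cons /= exprS; apply: ler_pM; rewrite ?exprn_ge0 ?(ltW e0) //.
  by have := h x; rewrite inE eqxx => /(_ isT); rewrite -leNgt -nsqN opprB.
by apply: IH => x' x's; apply: h; rewrite inE x's orbT.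
Unshelve. all: by end_near. Qed.

(** Implicit differentiation by divided differences: - p_y(z(t)) = (z(y) - z(t)) Q(y), where Q is
    continuous with value p_t'(z(t)) at t. *)
Lemma dC_root t (z : R -> C) (c' : nat -> C) : good t -> cC z t -> (\forall y \near t, root (p y) (z y)) ->
  (p t)^`().[z t] != 0 -> (forall k, dC (fun y => (p y)`_k) t (c' k)) ->
  dC z t (- (\sum_(k < d.+1) c' k * z t ^+ k) / (p t)^`().[z t]).
Proof.
move=> gt cz rz sz dc; have [hc hs] := gt.
pose Q y := \sum_(k < d.+1) (p y)`_k * \sum_(i < k) z y ^+ (k.-1 - i) * z t ^+ i.
have cX k : cC (fun y => z y ^+ k) t.
  elim: k => [|m IH]; first by apply: cC_ext (cC_cst 1 t).
  by apply: cC_ext (cCM cz IH) => y; rewrite exprS.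
have cQ : cC Q t.
  apply: (Q_sum (@cC_cst _ ^~ t) (fun f g => @cCD _ f g t)) => k; apply: cCM; first exact: C1_cC.
  apply: (Q_sum (@cC_cst _ ^~ t) (fun f g => @cCD _ f g t)) => i; apply: cCM => //; exact: cC_cst.
have st := nbhs_singleton hs.
have QE : Q t = (p t)^`().[z t].
  rewrite [in RHS]/deriv horner_poly st /Q big_ord_recl big_ord0 mulr0 add0r; apply: eq_bigr => k _.
  rewrite lift0.
  have -> : \sum_(i < k.+1) z t ^+ (k.+1.-1 - i) * z t ^+ i = z t ^+ k *+ k.+1.
    rewrite (eq_bigr (fun=> z t ^+ k)) => [|i _]; first by rewrite sumr_const card_ord.
    by rewrite -exprD subnK // -ltnS.
  by rewrite mulrnAr mulrnAl.
have nQ : \forall y \near t, Q y != 0 by apply: cC_near_neq0 cQ _; rewrite QE.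
pose phi y := - (p y).[z t].
have dphi : dC phi t (- (\sum_(k < d.+1) c' k * z t ^+ k)).
  have dk (k : 'I_d.+1) : dC (fun y => (p y)`_k * z t ^+ k) t (c' k * z t ^+ k).
    by apply: dC_eq (dCM (dc k) (dC_cst (z t ^+ k) t)) _; rewrite mulr0 addr0.
  apply: dCN; apply: dC_near (dC_sum (index_enum _) dk).
  by apply: filterS hs => y s; rewrite horner_size.
have phi0 : phi t = 0 by rewrite /phi; have /nbhs_singleton/rootP -> := rz; rewrite oppr0.
have iQ : cC (fun y => (Q y)^-1) t by apply: cC_inv => //; rewrite QE.
have dd := dC_mul0 dphi phi0 iQ; rewrite QE in dd.
apply: dC_near (dC_eq (dCD (dC_cst (z t) t) dd) (add0r _)).
near=> y; have Qy : Q y != 0 by near: y.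
have ry : root (p y) (z y) by near: y.
have sy : size (p y) = d.+1 by near: y.
suff E : phi y = (z y - z t) * Q y by rewrite E mulfK // addrC subrK.
rewrite /phi -[- _]add0r -(rootP ry) !horner_size // -sumrB /Q mulr_sumr; apply: eq_bigr => k _.
rewrite -mulrBr mulrCA; congr (_ * _); exact: subrXX.
Unshelve. all: by end_near. Qed.

End RootBranches.

(** * Local enumeration of all roots by C^1 branches *)

Section Branches.
Context {R : realType}.
Local Notation C := R[i].

Definition derC (f : R -> C) (t : R) : C :=
  derive1 (fun t => complex.Re (f t)) t +i* derive1 (fun t => complex.Im (f t)) t.

Lemma derCE (f : R -> C) t a : dC f t a -> derC f t = a.
Proof.
by move=> [d1 d2]; apply: complex_eq; rewrite /= derive1E; [exact: (@derive_val _ _ _ _ _ _ _ d1)|exact: (@derive_val _ _ _ _ _ _ _ d2)].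
Qed.

Lemma C1P (f : R -> C) t : C1 f t -> \forall y \near t, dC f y (derC f y) /\ cC (derC f) y.
Proof.
move=> [f' h]; have h2 := near_join h; near=> y.
have [|d c] := near h y => //; split; first by rewrite (derCE d).
apply: cC_near c; have : \forall x \near y, dC f x (f' x) /\ cC f' x by near: y; exact: h2.
by apply: filterS => x [dx _]; rewrite (derCE dx).
Unshelve. all: by end_near. Qed.

Lemma cC_of_nsq (f : R -> C) t : (forall e : R, 0 < e -> \forall y \near t, nsq (f y - f t) < e) -> cC f t.
Proof.
move=> h; have h2 (e : R) : 0 < e -> \forall y \near t, `|complex.Re (f t) - complex.Re (f y)| < e /\ `|complex.Im (f t) - complex.Im (f y)| < e.
  move=> e0; have := h (e ^+ 2); rewrite exprn_gt0 // => /(_ isT); apply: filterS => y.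
  rewrite /nsq !raddfB /= => hy.
  have lt (a b : R) : a ^+ 2 + b ^+ 2 < e ^+ 2 -> `|a| < e.
    move=> hab; rewrite ltNge; apply/negP => ea; have b0 := sqr_ge0 b.
    have a2 : `|a| ^+ 2 = a ^+ 2 by rewrite real_normK ?num_real.
    nra.
  by split; rewrite distrC; [apply: lt hy|apply: (lt _ (complex.Re (f y) - complex.Re (f t))); rewrite addrC].
by split; apply/cvgrPdist_lt => e e0; apply: filterS (h2 e e0) => y [].
Qed.

Lemma Re_horner_deriv (p : {poly C}) d z : size p = d.+1 ->
  p^`().[z] = \sum_(i < d) (p`_i.+1 *+ i.+1) * z ^+ i.
Proof. by move=> s; rewrite /deriv horner_poly s. Qed.

Variables (p : R -> {poly C}) (d : nat).

(** The factor 4 leaves room for [nsqD], which loses a factor 2 when squared distances are added. *)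
Lemma min_sep (q : {poly C}) : q != 0 -> exists2 e : R, 0 < e &
  forall x y, root q x -> root q y -> x != y -> 4 * e <= nsq (x - y).
Proof.
move=> q0.
have [e e0 he] : exists2 e : R, 0 < e & forall x y, x \in rts q -> y \in rts q -> x != y -> 4 * e <= nsq (x - y).
  have H1 (z0 : C) : forall s : seq C, exists2 e : R, 0 < e & forall x, x \in s -> x != z0 -> 4 * e <= nsq (x - z0).
    elim=> [|y s [e e0 he]]; first by exists 1.
    have [->|yz] := eqVneq y z0.
      exists e => // x; rewrite inE => /orP[/eqP->|]; [by rewrite eqxx|exact: he].
    exists (Num.min e (nsq (y - z0) / 4)).
      by rewrite lt_min e0 divr_gt0 // nsq_gt0 // subr_eq0.
    move=> x; rewrite inE => /orP[/eqP-> _|xs xz].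
      have : Num.min e (nsq (y - z0) / 4) <= nsq (y - z0) / 4 by rewrite ge_min lexx orbT.
      lra.
    apply: le_trans (he x xs xz); rewrite ler_pM2l // ?ge_min ?lexx //.
  have H2 : forall s s' : seq C, exists2 e : R, 0 < e & forall x y, x \in s -> y \in s' -> x != y -> 4 * e <= nsq (x - y).
    move=> s; elim=> [|z s' [e e0 he]]; first by exists 1.
    have [e' e'0 he'] := H1 z s.
    exists (Num.min e e'); first by rewrite lt_min e0.
    have l1 : Num.min e e' <= e by rewrite ge_min lexx.
    have l2 : Num.min e e' <= e' by rewrite ge_min lexx orbT.
    move=> x y xs; rewrite inE => /orP[/eqP->|ys] xy.
      by have := he' x xs xy; lra.
    by have := he x y xs ys xy; lra.
  exact: H2.
by exists e => // x y rx ry; apply: he; rewrite mem_rts.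
Qed.

(** Each root at [t0] selects the unique root near it at nearby parameters. Selected roots are
    distinct, hence by degree they exhaust the roots; continuity follows from [near_root] and
    differentiability from [dC_root]. *)
Lemma branches t0 : (\forall y \near t0, good p d y) -> sep (p t0) ->
  exists zs : 'I_d -> R -> C, (forall j, C1 (zs j) t0) /\
   \forall y \near t0, perm_eq (rts (p y)) [seq zs j y | j <- enum 'I_d].
Proof.
move=> hg sp; have g0 := nbhs_singleton hg; have p0 := good_neq0 g0.
have s0 : size (p t0) = d.+1 by case: g0 => _ /nbhs_singleton.
have sr := size_rts s0; have ur := uniq_rts p0 sp.
pose r (j : 'I_d) := nth 0 (rts (p t0)) j.
have rr j : root (p t0) (r j) by rewrite -mem_rts // mem_nth // sr.
have rinj i j : i != j -> r i != r j by move=> ij; rewrite nth_uniq // sr.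
have [e e0 he] := min_sep p0.
pose S j t := [set x | root (p t) x /\ nsq (x - r j) < e / 4].
(* The default 0 of [xget] is harmless, since the set is inhabited for all parameters near [t0]. *)
pose z j t := xget 0 (S j t).
have e4 : 0 < e / 4 by lra.
have ex : \forall y \near t0, forall j, S j y (z j y).
  have : forall j, \forall y \near t0, S j y (z j y).
    move=> j; apply: filterS (near_root g0 (rr j) e4) => y [x rx xe].
    by apply: xgetPex; exists x.
  move=> h; exact: (@filter_forall _ _ (fun j y => S j y (z j y)) (nbhs t0) _ h).
have sz : \forall y \near t0, size (p y) = d.+1 by case: g0.
have inj y : (forall j, S j y (z j y)) -> injective (fun j => z j y).
  move=> h i j zij; apply/eqP; apply: contraT => ij.
  have [_ hi] := h i; have [_ hj] := h j; rewrite zij in hi.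
  have := he _ _ (rr i) (rr j) (rinj _ _ ij).
  have := nsqD (r i - z j y) (z j y - r j); rewrite addrA subrK.
  rewrite -(nsqN (r i - z j y)) opprB; lra.
have unq y : (forall j, S j y (z j y)) -> size (p y) = d.+1 -> forall j x, root (p y) x -> nsq (x - r j) < e -> x = z j y.
  move=> h sy j x rx xe; apply/eqP; apply: contraT => xz.
  have py : p y != 0 by rewrite -size_poly_eq0 sy.
  have : (size (x :: [seq z j y | j <- enum 'I_d]) < size (p y))%N.
    apply: max_poly_roots => //=.
      by rewrite rx /=; apply/allP => w /mapP[i _ ->]; case: (h i).
    rewrite map_inj_uniq ?enum_uniq ?andbT; last exact: inj.
    apply/mapP => -[i _ xi]; have [ij|ij] := eqVneq i j; first by rewrite xi ij eqxx in xz.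
    have [_ hi] := h i; rewrite -xi in hi.
    have := he _ _ (rr i) (rr j) (rinj _ _ ij).
    have := nsqD (r i - x) (x - r j); rewrite addrA subrK -(nsqN (r i - x)) opprB; lra.
  by rewrite /= size_map size_enum_ord sy ltnn.
have ex2 := near_join ex; have sz2 := near_join sz; have hg2 := near_join hg.
have cz j : \forall y \near t0, cC (z j) y.
  near=> y; apply: cC_of_nsq => e' e'0.
  have gy : good p d y by near: y.
  have [ry ny] : S j y (z j y) by have : forall j, S j y (z j y) by near: y.
  (* The second bound keeps the root found near [z j y] within the range where [unq] identifies it
     with the branch. *)
  have m0 : 0 < Num.min e' (e / 4) by rewrite lt_min e'0.
  have ey : \forall x \near y, forall j, S j x (z j x) by near: y; exact: ex2.
  have sy : \forall x \near y, size (p x) = d.+1 by near: y; exact: sz2.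
  have nr := near_root gy ry m0.
  near=> x; have [|w rw] := near nr x => //; rewrite lt_min => /andP[w1 w2].
  rewrite -(unq x _ _ j w rw) //; [by near: x|by near: x|].
  have := nsqD (w - z j y) (z j y - r j); rewrite addrA subrK; lra.
have cd j : \forall y \near t0, dC (z j) y (- (\sum_(k < d.+1) derC (fun y => (p y)`_k) y * z j y ^+ k) / (p y)^`().[z j y]) /\
    (p y)^`().[z j y] != 0.
  have cz2 := near_join (cz j).
  have c1 : cC (fun y => (p y)^`().[z j y]) t0.
    apply: (@cC_near _ (fun y => \sum_(i < d) ((p y)`_i.+1 *+ i.+1) * z j y ^+ i)).
      by apply: filterS sz => y sy; rewrite (Re_horner_deriv _ sy).
    apply: (Q_sum (@cC_cst _ ^~ t0) (fun f g => @cCD _ f g t0)) => i; apply: cCM.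
      case: g0 => hc _; have c := C1_cC (hc i.+1).
      by apply: cC_ext (cCM (cC_cst i.+1%:R t0) c) => y; rewrite mulr_natl.
    elim: (i : nat) => [|m IH]; first by apply: cC_ext (cC_cst 1 t0).
    by apply: cC_ext (cCM (nbhs_singleton (cz j)) IH) => y; rewrite exprS.
  have n1 : \forall y \near t0, (p y)^`().[z j y] != 0.
    by apply: cC_near_neq0 c1 _; apply: sp; case: (nbhs_singleton ex j).
  near=> y; split; last by near: y.
  have gy : good p d y by near: y.
  have ey : \forall x \near y, forall j, S j x (z j x) by near: y; exact: ex2.
  have ry : \forall x \near y, root (p x) (z j x) by apply: filterS ey => x /(_ j)[].
  have czy : cC (z j) y by near: y; exact: cz.
  have ny : (p y)^`().[z j y] != 0 by near: y.
  have dk k : dC (fun y => (p y)`_k) y (derC (fun y => (p y)`_k) y).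
    by case: gy => hc _; have [] := nbhs_singleton (C1P (hc k)).
  exact: (dC_root (c' := fun k => derC (fun y => (p y)`_k) y) gy czy ry ny dk).
exists z; split=> [j|].
  exists (fun y => - (\sum_(k < d.+1) derC (fun y => (p y)`_k) y * z j y ^+ k) / (p y)^`().[z j y]).
  have sd := cd j; near=> y; have [|d1 n1] := near sd y => //; split => //.
  have gy : good p d y by near: y.
  have czy := dC_cC d1.
  have cX k : cC (fun y => z j y ^+ k) y.
    elim: k => [|m IH]; first by apply: cC_ext (cC_cst 1 y).
    by apply: cC_ext (cCM czy IH) => x; rewrite exprS.
  case: gy => hc hs; apply: cCM.
    apply: cC_ext (cCM (cC_cst (-1) y) (Q_sum (@cC_cst _ ^~ y) (fun f g => @cCD _ f g y) (index_enum _)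
      (f := fun (k : 'I_d.+1) y => derC (fun y => (p y)`_k) y * z j y ^+ k) _)) => [x|k]; first by rewrite mulN1r.
    by apply: cCM => //; have [] := nbhs_singleton (C1P (hc k)).
  apply: cC_inv => //; apply: (@cC_near _ (fun y => \sum_(i < d) ((p y)`_i.+1 *+ i.+1) * z j y ^+ i)).
    by apply: filterS hs => x sx; rewrite (Re_horner_deriv _ sx).
  apply: (Q_sum (@cC_cst _ ^~ y) (fun f g => @cCD _ f g y)) => i; apply: cCM => //.
  by apply: cC_ext (cCM (cC_cst i.+1%:R y) (C1_cC (hc i.+1))) => x; rewrite mulr_natl.
near=> y.
have ey : forall j, S j y (z j y) by near: y.
have sy : size (p y) = d.+1 by near: y.
have uz : uniq [seq z j y | j <- enum 'I_d].
  rewrite map_inj_uniq ?enum_uniq //; exact: inj.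
have sub : {subset [seq z j y | j <- enum 'I_d] <= rts (p y)}.
  by move=> w /mapP[j _ ->]; rewrite mem_rts; [case: (ey j)|rewrite -size_poly_eq0 sy].
have le : (size (rts (p y)) <= size [seq z j y | j <- enum 'I_d])%N.
  by rewrite (size_rts sy) size_map size_enum_ord.
rewrite perm_sym; apply: uniq_perm => //; first exact: leq_size_uniq uz sub le.
by have [_ E] := uniq_min_size uz sub le.
Unshelve. all: by end_near. Qed.

End Branches.

From mathcomp Require Import ring lra complex all_field.

(** * Algebraically closed subfields and transcendental parameters *)

Record dfield (R : realType) := DField { df_pred : pred R[i]; df_closed : divring_closed df_pred }.

HB.instance Definition _ (R : realType) (D : dfield R) :=
  GRing.isDivringClosed.Build R[i] (df_pred D) (df_closed D).

(** The subfield as a type, over which polynomial rings can be formed. *)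
Record subT (R : realType) (D : dfield R) := InSub { subv : R[i]; subvP : subv \in df_pred D }.
HB.instance Definition _ (R : realType) (D : dfield R) := [isSub for (@subv R D)].
HB.instance Definition _ (R : realType) (D : dfield R) := [Choice of subT D by <:].
HB.instance Definition _ (R : realType) (D : dfield R) := [SubChoice_isSubIntegralDomain of subT D by <:].
HB.instance Definition _ (R : realType) (D : dfield R) := [SubIntegralDomain_isSubField of subT D by <:].

Section Subfields.
Context {R : realType}.
Local Notation C := R[i].
Implicit Types (S : dfield R).

Definition vl S : {rmorphism subT S -> C} := (val : subT S -> C).
(** [e1], [e2], [e3] evaluate polynomials over S in one to three variables: [w] is the place of a
    transcendental parameter, [z] of a primitive element, [T] of the inverse of a common
    denominator. *)
Definition e1 S (w : C) : {rmorphism {poly subT S} -> C} := (horner_eval w \o map_poly (vl S)).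
Definition e2 S (w z : C) : {rmorphism {poly {poly subT S}} -> C} := (horner_eval z \o map_poly (e1 S w)).
Definition e3 S (w z T : C) : {rmorphism {poly {poly {poly subT S}}} -> C} := (horner_eval T \o map_poly (e2 S w z)).

Arguments e1 : simpl never.
Arguments e2 : simpl never.
Arguments e3 : simpl never.

Definition inS S z := z \in df_pred S.
(** Contains every complex number algebraic over it, so that an element outside is
    transcendental. *)
Definition rclosed S := forall (p : {poly C}) z, p \is a polyOver (df_pred S) -> p != 0 -> root p z -> inS S z.

(** Algebraic closure of the field generated by [A]. The inductive form gives monotonicity by
    induction and, through [cl_code], countability. *)
Inductive cl (A : C -> Prop) : C -> Prop :=
| cl_in z of A z : cl A z
| cl_one : cl A 1
| cl_sub x y of cl A x & cl A y : cl A (x - y)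
| cl_div x y of cl A x & cl A y : cl A (x / y)
| cl_root s z of (forall x, x \in s -> cl A x) & Poly s != 0 & root (Poly s) z : cl A z.

Lemma cl_closed A : divring_closed (fun z : C => `[< cl A z >]).
Proof.
split; first by apply/asboolP; exact: cl_one.
  by move=> x y /asboolP hx /asboolP hy; apply/asboolP; exact: cl_sub.
by move=> x y /asboolP hx /asboolP hy; apply/asboolP; exact: cl_div.
Qed.

Definition clD A : dfield R := DField (@cl_closed A).

Lemma in_clD A z : inS (clD A) z <-> cl A z.
Proof. by split => [/asboolP|h] //; apply/asboolP. Qed.

Lemma clD_rclosed A : rclosed (clD A).
Proof.
move=> p z /polyOverP hp p0 rz; apply/in_clD; apply: (@cl_root A p) => //; rewrite ?polyseqK //.
by move=> x /(nthP 0)[i _ <-]; apply/in_clD; exact: hp.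
Qed.

Lemma cl_trans A A' z : (forall x, A x -> cl A' x) -> cl A z -> cl A' z.
Proof.
move=> h; elim=> [x /h //||x y _ hx _ hy|x y _ hx _ hy|s x _ hs s0 rx].
- exact: cl_one.
- exact: cl_sub.
- exact: cl_div.
- exact: cl_root hs s0 rx.
Qed.

Lemma e1C S w c : e1 S w c%:P = val c.
Proof. by rewrite -[LHS]/((map_poly (vl S) c%:P).[w]) map_polyC hornerC. Qed.
Lemma e1X S w : e1 S w 'X = w.
Proof. by rewrite -[LHS]/((map_poly (vl S) 'X).[w]) map_polyX hornerX. Qed.
Lemma e2C S w z c : e2 S w z c%:P = e1 S w c.
Proof. by rewrite -[LHS]/((map_poly (e1 S w) c%:P).[z]) map_polyC hornerC. Qed.
Lemma e2X S w z : e2 S w z 'X = z.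
Proof. by rewrite -[LHS]/((map_poly (e1 S w) 'X).[z]) map_polyX hornerX. Qed.
Lemma e3C S w z T c : e3 S w z T c%:P = e2 S w z c.
Proof. by rewrite -[LHS]/((map_poly (e2 S w z) c%:P).[T]) map_polyC hornerC. Qed.
Lemma e3X S w z T : e3 S w z T 'X = T.
Proof. by rewrite -[LHS]/((map_poly (e2 S w z) 'X).[T]) map_polyX hornerX. Qed.

Lemma val_inS S (c : subT S) : inS S (val c). Proof. exact: (valP c). Qed.

Lemma e1_in S w b : inS S w -> inS S (e1 S w b).
Proof.
move=> hw; apply: rpred_horner => //; apply/polyOverP => i; rewrite coef_map; exact: val_inS.
Qed.
Lemma e2_in S w z b : inS S w -> inS S z -> inS S (e2 S w z b).
Proof.
move=> hw hz; apply: rpred_horner => //; apply/polyOverP => i; rewrite coef_map; exact: e1_in.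
Qed.
Lemma e3_in S w z T b : inS S w -> inS S z -> inS S T -> inS S (e3 S w z T b).
Proof.
move=> hw hz hT; apply: rpred_horner => //; apply/polyOverP => i; rewrite coef_map; exact: e2_in.
Qed.

Lemma e1_eq0 S u b : rclosed S -> ~ inS S u -> e1 S u b = 0 -> b = 0.
Proof.
move=> rS nu h; apply/eqP; apply: contraT => b0; case: nu.
apply: (rS (map_poly (vl S) b)); last exact/rootP.
  by apply/polyOverP => i; rewrite coef_map; exact: val_inS.
by rewrite map_poly_eq0.
Qed.

Section Adjoin.
Variables (S : dfield R) (u : C).
Hypothesis rS : rclosed S.
Hypothesis nu : ~ inS S u.

Let adjP (z : C) : bool := `[< exists p q : {poly subT S}, e1 S u q != 0 /\ z = e1 S u p / e1 S u q >].

Lemma adj_closed : divring_closed adjP.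
Proof.
split.
- by apply/asboolP; exists 1, 1; rewrite rmorph1 oner_eq0 divr1.
- move=> x y /asboolP[p1 [q1 [h1 ->]]] /asboolP[p2 [q2 [h2 ->]]]; apply/asboolP.
  exists (p1 * q2 - p2 * q1), (q1 * q2); rewrite !(rmorphB, rmorphM) /= mulf_neq0 //; split => //.
  by field; rewrite h1 h2.
- move=> x y /asboolP[p1 [q1 [h1 ->]]] /asboolP[p2 [q2 [h2 ->]]]; apply/asboolP.
  have [p20|p20] := eqVneq (e1 S u p2) 0.
    by exists 0, 1; rewrite rmorph1 rmorph0 oner_eq0 p20 !mul0r invr0 mulr0.
  exists (p1 * q2), (q1 * p2); rewrite !rmorphM /= mulf_neq0 //; split => //.
  by rewrite invf_div mulf_div.
Qed.

Definition adj : dfield R := DField adj_closed.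

Definition ext (z : C) := cl (fun x => inS S x \/ x = u) z.

Lemma adj_frac (c : subT adj) : exists p q : {poly subT S}, e1 S u q != 0 /\ val c = e1 S u p / e1 S u q.
Proof. by case: c => z hz /=; apply/asboolP. Qed.

Lemma mem_adj z p q : e1 S u q != 0 -> z = e1 S u p / e1 S u q -> inS adj z.
Proof. by move=> h ->; apply/asboolP; exists p, q. Qed.

Lemma ext_alg z : ext z -> algebraicOver (vl adj) z.
Proof.
have base x : inS adj x -> algebraicOver (vl adj) x.
  by move=> hx; exact: (algebraic_id (vl adj) (InSub hx)).
elim=> [x [hx|->]||x y _ hx _ hy|x y _ hx _ hy|s x _ hs s0 rx].
- by apply: base; apply: (@mem_adj _ (InSub hx)%:P 1); rewrite rmorph1 ?oner_eq0 // divr1 e1C.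
- by apply: base; apply: (@mem_adj _ 'X 1); rewrite rmorph1 ?oner_eq0 // divr1 e1X.
- exact: algebraic1.
- exact: algebraic_sub.
- by apply: algebraic_mul => //; exact: algebraic_inv.
- apply/integral_algebraic; apply: (integral_root s0 rx); apply/integral_poly => i.
  rewrite coef_Poly; have [li|li] := ltnP i (size s); last first.
    by rewrite nth_default //; apply/integral_algebraic; exact: (algebraic0 (vl adj)).
  by apply/integral_algebraic/hs/mem_nth.
Qed.

Lemma clear_den (r : {poly subT adj}) : exists (D : {poly subT S}) (a : {poly {poly subT S}}),
  e1 S u D != 0 /\ forall z, e2 S u z a = e1 S u D * (map_poly (vl adj) r).[z].
Proof.
elim/poly_ind: r => [|r c [D [a [D0 h]]]].
  by exists 1, 0; rewrite rmorph1 oner_eq0; split => // z; rewrite !rmorph0 horner0 mulr0.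
have [p [q [q0 cE]]] := adj_frac c.
exists (D * q), (a * 'X * q%:P + (p * D)%:P); split; first by rewrite rmorphM mulf_neq0.
move=> z; rewrite (rmorphD (e2 S u z)) !(rmorphM (e2 S u z)) h e2X !e2C !(rmorphM (e1 S u)).
have -> : (map_poly (vl adj) (r * 'X + c%:P)).[z] = (map_poly (vl adj) r).[z] * z + vl adj c.
  by rewrite -[LHS]/(e1 adj z (r * 'X + c%:P)) (rmorphD (e1 adj z)) (rmorphM (e1 adj z)) e1X e1C.
by rewrite (_ : (vl adj c : C) = e1 S u p / e1 S u q) //; field.
Qed.

(** Denominators of an algebraic equation over S(u) are cleared. The result is not zero, since
    otherwise the original polynomial would vanish at all natural numbers. *)
Lemma alg_rel z : ext z -> exists2 a : {poly {poly subT S}}, a != 0 & e2 S u z a = 0.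
Proof.
move=> /ext_alg[r r0 rz]; have [D [a [D0 h]]] := clear_den r.
exists a; last by rewrite h (rootP rz) mulr0.
apply/eqP => a0; pose q := map_poly (vl adj) r.
have q0 : q != 0 by rewrite map_poly_eq0.
have all0 y : root q y.
  by apply/rootP; have := h y; rewrite a0 rmorph0 => /esym/eqP; rewrite mulf_eq0 (negbTE D0) => /eqP.
have U : uniq [seq k%:R : C | k <- iota 0 (size q)].
  by rewrite map_inj_uniq ?iota_uniq // => i j /eqP; rewrite eqr_nat => /eqP.
have A : all (root q) [seq k%:R : C | k <- iota 0 (size q)] by apply/allP => y _.
by have := max_poly_roots q0 A U; rewrite size_map size_iota ltnn.
Qed.

Lemma has_char0_adj : [pchar subT adj] =i pred0.
Proof.
apply/pcharf0P => k; apply/eqP/eqP => [h|->] //.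
have := congr1 (vl adj) h; rewrite rmorph_nat rmorph0 => /eqP; by rewrite pnatr_eq0 => /eqP.
Qed.

(** Primitive element theorem in characteristic zero, iterated along the list. *)
Lemma prim (xs : seq C) : (forall x, x \in xs -> ext x) ->
  exists2 z, ext z & forall x, x \in xs -> exists r : {poly subT adj}, (map_poly (vl adj) r).[z] = x.
Proof.
elim: xs => [|x xs IH] h; first by exists 1 => //; exact: cl_one.
have [|z' ez' hz'] := IH; first by move=> y ys; apply: h; rewrite inE ys orbT.
have ex : ext x by apply: h; rewrite inE eqxx.
have [p p0 px] := ext_alg ex; have [q q0 qz] := ext_alg ez'.
have [k [[rx rxE] [rz rzE]]] := pchar0_PET p0 px q0 qz has_char0_adj.
set z := z' *+ k - x in rxE rzE; exists z.
  apply: cl_sub => //; have nat0 : ext 0 by rewrite -(subrr 1); apply: cl_sub; exact: cl_one.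
  elim: k {rxE rzE z} => [|k IHk]; first by rewrite mulr0n.
  have -> : z' *+ k.+1 = z' *+ k - (0 - z') by rewrite sub0r opprK mulrSr.
  by apply: cl_sub => //; exact: cl_sub.
move=> y; rewrite inE => /orP[/eqP->|ys]; first by exists rx.
have [r rE] := hz' y ys; exists (r \Po rz).
by rewrite map_comp_poly horner_comp rzE.
Qed.

Lemma common_den z (xs : seq C) :
  (forall x, x \in xs -> exists r : {poly subT adj}, (map_poly (vl adj) r).[z] = x) ->
  exists D : {poly subT S}, e1 S u D != 0 /\ forall x, x \in xs -> exists a, e2 S u z a = e1 S u D * x.
Proof.
elim: xs => [|x xs IH] h; first by exists 1; rewrite rmorph1 oner_eq0.
have [|D [D0 hD]] := IH; first by move=> y ys; apply: h; rewrite inE ys orbT.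
have [|r rE] := h x; first by rewrite inE eqxx.
have [D' [a [D'0 ha]]] := clear_den r.
exists (D * D'); split; first by rewrite rmorphM mulf_neq0.
move=> y; rewrite inE => /orP[/eqP->|ys].
  by exists (a * D%:P); rewrite (rmorphM (e2 S u z)) ha e2C rE (rmorphM (e1 S u)); ring.
have [b hb] := hD y ys; exists (b * D'%:P); by rewrite (rmorphM (e2 S u z)) hb e2C (rmorphM (e1 S u)); ring.
Qed.

End Adjoin.

(** Steinitz exchange: the relation between [u] and [w] is read with its variables interchanged, and
    it stays nontrivial because [w] is transcendental over S. *)
Lemma ext_exchange S u w : rclosed S -> ~ inS S u -> ~ inS S w -> ext S u w -> ext S w u.
Proof.
move=> rS nu nw ew; have [a a0 ha] : exists2 a : {poly {poly subT S}}, a != 0 & e2 S u w a = 0 by exact: alg_rel.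
have E : e2 S u w a = e2 S w u (swapXY a).
  have H (b : {poly {poly subT S}}) x y : e2 S x y b = (map_poly (map_poly (vl S)) b).[y%:P].[x].
    rewrite -[LHS]/((map_poly (e1 S x) b).[y]) /e1 /=.
    rewrite (map_poly_comp (horner_eval x) (map_poly (vl S))) /=.
    by rewrite -(horner_evalE x (_.[_])) -horner_map /= /horner_eval hornerC.
  by rewrite !H -swapXY_map horner2_swapXY.
have b0 : swapXY a != 0 by rewrite swapXY_eq0.
pose q := map_poly (e1 S w) (swapXY a).
have q0 : q != 0.
  apply: contra b0 => /eqP q0; apply/eqP/polyP => i; rewrite coef0; apply: (e1_eq0 rS nw).
  by have := congr1 (fun p : {poly C} => p`_i) q0; rewrite coef_map coef0.
apply: (@cl_root _ q); rewrite ?polyseqK //; last by apply/rootP; rewrite -[LHS]/(e2 S w u (swapXY a)) -E.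
move=> x /(nthP 0)[i _ <-]; rewrite coef_map; apply/in_clD.
apply: rpred_horner; last by apply/in_clD; apply: cl_in; right.
apply/polyOverP => j; rewrite coef_map; apply/in_clD; apply: cl_in; left; exact: val_inS.
Qed.

End Subfields.

From mathcomp Require Import ring lra zify complex all_field.

(** * Minimal relations over an integral domain *)

Section MinimalRelation.
Variables (K : idomainType) (L : fieldType) (ev : {rmorphism {poly K} -> L}).
Hypothesis inj : forall c, ev c%:P = 0 -> c = 0.
Hypothesis char0 : forall k, (k.+1%:R : K) != 0.

Lemma deriv_neq0 (m : {poly K}) : (1 < size m)%N -> m^`() != 0.
Proof.
move=> sm; apply/eqP => h; have := congr1 (fun p : {poly K} => p`_(size m).-2) h.
rewrite coef_deriv coef0 => /eqP; rewrite -mulr_natr mulf_eq0 (negbTE (char0 _)) orbF.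
move: sm; case sE: (size m) => [|[|k]] // _ /=.
have : lead_coef m != 0 by rewrite lead_coef_eq0 -size_poly_eq0 sE.
by rewrite lead_coefE sE /= => /negbTE ->.
Qed.

Lemma minimal_relation : (exists2 a, a != 0 & ev a = 0) -> exists m : {poly K}, [/\ m != 0, ev m = 0, (1 < size m)%N &
  forall a, ev a = 0 -> (size a < size m)%N -> a = 0].
Proof.
move=> [a0 a00 ha0]; pose P k := `[< exists a : {poly K}, [/\ a != 0, ev a = 0 & size a = k] >].
have exP : exists k, P k by exists (size a0); apply/asboolP; exists a0.
case: (ex_minnP exP) => k /asboolP[m [m0 hm <-]] kmin; exists m; split => //.
  rewrite ltnNge; apply/negP => sm; move: hm; rewrite (size1_polyC sm) => /inj h.
  by move: m0; rewrite (size1_polyC sm) h polyC0 eqxx.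
move=> a ha sa; apply/eqP; apply: contraT => an0.
have : P (size a) by apply/asboolP; exists a.
by move/kmin; rewrite leqNgt sa.
Qed.

Variable m : {poly K}.
Hypothesis m0 : m != 0.
Hypothesis hm : ev m = 0.
Hypothesis sm : (1 < size m)%N.
Hypothesis mmin : forall a, ev a = 0 -> (size a < size m)%N -> a = 0.

Let evZ c (a : {poly K}) : ev (c *: a) = ev c%:P * ev a.
Proof. by rewrite -mul_polyC rmorphM. Qed.

(** In characteristic zero the derivative is nonzero and shorter than [m], so by minimality the two
    have no common factor and their resultant is nonzero. Over a domain a constant [r] replaces 1;
    specializations with nonzero [r] keep [m] separable. *)
Lemma bezout_deriv : exists (r : K) (a b : {poly K}), r != 0 /\ r%:P = a * m + b * m^`().
Proof.
have dm0 : ev m^`() != 0.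
  apply/eqP => h; have := deriv_neq0 sm; rewrite (mmin h) ?eqxx //; exact: lt_size_deriv.
have [s2|s2] := leqP (size m^`()) 1.
  have E := size1_polyC s2; exists (m^`()`_0), 0, 1; split; last by rewrite mul0r add0r mul1r -E.
  by apply/eqP => h; have := deriv_neq0 sm; rewrite E h polyC0 eqxx.
have [[a b] _ /= E] := resultant_in_ideal sm s2.
exists (resultant m m^`()), a, b; split => //.
(* A nontrivial common factor [g] would leave, after pseudo-division, a cofactor of [m] that is a
   smaller relation. *)
rewrite resultant_eq0 -leqNgt; set g := Pdiv.Idomain.gcdp _ _.
have := Pdiv.Idomain.dvdp_gcdl m m^`(); rewrite -/g Pdiv.Idomain.dvdp_eq => /eqP.
have := Pdiv.Idomain.dvdp_gcdr m m^`(); rewrite -/g Pdiv.Idomain.dvdp_eq => /eqP E2.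
have g0 : g != 0 by rewrite Pdiv.Idomain.gcdp_eq0 negb_and m0.
have lg k : ev ((lead_coef g ^+ k)%:P) != 0.
  by apply/eqP => /inj/eqP; rewrite expf_eq0 lead_coef_eq0 (negbTE g0) andbF.
have eg : ev g != 0.
  apply/eqP => h; have := congr1 ev E2; rewrite evZ rmorphM h mulr0 => /eqP.
  by rewrite mulf_eq0 (negbTE dm0) orbF (negbTE (lg _)).
set k := Pdiv.Idomain.divp m g; set c := lead_coef g ^+ _ => E1.
have c0 : c != 0 by rewrite /c expf_eq0 lead_coef_eq0 (negbTE g0) andbF.
have k0 : k != 0.
  apply/eqP => k0; have := congr1 (fun p : {poly K} => size p) E1.
  by rewrite k0 mul0r size_poly0 size_scale // => /eqP; rewrite size_poly_eq0 (negbTE m0).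
have ek : ev k = 0.
  have := congr1 ev E1; rewrite evZ hm mulr0 rmorphM => /esym/eqP.
  by rewrite mulf_eq0 (negbTE eg) orbF => /eqP.
have sk : (size m <= size k)%N.
  by rewrite leqNgt; apply/negP => h; move: k0; rewrite (mmin ek h) eqxx.
have := congr1 (fun p : {poly K} => size p) E1; rewrite size_scale // size_mul // => sE.
have kp : (0 < size k)%N by rewrite size_poly_gt0.
have gp : (0 < size g)%N by rewrite size_poly_gt0.
by move: sE sk kp gp; move: (size m) (size k) (size g) => x y z; lia.
Qed.

(** The remainder of pseudo-division by [m] is a relation of smaller size, hence zero. *)
Lemma reduce_minimal a : ev a = 0 -> exists k h, lead_coef m ^+ k *: a = h * m.
Proof.
move=> ha; have E := Pdiv.Idomain.divp_eq a m.
have r0 : Pdiv.Idomain.modp a m = 0.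
  apply: mmin; last by rewrite Pdiv.Idomain.ltn_modp.
  have := congr1 ev E; rewrite evZ ha mulr0 rmorphD rmorphM hm mulr0 add0r; by move=> <-.
by exists (Pdiv.Idomain.scalp a m), (Pdiv.Idomain.divp a m); rewrite E r0 addr0.
Qed.

End MinimalRelation.

(** * Specialization of algebraic functions of one transcendental *)

Section Spread.
Context {R : realType}.
Local Notation C := R[i].
Variables (S : dfield R) (u : C).
Hypothesis rS : rclosed S.
Hypothesis nu : ~ inS S u.

Lemma natr_neq0 k : (k.+1%:R : {poly subT S}) != 0.
Proof.
apply/eqP => h; have := congr1 (e1 S u) h; rewrite rmorph_nat rmorph0 => /eqP; by rewrite pnatr_eq0.
Qed.

Lemma e2Z w z c (a : {poly {poly subT S}}) : e2 S w z (c *: a) = e1 S w c * e2 S w z a.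
Proof. by rewrite -mul_polyC (rmorphM (e2 S w z)) e2C. Qed.

(** The third variable only ever takes the value 1/D; a power of D removes it, uniformly in [w] and
    [z]. *)
Lemma e3_clear (D : {poly subT S}) (a : {poly {poly {poly subT S}}}) : exists b : {poly {poly subT S}},
  forall w z, e1 S w D != 0 -> e2 S w z b = e1 S w D ^+ size a * e3 S w z (e1 S w D)^-1 a.
Proof.
exists (\sum_(k < size a) a`_k * (D ^+ (size a - k))%:P) => w z D0.
have -> : e3 S w z (e1 S w D)^-1 a = (map_poly (e2 S w z) a).[(e1 S w D)^-1] by [].
rewrite (@horner_coef_wide _ (size a)) ?size_poly // rmorph_sum mulr_sumr; apply: eq_bigr => k _.
rewrite (rmorphM (e2 S w z)) e2C rmorphXn coef_map mulrCA; congr (_ * _).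
by rewrite exprVn -expfB // ltnW.
Qed.

(** The elements of [xs] become values at (u, z1) of functions on the curve m(w, z) = 0. [B]
    collects the leading coefficient of [m], the constant of [bezout_deriv] and the denominator [D]:
    where it is nonzero, the fibre keeps its size, its points are simple, and every relation valid
    at (u, z1) holds at each point of the fibre. *)
Lemma spread (xs : seq C) : (forall x, x \in xs -> ext S u x) ->
  exists (z1 : C) (m : {poly {poly subT S}}) (D B : {poly subT S}) (X : C -> {poly {poly {poly subT S}}}),
  [/\ e1 S u B != 0, (forall x, x \in xs -> e3 S u z1 (e1 S u D)^-1 (X x) = x),
     root (map_poly (e1 S u) m) z1, (1 < size m)%N &
   forall w, e1 S w B != 0 -> [/\ e1 S w D != 0, size (map_poly (e1 S w) m) = size m, sep (map_poly (e1 S w) m) &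
     forall z, root (map_poly (e1 S w) m) z -> forall a, e3 S u z1 (e1 S u D)^-1 a = 0 -> e3 S w z (e1 S w D)^-1 a = 0]].
Proof.
move=> hx.
have [z1 ez hz] : exists2 z, ext S u z & forall x, x \in xs -> exists r : {poly subT (adj S u)}, (map_poly (vl (adj S u)) r).[z] = x by exact: prim.
have [D [D0 hD]] : exists D : {poly subT S}, e1 S u D != 0 /\ forall x, x \in xs -> exists a, e2 S u z1 a = e1 S u D * x by exact: common_den.
have inj c : e2 S u z1 c%:P = 0 -> c = 0 by rewrite e2C => /(e1_eq0 rS nu).
have [m [m0 hm sm mmin]] : exists m : {poly {poly subT S}}, [/\ m != 0, e2 S u z1 m = 0, (1 < size m)%N &
  forall a, e2 S u z1 a = 0 -> (size a < size m)%N -> a = 0].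
  by apply: minimal_relation => //; exact: alg_rel.
have [r [a [b [r0 rE]]]] := bezout_deriv inj natr_neq0 m0 hm sm mmin.
pose X x := if pselect (exists a, e2 S u z1 a = e1 S u D * x) is left h then 'X * (sval (cid h))%:P else 0.
have e1nz (c : {poly subT S}) : c != 0 -> e1 S u c != 0.
  by move=> c0; apply/eqP => h; move: c0; rewrite (e1_eq0 rS nu h) eqxx.
exists z1, m, D, (lead_coef m * r * D), X; split => //.
- by rewrite !rmorphM !mulf_neq0 // e1nz // lead_coef_eq0.
- move=> x xs'; rewrite /X; case: pselect => [h|]; last by move/(_ (hD x xs')).
  rewrite (rmorphM (e3 S u z1 (e1 S u D)^-1)) e3X e3C; case: cid => c /= ->; by rewrite mulKf.
- exact/rootP.
move=> w; rewrite !rmorphM !mulf_eq0 !negb_or => /andP[/andP[l0 rw] Dw].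
split => //.
- by rewrite size_map_poly_id0.
- move=> z rz; apply/eqP => h; move/eqP: rw; apply.
  have em : e2 S w z m = 0 by exact/rootP.
  have ed : e2 S w z m^`() = 0 by rewrite -[LHS]/((map_poly (e1 S w) m^`()).[z]) -deriv_map.
  have := congr1 (e2 S w z) rE; rewrite e2C (rmorphD (e2 S w z)) !(rmorphM (e2 S w z)) em ed !mulr0 addr0.
  by [].
- move=> z rz c hc; have [bb hb] := e3_clear D c.
  have h0 : e2 S u z1 bb = 0 by rewrite hb // hc mulr0.
  have [k [h kE]] := reduce_minimal m0 hm mmin h0.
  have em : e2 S w z m = 0 by exact/rootP.
  have := congr1 (e2 S w z) kE; rewrite e2Z (rmorphM (e2 S w z)) em mulr0 hb // (rmorphXn (e1 S w)) => /eqP.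
  by rewrite !mulf_eq0 !expf_eq0 (negbTE l0) (negbTE Dw) !andbF => /eqP.
Qed.

End Spread.

(** * Winding numbers and logarithmic derivatives *)

Section Winding.
Context {R : realType}.
Local Notation C := R[i].

Lemma cos_eq1 (x : R) : cos x = 1 -> exists k : int, x = (pi *+ 2) * k%:~R.
Proof.
move=> cx; have pi0 : 0 < (pi *+ 2 : R) by rewrite pmulrn_lgt0 // pi_gt0.
have per (y : R) (m : nat) : cos (y + (pi *+ 2) * m%:R) = cos y.
  elim: m => [|m IH]; first by rewrite mulr0 addr0.
  by rewrite -natr1 mulrDr mulr1 addrA cosD2pi.
pose k := Num.floor (x / (pi *+ 2)); exists k.
pose r := x - (pi *+ 2) * k%:~R.
have /andP[k1 k2] := floor_itv (x / (pi *+ 2)).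
have r0 : 0 <= r by rewrite subr_ge0 mulrC -ler_pdivlMr.
have r1 : r < pi *+ 2.
  by move: k2; rewrite ltr_pdivrMr // intrD mulrDl mul1r addrC mulrC -ltrBlDr.
have cr : cos r = 1.
  rewrite /r; case: (k) => m; rewrite ?NegzE ?mulrNz.
    by rewrite -(per _ m) subrK.
  by rewrite mulrN opprK per.
suff : r = 0 by move/eqP; rewrite subr_eq0 => /eqP.
apply/eqP; apply: contraT => rn0.
have s0 : 0 < sin (r / 2).
  have rp : 0 < r by rewrite lt_neqAle eq_sym rn0.
  by apply: sin_gt0_pi; move: r1; rewrite mulr2n => r1; apply/andP; split; lra.
have := cosD (r / 2) (r / 2); rewrite -splitr cr -!expr2.
have := cos2Dsin2 (r / 2); nra.
Qed.

(** N times the exponential of minus a primitive of N'/N is constant. Comparing the ends, the real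
    part of the primitive returns to its value and the imaginary part changes by a multiple of 2
    pi. *)
Lemma winding (N : R -> C) (l : R) : 0 < l -> (forall t, C1 N t) -> (forall t, N t != 0) -> N l = N 0 ->
  exists (phi : R -> R) (k : int), (forall t, 0 <= t <= l -> dR phi t (complex.Im (derC N t / N t))) /\
    phi l - phi 0 = (pi *+ 2) * k%:~R.
Proof.
move=> l0 CN N0 Nl; pose g t := derC N t / N t.
have dN t : dC N t (derC N t) /\ cC (derC N) t by exact: nbhs_singleton (C1P (CN t)).
have cg t : cC g t by apply: cCM; [case: (dN t)|apply: cC_inv => //; exact: C1_cC].
have [a da] := @exists_primitive R (fun t => complex.Re (g t)) l l0 (fun t => proj1 (cg t)).
have [b db] := @exists_primitive R (fun t => complex.Im (g t)) l l0 (fun t => proj2 (cg t)).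
(* exp(-(a + i b)), written out in real and imaginary parts. *)
pose w t : C := (expR (- a t) * cos (b t)) +i* (- (expR (- a t) * sin (b t))).
have dw t : 0 <= t <= l -> dC w t (- g t * w t).
  move=> tl; have dea := dR_exp (dRN (da t tl)).
  have dcos := dR_comp (db t tl) (is_derive_cos (b t)).
  have dsin := dR_comp (db t tl) (is_derive_sin (b t)).
  split; [apply: dR_eq (dRM dea dcos) _|apply: dR_eq (dRN (dRM dea dsin)) _]; case: (g t) => gr gi.
    by rewrite /w ReMul /=; ring.
  by rewrite /w ImMul /=; ring.
have z t : 0 <= t <= l -> dC (fun t => N t * w t) t 0.
  move=> tl; apply: dC_eq (dCM (proj1 (dN t)) (dw t tl)) _.
  by rewrite /g; field; exact: N0.
have E : N 0 * w 0 = N l * w l.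
  by apply: complex_eq; [apply: (dR0_cst (f := fun t => complex.Re (N t * w t)) (ltW l0)) => t /z[]|apply: (dR0_cst (f := fun t => complex.Im (N t * w t)) (ltW l0)) => t /z[]].
rewrite Nl in E; have {}E := mulfI (N0 0) E.
have e1 := congr1 (@complex.Re R) E; have e2 := congr1 (@complex.Im R) E; rewrite /= in e1 e2.
have {}e2 : expR (- a 0) * sin (b 0) = expR (- a l) * sin (b l) by apply: oppr_inj.
set A := expR (- a 0) in e1 e2; set B := expR (- a l) in e1 e2.
have A0 : 0 < A by exact: expR_gt0.
have B0 : 0 < B by exact: expR_gt0.
have c1 := cos2Dsin2 (b 0); have c2 := cos2Dsin2 (b l).
have AB : A = B.
  have : A ^+ 2 = B ^+ 2.
    transitivity ((A * cos (b 0)) ^+ 2 + (A * sin (b 0)) ^+ 2); first by rewrite !exprMn -mulrDr c1 mulr1.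
    by rewrite e1 e2 !exprMn -mulrDr c2 mulr1.
  by move/eqP; rewrite eqrXn2 // ?ltW // => /eqP.
rewrite AB in e1 e2; have Bn : B != 0 by rewrite gt_eqF.
have {}e1 := mulfI Bn e1; have {}e2 := mulfI Bn e2.
have [k kE] : exists k : int, b l - b 0 = (pi *+ 2) * k%:~R.
  by apply: cos_eq1; rewrite cosB e1 e2 -!expr2.
by exists b, k.
Qed.

(** [a] is the logarithmic derivative of [f], in product form so that powers and products need no
    division. *)
Definition dL (f : R -> C) t (a : C) := dC f t (f t * a).

Lemma dL_of f t a : f t != 0 -> dC f t a -> dL f t (a / f t).
Proof. by move=> f0 df; apply: dC_eq df _; rewrite mulrC divfK. Qed.

Lemma dL_M f g t a b : dL f t a -> dL g t b -> dL (fun y => f y * g y) t (a + b).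
Proof. by move=> df dg; apply: dC_eq (dCM df dg) _; ring. Qed.

Lemma dL_X f t a k : dL f t a -> dL (fun y => f y ^+ k) t (k%:R * a).
Proof.
move=> df; elim: k => [|k IH].
  by rewrite mul0r; apply: dC_ext (dC_eq (dC_cst 1 t) _) => [y|]; rewrite ?expr0 ?mulr0.
apply: dC_ext (dC_eq (dL_M df IH) _) => [y|]; first by rewrite exprS.
by rewrite exprS -natr1; ring.
Qed.

Lemma dL_prod (I : Type) (r : seq I) (f : I -> R -> C) t (a : I -> C) :
  (forall i, dL (f i) t (a i)) -> dL (fun y => \prod_(i <- r) f i y) t (\sum_(i <- r) a i).
Proof.
move=> h; elim: r => [|i r IH].
  by rewrite big_nil; apply: dC_ext (dC_eq (dC_cst 1 t) _) => [y|]; rewrite ?big_nil ?mulr0.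
rewrite big_cons; apply: dC_ext (dC_eq (dL_M (h i) IH) _) => [y|]; by rewrite big_cons.
Qed.

Lemma dL_unique f t a b : f t != 0 -> dL f t a -> dL f t b -> a = b.
Proof. by move=> f0 da db; apply: (mulfI f0); exact: dC_unique da db. Qed.

End Winding.

(* Transfer along a specialization: [rel x y] says that y is the specialization of x. *)
Section Transfer.
Context {R : realType}.
Local Notation C := R[i].
Variable rel : C -> C -> Prop.
Variable ok : C -> Prop.
Hypothesis relD : forall x x' y y', rel x y -> rel x' y' -> rel (x + x') (y + y').
Hypothesis relM : forall x x' y y', rel x y -> rel x' y' -> rel (x * x') (y * y').
Hypothesis rel_cst : forall c, ok c -> rel c c.
Hypothesis rel_int : forall k : int, rel k%:~R k%:~R.
Hypothesis rel_fun : forall x y y', rel x y -> rel x y' -> y = y'.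

Lemma rel0 : rel 0 0. Proof. exact: (rel_int 0). Qed.
Lemma rel1 : rel 1 1. Proof. exact: (rel_int 1). Qed.

Lemma rel_sum (I : Type) (r : seq I) (f g : I -> C) : (forall i, rel (f i) (g i)) ->
  rel (\sum_(i <- r) f i) (\sum_(i <- r) g i).
Proof. by move=> h; elim: r => [|i r IH]; rewrite ?big_nil ?big_cons; [exact: rel0|exact: relD]. Qed.

Lemma rel_prod (I : Type) (r : seq I) (f g : I -> C) : (forall i, rel (f i) (g i)) ->
  rel (\prod_(i <- r) f i) (\prod_(i <- r) g i).
Proof. by move=> h; elim: r => [|i r IH]; rewrite ?big_nil ?big_cons; [exact: rel1|exact: relM]. Qed.

Lemma rel_X x y k : rel x y -> rel (x ^+ k) (y ^+ k).
Proof. by move=> h; elim: k => [|k IH]; rewrite ?expr0 ?exprS; [exact: rel1|exact: relM]. Qed.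

Lemma rel_N x y : rel x y -> rel (- x) (- y).
Proof. by move=> h; rewrite -mulN1r -[- y]mulN1r; apply: relM => //; exact: (rel_int (-1)). Qed.

Lemma rel_dot k (a a' b b' : 'rV[C]_k) : (forall j, rel (a 0 j) (a' 0 j)) -> (forall j, rel (b 0 j) (b' 0 j)) ->
  rel (dot a b) (dot a' b').
Proof. by move=> h h'; apply: rel_sum => j; exact: relM. Qed.

Lemma rel_cross k (p p' : 'I_k -> 'rV[C]_k.+1) j : (forall i j, rel (p i 0 j) (p' i 0 j)) ->
  rel (cross p 0 j) (cross p' 0 j).
Proof.
move=> h; rewrite !mxE; have sg m : rel ((-1) ^+ m) ((-1) ^+ m) by apply: rel_X; exact: (rel_int (-1)).
apply: relM => //; apply: rel_sum => s; apply: relM => //; apply: rel_prod => i; by rewrite !mxE.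
Qed.

Variables (V : finType) (n q : nat) (f : 'I_q -> 'I_n.+1 -> V) (G : 'I_q -> 'M[R]_n.+1) (g : 'rV[C]_n.+2).
Hypothesis okG : forall s i j, ok (G s i j)%:C.
Hypothesis okK : forall s i j, ok (kermx (G s) i j)%:C.
Hypothesis okI : forall s i j, ok (invmx (G s) i j)%:C.
Hypothesis okk : forall s i, ok ((kap G s i)%:C / (\det (G s))%:C).
Hypothesis okg : forall j, ok (g 0 j).
Variables (P P' : V -> 'rV[C]_n.+2).
Hypothesis rP : forall v j, rel (P v 0 j) (P' v 0 j).

(** The condition [kerrel] quantifies over all kernel vectors. It reduces to the rows of [kermx],
    finitely many relations with coefficients in the base, and those specialize. *)
Lemma transfer_conf : conf f G P -> conf f G P'.
Proof.
move=> cP s; have [gr kr] := cP s; split=> [i j|c hc].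
  by apply: rel_fun (rel_dot (rP (f s i)) (rP (f s j))) _; rewrite gr; apply: rel_cst; exact: okG.
have kz r : \sum_j (kermx (G s) r j)%:C *: P' (f s j) = 0.
  apply/rowP => l; rewrite summxE [RHS]mxE; symmetry.
  apply: (rel_fun rel0); have h : \sum_j (kermx (G s) r j)%:C * P (f s j) 0 l = 0.
    have kk k : \sum_j kermx (G s) r j * G s j k = 0.
      by have := congr1 (fun M : 'M[R]_n.+1 => M r k) (mulmx_ker (G s)); rewrite !mxE.
    have e : (\sum_j (kermx (G s) r j)%:C *: P (f s j)) 0 l = 0 by rewrite (kr _ kk) mxE.
    by rewrite summxE in e; apply: etrans e; apply: eq_bigr => j _; rewrite [RHS]mxE.
  have : rel (\sum_j (kermx (G s) r j)%:C * P (f s j) 0 l) (\sum_j (kermx (G s) r j)%:C * P' (f s j) 0 l).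
    by apply: rel_sum => j; apply: relM; [apply: rel_cst; exact: okK|exact: rP].
  rewrite h => h'; rewrite (eq_bigr (fun j => (kermx (G s) r j)%:C * P' (f s j) 0 l)) // => j _; by rewrite mxE.
have /submxP[y yE] : (\row_j c j <= kermx (G s))%MS.
  by apply/sub_kermxP; apply/rowP => k; rewrite !mxE -[RHS](hc k); apply: eq_bigr => j _; rewrite mxE.
have cE j : c j = \sum_r y 0 r * kermx (G s) r j.
  by have := congr1 (fun M : 'rV__ => M 0 j) yE; rewrite !mxE.
under eq_bigr => j _ do rewrite cE rc_sum scaler_suml.
rewrite exchange_big big1 // => r _ /=.
under eq_bigr => j _ do rewrite rcM -scalerA.
by rewrite -scaler_sumr kz scaler0.
Qed.

Lemma transfer_zeta b s i : rel (zeta f G g b s i P) (zeta f G g b s i P').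
Proof.
rewrite /zeta; case: (\det (G s) == 0).
  apply rel1.
cbv zeta.
have rN : rel ((kap G s i)%:C / (\det (G s))%:C * dot (cross (fun i => P (f s i))) g)
   ((kap G s i)%:C / (\det (G s))%:C * dot (cross (fun i => P' (f s i))) g).
  apply: relM; first by apply: rel_cst; exact: okk.
  apply: rel_dot => j; last by apply: rel_cst; exact: okg.
  by apply: rel_cross => k l; exact: rP.
apply: relD; last by case: b; [exact: rel_N rN|exact: rN].
apply: rel_dot => j; first by apply: rel_cst; exact: okg.
rewrite /qv !summxE; apply: rel_sum => k; rewrite [X in rel X _]mxE [X in rel _ X]mxE.
by apply: relM; [apply: rel_cst; exact: okI|exact: rP].
Qed.

End Transfer.

(** * Integral coordinates for finitely many real numbers *)

Section IntegerBasis.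
Context {R : realType}.

Definition zindep B (mu : 'I_B -> R) := forall k : 'I_B -> int, \sum_b (k b)%:~R * mu b = 0 -> forall b, k b = 0.

(** A further number either depends rationally on the basis found so far, which is then divided by
    the denominator [k0], or is added to it. Integer coordinates are wanted because they become
    exponents of monomials. *)
Lemma integer_basis (m : nat) (c : 'I_m -> R) : exists B (mu : 'I_B -> R) (M : 'I_B -> 'I_m -> int),
  zindep mu /\ forall a, c a = \sum_b (M b a)%:~R * mu b.
Proof.
elim: m c => [|m IH] c.
  by exists 0%N, (fun=> 0), (fun _ _ => 0); split => [k _|] [].
have [B [mu [M [ind E]]]] := IH (fun a => c (lift ord0 a)).
have [[k0 [k [k00 kE]]]|no] := pselect (exists (k0 : int) (k : 'I_B -> int), k0 != 0 /\ k0%:~R * c ord0 = \sum_b (k b)%:~R * mu b).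
  have k0R : (k0%:~R : R) != 0 by rewrite intr_eq0.
  exists B, (fun b => mu b / k0%:~R), (fun b => vcons (k b) (fun a => k0 * M b a)); split=> [l lE|a].
    apply: ind; have : (\sum_b (l b)%:~R * mu b) / k0%:~R = 0.
      by rewrite -[RHS]lE mulr_suml; apply: eq_bigr => b _; rewrite mulrA.
    by move/eqP; rewrite mulf_eq0 invr_eq0 (negbTE k0R) orbF => /eqP.
  rewrite /vcons; case: (unliftP ord0 a) => [j ->|->].
    by rewrite E; apply: eq_bigr => b _; rewrite intrM; field.
  apply: (mulfI k0R); rewrite kE mulr_sumr; apply: eq_bigr => b _; by field.
exists B.+1, (vcons (c ord0) mu), (fun b a => match unlift ord0 a with
   | Some j => vcons 0 (fun b' => M b' j) b | None => (b == ord0)%:Z end); split=> [k kE|a].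
  have E1 : (k ord0)%:~R * c ord0 = \sum_b (- k (lift ord0 b))%:~R * mu b.
    apply/eqP; rewrite -subr_eq0 -sumrN; apply/eqP; rewrite -[RHS]kE big_ord_recl /vcons unlift_none; congr (_ + _).
    by apply: eq_bigr => b _; rewrite liftK mulrNz mulNr opprK.
  have kz : k ord0 = 0.
    by apply/eqP; apply: contraT => k0; case: no; exists (k ord0), (fun b => - k (lift ord0 b)).
  move=> b; case: (unliftP ord0 b) => [j ->|-> //].
  have : \sum_b (- k (lift ord0 b))%:~R * mu b = 0 by rewrite -E1 kz mul0r.
  by move/ind/(_ j)/eqP; rewrite oppr_eq0 => /eqP.
rewrite big_ord_recl /vcons unlift_none; case: (unliftP ord0 a) => [j ->|->].
  by rewrite mul0r add0r E; apply: eq_bigr => b _; rewrite liftK.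
rewrite eqxx mul1r big1 ?addr0 // => b _; by rewrite eq_sym (negbTE (neq_lift _ _)) mul0r.
Qed.

End IntegerBasis.

(** * Variation of the potential along C^1 paths of configurations *)

Section Paths.
Context {R : realType}.
Local Notation C := R[i].

Lemma C1_ext (f g : R -> C) t : (forall y, f y = g y) -> C1 f t -> C1 g t.
Proof. by move=> /funext ->. Qed.

Lemma C1_poly (K : nzRingType) (e : R -> K -> C) (z : R -> C) (p : {poly K}) t :
  (forall y, e y 0 = 0) -> (forall c, C1 (fun y => e y c) t) -> C1 z t ->
  C1 (fun y => (map_poly (e y) p).[z y]) t.
Proof.
move=> e0 he hz; apply: (@C1_ext (fun y => \sum_(i < size p) e y p`_i * z y ^+ i)).
  move=> y; rewrite (@horner_coef_wide _ (size p)) ?size_poly //.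
  by apply: eq_bigr => i _; rewrite coef_map_id0.
apply: (Q_sum (C1_cst ^~ t) (fun f g => @C1D _ f g t)) => i; apply: C1M => //.
elim: (i : nat) => [|k IH]; first by apply: C1_ext (C1_cst 1 t).
by apply: C1_ext (C1M hz IH) => y; rewrite exprS.
Qed.

Lemma C1_e1 S (w : R -> C) b t : C1 w t -> C1 (fun y => e1 S (w y) b) t.
Proof.
move=> hw; apply: (C1_poly (e := fun=> vl S) b (fun y => rmorph0 (vl S)) _ hw) => c; exact: C1_cst.
Qed.

Lemma C1_e2 S (w z : R -> C) b t : C1 w t -> C1 z t -> C1 (fun y => e2 S (w y) (z y) b) t.
Proof.
move=> hw hz; apply: (C1_poly (e := fun y => e1 S (w y)) b (fun y => rmorph0 (e1 S (w y))) _ hz) => c; exact: C1_e1.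
Qed.

Lemma C1_e3 S (w z T : R -> C) b t : C1 w t -> C1 z t -> C1 T t -> C1 (fun y => e3 S (w y) (z y) (T y) b) t.
Proof.
move=> hw hz hT; apply: (C1_poly (e := fun y => e2 S (w y) (z y)) b (fun y => rmorph0 (e2 S (w y) (z y))) _ hT) => c; exact: C1_e2.
Qed.

Variables (V : finType) (n q : nat) (f : 'I_q -> 'I_n.+1 -> V).
Hypothesis pm : is_pseudomanifold f.
Hypothesis oriented : is_oriented f.
Variable G : 'I_q -> 'M[R]_n.+1.
Hypothesis cG : forall s, coer (G s).
Hypothesis lG : forall s, lor (G s).
Hypothesis sgnG : forall s i, 0 <= - \det (row' i (col' i (G s))).
Variable g : 'rV[C]_n.+2.
Implicit Types (P : V -> 'rV[C]_n.+2).

Definition Ia : finType := (bool * 'I_q * 'I_n.+1)%type.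
Definition za (a : Ia) P : C := zeta f G g a.1.1 a.1.2 a.2 P.
(** The sign merges the difference of the two logarithmic terms of each ridge into one sum over
    [Ia]. *)
Definition ca (a : Ia) : R := if a.1.1 then - coef G a.1.2 a.2 else coef G a.1.2 a.2.
Definition gconf P := conf f G P /\ forall a, za a P != 0.
Definition C1path (P : R -> V -> 'rV[C]_n.+2) t := forall v j, C1 (fun y => P y v 0 j) t.

Lemma C1_za a (P : R -> V -> 'rV[C]_n.+2) t : C1path P t -> C1 (fun y => za a (P y)) t.
Proof.
move=> hP; rewrite /za /zeta; case: (\det _ == 0); first exact: C1_cst.
have Qd := Q_dot (C1_cst ^~ t) (fun f g => @C1D _ f g t) (fun f g => @C1M _ f g t).
have Qc := Q_cross (C1_cst ^~ t) (fun f g => @C1D _ f g t) (fun f g => @C1M _ f g t).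
have h1 : C1 (fun y => (kap G a.1.2 a.2)%:C / (\det (G a.1.2))%:C * dot (cross (fun i => P y (f a.1.2 i))) g) t.
  apply: C1M; first exact: C1_cst.
  apply: Qd => j; last exact: C1_cst.
  by apply: Qc => i k; exact: hP.
apply: C1D.
  apply: Qd => j; first exact: C1_cst.
  apply: (@C1_ext (fun y => \sum_k (invmx (G a.1.2) a.2 k)%:C * P y (f a.1.2 k) 0 j)).
    by move=> y; rewrite summxE; apply: eq_bigr => k _; rewrite mxE.
  apply: (Q_sum (C1_cst ^~ t) (fun f g => @C1D _ f g t)) => k; apply: C1M; [exact: C1_cst|exact: hP].
case: (a.1.1) => //; by apply: C1_ext (C1M (C1_cst (-1) t) h1) => y; rewrite mulN1r.
Qed.

Lemma near_C1path (P : R -> V -> 'rV[C]_n.+2) t : C1path P t -> \forall y \near t, C1path P y.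
Proof.
move=> hP.
have : \forall y \near t, forall v j, C1 (fun y => P y v 0 j) y.
  apply: (@filter_forall _ _ (fun v y => forall j, C1 (fun y => P y v 0 j) y) (nbhs t)) => v.
  apply: (@filter_forall _ _ (fun j y => C1 (fun y => P y v 0 j) y) (nbhs t)) => j.
  exact: C1_near2 (hP v j).
by [].
Qed.

Lemma dR_EK_path (P : R -> V -> 'rV[C]_n.+2) t : C1path P t -> (\forall y \near t, gconf (P y)) ->
  dR (fun y => EK f (P y)) t (\sum_a ca a * complex.Im (derC (fun y => za a (P y)) t / za a (P t))).
Proof.
move=> hP gP; have [_ z0] := nbhs_singleton gP.
pose P' y v : 'rV[C]_n.+2 := \row_j derC (fun y => P y v 0 j) y.
have dP : \forall y \near t, forall v j, dC (fun y => P y v 0 j) y (P' y v 0 j).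
  apply: filterS (near_C1path hP) => y hy v j; rewrite mxE.
  by have [] := nbhs_singleton (C1P (hy v j)).
have cP' v j : cC (fun y => P' y v 0 j) t.
  have [_ c] := nbhs_singleton (C1P (hP v j)); by apply: cC_ext c => y; rewrite mxE.
have cP : \forall y \near t, conf f G (P y) by apply: filterS gP => y [].
have dz b s i : dC (fun y => zeta f G g b s i (P y)) t (derC (fun y => za (b, s, i) (P y)) t).
  by have [] := nbhs_singleton (C1P (C1_za (b, s, i) hP)).
apply: dR_eq (dR_EK_dlog pm oriented cG lG sgnG dP cP' cP (fun b s i => z0 (b, s, i)) dz) _.
rewrite -(pair_big xpredT xpredT (fun bs i => ca (bs, i) * complex.Im (derC (fun y => za (bs, i) (P y)) t / za (bs, i) (P t)))) /=.
rewrite -(pair_big xpredT xpredT (fun b s => \sum_i ca (b, s, i) * complex.Im (derC (fun y => za (b, s, i) (P y)) t / za (b, s, i) (P t)))) /=.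
rewrite big_bool /= addrC -big_split; apply: eq_bigr => s _ /=; rewrite -big_split; apply: eq_bigr => i _ /=.
by rewrite raddfB /= mulrBr mulNr /za /ca /=.
Qed.

Variables (B : nat) (mu : 'I_B -> R) (M : 'I_B -> Ia -> int).
Hypothesis caE : forall a, ca a = \sum_b (M b a)%:~R * mu b.

(** Positive and negative parts of the exponents. A monomial is handled as the fraction of [wnum] by
    [wden], both polynomial in the coordinates, so that its relations specialize. *)
Definition np b a : nat := if M b a is Posz k then k else 0.
Definition nm b a : nat := if M b a is Negz k then k.+1 else 0.
Definition wnum b P : C := \prod_a za a P ^+ np b a.
Definition wden b P : C := \prod_a za a P ^+ nm b a.

Lemma npm b a : (np b a)%:R - (nm b a)%:R = (M b a)%:~R :> C.
Proof.
by rewrite /np /nm; case: (M b a) => k; rewrite ?subr0 // sub0r NegzE mulrNz.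
Qed.

Lemma wden_neq0 b P : gconf P -> wden b P != 0.
Proof. by move=> [_ z0]; apply/prodf_neq0 => a _; rewrite expf_neq0. Qed.
Lemma wnum_neq0 b P : gconf P -> wnum b P != 0.
Proof. by move=> [_ z0]; apply/prodf_neq0 => a _; rewrite expf_neq0. Qed.

Lemma dlog_ratio b (P : R -> V -> 'rV[C]_n.+2) (c : R -> C) (l : C) t : C1path P t -> (\forall y \near t, gconf (P y)) ->
  dL c t l -> (\forall y \near t, wnum b (P y) = c y * wden b (P y)) ->
  \sum_a (M b a)%:~R * (derC (fun y => za a (P y)) t / za a (P t)) = l.
Proof.
move=> hP gP dc h; have g0 := nbhs_singleton gP; have [_ z0] := g0.
have dz a : dL (fun y => za a (P y)) t (derC (fun y => za a (P y)) t / za a (P t)).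
  exact: (dL_of (z0 a) (proj1 (nbhs_singleton (C1P (C1_za a hP))))).
have d1 : dL (fun y => wnum b (P y)) t (\sum_a (np b a)%:R * (derC (fun y => za a (P y)) t / za a (P t))).
  exact: (dL_prod (index_enum _) (fun a => dL_X (np b a) (dz a))).
have d2 : dL (fun y => wden b (P y)) t (\sum_a (nm b a)%:R * (derC (fun y => za a (P y)) t / za a (P t))).
  exact: (dL_prod (index_enum _) (fun a => dL_X (nm b a) (dz a))).
have d3 := dL_M dc d2.
have h0 := nbhs_singleton h.
have d4 : dL (fun y => wnum b (P y)) t (l + \sum_a (nm b a)%:R * (derC (fun y => za a (P y)) t / za a (P t))).
  have hs : \forall y \near t, c y * wden b (P y) = wnum b (P y) by apply: filterS h => y e; exact: (esym e).
  exact: (dC_eq (dC_near hs d3) (congr1 (fun x => x * _) (esym h0))).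
have E := dL_unique (wnum_neq0 b g0) d1 d4.
transitivity (\sum_a (np b a)%:R * (derC (fun y => za a (P y)) t / za a (P t)) - \sum_a (nm b a)%:R * (derC (fun y => za a (P y)) t / za a (P t))).
  by rewrite -sumrB; apply: eq_bigr => a _; rewrite -npm mulrBl.
by rewrite E addrK.
Qed.

(** Regrouped along the basis [mu], the derivative of the potential is a combination of derivatives
    of arguments of the monomials, which are constant here. *)
Lemma dR_EK_const (P : R -> V -> 'rV[C]_n.+2) (c : 'I_B -> C) t : C1path P t -> (\forall y \near t, gconf (P y)) ->
  (forall b, \forall y \near t, wnum b (P y) = c b * wden b (P y)) -> dR (fun y => EK f (P y)) t 0.
Proof.
move=> hP gP h; apply: dR_eq (dR_EK_path hP gP) _.
transitivity (\sum_b mu b * complex.Im (\sum_a (M b a)%:~R * (derC (fun y => za a (P y)) t / za a (P t)))).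
  under eq_bigr => a _ do rewrite caE mulr_suml.
  rewrite exchange_big; apply: eq_bigr => b _ /=; rewrite Im_sum mulr_sumr; apply: eq_bigr => a _.
  have -> : (M b a)%:~R = ((M b a)%:~R)%:C :> C by rewrite rmorph_int.
  rewrite [in RHS]ImMul /= mul0r addr0; ring.
apply: big1 => b _; have dc : dL (fun=> c b) t 0 by rewrite /dL mulr0; exact: dC_cst.
by rewrite (dlog_ratio hP gP dc (h b)) mulr0.
Qed.

(** Once S contains these constants, [conf] and the values [zeta] are expressed by polynomials over
    S. *)
Definition Sok (S : dfield R) := [/\ forall s i j, inS S (G s i j)%:C, forall s i j, inS S (kermx (G s) i j)%:C,
  forall s i j, inS S (invmx (G s) i j)%:C, forall s i, inS S ((kap G s i)%:C / (\det (G s))%:C) & forall j, inS S (g 0 j)].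

Lemma za_inS (S : dfield R) P : Sok S -> (forall v j, inS S (P v 0 j)) -> forall a, inS S (za a P).
Proof.
move=> [q1 q2 q3 q4 q5] hP a.
(* Membership in S is obtained from [transfer_zeta] by taking as relation the equality of elements
   of S. *)
pose rel (x y : C) := x = y /\ inS S x.
suff [_] : rel (za a P) (za a P) by [].
apply: (@transfer_zeta R rel (inS S)) => //.
- by move=> x x' y y' [<- h] [<- h']; split => //; exact: rpredD.
- by move=> x x' y y' [<- h] [<- h']; split => //; exact: rpredM.
- by move=> k; split => //; exact: rpred_int.
Qed.

End Paths.

(** * Elimination of one transcendental parameter *)

Section OneStep.
Context {R : realType}.
Local Notation C := R[i].
Variables (V : finType) (n q : nat) (f : 'I_q -> 'I_n.+1 -> V).
Hypothesis pm : is_pseudomanifold f.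
Hypothesis oriented : is_oriented f.
Variable G : 'I_q -> 'M[R]_n.+1.
Hypothesis cG : forall s, coer (G s).
Hypothesis lG : forall s, lor (G s).
Hypothesis sgnG : forall s i, 0 <= - \det (row' i (col' i (G s))).
Variable g : 'rV[C]_n.+2.
Variables (B : nat) (mu : 'I_B -> R) (M : 'I_B -> Ia n q -> int).
Hypothesis caE : forall a, ca G a = \sum_b (M b a)%:~R * mu b.
Hypothesis muI : zindep mu.
Local Notation rV2 := 'rV[C]_n.+2.
Local Notation zz := (za f G g).
Local Notation num := (wnum f G g M).
Local Notation den := (wden f G g M).
Local Notation gconf := (gconf f G g).

Section Family.
Variables (S : dfield R) (u : C).
Hypothesis rS : rclosed S.
Hypothesis nu : ~ inS S u.
Hypothesis okS : Sok G g S.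

Lemma Sok_ext : Sok G g (clD (fun x => inS S x \/ x = u)).
Proof.
have h c : inS S c -> inS (clD (fun x => inS S x \/ x = u)) c.
  by move=> hc; apply/in_clD; apply: cl_in; left.
by case: okS => q1 q2 q3 q4 q5; split => *; apply: h.
Qed.

(** The coordinates of [P] are spread over a curve above the w-line. All conditions are relations
    over S and so hold above every [w] with nonzero [Bd]; monomials constant in S keep their value,
    and a monomial equal to the parameter [u] becomes equal to [w]. *)
Lemma family (P : V -> rV2) : gconf P -> (forall v j, ext S u (P v 0 j)) ->
  exists (z1 : C) (m : {poly {poly subT S}}) (D Bd : {poly subT S}) (Pw : C -> C -> V -> rV2),
  [/\ e1 S u Bd != 0, Pw u z1 = P, root (map_poly (e1 S u) m) z1, (1 < size m)%N &
   (forall v j, exists a, forall w z, Pw w z v 0 j = e3 S w z (e1 S w D)^-1 a) /\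
   forall w, e1 S w Bd != 0 -> [/\ e1 S w D != 0, size (map_poly (e1 S w) m) = size m, sep (map_poly (e1 S w) m) &
     forall z, root (map_poly (e1 S w) m) z -> [/\ gconf (Pw w z),
       (forall b c, inS S c -> num b P = c * den b P -> num b (Pw w z) = c * den b (Pw w z)) &
       forall b, num b P = u * den b P -> num b (Pw w z) = w * den b (Pw w z)]]].
Proof.
move=> [cP z0] eP.
(* The inverses of the logarithmic values are spread as well, which keeps these values nonzero after
   specialization. *)
pose xs := [seq P x.1 0 x.2 | x : V * 'I_n.+2] ++ [seq (zz a P)^-1 | a : Ia n q].
have exs x : x \in xs -> ext S u x.
  rewrite mem_cat => /orP[/mapP[y _ ->]|/mapP[a _ ->]]; first exact: eP.
  have hza := za_inS f Sok_ext (fun v j => proj2 (in_clD _ _) (eP v j)) a.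
  by apply/in_clD; rewrite /inS rpredV.
have [z1 [m [D [Bd [X [B0 XE rz sm H]]]]]] := spread rS nu exs.
pose Pw w z v : rV2 := \row_j e3 S w z (e1 S w D)^-1 (X (P v 0 j)).
have inx v j : P v 0 j \in xs by rewrite mem_cat; apply/orP; left; apply/mapP; exists (v, j); rewrite ?mem_enum.
exists z1, m, D, Bd, Pw; split; [exact: B0| |exact: rz|exact: sm|].
  by apply/funext => v; apply/rowP => j; rewrite mxE (XE _ (inx v j)).
split.
  by move=> v j; exists (X (P v 0 j)) => w z; rewrite mxE.
move=> w Bw; have [Dw sw sepw ker] := H w Bw; split; [exact: Dw|exact: sw|exact: sepw|].
move=> z rzw.
pose rel x y := exists a, e3 S u z1 (e1 S u D)^-1 a = x /\ e3 S w z (e1 S w D)^-1 a = y.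
have relD x x' y y' : rel x y -> rel x' y' -> rel (x + x') (y + y').
  by move=> [a [<- <-]] [b [<- <-]]; exists (a + b); rewrite (rmorphD (e3 S u z1 _)) (rmorphD (e3 S w z _)).
have relM x x' y y' : rel x y -> rel x' y' -> rel (x * x') (y * y').
  by move=> [a [<- <-]] [b [<- <-]]; exists (a * b); rewrite (rmorphM (e3 S u z1 _)) (rmorphM (e3 S w z _)).
have rel_cst c : inS S c -> rel c c.
  by move=> hc; exists ((((InSub hc)%:P)%:P)%:P); rewrite !e3C !e2C !e1C.
have rel_int (k : int) : rel k%:~R k%:~R.
  by exists (k%:~R); rewrite (rmorph_int (e3 S u z1 _)) (rmorph_int (e3 S w z _)).
have rel_fun x y y' : rel x y -> rel x y' -> y = y'.
  move=> [a [ax ay]] [b [bx by']]; apply/eqP; rewrite -subr_eq0 -ay -by' -(rmorphB (e3 S w z _)).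
  by apply/eqP; apply: (ker z rzw); rewrite (rmorphB (e3 S u z1 _)) ax bx subrr.
have rP v j : rel (P v 0 j) (Pw w z v 0 j) by exists (X (P v 0 j)); rewrite (XE _ (inx v j)) mxE.
have rza a : rel (zz a P) (zz a (Pw w z)).
  by case: okS => q1 q2 q3 q4 q5; apply: (@transfer_zeta R rel (inS S)).
have r1 : rel 1 1 by exact: (rel_int 1).
have gP : gconf (Pw w z).
  split; first by case: okS => q1 q2 q3 q4 q5; apply: (@transfer_conf R rel (inS S)) cP.
  move=> a; have iin : (zz a P)^-1 \in xs by rewrite mem_cat; apply/orP; right; apply/mapP; exists a; rewrite ?mem_enum.
  have : rel ((zz a P)^-1) (e3 S w z (e1 S w D)^-1 (X (zz a P)^-1)) by exists (X (zz a P)^-1); rewrite (XE _ iin).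
  move=> /(relM _ _ _ _ (rza a)); rewrite mulfV // => /(rel_fun _ _ _ r1) E.
  by apply: contra_eq_neq E => ->; rewrite mul0r oner_neq0.
have rnum b : rel (num b P) (num b (Pw w z)).
  by apply: (rel_prod relM rel_int) => a; exact: (rel_X relM rel_int).
have rden b : rel (den b P) (den b (Pw w z)).
  by apply: (rel_prod relM rel_int) => a; exact: (rel_X relM rel_int).
split; first exact: gP.
  move=> b c hc E.
  by apply: rel_fun (rnum b) _; rewrite E; apply: relM (rel_cst _ hc) (rden b).
move=> b E; apply: rel_fun (rnum b) _; rewrite E; apply: relM (rden b).
by exists (('X%:P)%:P); rewrite !e3C !e2C !e1X.
Qed.

Lemma family_branches (m : {poly {poly subT S}}) (D Bd : {poly subT S}) (Pw : C -> C -> V -> rV2) (w : R -> C) t0 :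
  (1 < size m)%N -> (forall v j, exists a, forall w z, Pw w z v 0 j = e3 S w z (e1 S w D)^-1 a) ->
  (forall w, e1 S w Bd != 0 -> [/\ e1 S w D != 0, size (map_poly (e1 S w) m) = size m, sep (map_poly (e1 S w) m) &
     forall z, root (map_poly (e1 S w) m) z -> gconf (Pw w z)]) ->
  (forall t, C1 w t) -> e1 S (w t0) Bd != 0 ->
  exists zs : 'I_(size m).-1 -> R -> C, [/\ forall j, C1path (fun t => Pw (w t) (zs j t)) t0,
   \forall y \near t0, e1 S (w y) Bd != 0 & \forall y \near t0, perm_eq (rts (map_poly (e1 S (w y)) m)) [seq zs j y | j <- enum 'I_(size m).-1]].
Proof.
move=> sm hPw H Cw B0.
have nB : \forall y \near t0, e1 S (w y) Bd != 0 by exact: (cC_near_neq0 (C1_cC (C1_e1 Bd (Cw t0))) B0).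
have nB2 := near_join nB.
have sm1 : (size m).-1.+1 = size m by rewrite prednK // (ltn_trans _ sm).
pose p y := map_poly (e1 S (w y)) m.
have hg : \forall y \near t0, good p (size m).-1 y.
  near=> y; split.
    by move=> k; apply: C1_ext (C1_e1 m`_k (Cw y)) => x; rewrite coef_map.
  have : \forall x \near y, e1 S (w x) Bd != 0 by near: y; exact: nB2.
  by apply: filterS => x Bx; rewrite sm1; have [_ -> _ _] := H _ Bx.
have [_ _ sp _] := H _ B0.
have [zs [Cz pe]] := branches hg sp.
exists zs; split => // j v k; have [a aE] := hPw v k.
apply: (@C1_ext _ (fun t => e3 S (w t) (zs j t) (e1 S (w t) D)^-1 a)) => [y|]; first by rewrite aE.
apply: C1_e3 => //; apply: C1_inv; last exact: C1_e1.
by have [D0 _ _ _] := H _ B0.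
Unshelve. all: by end_near. Qed.

End Family.

Lemma near_const (F : R -> R) t : (\forall y \near t, dR F y 0) -> \forall y \near t, F y = F t.
Proof.
move=> /nbhs_ballP[e /= e0 he]; apply/nbhs_ballP; exists e => //= y; rewrite /ball /= ltr_norml => /andP[h1 h2].
have [yt|ty'] := leP y t.
  apply: dR0_cst yt _ => x /andP[x1 x2]; apply: he; rewrite /ball /= ltr_norml; apply/andP; split; lra.
symmetry; apply: dR0_cst (ltW ty') _ => x /andP[x1 x2]; apply: he.
by rewrite /ball /= ltr_norml; apply/andP; split; lra.
Qed.

Lemma C1_id t : C1 (fun y : R => y%:C : C) t.
Proof.
exists (fun=> 1); near=> y; split; last exact: cC_cst.
by have := dC_real (dR_id y).
Unshelve. all: by end_near. Qed.

Lemma exists_nonroot (p : {poly C}) : p != 0 -> exists k : nat, ~~ root p k%:R.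
Proof.
move=> p0; apply: contrapT => h.
have all0 (k : nat) : root p k%:R by apply: contraT => nk; case: h; exists k.
have U : uniq [seq k%:R : C | k <- iota 0 (size p)].
  by rewrite map_inj_uniq ?iota_uniq // => i j /eqP; rewrite eqr_nat => /eqP.
have A : all (root p) [seq k%:R : C | k <- iota 0 (size p)] by apply/allP => y /mapP[k _ ->].
by have := max_poly_roots p0 A U; rewrite size_map size_iota ltnn.
Qed.

(** Parabolic arcs from u to u', one for each real K. In the coordinate [be] an inner point of an
    arc determines K as its imaginary part divided by t(1 - t), with t its real part. The chosen K
    exceeds [kk r] for all roots r, so none lies on the arc. *)
Lemma arc (p : {poly C}) (u u' : C) : p.[u] != 0 -> p.[u'] != 0 -> u != u' -> exists K : R, forall t : R, 0 <= t <= 1 ->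
  p.[u + (u' - u) * (t%:C * (1 + (0 +i* K) * (1 - t%:C)))] != 0.
Proof.
move=> pu pu' uu; have p0 : p != 0 by apply: contraNneq pu => ->; rewrite horner0.
have d0 : u' - u != 0 by rewrite subr_eq0 eq_sym.
pose be r := (r - u) / (u' - u).
pose kk r := `|complex.Im (be r) / (complex.Re (be r) * (1 - complex.Re (be r)))|.
pose K := 1 + \sum_(r <- rts p) kk r.
exists K => t /andP[t0 t1]; set w := u + _; apply/eqP => pw.
have rw : w \in rts p by rewrite mem_rts //; exact/rootP.
have bw : be w = t +i* (K * t * (1 - t)).
  rewrite /be /w addrC addKr mulrC mulKf //.
  by apply: complex_eq; rewrite !(ReMul, ReAdd, ImMul, ImAdd) /=; ring.
have tn0 : t != 0.
  by apply: contraNneq pu => tz; rewrite -pw /w tz mul0r mulr0 addr0.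
have tn1 : t != 1.
  by apply: contraNneq pu' => tz; rewrite -pw /w tz subrr mulr0 addr0 mulr1 mulr1 addrC subrK.
have K0 : 0 < K by rewrite ltr_pwDl // sumr_ge0 // => r _; exact: normr_ge0.
have kw : kk w = K.
  have t1' : 1 - t != 0 by rewrite subr_eq0 eq_sym.
  rewrite /kk bw /= -mulrA mulfK ?ger0_norm ?ltW //; by rewrite mulf_neq0.
have : kk w <= \sum_(r <- rts p) kk r.
  rewrite (big_rem _ rw) /= lerDl sumr_ge0 // => r _; exact: normr_ge0.
by rewrite kw /K; lra.
Qed.

(** With constant monomials the potential is locally constant on every branch. Its value at [P] is
    carried along an arc to a natural number, which lies in S; the configuration found there has
    coordinates algebraic over S. *)
Lemma step_const (S : dfield R) (u : C) (P : V -> rV2) : rclosed S -> ~ inS S u -> Sok G g S -> gconf P ->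
  (forall v j, ext S u (P v 0 j)) -> (forall b, inS S (num b P / den b P)) ->
  exists P1, [/\ gconf P1, (forall v j, inS S (P1 v 0 j)) & EK f P1 = EK f P].
Proof.
move=> rS nu okS gP eP hb.
have [z1 [m [D [Bd [Pw [B0 Pw1 rz sm [hPw H]]]]]]] := family rS nu okS gP eP.
pose BC := map_poly (vl S) Bd.
have BE w : e1 S w Bd = BC.[w] by [].
have BC0 : BC != 0 by apply: contraNneq B0 => h; rewrite BE h horner0.
have [k nk] := exists_nonroot BC0; pose u' : C := k%:R.
have u'S : inS S u' by exact: rpred_nat.
have uu : u != u' by apply/eqP => h; case: nu; rewrite h.
have [K hK] := arc B0 nk uu.
pose w t := u + (u' - u) * (t%:C * (1 + (0 +i* K) * (1 - t%:C))).
have Cw t : C1 w t.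
  have c1 := C1_id t; apply: C1D; first exact: C1_cst.
  apply: C1M; first exact: C1_cst.
  apply: C1M => //; apply: C1D; first exact: C1_cst.
  apply: C1M; first exact: C1_cst.
  apply: C1D; first exact: C1_cst.
  by apply: C1_ext (C1M (C1_cst (-1) t) c1) => y; rewrite mulN1r.
have w0 : w 0 = u by rewrite /w mul0r mulr0 addr0.
have w1 : w 1 = u' by rewrite /w subrr mulr0 addr0 mulr1 mulr1 addrC subrK.
pose p t := map_poly (e1 S (w t)) m.
have H' w' : e1 S w' Bd != 0 -> [/\ e1 S w' D != 0, size (map_poly (e1 S w') m) = size m, sep (map_poly (e1 S w') m) &
     forall z, root (map_poly (e1 S w') m) z -> gconf (Pw w' z)].
  move=> Bw; have [h1 h2 h3 h4] := H _ Bw; split; [exact: h1|exact: h2|exact: h3|].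
  by move=> z rz'; have [gz _ _] := h4 z rz'.
pose At t := exists2 z, root (p t) z & EK f (Pw (w t) z) = EK f P.
(* No branch is followed globally: it is locally constant in t whether some configuration above
   [w t] has the potential of [P], so its indicator has zero derivative. *)
pose chi t : R := if `[< At t >] then 1 else 0.
have dchi t : 0 <= t <= 1 -> dR chi t 0.
  move=> t01; have Bt : e1 S (w t) Bd != 0 by exact: hK.
  have [zs [Cp nB pe]] := family_branches sm hPw H' Cw Bt.
  have sz y : e1 S (w y) Bd != 0 -> p y != 0.
    by move=> By; have [_ sy _ _] := H _ By; rewrite -size_poly_eq0 sy -lt0n (ltn_trans _ sm).
  have nr j : \forall y \near t, root (p y) (zs j y).
    near=> y; have By : e1 S (w y) Bd != 0 by near: y.
    rewrite -(mem_rts _ (sz y By)).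
    have py : perm_eq (rts (p y)) [seq zs j y | j <- enum 'I_(size m).-1] by near: y.
    by rewrite (perm_mem py); apply: map_f; rewrite mem_enum.
  have cst j : \forall y \near t, EK f (Pw (w y) (zs j y)) = EK f (Pw (w t) (zs j t)).
    apply: (@near_const (fun y => EK f (Pw (w y) (zs j y)))).
    have nr2 := near_join (nr j); have nB2 := near_join nB; have nC := near_C1path (Cp j).
    near=> y.
    have ry : \forall x \near y, root (p x) (zs j x) by near: y; exact: nr2.
    have By : \forall x \near y, e1 S (w x) Bd != 0 by near: y; exact: nB2.
    have Cy : C1path (fun y => Pw (w y) (zs j y)) y by near: y; exact: nC.
    apply: (dR_EK_const pm oriented cG lG sgnG caE (c := fun b => num b P / den b P) Cy).
      near=> x; have Bx : e1 S (w x) Bd != 0 by near: x.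
      have rx : root (p x) (zs j x) by near: x.
      by have [_ _ _ h4] := H' (w x) Bx; exact: h4 _ rx.
    move=> b; near=> x; have Bx : e1 S (w x) Bd != 0 by near: x.
    have rx : root (p x) (zs j x) by near: x.
    have [_ _ _ h4] := H (w x) Bx; have [_ h5 _] := h4 (zs j x) rx.
    by apply: (h5 b _ (hb b)); rewrite divfK // wden_neq0.
  apply: dR_near (dR_cst (chi t) t).
  have cst' : \forall y \near t, forall j, EK f (Pw (w y) (zs j y)) = EK f (Pw (w t) (zs j t)).
    exact: (@filter_forall _ _ (fun j y => EK f (Pw (w y) (zs j y)) = EK f (Pw (w t) (zs j t))) (nbhs t)).
  have pt := nbhs_singleton pe.
  near=> y.
  have py : perm_eq (rts (p y)) [seq zs j y | j <- enum 'I_(size m).-1] by near: y.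
  have cy : forall j, EK f (Pw (w y) (zs j y)) = EK f (Pw (w t) (zs j t)) by near: y.
  have By : e1 S (w y) Bd != 0 by near: y.
  suff Aty : At t <-> At y.
    exact (congr1 (fun b : bool => (if b then 1 else 0) : R) (asbool_equiv_eq Aty)).
  split=> -[z rz' zE].
    have : z \in rts (p t) by rewrite (mem_rts _ (sz t Bt)).
    rewrite (perm_mem pt) => /mapP[j _ zj]; exists (zs j y).
      by rewrite -(mem_rts _ (sz y By)) (perm_mem py); apply: map_f; rewrite mem_enum.
    by rewrite (cy j) -zj.
  have : z \in rts (p y) by rewrite (mem_rts _ (sz y By)).
  rewrite (perm_mem py) => /mapP[j _ zj]; exists (zs j t).
    by rewrite -(mem_rts _ (sz t Bt)) (perm_mem pt); apply: map_f; rewrite mem_enum.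
  by rewrite -(cy j) -zj.
have E := dR0_cst ler01 dchi.
have c0 : chi 0 = 1.
  have A0 : At 0 by exists z1; [rewrite /p w0; exact: rz|rewrite w0 Pw1].
  exact (congr1 (fun b : bool => (if b then 1 else 0) : R) (asboolT A0)).
have [z rz' zE] : At 1.
  have [//|nA] := pselect (At 1); move: E; rewrite c0.
  have -> : chi 1 = 0 by exact (congr1 (fun b : bool => (if b then 1 else 0) : R) (asboolF nA)).
  by move/eqP; rewrite oner_eq0.
rewrite /p w1 in rz' zE; have Bu : e1 S u' Bd != 0 by exact: nk.
have [D0 su _ h4] := H _ Bu; have [gz _ _] := h4 z rz'.
exists (Pw u' z); split; [exact: gz| |exact: zE].
move=> v j; have [a ->] := hPw v j.
have zS : inS S z.
  apply: rS rz'; last by rewrite -size_poly_eq0 su -lt0n (ltn_trans _ sm).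
  by apply/polyOverP => i; rewrite coef_map; exact: e1_in.
have hD := e1_in D u'S; apply: e3_in; [exact: u'S|exact: zS|].
by rewrite /inS rpredV.
Unshelve. all: by end_near. Qed.

(** Over a large circle the products [N a] over the fibre have integral winding numbers [k a], and
    the sum [F] of potentials returns to its value, so the sum of [ca G a * k a] is 0. Independence
    of [mu] makes the sum of [M b a * k a] vanish for every b. But the monomial equal to [w] turns
    once on each of the d sheets, so for its index this sum is d, which is positive. *)
Lemma step_contra (S : dfield R) (u : C) (P : V -> rV2) b : rclosed S -> ~ inS S u -> Sok G g S -> gconf P ->
  (forall v j, ext S u (P v 0 j)) -> num b P = u * den b P -> False.
Proof.
move=> rS nu okS gP eP hb.
have [z1 [m [D [Bd [Pw [B0 Pw1 rz sm [hPw H]]]]]]] := family rS nu okS gP eP.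
pose BC := map_poly (vl S) Bd.
have BE w : e1 S w Bd = BC.[w] by [].
have BC0 : BC != 0 by apply: contraNneq B0 => h; rewrite BE h horner0.
(* [nsq] is the squared modulus and rho is at least 1, so rho^2 exceeds the squared modulus of every
   exceptional point: the circle encloses them all. *)
pose rho : R := 1 + \sum_(r <- rts BC) nsq r.
have rho1 : 1 <= rho by rewrite lerDl sumr_ge0 // => r _; exact: nsq_ge0.
pose w t : C := (rho * cos t) +i* (rho * sin t).
have dw t : dC w t ((0 +i* 1) * w t).
  split.
    by apply: dR_eq (dRZ rho (is_derive_cos t)) _; rewrite ReMul /=; ring.
  by apply: dR_eq (dRZ rho (is_derive_sin t)) _; rewrite ImMul /=; ring.
have Cw t : C1 w t.
  exists (fun t => (0 +i* 1) * w t); near=> y; split; first exact: dw.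
  by apply: cCM; [exact: cC_cst|exact: dC_cC (dw y)].
have hB t : e1 S (w t) Bd != 0.
  rewrite BE; apply/eqP => /rootP; rewrite -(mem_rts _ BC0) => wr.
  have : nsq (w t) <= \sum_(r <- rts BC) nsq r.
    by rewrite (big_rem _ wr) /= lerDl sumr_ge0 // => r _; exact: nsq_ge0.
  have -> : nsq (w t) = rho ^+ 2 by rewrite /nsq /= !exprMn -mulrDr cos2Dsin2 mulr1.
  have : rho = 1 + \sum_(r <- rts BC) nsq r by [].
  by move: (\sum_(r <- rts BC) nsq r) => x; nra.
pose p t := map_poly (e1 S (w t)) m.
pose d := (size m).-1.
have H' w' : e1 S w' Bd != 0 -> [/\ e1 S w' D != 0, size (map_poly (e1 S w') m) = size m, sep (map_poly (e1 S w') m) &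
     forall z, root (map_poly (e1 S w') m) z -> gconf (Pw w' z)].
  move=> Bw; have [h1 h2 h3 h4] := H _ Bw; split; [exact: h1|exact: h2|exact: h3|].
  by move=> z rz'; have [gz _ _] := h4 z rz'.
have sz y : p y != 0.
  by have [_ sy _ _] := H _ (hB y); rewrite -size_poly_eq0 sy -lt0n (ltn_trans _ sm).
have gr y z : z \in rts (p y) -> gconf (Pw (w y) z).
  by rewrite (mem_rts _ (sz y)) => rz'; have [_ _ _ h4] := H' _ (hB y); exact: h4.
(* Products and sums over the full fibre do not see the permutation of branches caused by the
   loop. *)
pose N a t := \prod_(z <- rts (p t)) zz a (Pw (w t) z).
pose F t := \sum_(z <- rts (p t)) EK f (Pw (w t) z).
have N0 a t : N a t != 0.
  rewrite /N prodf_seq_neq0; apply/allP => z zr /=; have [_ h] := gr t z zr; exact: h.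
have loc t : [/\ forall a, C1 (N a) t,
    dR F t (\sum_a ca G a * complex.Im (derC (N a) t / N a t)) &
    \sum_a (M b a)%:~R * (derC (N a) t / N a t) = d%:R * (0 +i* 1)].
  have [zs [Cp nB pe]] := family_branches sm hPw H' Cw (hB t).
  have nr j : \forall y \near t, root (p y) (zs j y).
    near=> y; rewrite -(mem_rts _ (sz y)).
    have py : perm_eq (rts (p y)) [seq zs j y | j <- enum 'I_(size m).-1] by near: y.
    by rewrite (perm_mem py); apply: map_f; rewrite mem_enum.
  have ng j : \forall y \near t, gconf (Pw (w y) (zs j y)).
    by apply: filterS (nr j) => y ry; apply: gr; rewrite (mem_rts _ (sz y)).
  have z0 j a : zz a (Pw (w t) (zs j t)) != 0 by have [_] := nbhs_singleton (ng j); exact.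
  have Cz j a : C1 (fun y => zz a (Pw (w y) (zs j y))) t by exact: C1_za (Cp j).
  pose L a j := derC (fun y => zz a (Pw (w y) (zs j y))) t / zz a (Pw (w t) (zs j t)).
  have dz j a : dL (fun y => zz a (Pw (w y) (zs j y))) t (L a j).
    exact: (dL_of (z0 j a) (proj1 (nbhs_singleton (C1P (Cz j a))))).
  have NE a : \forall y \near t, \prod_(j < d) zz a (Pw (w y) (zs j y)) = N a y.
    by apply: filterS pe => y py; rewrite /N (perm_big _ py) big_map big_enum.
  have FE : \forall y \near t, \sum_(j < d) EK f (Pw (w y) (zs j y)) = F y.
    by apply: filterS pe => y py; rewrite /F (perm_big _ py) big_map big_enum.
  have CN a : C1 (N a) t.
    apply: C1_near (NE a) _.
    exact: (Q_prod (C1_cst ^~ t) (fun f g => @C1M _ f g t) (index_enum _) (Cz ^~ a)).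
  have LN a : derC (N a) t / N a t = \sum_(j < d) L a j.
    have dN := dL_prod (index_enum 'I_d) (dz ^~ a).
    have := derCE (dC_near (NE a) dN); rewrite (nbhs_singleton (NE a)) => ->.
    by rewrite mulrC mulKf.
  split=> //.
    apply: dR_near FE _.
    apply: dR_eq (dR_sum (index_enum _) (fun j => dR_EK_path pm oriented cG lG sgnG (Cp j) (ng j))) _.
    rewrite exchange_big; apply: eq_bigr => a _ /=; rewrite LN Im_sum mulr_sumr; by apply: eq_bigr => j _.
  have dw1 : dL w t (0 +i* 1) by apply: dC_eq (dw t) _; rewrite mulrC.
  have R1 j : \sum_a (M b a)%:~R * L a j = 0 +i* 1.
    apply: (dlog_ratio (Cp j) (ng j) dw1); apply: filterS (nr j) => y ry.
    by have [_ _ _ h4] := H _ (hB y); have [_ _ h5] := h4 _ ry; exact: h5.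
  under eq_bigr => a _ do rewrite LN mulr_sumr.
  rewrite exchange_big (eq_bigr (fun=> 0 +i* 1)) => [|j _]; last exact: R1.
  by rewrite sumr_const card_ord mulr_natl.
have l0 : 0 < (pi *+ 2 : R) by rewrite pmulrn_lgt0 // pi_gt0.
have wl : w (pi *+ 2) = w 0 by rewrite /w cos2pi sin2pi cos0 sin0.
have pl : p (pi *+ 2) = p 0 by rewrite /p wl.
have Nl a : N a (pi *+ 2) = N a 0 by rewrite /N pl wl.
have wd a : exists phk : (R -> R) * int, (forall t, 0 <= t <= pi *+ 2 -> dR phk.1 t (complex.Im (derC (N a) t / N a t))) /\
    phk.1 (pi *+ 2) - phk.1 0 = (pi *+ 2) * phk.2%:~R.
  have [phi [k hk]] := winding l0 (fun t => let: And3 h _ _ := loc t in h a) (N0 a) (Nl a).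
  by exists (phi, k).
pose phi a := (sval (cid (wd a))).1; pose k a := (sval (cid (wd a))).2.
have dphi a : forall t, 0 <= t <= pi *+ 2 -> dR (phi a) t (complex.Im (derC (N a) t / N a t)) by case: (svalP (cid (wd a))).
have ephi a : phi a (pi *+ 2) - phi a 0 = (pi *+ 2) * (k a)%:~R by case: (svalP (cid (wd a))).
have pin : (pi *+ 2 : R) != 0 by rewrite gt_eqF.
have S1 : \sum_a ca G a * (k a)%:~R = 0.
  have E : F 0 - \sum_a ca G a * phi a 0 = F (pi *+ 2) - \sum_a ca G a * phi a (pi *+ 2).
    apply: (dR0_cst (f := fun t => F t - \sum_a ca G a * phi a t) (ltW l0)) => t tl.
    have [_ dF _] := loc t.
    by apply: dR_eq (dRB dF (dR_sum (index_enum _) (fun a => dRZ (ca G a) (dphi a t tl)))) _; rewrite subrr.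
  have Fl : F (pi *+ 2) = F 0 by rewrite /F pl wl.
  rewrite Fl in E; have {}E : \sum_a ca G a * (phi a (pi *+ 2) - phi a 0) = 0.
    move/addrI: E => /oppr_inj E.
    rewrite (eq_bigr (fun a => ca G a * phi a (pi *+ 2) - ca G a * phi a 0)) => [|a _]; last exact: mulrBr.
    by rewrite sumrB -E subrr.
  apply: (mulfI pin); rewrite mulr0 mulr_sumr -[RHS]E; apply: eq_bigr => a _; by rewrite ephi mulrCA.
have S2 : \sum_a M b a * k a = 0.
  apply: (muI (k := fun b => \sum_a M b a * k a)); rewrite -[RHS]S1.
  under [RHS]eq_bigr => a _ do rewrite caE mulr_suml.
  rewrite exchange_big; apply: eq_bigr => b' _ /=; rewrite rmorph_sum mulr_suml; apply: eq_bigr => a _.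
  first [by rewrite intrM mulrAC|by rewrite /= intrM mulrAC|by rewrite rmorphM mulrAC|by rewrite /= rmorphM mulrAC].
have S3 : \sum_a (M b a)%:~R * (k a)%:~R = d%:R :> R.
  have E : \sum_a (M b a)%:~R * phi a 0 - d%:R * 0 = \sum_a (M b a)%:~R * phi a (pi *+ 2) - d%:R * (pi *+ 2).
    apply: (dR0_cst (f := fun t => \sum_a (M b a)%:~R * phi a t - d%:R * t) (ltW l0)) => t tl.
    have [_ _ h] := loc t.
    apply: dR_eq (dRB (dR_sum (index_enum _) (fun a => dRZ ((M b a)%:~R) (dphi a t tl))) (dRZ d%:R (dR_id t))) _.
    have := congr1 (@complex.Im R) h; rewrite Im_sum => h'.
    have E1 : complex.Im (d%:R * (0 +i* 1) : C) = d%:R by rewrite -(rmorph_nat (real_complex R)) ImMul /= mulr1 mul0r addr0.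
    rewrite E1 in h'; rewrite mulr1 -[X in _ - X]h' ; apply/eqP; rewrite subr_eq0; apply/eqP; apply: eq_bigr => a _.
    by rewrite -(rmorph_int (real_complex R)) [in RHS]ImMul /= mul0r addr0.
  rewrite mulr0 subr0 in E.
  have {}E : \sum_a (M b a)%:~R * (phi a (pi *+ 2) - phi a 0) = d%:R * (pi *+ 2).
    rewrite (eq_bigr (fun a => (M b a)%:~R * phi a (pi *+ 2) - (M b a)%:~R * phi a 0)) => [|a _]; last exact: mulrBr.
    by rewrite sumrB E opprB addrC subrK.
  apply: (mulfI pin); rewrite [RHS]mulrC -E mulr_sumr; apply: eq_bigr => a _; by rewrite ephi mulrCA.
have : (d%:R : R) = 0.
  rewrite -S3; have -> : \sum_a (M b a)%:~R * (k a)%:~R = (\sum_a M b a * k a)%:~R :> R.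
    rewrite rmorph_sum; apply: eq_bigr => a _.
    first [by rewrite intrM|by rewrite /= intrM|by rewrite rmorphM|by rewrite /= rmorphM].
  by rewrite S2.
by move/eqP; rewrite pnatr_eq0 /d; case: (size m) sm => [|[|x]].
Unshelve. all: by end_near. Qed.

End OneStep.

(** * Countability of an algebraic closure *)

Section Countable.
Context {R : realType}.
Local Notation C := R[i].

Lemma cl_rclosed (S : dfield R) z : rclosed S -> cl (fun x => inS S x) z -> inS S z.
Proof.
move=> rS; elim=> [//||x y _ hx _ hy|x y _ hx _ hy|s x _ hs s0 rx].
- exact: rpred1.
- exact: rpredB.
- exact: rpred_div.
- apply: rS s0 rx; apply/polyOverP => i; rewrite coef_Poly.
  have [li|li] := ltnP i (size s); last by rewrite nth_default //; exact: rpred0.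
  by apply: hs; exact: mem_nth.
Qed.

Variable A : seq C.

(** Decodes derivations of [cl]: leaves are generators, the labels 0, 1, 2 mean difference, quotient
    and one, and k + 3 selects the k-th root of the polynomial whose coefficients are the
    subtrees. *)
Fixpoint evt (t : GenTree.tree nat) : C := match t with
  | GenTree.Leaf k => nth 0 A k
  | GenTree.Node k l => let vs := map evt l in
     match k with 0 => vs`_0 - vs`_1 | 1 => vs`_0 / vs`_1 | 2 => 1 | k'.+3 => (rts (Poly vs))`_k' end
  end.

Lemma cl_code z : cl (fun x => x \in A) z -> exists t, evt t = z.
Proof.
elim=> [x xA||x y _ [tx <-] _ [ty <-]|x y _ [tx <-] _ [ty <-]|s x _ hs s0 rx].
- by exists (GenTree.Leaf (index x A)); rewrite /= nth_index.
- by exists (GenTree.Node 2 [::]).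
- by exists (GenTree.Node 0 [:: tx; ty]).
- by exists (GenTree.Node 1 [:: tx; ty]).
have [ts tsE] : exists ts, map evt ts = s.
  elim: s hs {s0 rx} => [|y s IH] hs; first by exists [::].
  have [|ts <-] := IH; first by move=> w ws; apply: hs; rewrite inE ws orbT.
  have [|t <-] := hs y; first by rewrite inE eqxx.
  by exists (t :: ts).
exists (GenTree.Node (index x (rts (Poly s))).+3 ts); rewrite /= tsE nth_index //.
by rewrite mem_rts.
Qed.

End Countable.

(** * The potential takes countably many values *)

Section Values.
Context {R : realType}.
Local Notation C := R[i].
Variables (V : finType) (n q : nat) (f : 'I_q -> 'I_n.+1 -> V).
Hypothesis pm : is_pseudomanifold f.
Hypothesis oriented : is_oriented f.
Variable G : 'I_q -> 'M[R]_n.+1.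
Hypothesis cG : forall s, coer (G s).
Hypothesis lG : forall s, lor (G s).
Hypothesis sgnG : forall s i, 0 <= - \det (row' i (col' i (G s))).
Local Notation rV2 := 'rV[C]_n.+2.

(** If [u] lies outside S, either all monomials at [P] lie in S and [step_const] applies, or some
    monomial [w] does not. In the latter case exchange makes [w] the parameter, a monomial equal to
    its own parameter, and [step_contra] excludes this. *)
Lemma one_step g (S : dfield R) (u : C) (P : V -> rV2) : rclosed S -> Sok G g S -> gconf f G g P ->
  (forall v j, ext S u (P v 0 j)) ->
  exists P1, [/\ gconf f G g P1, (forall v j, inS S (P1 v 0 j)) & EK f P1 = EK f P].
Proof.
move=> rS okS gP eP.
have [B [mu [M0 [muI cE]]]] := integer_basis (fun a : 'I_#|Ia n q| => ca G (enum_val a)).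
pose M b (a : Ia n q) := M0 b (enum_rank a).
have caE a : ca G a = \sum_b (M b a)%:~R * mu b by rewrite -cE enum_rankK.
have [uS|uS] := pselect (inS S u).
  exists P; split => // v j; apply: (cl_rclosed rS); apply: cl_trans (eP v j) => x [xS|->]; exact: cl_in.
have [hb|] := pselect (forall b, inS S (wnum f G g M b P / wden f G g M b P)).
  exact: (step_const pm oriented cG lG sgnG caE rS uS okS gP eP hb).
move=> /existsNP[b nb]; exfalso; set w := _ / _ in nb.
have Eb : wnum f G g M b P = w * wden f G g M b P by rewrite divfK // wden_neq0.
have hza := za_inS f (Sok_ext u okS) (fun v j => proj2 (in_clD _ _) (eP v j)).
have ew : ext S u w.
  apply/in_clD; rewrite /w /wnum /wden /inS; apply: rpred_div; apply: rpred_prod => a _; apply: rpredX; exact: hza.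
have eu := ext_exchange rS uS nb ew.
have eP2 v j : ext S w (P v 0 j).
  apply: cl_trans (eP v j) => x [xS|->]; last exact: eu.
  by apply: cl_in; left.
exact: (step_contra pm oriented cG lG sgnG caE muI rS nb okS gP eP2 Eb).
Qed.

(** Induction on the generators: the others are removed over the closure of S(x), then x itself. *)
Lemma tower g (xs : seq C) : forall (S : dfield R) (P : V -> rV2), rclosed S -> Sok G g S -> gconf f G g P ->
  (forall v j, cl (fun x => inS S x \/ x \in xs) (P v 0 j)) ->
  exists P1, [/\ gconf f G g P1, (forall v j, inS S (P1 v 0 j)) & EK f P1 = EK f P].
Proof.
elim: xs => [|x xs IH] S P rS okS gP eP.
  exists P; split => // v j; apply: (cl_rclosed rS); apply: cl_trans (eP v j) => y [yS|//]; exact: cl_in.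
pose S' := clD (fun y => inS S y \/ y = x).
have [|P1 [gP1 h1 E1]] := IH S' P (@clD_rclosed _ _) (Sok_ext x okS) gP.
  move=> v j; apply: cl_trans (eP v j) => y [yS|]; first by apply: cl_in; left; apply/in_clD; apply: cl_in; left.
  rewrite inE => /orP[/eqP->|ys]; last by apply: cl_in; right.
  by apply: cl_in; left; apply/in_clD; apply: cl_in; right.
have [|P2 [gP2 h2 E2]] := @one_step g S x P1 rS okS gP1.
  by move=> v j; apply/in_clD; exact: h1.
exists P2; split; [exact: gP2|exact: h2|exact: (etrans E2 E1)].
Qed.

(** Points of the rational normal curve with natural parameter: their coordinates lie in every
    subfield, so [g] adds no generator to the base field. *)
Definition gvec (r : nat) : rV2 := \row_j r%:R ^+ j.

(** Each logarithmic value is a polynomial in r whose coefficients are the coordinates of the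
    isotropic vector [y a]. For a nondegenerate facet that vector is nonzero, as its product with
    the vertex opposite to the ridge is 1. *)
Lemma generic_gvec (P : V -> rV2) : conf f G P -> exists r, forall a, za f G (gvec r) a P != 0.
Proof.
move=> cP.
pose y (a : Ia n q) : rV2 := qv (fun i => P (f a.1.2 i)) (G a.1.2) a.2 +
  (if a.1.1 then -1 else 1) * ((kap G a.1.2 a.2)%:C / (\det (G a.1.2))%:C) *: cross (fun i => P (f a.1.2 i)).
pose pa (a : Ia n q) : {poly C} := if \det (G a.1.2) == 0 then 1 else \poly_(j < n.+2) y a 0 (inord j).
have pE a r : (pa a).[r%:R] = za f G (gvec r) a P.
  rewrite /pa /za /zeta; case: (\det (G a.1.2) == 0); first by rewrite hornerC.
  cbv zeta; rewrite horner_poly.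
  have -> : \sum_(j < n.+2) y a 0 (inord j) * r%:R ^+ j = dot (y a) (gvec r).
    by apply: eq_bigr => j _; rewrite inord_val [gvec r 0 j]mxE.
  rewrite /y dotDl dotZl [dot (qv _ _ _) _]dotC; congr (_ + _).
  by case: (a.1.1); rewrite ?mulN1r ?mul1r ?mulNr.
have p0 a : pa a != 0.
  rewrite /pa; have [_|d0] := eqVneq (\det (G a.1.2)) 0; first exact: oner_neq0.
  apply/eqP => h; have [gr _] := cP a.1.2.
  have : dot (y a) (P (f a.1.2 a.2)) = 1.
    by rewrite /y dotDl dotZl (dot_qv_p gr d0) eqxx [dot (cross _) _]dotC (dot_cross0 (fun i => P (f a.1.2 i))) mulr0 addr0.
  have -> : y a = 0.
    apply/rowP => j; rewrite [RHS]mxE; have := congr1 (fun p : {poly C} => p`_j) h.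
    by rewrite coef_poly ltn_ord inord_val coef0.
  by rewrite dot0l => /esym/eqP; rewrite oner_eq0.
have [r] := @exists_nonroot R (\prod_a pa a) ltac:(by apply/prodf_neq0 => a _; exact: p0).
rewrite /root horner_prod => /prodf_neq0 h; exists r => a; rewrite -pE; exact: h.
Qed.

(** The base field depends on [G] alone and configurations over it are coded by finite tables of
    trees. The vector [g] may vary with [P], because [EK] does not involve it. *)
Lemma EK_countable : exists h : nat -> R, forall P, conf f G P -> exists k, EK f P = h k.
Proof.
pose K1 := [seq (G x.1 x.2.1 x.2.2)%:C  | x <- enum {: 'I_q * ('I_n.+1 * 'I_n.+1)}].
pose K2 := [seq (kermx (G x.1) x.2.1 x.2.2)%:C  | x <- enum {: 'I_q * ('I_n.+1 * 'I_n.+1)}].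
pose K3 := [seq (invmx (G x.1) x.2.1 x.2.2)%:C  | x <- enum {: 'I_q * ('I_n.+1 * 'I_n.+1)}].
pose K4 := [seq (kap G x.1 x.2)%:C / (\det (G x.1))%:C  | x <- enum {: 'I_q * 'I_n.+1}].
pose A := K1 ++ K2 ++ K3 ++ K4.
pose S := clD (fun x => x \in A).
have inA x : x \in A -> inS S x by move=> xA; apply/in_clD; exact: cl_in.
have okS r : Sok G (gvec r) S.
  split.
  - by move=> s i j; apply: inA; rewrite !mem_cat; apply/orP; left; apply/mapP; exists (s, (i, j)); rewrite ?mem_enum.
  - by move=> s i j; apply: inA; rewrite !mem_cat; apply/or4P; apply: Or42; apply/mapP; exists (s, (i, j)); rewrite ?mem_enum.
  - by move=> s i j; apply: inA; rewrite !mem_cat; apply/or4P; apply: Or43; apply/mapP; exists (s, (i, j)); rewrite ?mem_enum.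
  - by move=> s i; apply: inA; rewrite !mem_cat; apply/or4P; apply: Or44; apply/mapP; exists (s, i); rewrite ?mem_enum.
  - by move=> j; rewrite mxE /inS rpredX // rpred_nat.
pose T : countType := {ffun V * 'I_n.+2 -> GenTree.tree nat}.
pose h k : R := if unpickle k is Some c then EK f (fun v => \row_j evt A ((c : T) (v, j))) else 0.
exists h => P cP; have [r z0] := generic_gvec cP.
have [|P1 [gP1 h1 E1]] := @tower (gvec r) [seq P x.1 0 x.2 | x : V * 'I_n.+2] S P (@clD_rclosed _ _) (okS r) (conj cP z0).
  by move=> v j; apply: cl_in; right; apply/mapP; exists (v, j); rewrite ?mem_enum.
have code (x : V * 'I_n.+2) : exists t, evt A t = P1 x.1 0 x.2 by apply: cl_code; apply/in_clD; exact: h1.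
pose c : T := [ffun x => sval (cid (code x))].
exists (pickle c); rewrite /h pickleK -E1; congr (EK f _); apply/funext => v; apply/rowP => j.
by rewrite mxE ffunE; case: cid => t /= ->.
Qed.

End Values.

(** * Continuity of the volume and conclusion *)

(** Two distinct values would put a whole interval, of positive Lebesgue measure, into a countable
    set. *)
Lemma continuous_countable_const (R : realType) (a b : R) (F : R -> R) (h : nat -> R) :
  (forall t, a < t < b -> {for t, continuous F}) -> (forall t, a < t < b -> exists k, F t = h k) ->
  forall t t', a < t < b -> a < t' < b -> F t = F t'.
Proof.
move=> cF hF t t' ht ht'.
wlog tt : t t' ht ht' / t <= t'.
  move=> W; have [l|l] := leP t t'; first exact: W.
  by apply/esym; apply: W (ltW l).
apply/eqP; apply: contraT => ne.
set m := Num.min (F t) (F t'); set M := Num.max (F t) (F t').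
have mM : m < M.
  move: ne; rewrite neq_lt => /orP[l|l]; rewrite /m /M.
    by rewrite (min_l (ltW l)) (max_r (ltW l)).
  by rewrite (min_r (ltW l)) (max_l (ltW l)).
have inab x : t <= x <= t' -> a < x < b.
  move=> /andP[h1 h2]; case/andP: ht => h3 _; case/andP: ht' => _ h4.
  by rewrite (lt_le_trans h3 h1) (le_lt_trans h2 h4).
have sub : `[m, M]%classic `<=` range h.
  move=> v /=; rewrite in_itv /= => mv.
  have cw : {within `[t, t'], continuous F}.
    apply: continuous_in_subspaceT => x; rewrite inE /= in_itv /= => xt.
    by apply: cF; exact: inab.
  have [c ct <-] := IVT tt cw mv; rewrite in_itv /= in ct.
  have [k ->] := hF c (inab c ct).
  by exists k.
have : lebesgue_measure (`[m, M]%classic : set R) = 0%E :> \bar R.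
  apply: countable_lebesgue_measure0; apply: sub_countable (subset_card_le sub) _.
  exact: sub_countable (card_image_le _ _) (countableP _).
rewrite lebesgue_measure_itv /= lte_fin mM -EFinB => -[] /eqP; rewrite subr_eq0 => /eqP E.
by rewrite E ltxx in mM.
Qed.

(** Strict monotonicity of arcosh on [1, oo); it turns constant edge lengths into constant Gram
    matrices. *)
Lemma arcosh_inj (R : realType) (x y : R) : 1 <= x -> 1 <= y ->
  ln (x + Num.sqrt (x ^+ 2 - 1)) = ln (y + Num.sqrt (y ^+ 2 - 1)) -> x = y.
Proof.
move=> x1 y1.
have pos (z : R) : 1 <= z -> z + Num.sqrt (z ^+ 2 - 1) \is Num.pos.
  by move=> z1; rewrite posrE ltr_wpDr ?sqrtr_ge0 // (lt_le_trans ltr01).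
have mono (u v : R) : 1 <= u -> u < v -> u + Num.sqrt (u ^+ 2 - 1) < v + Num.sqrt (v ^+ 2 - 1).
  move=> u1 uv; apply: ltr_leD => //; apply: ler_wsqrtr; rewrite lerB // lerXn2r ?nnegrE ?(ltW uv) //; lra.
move=> /(ln_inj (pos x x1) (pos y y1)) E.
by case: (ltgtP x y) => // [/(mono _ _ x1)|/(mono _ _ y1)]; rewrite E ltxx.
Qed.

Lemma Im_i_odd (R : realType) n : odd n -> complex.Im ((0 +i* 1) ^+ n : R[i]) != 0.
Proof.
move=> on; rewrite -(odd_double_half n) on add1n exprS -mul2n exprM.
have -> : (0 +i* 1 : R[i]) ^+ 2 = (-1)%:C by apply: complex_eq; rewrite expr2 ?ReMul ?ImMul /=; ring.
by rewrite -(rmorphXn (real_complex R)) ImMul /= mul0r mul1r add0r signr_eq0.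
Qed.

Section ContinuityAt.
Context {R : realType}.
Implicit Type x : R.

Lemma cts_sum (I : Type) (r : seq I) (F : I -> R -> R) x :
  (forall i, F i y @[y --> x] --> F i x) -> (\sum_(i <- r) F i y) @[y --> x] --> \sum_(i <- r) F i x.
Proof.
move=> h; elim: r => [|i r IH].
  rewrite big_nil (_ : (fun y => \sum_(i <- [::]) F i y) = fun=> 0); first exact: cvg_cst.
  by apply/funext => y; rewrite big_nil.
rewrite big_cons (_ : (fun y => \sum_(j <- i :: r) F j y) = fun y => F i y + \sum_(j <- r) F j y).
  exact: (cvgD (h i) IH).
by apply/funext => y; rewrite big_cons.
Qed.

Lemma cts_prod (I : Type) (r : seq I) (F : I -> R -> R) x :
  (forall i, F i y @[y --> x] --> F i x) -> (\prod_(i <- r) F i y) @[y --> x] --> \prod_(i <- r) F i x.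
Proof.
move=> h; elim: r => [|i r IH].
  rewrite big_nil (_ : (fun y => \prod_(i <- [::]) F i y) = fun=> 1); first exact: cvg_cst.
  by apply/funext => y; rewrite big_nil.
rewrite big_cons (_ : (fun y => \prod_(j <- i :: r) F j y) = fun y => F i y * \prod_(j <- r) F j y).
  exact: (cvgM (h i) IH).
by apply/funext => y; rewrite big_cons.
Qed.

Lemma cts_det m (A : R -> 'M[R]_m) x : (forall i j, A y i j @[y --> x] --> A x i j) ->
  \det (A y) @[y --> x] --> \det (A x).
Proof.
move=> h; apply: (cts_sum (F := fun (s : 'S_m) y => (-1) ^+ s * \prod_i A y i (s i))) => s.
apply: (cvgM (cvg_cst _)).
exact: (cts_prod (F := fun i y => A y i (s i)) (fun i => h i (s i))).
Qed.

(** The flexion is merely continuous, so continuity is read off the estimate [mom_taylor] and not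
    from a derivative. *)
Lemma cts_mom m (s : seq 'I_m) (G : R -> 'M[R]_m) x :
  (\forall y \near x, coer (G y)) -> (forall i j, G y i j @[y --> x] --> G x i j) ->
  mom s (G y) @[y --> x] --> mom s (G x).
Proof.
move=> cG h.
pose D i j y := G y i j - G x i j.
pose L y := mom s (G x) - \sum_i \sum_j D i j y * mom [:: i, j & s] (G x).
pose N y := \sum_i \sum_j `|D i j y|.
have cd i j : D i j y @[y --> x] --> D i j x by exact: (cvgB (h i j) (cvg_cst _)).
have cL : L y @[y --> x] --> L x.
  apply: (cvgB (cvg_cst _)).
  apply: (cts_sum (F := fun i y => \sum_j D i j y * mom [:: i, j & s] (G x))) => i.
  apply: (cts_sum (F := fun j y => D i j y * mom [:: i, j & s] (G x))) => j.
  exact: (cvgM (cd i j) (cvg_cst _)).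
have cN : N y @[y --> x] --> N x.
  apply: (cts_sum (F := fun i y => \sum_j `|D i j y|)) => i.
  apply: (cts_sum (F := fun j y => `|D i j y|)) => j.
  exact: (cvg_norm (cd i j)).
have D0 i j : D i j x = 0 by rewrite /D subrr.
have N0 : N x = 0 by rewrite /N big1 // => i _; rewrite big1 // => j _; rewrite D0 normr0.
have Lx : L x = mom s (G x) by rewrite /L big1 ?subr0 // => i _; rewrite big1 // => j _; rewrite D0 mul0r.
pose B y := Cst m (size s + 4) * (N y * N y).
have cB : B y @[y --> x] --> (0 : R).
  have H : B y @[y --> x] --> B x by exact: (cvgM (cvg_cst _) (cvgM cN cN)).
  have B0 : B x = 0 by rewrite /B N0 !mulr0.
  by rewrite B0 in H.
have cB' : - B y @[y --> x] --> (0 : R) by have H := cvgN cB; rewrite oppr0 in H; exact: H.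
have hb : \forall y \near x, - B y <= mom s (G y) - L y <= B y.
  have cx := nbhs_singleton cG; apply: filterS cG => y cy; rewrite -ler_norml.
  have := mom_taylor s cx cy.
  have -> : mom s (G x) - \sum_i \sum_j (G y - G x) i j * mom [:: i, j & s] (G x) = L y.
    by congr (_ - _); apply: eq_bigr => i _; apply: eq_bigr => j _; rewrite !mxE.
  have -> : mxabs (G y - G x) = N y.
    by apply: eq_bigr => i _; apply: eq_bigr => j _; rewrite !mxE.
  by rewrite expr2.
have cE : (mom s (G y) - L y) @[y --> x] --> (0 : R) by exact: (squeeze_cvgr hb cB' cB).
have H := cvgD cE cL; rewrite Lx add0r in H.
rewrite (_ : (fun y => mom s (G y)) = fun y => mom s (G y) - L y + L y); first exact: H.
by apply/funext => y; rewrite subrK.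
Qed.

End ContinuityAt.

(** Through [Vor_formula] the volume is a sum of products of determinants and moments, continuous
    also where a simplex degenerates and the sign in [Vor] jumps. *)
Lemma VK_continuous (R : realType) (V : finType) (n q : nat) (f : 'I_q -> 'I_n -> V) (a b : R)
    (p : R -> V -> pt R n) (o : pt R n) : in_Lambda o ->
  (forall t, a < t < b -> forall v, in_Lambda (p t v)) ->
  (forall v k, {within [set x : R | a < x < b], continuous (fun t => p t v k)}) ->
  forall t, a < t < b -> {for t, continuous (fun t => VK f o (p t))}.
Proof.
move=> oL pL pc t ht.
have oab : open [set x : R | a < x < b].
  have -> : [set x : R | a < x < b] = `]a, b[%classic by apply/seteqP; split=> x; rewrite /= in_itv.
  by first [exact: itv_open|exact: interval_open|apply: interval_open].
have pcc v k : p y v k @[y --> t] --> p t v k.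
  have := pc v k; rewrite (continuous_open_subspace _ oab) => H.
  exact: (H t (mem_set ht)).
have nr : \forall y \near t, a < y < b by exact: open_nbhs_nbhs (conj oab ht).
pose w s y : 'I_n.+1 -> pt R n := fun j => match unlift ord0 j with Some i => p y (f s i) | None => o end.
have wL s y : a < y < b -> forall j, in_Lambda (w s y j).
  by move=> hy j; rewrite /w; case: unlift => [i|]; [exact: pL|exact: oL].
have wc s j k : w s y j k @[y --> t] --> w s t j k.
  by rewrite /w; case: unlift => [i|]; [exact: pcc|exact: cvg_cst].
have gc s i j : gram (w s y) i j @[y --> t] --> gram (w s t) i j.
  rewrite (_ : (fun y => gram (w s y) i j) = fun y => minkowski (w s y i) (w s y j)); last first.
    by apply/funext => y; rewrite mxE.
  rewrite [gram _ _ _]mxE; apply: (cvgB (cvgM (wc s i ord0) (wc s j ord0))).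
  apply: (cts_sum (F := fun k y => w s y i (lift ord0 k) * w s y j (lift ord0 k))) => k.
  exact: (cvgM (wc s i (lift ord0 k)) (wc s j (lift ord0 k))).
have mc s i j : wmx (w s y) i j @[y --> t] --> wmx (w s t) i j.
  rewrite (_ : (fun y => wmx (w s y) i j) = fun y => w s y i j); last by apply/funext => y; rewrite mxE.
  by rewrite [wmx _ _ _]mxE; exact: wc.
pose T s y := (fine (@gam R n))^-1 * (\det (wmx (w s y)) * mom [::] (gram (w s y))).
have FE y : a < y < b -> VK f o (p y) = \sum_s T s y.
  by move=> hy; rewrite /VK; apply: eq_bigr => s _; exact: (Vor_formula (wL s y hy)).
have Fc : (\sum_s T s y) @[y --> t] --> \sum_s T s t.
  apply: (cts_sum (F := T)) => s; rewrite /T; apply: (cvgM (cvg_cst _)).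
  apply: cvgM; first exact: (cts_det (mc s)).
  apply: (cts_mom _ (gc s)); apply: filterS nr => y hy; apply: coer_gram => i; exact: wL.
suff H : VK f o (p y) @[y --> t] --> VK f o (p t) by exact: H.
rewrite (FE t ht); apply: cvg_trans; last exact: Fc.
by apply: near_eq_cvg; apply: filterS nr => y hy; rewrite (FE y hy).
Qed.

(** A kernel vector of the Gram matrix gives an isotropic combination orthogonal to a point of
    Lambda, hence zero by [orth_timelike]; this is [kerrel]. *)
Lemma conf_cpx (R : realType) (V : finType) (n q : nat) (f : 'I_q -> 'I_n.+1 -> V) (G : 'I_q -> 'M[R]_n.+1)
    (p : V -> pt R n.+1) : (forall v, in_Lambda (p v)) -> (forall s, gram (fun i => p (f s i)) = G s) ->
  conf f G (fun v => cpx (p v)).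
Proof.
move=> pL gE s; split; first by rewrite -gE; exact: rgram_cpx.
move=> c hc; pose x : pt R n.+1 := fun k => \sum_j c j * p (f s j) k.
have xm j : minkowski x (p (f s j)) = 0.
  by rewrite /x minkowski_suml -[RHS](hc j); apply: eq_bigr => i _; rewrite -gE mxE.
have xx : minkowski x x = 0 by rewrite {1}/x minkowski_suml big1 // => i _; rewrite minkowskiC xm mulr0.
have [_ /(_ xx) x0] := orth_timelike (pL (f s ord0)) (xm ord0).
apply/rowP => k; rewrite summxE [RHS]mxE.
transitivity ((if k == ord0 then 1 else 0 +i* 1 : R[i]) * (x k)%:C); last by rewrite (x0 k) (rmorph0 (real_complex R)) mulr0.
rewrite /x rc_sum mulr_sumr; apply: eq_bigr => j _; rewrite !mxE.
by case: eqP => _; apply: complex_eq; rewrite /= ?ReMul ?ImMul /=; ring.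
Qed.

Theorem theorem4 (R : realType) (n : nat) (V : finType) (q : nat)
  (f : 'I_q -> 'I_n -> V) (a b : R) (p : R -> V -> pt R n) :
  (3 <= n)%N -> odd n ->
  is_pseudomanifold f -> is_oriented f ->
  is_flexion f a b p ->
  forall o : pt R n, in_Lambda o ->
  forall t t', a < t < b -> a < t' < b ->
  VK f o (p t) = VK f o (p t').
Proof.
(* The ambient dimension becomes m + 2; a facet has m + 2 vertices and a ridge m + 1. *)
case: n f p => [|[|m]] f p n3; [exfalso; exact (notF n3)|exfalso; exact (notF n3)|].
move=> om pm orr [pL [pc pd]] o oL t1 t2 h1 h2.
pose G s := gram (fun i => p t1 (f s i)).
have gramE t : a < t < b -> forall s, gram (fun i => p t (f s i)) = G s.
  move=> ht s; apply/matrixP => i j; rewrite !mxE.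
  have [<-|ij] := eqVneq i j; first by have [-> _] := pL t ht (f s i); have [-> _] := pL t1 h1 (f s i).
  have ed : is_edge f (f s i) (f s j).
    have [finj _] := pm; split; first by apply: contraNneq ij => /finj ->.
    by exists s; split; apply/imsetP; [exists i|exists j].
  apply: arcosh_inj; [exact: (minkowski_ge1 (pL t ht _) (pL t ht _))|exact: (minkowski_ge1 (pL t1 h1 _) (pL t1 h1 _))|exact: (pd _ _ ed t t1 ht h1)].
have cG s : coer (G s) by apply: coer_gram => i; exact: pL.
have lG s : lor (G s).
  by move=> l c hc; apply: (gram_kernel_minor (w := fun i => p t1 (f s i)) _ hc) => i; exact: pL.
(* The Gram determinant of m + 1 points has sign (-1)^m or vanishes, and m is odd with n = m + 2. *)
have sgnG s i : 0 <= - \det (row' i (col' i (G s))).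
  have -> : row' i (col' i (G s)) = gram (fun j => p t1 (f s (lift i j))) by apply/matrixP => j k; rewrite !mxE.
  have := gram_sign (w := fun j => p t1 (f s (lift i j))) (fun j => pL t1 h1 (f s (lift i j))).
  have om' : odd m by move: om; rewrite /= negbK.
  by rewrite -signr_odd om' expr1 mulN1r.
have [h hh] := EK_countable pm orr cG lG sgnG.
(* Nonzero because i^n is purely imaginary for odd n; the potential therefore determines the
   volume. *)
pose kk := - complex.Im ((0 +i* 1) ^+ m.+2 : R[i]) * fine (@gam R m.+2).
have kk0 : kk != 0.
  apply: mulf_neq0; first by rewrite oppr_eq0; exact: (@Im_i_odd R m.+2 om).
  have [gpos gfin] := @gam_fin R m.+2.
  by rewrite gt_eqF // fine_gt0 // gpos -ge0_fin_numE // ltW.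
have VE t : a < t < b -> VK f o (p t) = kk^-1 * EK f (fun v => cpx (p t v)).
  move=> ht.
  have -> : EK f (fun v => cpx (p t v)) = kk * VK f o (p t) by exact: (etrans (VK_EK pm orr oL (pL t ht)) (mulrA _ _ _)).
  by rewrite (mulKf kk0).
have ct t : a < t < b -> {for t, continuous (fun t => VK f o (p t))} by move=> ht; exact: (@VK_continuous R V m.+2 q f a b p o oL pL pc t ht).
have cv t : a < t < b -> exists k, VK f o (p t) = kk^-1 * h k.
  move=> ht; have [k hk] := hh _ (conf_cpx (pL t ht) (gramE t ht)); exists k.
  by rewrite (VE t ht) hk.
exact: (continuous_countable_const (h := fun k => kk^-1 * h k) ct cv h1 h2).
Qed.
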